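(* Let $(M^n,g)$ be a complete Riemannian manifold of dimension $n$, $\mathcal O\in M$, $R>0$, $T>0$, let $m\in(0,1)$ with $m>m_c=1-\frac2n$, and let $u$ be a positive smooth solution of the fast diffusion equation $\partial_t u=\Delta u^m$ on $Q=B(\mathcal O,R)\times[0,T]$. Let $v=\frac{m}{m-1}u^{m-1}$ (so $v<0$), $\bar v_{\max}^{R,T}=\max_{B(\mathcal O,R)\times[0,T]}(-v)$, and $a=\frac{n(m-1)}{n(m-1)+2}<0$. (1) Assume $\operatorname{Ric}\ge0$ on $B(\mathcal O,R)$. Then for any $0<\alpha<1$ and $\epsilon_1>0$ satisfying $$\bar C_1(a,\alpha,\epsilon_1):=1+(-a)(1-\alpha)-(1-\alpha)\frac{(1-a+\epsilon_1)^2}{(1-\alpha)-a}>0,$$ we have $$\frac{|\nabla v|^2}{v}-\alpha\frac{v_t}{v}\ge-\frac{(-a)\alpha^2}{\bar C_1(a,\alpha,\epsilon_1)}\left(\frac1t+\frac{\bar v_{\max}^{R,T}}{R^2}\bigl(\bar C_2(a,\alpha,\epsilon_1)+\bar C_3\bigr)\right)$$ at every $(x,t)\in B(\mathcal O,R/2)\times[0,T]$ with $t>0$, where $$\bar C_2(a,\alpha,\epsilon_1)=1600\,m^2\frac{(-a)\alpha^2}{2\epsilon_1(1-\alpha)},\qquad \bar C_3=40(1-m)(n+2).$$ (2) Assume $\operatorname{Ric}\ge-(n-1)K^2$ on $B(\mathcal O,R)$ for some $K\ge0$. Then for any $0<\alpha<1$, $\epsilon_1>0$, $\epsilon_2>0$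 satisfying $$(1-\alpha)-a-(1-\alpha)\epsilon_2^2>0\quad\text{and}\quad \bar C_1':=1+(-a)(1-\alpha)-(1-\alpha)\frac{(1-a+\epsilon_1)^2}{(1-\alpha)-a-(1-\alpha)\epsilon_2^2}>0,$$ we have $$\frac{|\nabla v|^2}{v}-\alpha\frac{v_t}{v}\ge-\frac{(-a)\alpha^2}{\bar C_1'}\left(\frac1t+\bar C_4(\alpha,\epsilon_2)\sqrt{\bar C_1'}\,K^2\,\bar v_{\max}^{R,T}\right)-\frac{(-a)\alpha^2}{\bar C_1'}\,\frac{\bar v_{\max}^{R,T}}{R^2}\bigl(\bar C_2(a,\alpha,\epsilon_1)+\bar C_5(KR)\bigr)$$ at every $(x,t)\in B(\mathcal O,R/2)\times[0,T]$ with $t>0$, where $\bar C_2(a,\alpha,\epsilon_1)$ is as in (1) and $$\bar C_4(\alpha,\epsilon_2)=\frac{(n-1)(1-m)}{(1-\alpha)\epsilon_2},\qquad \bar C_5(KR)=40(1-m)\bigl[3+(n-1)(1+KR)\bigr].$$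
   Context: $B(\mathcal O,R)$ is the geodesic ball of radius $R$ centered at $\mathcal O$. $\Delta$, $\nabla$ and $|\cdot|$ are the Laplace–Beltrami operator, gradient and norm of $g$; $\operatorname{Ric}\ge c$ means $\operatorname{Ric}\ge c\,g$ as quadratic forms; $v_t=\partial_t v$. The maximum $\bar v_{\max}^{R,T}$ is understood as a supremum if it is not attained. *)

(* Defs.v *)
From HB Require Import structures.
From mathcomp Require Import all_boot all_order all_algebra.
From mathcomp Require Import all_classical all_reals all_analysis.
Set Implicit Arguments.
Unset Strict Implicit.
Unset Printing Implicit Defensive.
Import Order.TTheory GRing.Theory Num.Theory.
Import numFieldNormedType.Exports.
Local Open Scope classical_set_scope.
Local Open Scope ring_scope.

(* C^k and C^oo maps on a set U, which is meant to be open: all the iterated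
   directional derivatives of order at most k exist and are continuous on U. *)
Fixpoint Ck_on (R : realType) (V W : normedModType R) (k : nat) (U : set V)
    (f : V -> W) : Prop :=
  (forall y, U y -> {for y, continuous f}) /\
  match k with
  | 0 => True
  | k'.+1 => forall v, (forall y, U y -> derivable f y v) /\ Ck_on k' U ('D_v f)
  end.

Definition smooth_on (R : realType) (V W : normedModType R) (U : set V)
  (f : V -> W) : Prop := forall k, Ck_on k U f.

(* A smooth n-manifold structure on M together with a Riemannian metric.
   The smooth structure is given by an atlas indexed by the points of M: the
   chart of index p is the homeomorphism chart p, of inverse chart_inv p, from
   the open neighborhood chart_dom p of p onto an open set of R^n.  The values
   of chart p, chart_inv p and metric p outside of these sets are irrelevant.
   Tangent vectors are row vectors; metric p y is the Gram matrix (g_ij(y)) of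
   the metric at the point of coordinates y in the chart of index p. *)
Record riemannian (R : realType) (n : nat) (M : topologicalType) := Riemannian {
  chart_dom : M -> set M ;
  chart : M -> M -> 'rV[R]_n ;
  chart_inv : M -> 'rV[R]_n -> M ;
  metric : M -> 'rV[R]_n -> 'M[R]_n ;
  manifold_hausdorff : hausdorff_space M ;
  manifold_second_countable : @second_countable M ;
  chart_dom_open : forall p, open (chart_dom p) ;
  chart_dom_center : forall p, chart_dom p p ;
  chart_cod_open : forall p, open (chart p @` chart_dom p) ;
  chart_continuous : forall p x,
    chart_dom p x -> {for x, continuous (chart p)} ;
  chart_inv_continuous : forall p y,
    (chart p @` chart_dom p) y -> {for y, continuous (chart_inv p)} ;
  chartK : forall p x, chart_dom p x -> chart_inv p (chart p x) = x ;
  transition_smooth : forall p q,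
    smooth_on (chart p @` (chart_dom p `&` chart_dom q))
      (chart q \o chart_inv p) ;
  metric_smooth : forall p, smooth_on (chart p @` chart_dom p) (metric p) ;
  metric_sym : forall p y,
    (chart p @` chart_dom p) y -> (metric p y)^T = metric p y ;
  metric_posdef : forall p y, (chart p @` chart_dom p) y ->
    forall v : 'rV[R]_n, v != 0 -> 0 < (v *m metric p y *m v^T) 0 0 ;
  metric_transition : forall p q x, chart_dom p x -> chart_dom q x ->
    forall v w : 'rV[R]_n,
    let J (z : 'rV[R]_n) : 'rV[R]_n :=
      'D_z (chart q \o chart_inv p) (chart p x) in
    (v *m metric p (chart p x) *m w^T) 0 0 =
    (J v *m metric q (chart q x) *m (J w)^T) 0 0 }.

(* Coordinate formulas for a metric G given on an open set of R^n. *)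
Section LocalGeometry.
Context {R : realType} {n : nat}.
Implicit Types (G : 'rV[R]_n -> 'M[R]_n) (F : 'rV[R]_n -> R)
  (X : 'rV[R]_n -> 'rV[R]_n) (y : 'rV[R]_n) (i j k l : 'I_n).

Definition pderiv i F y : R := 'D_(delta_mx 0 i : 'rV[R]_n) F y.

(* Gamma^k_{ij} *)
Definition christoffel G k i j y : R :=
  2^-1 * \sum_l invmx (G y) k l *
    (pderiv i (fun z => G z j l) y + pderiv j (fun z => G z i l) y
     - pderiv l (fun z => G z i j) y).

(* the component on e_l of R(e_k, e_j) e_i, where
   R(X, Y) = nabla_X nabla_Y - nabla_Y nabla_X - nabla_[X, Y] *)
Definition riemann G l i k j y : R :=
  pderiv k (christoffel G l j i) y - pderiv j (christoffel G l k i) y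
  + \sum_p (christoffel G l k p y * christoffel G p j i y
            - christoffel G l j p y * christoffel G p k i y).

Definition ricci_mx G y : 'M[R]_n := \matrix_(i, j) \sum_k riemann G k i k j y.

Definition local_grad G F y : 'rV[R]_n :=
  \row_k \sum_i invmx (G y) k i * pderiv i F y.

(* the trace of the covariant derivative of X *)
Definition local_div G X y : R :=
  \sum_i (pderiv i (fun z => X z 0 i) y
          + \sum_j christoffel G i i j y * X y 0 j).

Definition local_laplacian G F y : R := local_div G (local_grad G F) y.

End LocalGeometry.

(* At a point p, geometric quantities are computed in the chart of index p,
   tangent vectors at p being identified with their coordinates. *)
Section Geometry.
Context {R : realType} {n : nat} {M : topologicalType}.
Variable g : riemannian R n M.
Implicit Types (p q x : M) (f : M -> R) (v w : 'rV[R]_n).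

Definition inner p v w : R := (v *m metric g p (chart g p p) *m w^T) 0 0.

Definition norm p v : R := Num.sqrt (inner p v v).

Definition grad f p : 'rV[R]_n :=
  local_grad (metric g p) (f \o chart_inv g p) (chart g p p).

Definition laplacian f p : R :=
  local_laplacian (metric g p) (f \o chart_inv g p) (chart g p p).

Definition ricci p v w : R :=
  (v *m ricci_mx (metric g p) (chart g p p) *m w^T) 0 0.

Definition ricci_ge (B : set M) (c : R) : Prop :=
  forall p, B p -> forall v, c * inner p v v <= ricci p v v.

Definition C1_curve (gam : R -> M) : Prop :=
  forall t, t \in `[0, 1] ->
    {for t, continuous gam} /\
    exists U : set R, [/\ open U, U t & Ck_on 1 U (chart g (gam t) \o gam)].

Definition velocity (gam : R -> M) (t : R) : 'rV[R]_n :=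
  derive1 (chart g (gam t) \o gam) t.

Definition curve_length (gam : R -> M) : \bar R :=
  (\int[lebesgue_measure]_(t in `[0%R, 1%R])
     (norm (gam t) (velocity gam t))%:E)%E.

(* there is a piecewise C^1 curve of length L from p to q *)
Inductive joined_by : M -> M -> \bar R -> Prop :=
| joined_refl p : joined_by p p 0%E
| joined_step (gam : R -> M) q L : C1_curve gam ->
    joined_by (gam 1) q L -> joined_by (gam 0) q (curve_length gam + L)%E.

(* It is +oo when p and q are in different connected components. *)
Definition geodist p q : \bar R := ereal_inf [set L | joined_by p q L].

Definition geoball p (r : R) : set M := [set x | (geodist p x < r%:E)%E].

Definition complete_riemannian : Prop :=
  forall x : nat -> M,
    (forall e : R, 0 < e -> exists N, forall i j, (N <= i)%N -> (N <= j)%N ->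
       (geodist (x i) (x j) < e%:E)%E) ->
    exists l, forall e : R, 0 < e -> exists N, forall i, (N <= i)%N ->
       (geodist (x i) l < e%:E)%E.

(* Smoothness on B x [0, T], B being open in M: every point of B x [0, T] has,
   in coordinates, an open neighborhood W in R^n x R on which there is a smooth
   function that coincides with u on the part of W lying in B x [0, T]. *)
Definition smooth_spacetime (B : set M) (T : R) (u : M -> R -> R) : Prop :=
  forall p t, B p -> t \in `[0, T] ->
  exists (W : set ('rV[R]_n * R)%type) (U : ('rV[R]_n * R)%type -> R),
    [/\ open W, W (chart g p p, t), smooth_on W U &
      forall q s, chart_dom g p q -> B q -> s \in `[0, T] ->
        W (chart g p q, s) -> U (chart g p q, s) = u q s].

End Geometry.

(* The derivative of f : [0, T] -> R at t, one-sided at 0 and T. *)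
Definition time_deriv (R : realType) (T : R) (f : R -> R) (t : R) : R :=
  lim ((fun s => (f s - f t) / (s - t)) @ within `[0, T] t^').

Definition fde_solution (R : realType) (n : nat) (M : topologicalType)
    (g : riemannian R n M) (B : set M) (T m : R) (u : M -> R -> R) : Prop :=
  [/\ smooth_spacetime g B T u,
      forall x t, B x -> t \in `[0, T] -> 0 < u x t &
      forall x t, B x -> t \in `[0, T] ->
        time_deriv T (u x) t = laplacian g (fun y => u y t `^ m) x].

Definition pressure (R : realType) (M : Type) (m : R) (u : M -> R -> R)
  (x : M) (t : R) : R := m / (m - 1) * u x t `^ (m - 1).

Definition sup_neg (R : realType) (M : Type) (B : set M) (T : R)
    (v : M -> R -> R) : \bar R :=
  ereal_sup [set z | exists x t, [/\ B x, t \in `[0, T] & z = (- v x t)%:E]].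

(* |nabla v|^2 / v - alpha v_t / v *)
Definition harnack (R : realType) (n : nat) (M : topologicalType)
    (g : riemannian R n M) (T alpha : R) (v : M -> R -> R) (x : M) (t : R) : R :=
  norm g x (grad g (fun y => v y t) x) ^+ 2 / v x t
  - alpha * (time_deriv T (v x) t / v x t).

Section Constants.
Context {R : realType}.

Definition a_const (n : nat) (m : R) : R := n%:R * (m - 1) / (n%:R * (m - 1) + 2).

Definition C1 (a alpha eps1 : R) : R :=
  1 + (- a) * (1 - alpha)
  - (1 - alpha) * ((1 - a + eps1) ^+ 2 / ((1 - alpha) - a)).

Definition C1' (a alpha eps1 eps2 : R) : R :=
  1 + (- a) * (1 - alpha)
  - (1 - alpha) * ((1 - a + eps1) ^+ 2
                   / ((1 - alpha) - a - (1 - alpha) * eps2 ^+ 2)).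

Definition C2 (m a alpha eps1 : R) : R :=
  1600 * m ^+ 2 * ((- a) * alpha ^+ 2 / (2 * eps1 * (1 - alpha))).

Definition C3 (n : nat) (m : R) : R := 40 * (1 - m) * (n%:R + 2).

Definition C4 (n : nat) (m alpha eps2 : R) : R :=
  (n%:R - 1) * (1 - m) / ((1 - alpha) * eps2).

Definition C5 (n : nat) (m KR : R) : R :=
  40 * (1 - m) * (3 + (n%:R - 1) * (1 + KR)).

End Constants.

(* Main.v *)
Require Import Defs.
From HB Require Import structures.
From mathcomp Require Import all_boot all_order all_algebra.
From mathcomp Require Import all_classical all_reals all_analysis.
From mathcomp Require Import ring lra.
Set Implicit Arguments.
Unset Strict Implicit.
Unset Printing Implicit Defensive.
Import Order.TTheory GRing.Theory Num.Theory.
Import numFieldNormedType.Exports.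
Local Open Scope classical_set_scope.
Local Open Scope ring_scope.

(** Write z = v_t / v, y = |grad v|^2 / v and F = alpha z - y, the opposite of the left-hand side.
The pressure v solves v_t = (m - 1) v Lap v + |grad v|^2, so that P = z - y = (m - 1) Lap v and
F = P - (1 - alpha) z.  The Bochner formula bounds F_t - (m - 1) v Lap F by
2 m <grad v, grad F> + P^2 / a - (1 - alpha) z^2 + 2 (1 - m) kappa |grad v|^2 when Ric >= - kappa.
One maximizes s (1 - d^2 / rho^2)^2 F over the closed ball of radius rho = R / 2 around the target
point x, where d is the distance to x, and over the times s in [0, t]; closed balls are compact
because the manifold is complete.  At the maximum, rho^2 (1 - sqrt (c / F)) is, for a suitable
constant c, a smooth function touching d^2 from below, so its gradient is at most 2 d and its
Laplacian is controlled by comparison; a quadratic inequality for F and |grad v|^2 / (- v) follows.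

The Laplacian comparison avoids geodesics and Jacobi fields.  Let q be at distance r' of the maximum
point.  A nearly minimizing chain from q to that point is varied in the directions of transported
orthonormal frames, with amplitude growing linearly along the chain.  The second variation of the
length of each short link is estimated in a chart, the variation being made along the approximate
exponential map e |-> y + e' - Gamma_y (e', e') / 2 with e' = e - Gamma_c (y - c, e), c the center of
the chart.  Summing over the links gives Lap d_q <= n / r' + kappa r' in the barrier sense. *)

(** * Calculus of C^k maps *)

Section CkBasics.
Context {R : realType}.
Implicit Types V W : normedModType R.

(** The distance to a point is merely Lipschitz, and minimizing geodesics and the cut locus are
    avoided altogether, so the distance is never differentiated. Only upper bounds for it are used,
    as lengths of explicit curves, and all derivatives fall on the smooth function touching it from
    below. The weight is squared so that this barrier is affine in F^(-1/2), and so that the weight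
    cancels its own inverse square in the final bound. The factor s yields the term 1 / t. Closed
    balls of radius R / 2 around points of B(O, R / 2) stay in B(O, R), where the curvature bound
    holds. The comparison has n / r' instead of the sharp (n - 1) / r', since all n directions of
    the frame are varied with linear amplitude; the constant 40 leaves room for this. Choosing r' =
    r / (1 + K r) balances n / r' against (n - 1) K^2 r' and gives a bound linear in K r. In the
    last quadratic inequality [eps1] pays for the gradient of the weight and [eps2] for the
    curvature; eliminating |grad v|^2 / (- v) by completing a square produces exactly the constants
    [C1] and [C1']. *)

Lemma ler_mx_entry m n (A : 'M[R]_(m, n)) i j : `|A i j| <= `|A|.
Proof.
rewrite [leRHS]/Num.Def.normr/= mx_normrE.
by apply: le_trans; last exact: (le_bigmax _ _ (i, j)).
Qed.

Lemma mx_norm_le m n (A : 'M[R]_(m, n)) (e : R) : 0 <= e ->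
  (forall i j, `|A i j| <= e) -> `|A| <= e.
Proof.
move=> e0 H; rewrite [leLHS]/Num.Def.normr/= mx_normrE.
by apply/(bigmax_le _ e0) => -[i j] _ /=; exact: H.
Qed.

Lemma cvg_mxP (T : Type) (F : set_system T) m n (f : T -> 'M[R]_(m, n))
    (A : 'M[R]_(m, n)) :
  ProperFilter F ->
  f @ F --> A <-> (forall i j, (fun x => f x i j) @ F --> A i j).
Proof.
move=> FF; split=> [fA i j|H]; apply/cvgrPdist_le => /= e e0; near=> x.
  have -> : A i j - f x i j = (A - f x) i j by rewrite !mxE.
  by apply: le_trans (ler_mx_entry _ _ _) _; near: x; move/cvgrPdist_le: fA; apply.
apply: mx_norm_le; first exact: ltW.
near: x; apply: filter_forall => i; apply: filter_forall => j.
by near=> x; rewrite !mxE; near: x; have /cvgrPdist_le := H i j; apply.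
Unshelve. all: end_near. Qed.

Lemma derive_on_ext V W (U : set V) (f g : V -> W) (v y : V) : open U ->
  (forall y, U y -> f y = g y) -> U y ->
  (derivable f y v -> derivable g y v) /\ 'D_v f y = 'D_v g y.
Proof.
move=> oU fg Uy; have fgy : \near y, f y = g y.
  by near=> z; apply: fg; near: z; exact: open_nbhs_nbhs.
by split; [exact: near_eq_derivable | exact: near_eq_derive].
Unshelve. all: end_near. Qed.

Lemma Ck_ext V W k (U : set V) (f g : V -> W) : open U ->
  (forall y, U y -> f y = g y) -> Ck_on k U f -> Ck_on k U g.
Proof.
elim: k f g => [|k IH] f g oU fg [cf df]; split.
- move=> y Uy; rewrite /prop_for /continuous_at -fg//.
  apply: cvg_trans (cf y Uy); apply: near_eq_cvg; near=> z.
  by rewrite fg//; near: z; exact: open_nbhs_nbhs.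
- by [].
- move=> y Uy; rewrite /prop_for /continuous_at -fg//.
  apply: cvg_trans (cf y Uy); apply: near_eq_cvg; near=> z.
  by rewrite fg//; near: z; exact: open_nbhs_nbhs.
- move=> v; have [d1 d2] := df v; split.
    by move=> y Uy; have [+ _] := derive_on_ext v oU fg Uy; apply; exact: d1.
  by apply: IH d2 => // y Uy; have [_ ->] := derive_on_ext v oU fg Uy.
Unshelve. all: end_near. Qed.

Lemma Ck_continuous V W k (U : set V) (f : V -> W) y :
  Ck_on k U f -> U y -> {for y, continuous f}.
Proof. by case: k => [|k] [+ _]; apply. Qed.

Lemma Ck_derivable V W k (U : set V) (f : V -> W) y v :
  Ck_on k.+1 U f -> U y -> derivable f y v.
Proof. by move=> [_ /(_ v)[+ _]]; apply. Qed.

Arguments Ck_derivable {V W k U f y} v.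

Lemma Ck_derive V W k (U : set V) (f : V -> W) v :
  Ck_on k.+1 U f -> Ck_on k U ('D_v f).
Proof. by move=> [_ /(_ v)[_ +]]. Qed.

Arguments Ck_derive {V W k U f} v.

Lemma Ck_pred V W k (U : set V) (f : V -> W) : Ck_on k.+1 U f -> Ck_on k U f.
Proof.
elim: k f => [|k IH] f [cf df]; split=> // v; have [d1 d2] := df v; split=> //.
exact: IH.
Qed.

Lemma Ck_le V W j k (U : set V) (f : V -> W) : (j <= k)%N ->
  Ck_on k U f -> Ck_on j U f.
Proof.
move=> /subnK <-; elim: (k - j)%N => // i IH; rewrite addSn => /Ck_pred.
exact: IH.
Qed.

Lemma Ck_sub V W k (U U' : set V) (f : V -> W) : U' `<=` U ->
  Ck_on k U f -> Ck_on k U' f.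
Proof.
move=> sU; elim: k f => [|k IH] f [cf df]; split=> //.
- by move=> y /sU; exact: cf.
- by move=> y /sU; exact: cf.
- move=> v; have [d1 d2] := df v; split; first by move=> y /sU; exact: d1.
  exact: IH.
Qed.

Lemma Ck_cst V W k (U : set V) (c : W) : Ck_on k U (cst c : V -> W).
Proof.
elim: k c => [|k IH] c; split=> //; try by move=> y _; exact: cst_continuous.
move=> v; split; first by move=> y _; exact: derivable_cst.
have -> : 'D_v (cst c : V -> W) = cst 0 by apply/funext => y; rewrite derive_cst.
exact: IH.
Qed.

Lemma is_derive_linear V W (f : {linear V -> W}) (x v : V) :
  is_derive x v f (f v).
Proof.
have H : (fun h : R => h^-1 *: ((f \o shift x) (h *: v) - f x)) @ 0^' --> f v.
  apply: cvg_trans (cvg_cst (F := 0^') (f v)); apply: near_eq_cvg; near=> h.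
  have -> : (f \o shift x) (h *: v) = f (h *: v) + f x by rewrite -linearD.
  rewrite addrK linearZ /= scalerA mulVf ?scale1r//.
  by near: h; exact: nbhs_dnbhs_neq.
by apply: DeriveDef; [exact: cvgP H | exact: (cvg_lim _ H)].
Unshelve. all: end_near. Qed.

Lemma Ck_linear V W k (U : set V) (f : {linear V -> W}) :
  continuous f -> Ck_on k U f.
Proof.
move=> cf; case: k => [|k]; split=> //; try by move=> y _; exact: cf.
move=> v; split; first by move=> y _; have [] := is_derive_linear f y v.
have -> : 'D_v f = cst (f v).
  by apply/funext => y; have [_ ->] := is_derive_linear f y v.
exact: Ck_cst.
Qed.

Lemma Ck_add V W k (U : set V) (f g : V -> W) : open U ->
  Ck_on k U f -> Ck_on k U g -> Ck_on k U (fun y => f y + g y).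
Proof.
move=> oU; elim: k f g => [|k IH] f g [cf df] [cg dg]; split=> //.
- by move=> y Uy; apply: cvgD; [exact: cf|exact: cg].
- by move=> y Uy; apply: cvgD; [exact: cf|exact: cg].
- move=> v; have [f1 f2] := df v; have [g1 g2] := dg v; split.
    by move=> y Uy; apply: derivableD; [exact: f1|exact: g1].
  apply: Ck_ext (IH _ _ f2 g2) => // y Uy.
  by rewrite -(deriveD (f1 _ Uy) (g1 _ Uy)).
Qed.

Lemma Ck_opp V W k (U : set V) (f : V -> W) : open U ->
  Ck_on k U f -> Ck_on k U (fun y => - f y).
Proof.
move=> oU; elim: k f => [|k IH] f [cf df]; split=> //.
- by move=> y Uy; apply: cvgN; exact: cf.
- by move=> y Uy; apply: cvgN; exact: cf.
- move=> v; have [f1 f2] := df v; split.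
    by move=> y Uy; apply: derivableN; exact: f1.
  apply: Ck_ext (IH _ f2) => // y Uy.
  by rewrite -(deriveN (f1 _ Uy)).
Qed.

Lemma Ck_mul V k (U : set V) (f g : V -> R) : open U ->
  Ck_on k U f -> Ck_on k U g -> Ck_on k U (fun y => f y * g y).
Proof.
move=> oU; elim: k f g => [|k IH] f g Cf Cg.
  by split=> // y Uy; exact: (continuousM (Ck_continuous Cf Uy) (Ck_continuous Cg Uy)).
split.
  by move=> y Uy; exact: (continuousM (Ck_continuous Cf Uy) (Ck_continuous Cg Uy)).
move=> v; have f1 := Ck_derivable v Cf; have g1 := Ck_derivable v Cg; split.
  by move=> y Uy; apply: derivableM; [exact: f1|exact: g1].
apply: (@Ck_ext _ _ _ _ (fun y => f y * 'D_v g y + g y * 'D_v f y)) => //.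
  by move=> y Uy; rewrite -[RHS]/('D_v (f * g) y) (deriveM (f1 _ Uy) (g1 _ Uy)).
apply: Ck_add => //; apply: IH.
- exact: Ck_pred Cf.
- exact: (Ck_derive v Cg).
- exact: Ck_pred Cg.
- exact: (Ck_derive v Cf).
Qed.

Lemma Ck_sum V W k (U : set V) (I : Type) (r : seq I) (f : I -> V -> W) :
  open U -> (forall i, Ck_on k U (f i)) ->
  Ck_on k U (fun y => \sum_(i <- r) f i y).
Proof.
move=> oU Cf; elim: r => [|i r IH].
  by apply: (Ck_ext oU _ (Ck_cst k U (0 : W))) => y _; rewrite big_nil.
by apply: (Ck_ext oU _ (Ck_add oU (Cf i) IH)) => y _; rewrite big_cons.
Qed.

Lemma Ck_inv V k (U : set V) (f : V -> R) : open U ->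
  (forall y, U y -> f y != 0) ->
  Ck_on k U f -> Ck_on k U (fun y => (f y)^-1).
Proof.
move=> oU f0; elim: k => [|k IH] Cf.
  by split=> // y Uy; apply: cvgV; [exact: f0|exact: (Ck_continuous Cf)].
split; first by move=> y Uy; apply: cvgV; [exact: f0|exact: (Ck_continuous Cf)].
move=> v; have f1 := Ck_derivable v Cf; split.
  by move=> y Uy; apply: derivableV; [exact: f0|exact: f1].
have C' := IH (Ck_pred Cf).
apply: (@Ck_ext _ _ _ _ (fun y => - ((f y)^-1 * (f y)^-1 * 'D_v f y))) => //.
  move=> y Uy; rewrite (deriveV (f0 _ Uy) (f1 _ Uy)) /= -expr2 exprVn.
  by rewrite scaleNr.
by apply: Ck_opp => //; do !apply: Ck_mul => //; exact: Ck_derive.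
Qed.

Lemma Ck_mx V k m n (U : set V) (f : V -> 'M[R]_(m, n)) : open U ->
  (forall i j, Ck_on k U (fun y => f y i j)) -> Ck_on k U f.
Proof.
move=> oU; elim: k f => [|k IH] f Cf.
  split=> // y Uy; apply/cvg_mxP => i j; exact: (Ck_continuous (Cf i j) Uy).
split; first by move=> y Uy; apply/cvg_mxP => i j; exact: (Ck_continuous (Cf i j) Uy).
move=> v; have f1 y : U y -> derivable f y v.
  by move=> Uy; apply/derivable_mxP => i j; exact: (Ck_derivable v (Cf i j)).
split=> //; apply: IH => i j.
apply: (Ck_ext oU _ (Ck_derive v (Cf i j))) => y Uy.
by rewrite (derive_mx (f1 _ Uy)) mxE.
Qed.

Lemma Ck_mxP V k m n (U : set V) (f : V -> 'M[R]_(m, n)) : open U ->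
  Ck_on k U f <-> (forall i j, Ck_on k U (fun y => f y i j)).
Proof.
move=> oU; split; last exact: Ck_mx.
elim: k f => [|k IH] f Cf i j.
  by split=> // y Uy; have /cvg_mxP := Ck_continuous Cf Uy; apply.
split; first by move=> y Uy; have /cvg_mxP := Ck_continuous Cf Uy; apply.
move=> v; split.
  by move=> y Uy; have /derivable_mxP := Ck_derivable v Cf Uy; apply.
apply: (Ck_ext oU _ (IH _ (Ck_derive v Cf) i j)) => y Uy.
by rewrite (derive_mx (Ck_derivable v Cf Uy)) mxE.
Qed.

Lemma derive_coord V m n (f : V -> 'M[R]_(m, n)) y v i j :
  derivable f y v -> 'D_v (fun z => f z i j) y = ('D_v f y) i j.
Proof. by move=> df; rewrite (derive_mx df) mxE. Qed.

End CkBasics.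
Arguments Ck_derivable {R V W k U f y} v.
Arguments Ck_derive {R V W k U f} v.

(** * Mean value arguments along lines and symmetry of second derivatives *)

Section LineCalculus.
Context {R : realType}.
Implicit Types V W : normedModType R.

Lemma is_derive_line V W (f : V -> W) (x v : V) (s : R) :
  derivable f (x + s *: v) v ->
  is_derive s (1 : R) (fun t : R => f (x + t *: v)) ('D_v f (x + s *: v)).
Proof.
move=> df.
have E : (fun h : R => h^-1 *: (((fun t : R => f (x + t *: v)) \o shift s)
             (h *: (1 : R)) - f (x + s *: v))) =
         (fun h : R => h^-1 *: ((f \o shift (x + s *: v)) (h *: v)
             - f (x + s *: v))).
  apply/funext => h /=; congr (_ *: (f _ - _)).
  by rewrite [h *: (1 : R)]mulr1 scalerDl addrCA.
by split; rewrite /derivable /derive E.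
Qed.

(** Existence of a directional derivative says nothing about linearity in the direction, but
    homogeneity survives: it is a change of the parameter on one line. *)
Lemma is_derive_scale V (g : V -> R) (y u : V) (t : R) : derivable g y u ->
  is_derive y (t *: u) g (t * 'D_u g y).
Proof.
move=> dg; have : is_derive 0 (1 : R) (fun h : R => g (y + h *: u)) ('D_u g y).
  by have := @is_derive_line _ _ g y u 0; rewrite scale0r addr0; apply.
move=> h1.
have h2 : is_derive (0 : R) (1 : R) (fun h : R => t *: h) (t *: (1 : R)).
  exact: is_deriveZ.
have h3 : is_derive (t *: (0 : R)) (1 : R) (fun h : R => g (y + h *: u)) ('D_u g y).
  by rewrite scaler0.
have [h4 h5] := is_derive1_comp h3 h2.
have E : (fun h : R => h^-1 *: ((g \o shift y) (h *: (t *: u)) - g y)) =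
    (fun h : R => h^-1 *: ((((fun h : R => g (y + h *: u)) \o (fun h : R => t *: h))
      \o shift 0) (h *: (1 : R)) -
      ((fun h : R => g (y + h *: u)) \o (fun h : R => t *: h)) 0)).
  apply/funext => h /=; rewrite scaler0 scale0r !addr0 [h *: (1 : R)]mulr1.
  have -> : h *: (t *: u) + y = y + (t *: h) *: u.
    by rewrite scalerA addrC; congr (_ + _ *: _); exact: mulrC.
  by [].
split; first by rewrite /derivable E.
by rewrite /derive E; move: h5; rewrite /derive => ->; rewrite [t *: _]mulr1 mulrC.
Qed.

Lemma line_MVT V (f : V -> R) (x v : V) :
  (forall s : R, 0 <= s <= 1 -> derivable f (x + s *: v) v) ->
  exists2 s : R, 0 <= s <= 1 & f (x + v) - f x = 'D_v f (x + s *: v).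
Proof.
move=> df.
have [|||s] := @MVT_segment R (fun t => f (x + t *: v))
    (fun t => 'D_v f (x + t *: v)) 0 1.
- exact: ler01.
- move=> s; rewrite in_itv /= => /andP[s0 s1].
  by apply: is_derive_line; apply: df; rewrite !ltW.
- apply: continuous_in_subspaceT => s; rewrite inE /= in_itv /= => /df/is_derive_line.
  by move=> [d _]; apply: differentiable_continuous; exact/derivable1_diffP.
- rewrite in_itv /= => s01; rewrite scale1r scale0r addr0 subr0 mulr1.
  by exists s.
Qed.

(** Symmetrization removes the first-order term: [s |-> f s + f (- s) - B s^2] is nonincreasing on
    [0, 1], by the mean value theorem for [df] on [- s, s]. *)
Lemma second_diff_le (f df ddf : R -> R) (B : R) :
  (forall s : R, -1 <= s <= 1 -> is_derive s (1 : R) f (df s)) ->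
  (forall s : R, -1 <= s <= 1 -> is_derive s (1 : R) df (ddf s)) ->
  (forall s : R, -1 <= s <= 1 -> ddf s <= B) ->
  f 1 + f (-1) - 2 * f 0 <= B.
Proof.
move=> d1 d2 hB.
have step (s : R) : 0 <= s -> s <= 1 -> df s - df (- s) <= 2 * s * B.
  move=> s0 s1.
  have [|||c] := @MVT_segment R df ddf (- s) s.
  - lra.
  - by move=> t; rewrite in_itv /= => /andP[? ?]; apply: d2; lra.
  - apply: continuous_in_subspaceT => t; rewrite inE /= in_itv /= => /andP[? ?].
    have [|d _] := d2 t; first lra.
    by apply: differentiable_continuous; exact/derivable1_diffP.
  - rewrite in_itv /= => /andP[? ?] ->.
    have : ddf c <= B by apply: hB; lra.
    by nra.
pose k (s : R) := f s + f (- s) - B * (s * s).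
have dk (s : R) : -1 <= s <= 1 ->
    is_derive s (1 : R) k (df s - df (- s) - B * (s + s)).
  move=> s1; have h1 := d1 s s1.
  have h2 : is_derive (- s) (1 : R) f (df (- s)) by apply: d1; lra.
  have h3 : is_derive s (1 : R) (fun t => - t) (- 1) by exact: is_deriveN.
  have h4 := is_derive1_comp h2 h3.
  rewrite /k; apply: is_derive_eq.
  by rewrite /GRing.scale /=; ring.
have [|||c] := @MVT_segment R k (fun s => df s - df (- s) - B * (s + s)) 0 1.
- exact: ler01.
- by move=> t; rewrite in_itv /= => /andP[? ?]; apply: dk; lra.
- apply: continuous_in_subspaceT => t; rewrite inE /= in_itv /= => /andP[? ?].
  have [|d _] := dk t; first lra.
  by apply: differentiable_continuous; exact/derivable1_diffP.
rewrite in_itv /= => /andP[c0 c1]; have := step c c0 c1.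
by rewrite /k oppr0; nra.
Qed.

Lemma sub_lt_of_dist (a b c e : R) :
  `|b - c| < e / 2 -> `|a - c| < e / 2 -> a - b < e.
Proof. by rewrite !ltr_norml => /andP[? ?] /andP[? ?]; lra. Qed.

(** The second difference of [f] over a parallelogram of sides t v and t w does not depend on the
    order of the sides, and for each order it is t^2 times the corresponding mixed derivative at a
    nearby point. Continuity of both mixed derivatives concludes; by symmetry a one-sided inequality
    up to every [e] is enough. *)
Lemma Schwarz V (U : set V) (f : V -> R) (v w x : V) : open U ->
  Ck_on 2 U f -> U x -> 'D_v ('D_w f) x = 'D_w ('D_v f) x.
Proof.
move=> oU Cf Ux.
wlog suff : v w / forall e : R, 0 < e -> 'D_v ('D_w f) x - 'D_w ('D_v f) x < e.
  move=> H; apply/eqP; rewrite eq_le; apply/andP; split; rewrite -subr_le0;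
  by apply/ler_addgt0Pl => e e0; rewrite addr0 ltW//; apply: H.
move=> e e0.
have c1 : {for x, continuous ('D_v ('D_w f))}.
  by apply: (Ck_continuous (k := 0) _ Ux); do 2!apply: Ck_derive.
have c2 : {for x, continuous ('D_w ('D_v f))}.
  by apply: (Ck_continuous (k := 0) _ Ux); do 2!apply: Ck_derive.
have : \forall y \near x, U y /\
    (`|'D_v ('D_w f) x - 'D_v ('D_w f) y| < e / 2 /\
     `|'D_w ('D_v f) x - 'D_w ('D_v f) y| < e / 2).
  apply: filterI; first exact: open_nbhs_nbhs.
  apply: filterI.
  - by move/cvgrPdist_lt : c1; apply; rewrite divr_gt0.
  - by move/cvgrPdist_lt : c2; apply; rewrite divr_gt0.
move=> /nbhs_ballP[r /= r0 Hr].
have [t [t0 tr]] : exists t : R, 0 < t /\ t * (`|v| + `|w|) < r.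
  have N0 : 0 < `|v| + `|w| + 1 by rewrite ltr_wpDl// addr_ge0.
  exists (r / (2 * (`|v| + `|w| + 1))); split.
    by rewrite divr_gt0// mulr_gt0.
  rewrite mulrAC ltr_pdivrMr ?mulr_gt0//.
  by have := normr_ge0 v; have := normr_ge0 w; nra.
have inb (a b : R) : 0 <= a <= 1 -> 0 <= b <= 1 ->
    ball x r (x + a *: (t *: v) + b *: (t *: w)).
  move=> /andP[a0 a1] /andP[b0 b1].
  rewrite -ball_normE /= -addrA opprD addrA subrr sub0r normrN.
  apply: le_lt_trans (ler_normD _ _) _.
  rewrite !normrZ (ger0_norm a0) (ger0_norm b0) (gtr0_norm t0).
  apply: le_lt_trans tr.
  by rewrite mulrDr; apply: lerD; apply: ler_piMl => //;
    rewrite mulr_ge0// ltW.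
(* Two mean value steps: along [p] for the increment of [f] in the direction [q], then along [q] for
   ['D_p f]. *)
have key (p q : V) : (forall a b : R, 0 <= a <= 1 -> 0 <= b <= 1 ->
      ball x r (x + a *: (t *: p) + b *: (t *: q))) ->
    exists y, ball x r y /\ f (x + t *: p + t *: q) - f (x + t *: p)
       - (f (x + t *: q) - f x) = t * (t * 'D_q ('D_p f) y).
  move=> Hpq.
  have dscale (g : V -> R) (y u : V) : derivable g y u ->
      derivable g y (t *: u) /\ 'D_(t *: u) g y = t * 'D_u g y.
    by move=> /(is_derive_scale t)[h4 h5]; split.
  pose F y := f (y + t *: q) - f y.
  have dF y : U y -> U (y + t *: q) -> is_derive y (t *: p) F
      (t * 'D_p f (y + t *: q) - t * 'D_p f y).
    move=> U1 U2; rewrite /F.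
    have [a1 a2] := dscale _ _ _ (Ck_derivable p Cf U1).
    have [b1 b2] := dscale _ _ _ (Ck_derivable p Cf U2).
    rewrite -a2 -b2.
    have h1 : is_derive y (t *: p) (fun y => f (y + t *: q)) ('D_(t *: p) f (y + t *: q)).
      have E : (fun h : R => h^-1 *: (((fun y => f (y + t *: q)) \o shift y) (h *: (t *: p)) - f (y + t *: q)))
       = (fun h : R => h^-1 *: ((f \o shift (y + t *: q)) (h *: (t *: p)) - f (y + t *: q))).
        by apply/funext => h /=; rewrite addrA.
      by split; rewrite /derivable /derive E.
    have h2 : is_derive y (t *: p) f ('D_(t *: p) f y) by split.
    exact: is_deriveB.
  have inU a b : 0 <= a <= 1 -> 0 <= b <= 1 -> U (x + a *: (t *: p) + b *: (t *: q)).
    by move=> ha hb; have [] := Hr _ (Hpq a b ha hb).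
  have i01 : 0 <= (1 : R) <= 1 by rewrite ler01 lexx.
  have i00 : 0 <= (0 : R) <= 1 by rewrite ler01 lexx.
  have [s hs|s hs E] := @line_MVT _ F x (t *: p).
    have [//||//] := dF (x + s *: (t *: p)).
    - by have := inU s 0 hs i00; rewrite scale0r addr0.
    - by have := inU s 1 hs i01; rewrite scale1r.
  have us0 : U (x + s *: (t *: p)) by have := inU s 0 hs i00; rewrite scale0r addr0.
  have us1 : U (x + s *: (t *: p) + t *: q).
    by have := inU s 1 hs i01; rewrite scale1r.
  have [_ E2] := dF _ us0 us1.
  have [b hb|b hb E3] := @line_MVT _ ('D_p f) (x + s *: (t *: p)) (t *: q).
    by apply: (dscale _ _ _ _).1; apply: (Ck_derivable q (Ck_derive p Cf)); exact: inU.
  exists (x + s *: (t *: p) + b *: (t *: q)); split; first exact: Hpq.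
  rewrite -[LHS]/(F (x + t *: p) - F x) E E2 -mulrBr E3; congr (_ * _).
  by apply: (dscale _ _ _ _).2; apply: (Ck_derivable q (Ck_derive p Cf)); exact: inU.
have [y1 [By1 E1]] := key v w inb.
have [y2 [By2 E2]] : exists y, ball x r y /\ f (x + t *: w + t *: v) - f (x + t *: w)
       - (f (x + t *: v) - f x) = t * (t * 'D_v ('D_w f) y).
  by apply: key => a b ha hb; rewrite addrAC; exact: inb.
have E : 'D_w ('D_v f) y1 = 'D_v ('D_w f) y2.
  apply: (mulfI (lt0r_neq0 t0)); apply: (mulfI (lt0r_neq0 t0)).
  have aux (a b c d : R) : a - b - (c - d) = a - c - (b - d) by ring.
  rewrite (addrAC x (t *: w)) in E2.
  exact: (etrans (esym E1) (etrans (aux _ _ _ _) E2)).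
have [_ [_ n1]] := Hr _ By1; have [_ [n2 _]] := Hr _ By2.
by rewrite E in n1; exact: sub_lt_of_dist n1 n2.
Unshelve. all: end_near. Qed.

End LineCalculus.

(** * Chain rules for maps with continuous directional derivatives *)

Section ChainRule.
Context {R : realType}.
Implicit Types V W : normedModType R.

Notation "''e_' i" := (delta_mx 0 i) (at level 8, i at level 2, format "''e_' i").

(** Going from [y] to [z] one coordinate at a time and applying the mean value theorem on each edge
    turns continuous partial derivatives into a factorization of the increment with factors
    continuous at [y]. This is the form of differentiability from which the chain rules follow. *)
Lemma caratheodory n (O : set 'rV[R]_n) (g : 'rV[R]_n -> R) (y : 'rV[R]_n) :
  open O -> Ck_on 1 O g -> O y ->
  exists A : 'I_n -> 'rV[R]_n -> R,
    (forall i, A i z @[z --> y] --> 'D_'e_i g y) /\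
    (\forall z \near y, g z - g y = \sum_i (z 0 i - y 0 i) * A i z).
Proof.
move=> oO Cg Oy.
have /nbhs_ballP[r /= r0 Hr] : nbhs y O by exact: open_nbhs_nbhs.
pose P z (c : 'I_n -> 'rV[R]_n) := (forall i, `|c i - y| <= `|z - y|) /\
  g z - g y = \sum_i (z 0 i - y 0 i) * 'D_'e_i g (c i).
have ex z : ball y r z -> exists c, P z c.
  move=> Bz.
  (* The corners of the staircase from [y] (k = 0) to [z] (k = n): the first k coordinates are
     already those of [z]. *)
  pose mix (k : nat) : 'rV[R]_n := \row_j (if (j < k)%N then z 0 j else y 0 j).
  have mixS (k : 'I_n) : mix k.+1 = mix k + (z 0 k - y 0 k) *: 'e_k.
    apply/rowP => j; rewrite !mxE eqxx /=; have [->|ne] := eqVneq j k.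
      by rewrite ltnS leqnn ltnn mulr1 addrC subrK.
    rewrite mulr0 addr0 ltnS leq_eqVlt.
    by have -> : (nat_of_ord j == k) = false by apply/negbTE.
  have near_mix (k : 'I_n) (s : R) : 0 <= s <= 1 ->
      `|mix k + s *: ((z 0 k - y 0 k) *: 'e_k) - y| <= `|z - y|.
    move=> /andP[s0 s1]; apply: mx_norm_le => // i j; rewrite ord1 !mxE eqxx /=.
    have zy : `|z 0 j - y 0 j| <= `|z - y|.
      by have := ler_mx_entry (z - y) 0 j; rewrite !mxE.
    case: eqVneq => [->|ne].
      rewrite ltnn mulr1 addrC addKr normrM (ger0_norm s0).
      have zk : `|z 0 k - y 0 k| <= `|z - y|.
        by have := ler_mx_entry (z - y) 0 k; rewrite !mxE.
      by apply: le_trans zk; apply: ler_piMl.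
    by rewrite !mulr0 addr0; case: ifP => _ //; rewrite subrr normr0.
  have inO w : `|w - y| <= `|z - y| -> O w.
    move=> wz; apply: Hr; rewrite -ball_normE /= distrC.
    by apply: le_lt_trans wz _; move: Bz; rewrite -ball_normE /= distrC.
  have step (k : 'I_n) : exists c, `|c - y| <= `|z - y| /\
      g (mix k.+1) - g (mix k) = (z 0 k - y 0 k) * 'D_'e_k g c.
    have der s : 0 <= s <= 1 ->
        derivable g (mix k + s *: ((z 0 k - y 0 k) *: 'e_k)) 'e_k.
      by move=> hs; apply: (Ck_derivable _ Cg); apply: inO; exact: near_mix.
    have [s hs|s hs E] := @line_MVT R _ g (mix k) ((z 0 k - y 0 k) *: 'e_k).
      by have [] := is_derive_scale (z 0 k - y 0 k) (der s hs).
    exists (mix k + s *: ((z 0 k - y 0 k) *: 'e_k)); split; first exact: near_mix.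
    by rewrite mixS E; have [_ ->] := is_derive_scale (z 0 k - y 0 k) (der s hs).
  have [c hc] := choice step.
  exists c; split; first by move=> i; have [] := hc i.
  have -> : g z - g y = g (mix n) - g (mix 0).
    congr (g _ - g _); apply/rowP => j; rewrite !mxE ?ltn_ord//.
  rewrite -(telescope_sumr (fun k => g (mix k))) // big_mkord.
  by apply: eq_bigr => k _; have [] := hc k.
have [c hc] : exists c : 'rV[R]_n -> 'I_n -> 'rV[R]_n,
    forall z, ball y r z -> P z (c z).
  have ex' (z : 'rV[R]_n) : exists c : 'I_n -> 'rV[R]_n, ball y r z -> P z c.
    have [/ex[c hc]|nB] := pselect (ball y r z); first by exists c.
    by exists (fun=> 0).
  by have [c hc] := choice ex'; exists c.
exists (fun i z => 'D_'e_i g (c z i)); split.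
  move=> i; have cg : {for y, continuous ('D_'e_i g)}.
    exact: (Ck_continuous (Ck_derive _ Cg)).
  have cz : c z i @[z --> y] --> y.
    move=> A /nbhs_ballP[e /= e0 HA]; apply/nbhs_ballP.
    exists (Num.min r e) => /=; first by rewrite lt_min r0 e0.
    move=> z; rewrite -ball_normE /= lt_min => /andP[zr ze]; apply: HA.
    rewrite -ball_normE /= distrC; have [|+ _] := hc z.
      by rewrite -ball_normE.
    by move=> /(_ i) h; apply: le_lt_trans h _; rewrite distrC.
  exact: (cvg_comp _ _ cz cg).
near=> z; have [|//] := hc z.
by near: z; exact: nbhsx_ballx.
Unshelve. all: end_near. Qed.

Lemma cvg_sumr (T : Type) (F : set_system T) (FF : ProperFilter F) W I
    (r : seq I) (f : I -> T -> W) (l : I -> W) :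
  (forall i, f i x @[x --> F] --> l i) ->
  \sum_(i <- r) f i x @[x --> F] --> \sum_(i <- r) l i.
Proof.
move=> H; elim: r => [|i r IH].
  by under eq_fun do rewrite big_nil; rewrite big_nil; exact: cvg_cst.
by under eq_fun do rewrite big_cons; rewrite big_cons; exact: cvgD.
Qed.

Lemma derivable_line_cvg V W (f : V -> W) (x v : V) : derivable f x v ->
  f (h *: v + x) @[h --> (0 : R)] --> f x.
Proof.
move=> df; have : is_derive (0 : R) (1 : R) (fun h : R => f (x + h *: v)) ('D_v f x).
  by have := @is_derive_line R V W f x v 0; rewrite scale0r addr0; apply.
move=> [d _]; have /differentiable_continuous : differentiable (fun h : R => f (x + h *: v)) (0 : R).
  exact/derivable1_diffP.
rewrite /prop_for /continuous_at scale0r addr0.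
by under eq_fun do rewrite addrC.
Qed.

(** Only the derivative of [f] along [v] is at hand. The Caratheodory factors of [g] write the
    difference quotient as a finite sum of products, each factor of which has a limit. *)
Lemma is_derive_comp_rV V n (O : set 'rV[R]_n) (g : 'rV[R]_n -> R)
    (f : V -> 'rV[R]_n) (x v : V) : open O -> Ck_on 1 O g -> O (f x) ->
  derivable f x v ->
  is_derive x v (fun z => g (f z)) (\sum_i ('D_v f x) 0 i * 'D_'e_i g (f x)).
Proof.
move=> oO Cg Of df.
have [A [cA EA]] := caratheodory oO Cg Of.
have fc := derivable_line_cvg df.
have fc' : f (h *: v + x) @[h --> (0 : R)^'] --> f x.
  exact: cvg_within_filter fc.
have H : h^-1 *: (g (f (h *: v + x)) - g (f x)) @[h --> (0 : R)^']
    --> \sum_i ('D_v f x) 0 i * 'D_'e_i g (f x).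
  apply: (@cvg_trans _ ((\sum_i (h^-1 *: (f (h *: v + x) - f x)) 0 i *
      A i (f (h *: v + x))) @[h --> (0 : R)^'])).
    apply: near_eq_cvg; near=> h.
    have -> : g (f (h *: v + x)) - g (f x) =
        \sum_i (f (h *: v + x) 0 i - f x 0 i) * A i (f (h *: v + x)).
      by near: h; exact: (fc' _ EA).
    rewrite [RHS]mulr_sumr; apply: eq_bigr => i _; rewrite !mxE mulrA; congr (_ * _).
  apply: cvg_sumr => i; apply: cvgM.
    have /cvg_mxP : (h^-1 *: (f (h *: v + x) - f x)) @[h --> (0 : R)^'] --> 'D_v f x.
      exact: df.
    by apply.
  by apply: (@cvg_comp _ _ _ _ (A i) _ _ _ fc' (cA i)).
by apply: DeriveDef; [exact: cvgP H | exact: (cvg_lim _ H)].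
Unshelve. all: end_near. Qed.

(** Linearity in the direction, obtained from the chain rule with the identity as inner map. *)
Lemma derive_rV n (O : set 'rV[R]_n) (g : 'rV[R]_n -> R) (x v : 'rV[R]_n) :
  open O -> Ck_on 1 O g -> O x -> 'D_v g x = \sum_i v 0 i * 'D_'e_i g x.
Proof.
move=> oO Cg Ox.
have [d1 d2] : is_derive x v (id : 'rV[R]_n -> 'rV[R]_n) v by exact: is_derive_id.
have [_ ->] := @is_derive_comp_rV _ _ _ _ id _ _ oO Cg Ox d1.
by rewrite d2.
Qed.

Lemma derive_rV_mx n p q (O : set 'rV[R]_n) (g : 'rV[R]_n -> 'M[R]_(p, q))
    (x v : 'rV[R]_n) :
  open O -> Ck_on 1 O g -> O x -> 'D_v g x = \sum_i v 0 i *: 'D_'e_i g x.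
Proof.
move=> oO Cg Ox; apply/matrixP => i j; rewrite summxE.
rewrite -(derive_coord _ _ (Ck_derivable v Cg Ox)).
have Cij : Ck_on 1 O (fun y => g y i j) by exact: (Ck_mxP 1 g oO).1.
rewrite (derive_rV _ oO Cij Ox); apply: eq_bigr => k _; rewrite mxE.
by rewrite -(derive_coord _ _ (Ck_derivable _ Cg Ox)).
Qed.

Lemma is_derive_comp V n p q (O : set 'rV[R]_n) (g : 'rV[R]_n -> 'M[R]_(p, q))
    (f : V -> 'rV[R]_n) (x v : V) : open O -> Ck_on 1 O g -> O (f x) ->
  derivable f x v ->
  is_derive x v (fun z => g (f z)) ('D_('D_v f x) g (f x)).
Proof.
move=> oO Cg Of df.
have H i j := is_derive_comp_rV oO ((Ck_mxP 1 g oO).1 Cg i j) Of df.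
have d : derivable (fun z => g (f z)) x v.
  by apply/derivable_mxP => i j; have [] := H i j.
split; first exact: d.
apply/matrixP => i j; rewrite -(derive_coord _ _ d).
have [_ ->] := H i j.
rewrite (derive_rV_mx _ oO Cg Of) summxE; apply: eq_bigr => k _; rewrite mxE.
by rewrite (derive_coord _ _ (Ck_derivable _ Cg Of)).
Qed.

Lemma is_derive_comp_scalar V n (O : set 'rV[R]_n) (g : 'rV[R]_n -> R)
    (f : V -> 'rV[R]_n) (x v : V) : open O -> Ck_on 1 O g -> O (f x) ->
  derivable f x v ->
  is_derive x v (fun z => g (f z)) ('D_('D_v f x) g (f x)).
Proof.
move=> oO Cg Of df; rewrite (derive_rV _ oO Cg Of).
exact: (is_derive_comp_rV oO Cg Of df).
Qed.

Lemma Ck_comp V n k (U : set V) (O : set 'rV[R]_n) (g : 'rV[R]_n -> R)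
    (f : V -> 'rV[R]_n) : open U -> open O -> (forall x, U x -> O (f x)) ->
  Ck_on k O g -> Ck_on k U f -> Ck_on k U (fun x => g (f x)).
Proof.
move=> oU oO UO; elim: k g => [|k IH] g Cg Cf.
  split=> // y Uy; apply: continuous_comp; first exact: (Ck_continuous Cf).
  by apply: (Ck_continuous Cg); exact: UO.
split.
  move=> y Uy; apply: continuous_comp; first exact: (Ck_continuous Cf).
  by apply: (Ck_continuous Cg); exact: UO.
have Cg1 : Ck_on 1 O g by apply: Ck_le Cg.
have Cf1 : Ck_on 1 U f by apply: Ck_le Cf.
move=> v; have H y (Uy : U y) :=
  is_derive_comp_rV oO Cg1 (UO _ Uy) (Ck_derivable v Cf1 Uy).
split; first by move=> y Uy; have [] := H y Uy.
apply: (@Ck_ext _ _ _ _ _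
   (fun y => \sum_i ('D_v f y) 0 i * 'D_'e_i g (f y))) => //.
  by move=> y Uy; have [_ ->] := H y Uy.
apply: Ck_sum => // i; apply: Ck_mul => //.
  by have /Ck_mxP := Ck_derive v Cf; apply.
exact: (IH _ (Ck_derive _ Cg) (Ck_pred Cf)).
Qed.

Lemma Ck_comp_mx V n p q k (U : set V) (O : set 'rV[R]_n)
    (g : 'rV[R]_n -> 'M[R]_(p, q)) (f : V -> 'rV[R]_n) :
  open U -> open O -> (forall x, U x -> O (f x)) ->
  Ck_on k O g -> Ck_on k U f -> Ck_on k U (fun x => g (f x)).
Proof.
move=> oU oO UO /(Ck_mxP _ _ oO) Cg Cf; apply/Ck_mxP => // i j.
exact: (Ck_comp oU oO UO (Cg i j) Cf).
Qed.

Lemma is_derive_comp1 V (F : R -> R) (f : V -> R) (x v : V) (a : R) :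
  is_derive (f x) (1 : R) F a -> derivable f x v ->
  is_derive x v (fun z => F (f z)) (a * 'D_v f x).
Proof.
move=> dF df.
have h1 : is_derive 0 (1 : R) (fun h : R => f (x + h *: v)) ('D_v f x).
  by have := @is_derive_line _ _ _ f x v 0; rewrite scale0r addr0; apply.
have h3 : is_derive ((fun h : R => f (x + h *: v)) 0) (1 : R) F a.
  by rewrite scale0r addr0.
have [h4 h5] := is_derive1_comp h3 h1.
have E : (fun h : R => h^-1 *: (((fun z => F (f z)) \o shift x) (h *: v) - F (f x))) =
    (fun h : R => h^-1 *: (((F \o (fun h : R => f (x + h *: v)))
      \o shift 0) (h *: (1 : R)) - (F \o (fun h : R => f (x + h *: v))) 0)).
  apply/funext => h /=; rewrite scale0r !addr0 [h *: (1 : R)]mulr1.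
  by rewrite (addrC x).
split; first by rewrite /derivable E.
by rewrite /derive E; move: h5; rewrite /derive => ->.
Qed.

Lemma is_derive_powR V (f : V -> R) (x v : V) (a : R) : 0 < f x ->
  derivable f x v ->
  is_derive x v (fun z => f z `^ a) (a * f x `^ (a - 1) * 'D_v f x).
Proof. by move=> f0 df; exact: (is_derive_comp1 (is_derive1_powR a f0) df). Qed.

Lemma Ck_powR V k (U : set V) (f : V -> R) (a : R) : open U ->
  (forall y, U y -> 0 < f y) -> Ck_on k U f -> Ck_on k U (fun y => f y `^ a).
Proof.
move=> oU f0; have cont j b : Ck_on j U f -> forall y, U y ->
    {for y, continuous (fun y => f y `^ b)}.
  move=> Cf y Uy; apply: (@continuous_comp _ _ _ f (fun z => z `^ b)).
    exact: (Ck_continuous Cf).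
  have [d _] := is_derive1_powR b (f0 _ Uy).
  by apply: differentiable_continuous; exact/derivable1_diffP.
elim: k a => [|k IH] a Cf; first by split=> //; exact: cont Cf.
split; first exact: cont Cf.
move=> v; split.
  by move=> y Uy; have [] := is_derive_powR a (f0 _ Uy) (Ck_derivable v Cf Uy).
apply: (@Ck_ext _ _ _ _ _ (fun y => a * f y `^ (a - 1) * 'D_v f y)) => //.
  by move=> y Uy; have [_ ->] := is_derive_powR a (f0 _ Uy) (Ck_derivable v Cf Uy).
apply: Ck_mul => //; last exact: Ck_derive.
apply: Ck_mul => //; first exact: Ck_cst.
by apply: IH; exact: Ck_pred.
Qed.

Lemma Ck_slice V W k (U : set (V * R)%type) (f : (V * R)%type -> W) (t : R) :
  Ck_on k U f -> Ck_on k [set y | U (y, t)] (fun y => f (y, t)).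
Proof.
elim: k f => [|k IH] f Cf.
  split=> // y Uy; apply: (@continuous_comp _ _ _ (fun y => (y, t)) f).
    rewrite /prop_for /continuous_at.
    by apply: (@cvg_pair _ _ _ _ (nbhs y) (nbhs t)); [exact: cvg_id|exact: cvg_cst].
  exact: (Ck_continuous Cf).
split.
  move=> y Uy; apply: (@continuous_comp _ _ _ (fun y => (y, t)) f).
    rewrite /prop_for /continuous_at.
    by apply: (@cvg_pair _ _ _ _ (nbhs y) (nbhs t)); [exact: cvg_id|exact: cvg_cst].
  exact: (Ck_continuous Cf).
move=> v.
have E y : (fun h : R => h^-1 *: (((fun y => f (y, t)) \o shift y) (h *: v) - f (y, t))) =
    (fun h : R => h^-1 *: ((f \o shift (y, t)) (h *: (v, 0)) - f (y, t))).
  by apply/funext => h /=; rewrite -[h *: (v, 0)]/(h *: v, h *: 0) scaler0 -[(_, _) + _]/(_, _) /= add0r.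
split.
  by move=> y Uy; rewrite /derivable E; exact: (Ck_derivable (v, 0) Cf Uy).
have -> : 'D_v (fun y => f (y, t)) = (fun y => 'D_(v, 0) f (y, t)).
  by apply/funext => y; rewrite /derive E.
exact: IH (Ck_derive _ Cf).
Qed.

Lemma derive_slice V W (f : (V * R)%type -> W) (y : V) (t : R) (v : V) :
  'D_v (fun y => f (y, t)) y = 'D_(v, 0) f (y, t).
Proof.
rewrite /derive; set F := fun h : R => _; set G := (X in _ = lim (X @ _)).
have -> // : F = G; apply/funext => h; rewrite /F /G /=.
by rewrite -[h *: (v, 0)]/(h *: v, h *: 0) scaler0 -[(_, _) + _]/(_, _) /= add0r.
Qed.

Lemma Ck_fst V W k (U : set V) (f : V -> W) :
  Ck_on k U f -> Ck_on k [set z : V * R | U z.1] (fun z => f z.1).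
Proof.
elim: k f => [|k IH] f Cf.
  split=> // y Uy; apply: (@continuous_comp _ _ _ fst f); first exact: cvg_fst.
  exact: (Ck_continuous Cf).
split.
  move=> y Uy; apply: (@continuous_comp _ _ _ fst f); first exact: cvg_fst.
  exact: (Ck_continuous Cf).
move=> v; split; first by move=> y Uy; exact: (Ck_derivable v.1 Cf Uy).
exact: IH (Ck_derive v.1 Cf).
Qed.

End ChainRule.

(** * Riemannian calculus in a commutative ring with commuting derivations *)

Section DifferentialRing.
Context {K : comPzRingType} {n : nat}.

Definition derivation (d : K -> K) :=
  (forall f g, d (f + g) = d f + d g) /\ (forall f g, d (f * g) = d f * g + f * d g).

Section Derivation.
Variables (d : K -> K) (dd : derivation d).

Lemma derD f g : d (f + g) = d f + d g. Proof. exact: dd.1. Qed.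
Lemma derM f g : d (f * g) = d f * g + f * d g. Proof. exact: dd.2. Qed.
Lemma der0 : d 0 = 0.
Proof. by apply: (addrI (d 0)); rewrite -derD !addr0. Qed.
Lemma derN f : d (- f) = - d f.
Proof. by apply: (addrI (d f)); rewrite -derD !subrr der0. Qed.
Lemma derB f g : d (f - g) = d f - d g. Proof. by rewrite derD derN. Qed.
Lemma der1 : d 1 = 0.
Proof. by apply: (addrI (d 1)); rewrite addr0 -{3}[1]mulr1 derM mulr1 mul1r. Qed.
Lemma der_sum (I : Type) (r : seq I) (P : pred I) (F : I -> K) :
  d (\sum_(i <- r | P i) F i) = \sum_(i <- r | P i) d (F i).
Proof.
elim: r => [|i r IH]; first by rewrite !big_nil der0.
by rewrite !big_cons; case: (P i); rewrite ?derD IH.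
Qed.
Lemma der_natr k : d k%:R = 0.
Proof. by elim: k => [|k IH]; rewrite ?der0// -addn1 natrD derD IH der1 addr0. Qed.
End Derivation.

Variables (D : 'I_n -> K -> K) (g h : 'I_n -> 'I_n -> K) (hf : K).
Hypothesis dD : forall i, derivation (D i).
Hypothesis DC : forall i j f, D i (D j f) = D j (D i f).
Hypothesis gS : forall i j, g i j = g j i.
Hypothesis hS : forall i j, h i j = h j i.
Hypothesis gh : forall i j, \sum_k g i k * h k j = (i == j)%:R.
Hypothesis hfE : hf + hf = 1.

(** From here to [rric] the definitions mirror the coordinate formulas for the connection and the
    curvature, inside an abstract ring: [D i] are the coordinate derivations, [g] the metric, [h]
    its inverse and [hf] one half. Derivatives of ring elements are ring elements, so tensor
    identities reduce to [ring] and manipulations of sums, without any differentiability side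
    condition. The ring will be that of smooth functions on an open subset of space-time. *)
Definition rGam k i j := hf * \sum_l h k l * (D i (g j l) + D j (g i l) - D l (g i j)).
Definition rgrad f k := \sum_i h k i * D i f.
Definition rcov (X : 'I_n -> K) k i := D i (X k) + \sum_j rGam k i j * X j.
Definition rdiv (X : 'I_n -> K) := \sum_i (D i (X i) + \sum_j rGam i i j * X j).
Definition rlap f := rdiv (rgrad f).
Definition rip f1 f2 := \sum_i rgrad f1 i * D i f2.
Definition rriem l i k j := D k (rGam l j i) - D j (rGam l k i)
  + \sum_p (rGam l k p * rGam p j i - rGam l j p * rGam p k i).
Definition rric i j := \sum_k rriem k i k j.

Lemma rGamS k i j : rGam k i j = rGam k j i.
Proof.
rewrite /rGam; congr (_ * _); apply: eq_bigr => l _.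
by rewrite (gS i j) [D i _ + _]addrC.
Qed.

Lemma sum_delta (F : 'I_n -> K) i : \sum_j (i == j)%:R * F j = F i.
Proof.
rewrite (bigD1 i) //= eqxx mul1r big1 ?addr0// => j ne.
by rewrite eq_sym (negbTE ne) mul0r.
Qed.

Lemma sum_gh (F : 'I_n -> K) i : \sum_k g i k * (\sum_j h k j * F j) = F i.
Proof.
under eq_bigr do rewrite mulr_sumr.
rewrite exchange_big /= -[RHS]sum_delta; apply: eq_bigr => j _.
by rewrite -gh mulr_suml; apply: eq_bigr => k _; rewrite mulrA.
Qed.

Lemma sum_hg (F : 'I_n -> K) i : \sum_k h i k * (\sum_j g k j * F j) = F i.
Proof.
under eq_bigr do rewrite mulr_sumr.
rewrite exchange_big /= -[RHS]sum_delta; apply: eq_bigr => j _.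
rewrite eq_sym -gh mulr_suml; apply: eq_bigr => k _.
by rewrite mulrA (hS i k) (gS k j) [h k i * _]mulrC.
Qed.

Lemma lower_Gam m i j :
  \sum_k g m k * rGam k i j = hf * (D i (g j m) + D j (g i m) - D m (g i j)).
Proof.
rewrite -[RHS](sum_gh (fun m => hf * (D i (g j m) + D j (g i m) - D m (g i j))) m).
apply: eq_bigr => k _; congr (_ * _); rewrite /rGam mulr_sumr.
by apply: eq_bigr => l _; ring.
Qed.

Lemma hf2 (x : K) : x = hf * x + hf * x.
Proof. by rewrite -mulrDl hfE mul1r. Qed.

Lemma metric_compat_ring i j k :
  D i (g j k) = \sum_l g k l * rGam l i j + \sum_l g j l * rGam l i k.
Proof.
rewrite !lower_Gam (gS i k) (gS i j) (gS k j) [LHS]hf2; ring.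
Qed.

Lemma grad_lower f i : \sum_k g i k * rgrad f k = D i f.
Proof. exact: sum_gh. Qed.

(** The Hessian with both indices lowered. It is this form that is symmetric, whereas
    [rcov (rgrad f)] is the corresponding endomorphism. *)
Definition rHess f l i := \sum_k g l k * rcov (rgrad f) k i.

Lemma rHessE f l i : rHess f l i =
  D i (D l f) + hf * \sum_j (D j (g i l) - D i (g l j) - D l (g i j)) * rgrad f j.
Proof.
rewrite /rHess /rcov; under eq_bigr do rewrite mulrDr.
rewrite big_split /=.
have -> : \sum_k g l k * D i (rgrad f k) =
    D i (D l f) - \sum_j D i (g l j) * rgrad f j.
  rewrite -(grad_lower f l) (der_sum (dD i)) -sumrB; apply: eq_bigr => k _.
  by rewrite (derM (dD i)); ring.
have -> : \sum_k g l k * (\sum_j rGam k i j * rgrad f j) =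
    \sum_j hf * (D i (g j l) + D j (g i l) - D l (g i j)) * rgrad f j.
  under eq_bigr do rewrite mulr_sumr.
  rewrite exchange_big /=; apply: eq_bigr => j _.
  by rewrite -lower_Gam mulr_suml; apply: eq_bigr => k _; rewrite mulrA.
rewrite -addrA; congr (_ + _); rewrite mulr_sumr addrC -sumrB.
apply: eq_bigr => j _; rewrite (gS j l) [in LHS](hf2 (D i (g l j) * _)); ring.
Qed.

(** Commutation of the coordinate derivations, together with the symmetry of the metric: the
    Levi-Civita connection has no torsion. *)
Lemma rHessS f l i : rHess f l i = rHess f i l.
Proof.
rewrite !rHessE (DC i l); congr (_ + _ * _); apply: eq_bigr => j _.
by rewrite (gS i l); ring.
Qed.

Lemma ripE f1 f2 : rip f1 f2 = \sum_i \sum_j g i j * rgrad f1 i * rgrad f2 j.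
Proof.
apply: eq_bigr => i _; rewrite -grad_lower mulr_sumr.
by apply: eq_bigr => j _; ring.
Qed.

Lemma ripC f1 f2 : rip f1 f2 = rip f2 f1.
Proof.
rewrite !ripE exchange_big /=; apply: eq_bigr => i _; apply: eq_bigr => j _.
by rewrite (gS j i); ring.
Qed.

(** Metric compatibility rewrites the derivatives of [g] as Christoffel terms ([E1]), which are
    exactly those missing to complete the derivatives of [rgrad f] into covariant ones. *)
Lemma D_rip f i : D i (rip f f) = 2 * \sum_l rHess f l i * rgrad f l.
Proof.
set X := rgrad f.
have E : D i (rip f f) =
    \sum_k \sum_l (D i (g k l) * X k * X l) +
    2 * \sum_k \sum_l (g k l * D i (X k) * X l).
  rewrite ripE (der_sum (dD i)).
  have E2 : \sum_k \sum_l g k l * D i (X k) * X l = \sum_k \sum_l g k l * X k * D i (X l).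
    rewrite exchange_big; apply: eq_bigr => k _; apply: eq_bigr => l _.
    by rewrite (gS l k); ring.
  have -> : 2 * (\sum_k \sum_l g k l * D i (X k) * X l) =
    \sum_k \sum_l g k l * D i (X k) * X l + \sum_k \sum_l g k l * X k * D i (X l).
    by rewrite -E2; ring.
  rewrite -!big_split; apply: eq_bigr => k _; rewrite (der_sum (dD i)) -!big_split.
  by apply: eq_bigr => l _ /=; rewrite !(derM (dD i)) -/X; ring.
have E1 : \sum_k \sum_l (D i (g k l) * X k * X l) =
    2 * \sum_k \sum_l (g k l * (\sum_j rGam k i j * X j) * X l).
  pose T := \sum_k \sum_l \sum_p g l p * rGam p i k * X k * X l.
  have -> : \sum_k \sum_l (g k l * (\sum_j rGam k i j * X j) * X l) = T.
    rewrite /T (eq_bigr _ (fun k _ => eq_bigr _ (fun l _ => esym (erefl _)))).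
    transitivity (\sum_k \sum_l \sum_j g k l * rGam k i j * X j * X l).
      apply: eq_bigr => k _; apply: eq_bigr => l _; rewrite mulr_sumr mulr_suml.
      by apply: eq_bigr => j _; ring.
    under eq_bigr do rewrite exchange_big /=.
    rewrite exchange_big /=; apply: eq_bigr => k _.
    rewrite exchange_big /=; apply: eq_bigr => l _; apply: eq_bigr => p _.
    by rewrite (gS p l).
  transitivity (T + T); last by ring.
  have {2}-> : T = \sum_k \sum_l \sum_p g k p * rGam p i l * X k * X l.
    rewrite /T exchange_big; apply: eq_bigr => k _; apply: eq_bigr => l _.
    by apply: eq_bigr => p _; ring.
  rewrite -big_split; apply: eq_bigr => k _; rewrite -big_split; apply: eq_bigr => l _.
  rewrite metric_compat_ring !mulrDl !mulr_suml; congr (_ + _);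
  by apply: eq_bigr => p _; ring.
rewrite E E1 -mulrDr; congr (_ * _); rewrite -big_split /=.
under eq_bigr do rewrite -big_split /=.
rewrite exchange_big; apply: eq_bigr => l _; rewrite /rHess mulr_suml.
apply: eq_bigr => k _; rewrite /rcov (gS l k) -/X; ring.
Qed.

Lemma grad_rip f k : rgrad (rip f f) k = 2 * \sum_l rcov (rgrad f) k l * rgrad f l.
Proof.
rewrite /rgrad -/(rgrad f).
under eq_bigr do rewrite D_rip.
transitivity (2 * \sum_l (\sum_i h k i * rHess f i l) * rgrad f l).
  transitivity (2 * \sum_i \sum_l h k i * rHess f i l * rgrad f l).
    rewrite mulr_sumr; apply: eq_bigr => i _; rewrite mulrCA; congr (_ * _).
    by rewrite mulr_sumr; apply: eq_bigr => l _; rewrite (rHessS f i l); ring.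
  rewrite exchange_big; congr (_ * _); apply: eq_bigr => l _.
  by rewrite mulr_suml.
congr (_ * _); apply: eq_bigr => l _; congr (_ * _).
exact: sum_hg.
Qed.

(** The contracted Ricci identity nabla_i nabla_l X^i = nabla_l nabla_i X^i + Ric(X)_l. The
    Christoffel terms of the outer derivative are written out, the one for the upper index on the
    left and the one for the lower index on the right. *)
Lemma divergence_commutator (X : 'I_n -> K) l :
  \sum_i D i (rcov X i l) + \sum_i \sum_j rGam i i j * rcov X j l =
  \sum_i \sum_j rcov X i j * rGam j i l + \sum_i D l (rcov X i i)
  + \sum_k rric k l * X k.
Proof.
have e1 : \sum_i D i (rcov X i l) = \sum_i D i (D l (X i)) +
    (\sum_i \sum_j D i (rGam i l j) * X j + \sum_i \sum_j rGam i l j * D i (X j)).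
  rewrite -!big_split; apply: eq_bigr => i _; rewrite (derD (dD i)); congr (_ + _).
  rewrite (der_sum (dD i)) -big_split; apply: eq_bigr => j _.
  by rewrite (derM (dD i)).
have e2 : \sum_i D l (rcov X i i) = \sum_i D l (D i (X i)) +
    (\sum_i \sum_j D l (rGam i i j) * X j + \sum_i \sum_j rGam i i j * D l (X j)).
  rewrite -!big_split; apply: eq_bigr => i _; rewrite (derD (dD l)); congr (_ + _).
  rewrite (der_sum (dD l)) -big_split; apply: eq_bigr => j _.
  by rewrite (derM (dD l)).
have e3 : \sum_i \sum_j rGam i i j * rcov X j l =
    \sum_i \sum_j rGam i i j * D l (X j) +
    \sum_i \sum_j \sum_k rGam i i j * rGam j l k * X k.
  rewrite -!big_split; apply: eq_bigr => i _; rewrite -big_split; apply: eq_bigr => j _.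
  rewrite mulrDr; congr (_ + _); rewrite mulr_sumr.
  by apply: eq_bigr => k _; rewrite mulrA.
have e4 : \sum_i \sum_j rcov X i j * rGam j i l =
    \sum_i \sum_j rGam i l j * D i (X j) +
    \sum_i \sum_j \sum_k rGam i l j * rGam j i k * X k.
  rewrite exchange_big -!big_split; apply: eq_bigr => i _.
  rewrite -big_split; apply: eq_bigr => j _.
  rewrite mulrDl (rGamS i j l) [D _ _ * _]mulrC; congr (_ + _).
  by rewrite mulr_suml; apply: eq_bigr => k _; ring.
have e5 : \sum_k rric k l * X k =
    \sum_i \sum_j D i (rGam i l j) * X j - \sum_i \sum_j D l (rGam i i j) * X j
    + (\sum_i \sum_j \sum_k rGam i i j * rGam j l k * X k
       - \sum_i \sum_j \sum_k rGam i l j * rGam j i k * X k).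
  under eq_bigr do rewrite mulr_suml.
  rewrite exchange_big -!sumrB -big_split; apply: eq_bigr => i _ /=.
  rewrite [X in _ + (X - _)]exchange_big [X in _ + (_ - X)]exchange_big.
  rewrite -!sumrB -big_split; apply: eq_bigr => k _ /=.
  rewrite /rriem !mulrDl mulNr mulr_suml -sumrB; congr (_ + _).
  by apply: eq_bigr => p _; ring.
have e0 : \sum_i D l (D i (X i)) = \sum_i D i (D l (X i)).
  by apply: eq_bigr => i _; rewrite DC.
by rewrite e1 e2 e3 e4 e5 e0; ring.
Qed.

(** The field is nabla_X X. For [X = rgrad f] it is half the gradient of [rip f f] ([grad_rip]),
    which makes this identity the Bochner formula. *)
Lemma div_cov (X : 'I_n -> K) :
  rdiv (fun k => \sum_l rcov X k l * X l) =
  \sum_i \sum_l rcov X i l * rcov X l i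
  + \sum_l X l * D l (rdiv X) + \sum_i \sum_j rric i j * X i * X j.
Proof.
have -> : rdiv (fun k => \sum_l rcov X k l * X l) =
   \sum_i \sum_l rcov X i l * D i (X l) +
   \sum_l (\sum_i D i (rcov X i l) + \sum_i \sum_j rGam i i j * rcov X j l) * X l.
  have -> : \sum_l (\sum_i D i (rcov X i l) + \sum_i \sum_j rGam i i j * rcov X j l) * X l
     = \sum_i \sum_l (D i (rcov X i l) + \sum_j rGam i i j * rcov X j l) * X l.
    rewrite exchange_big; apply: eq_bigr => l _.
    by rewrite -big_split mulr_suml.
  rewrite -big_split; apply: eq_bigr => i _ /=.
  rewrite (der_sum (dD i)).
  have -> : \sum_j rGam i i j * (\sum_l rcov X j l * X l) =
     \sum_l (\sum_j rGam i i j * rcov X j l) * X l.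
    under eq_bigr do rewrite mulr_sumr.
    rewrite exchange_big; apply: eq_bigr => l _; rewrite mulr_suml.
    by apply: eq_bigr => j _; rewrite mulrA.
  rewrite -!big_split; apply: eq_bigr => l _ /=.
  by rewrite (derM (dD i)); ring.
under [X in _ + X = _]eq_bigr do rewrite divergence_commutator.
have -> : \sum_i \sum_l rcov X i l * rcov X l i =
   \sum_i \sum_l rcov X i l * D i (X l) +
   \sum_l (\sum_i \sum_j rcov X i j * rGam j i l) * X l.
  have -> : \sum_l (\sum_i \sum_j rcov X i j * rGam j i l) * X l =
     \sum_i \sum_j rcov X i j * (\sum_l rGam j i l * X l).
    under eq_bigr do rewrite mulr_suml.
    rewrite exchange_big; apply: eq_bigr => i _.
    under eq_bigr do rewrite mulr_suml.
    rewrite exchange_big; apply: eq_bigr => j _; rewrite mulr_sumr.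
    by apply: eq_bigr => k _; rewrite mulrA.
  rewrite -big_split; apply: eq_bigr => i _; rewrite -big_split.
  by apply: eq_bigr => l _; rewrite /= -mulrDr.
rewrite -!addrA; congr (_ + _).
have -> : \sum_l X l * D l (rdiv X) = \sum_l (\sum_i D l (rcov X i i)) * X l.
  by apply: eq_bigr => l _; rewrite mulrC /rdiv (der_sum (dD l)).
have -> : \sum_i \sum_j rric i j * X i * X j = \sum_l (\sum_k rric k l * X k) * X l.
  by rewrite exchange_big; apply: eq_bigr => l _; rewrite mulr_suml.
by rewrite -!big_split; apply: eq_bigr => l _; rewrite /= -!mulrDl addrA.
Qed.

(** The squared norm of the Hessian, written as the trace of the square of the endomorphism
    [rcov (rgrad f)] so that no index has to be raised. *)
Definition rhess2 f := \sum_i \sum_l rcov (rgrad f) i l * rcov (rgrad f) l i.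
Definition rRic f := \sum_i \sum_j rric i j * rgrad f i * rgrad f j.

Lemma rdiv_scale (c : K) (X : 'I_n -> K) :
  rdiv (fun k => c * X k) = c * rdiv X + \sum_i X i * D i c.
Proof.
rewrite /rdiv mulr_sumr -big_split; apply: eq_bigr => i _ /=.
rewrite (derM (dD i)) mulrDr mulr_sumr.
have -> : \sum_j rGam i i j * (c * X j) = \sum_j c * (rGam i i j * X j).
  by apply: eq_bigr => j _; ring.
ring.
Qed.

Lemma eq_rdiv (X Y : 'I_n -> K) : X =1 Y -> rdiv X = rdiv Y.
Proof.
move=> E; apply: eq_bigr => i _; rewrite E; congr (_ + _).
by apply: eq_bigr => j _; rewrite E.
Qed.

Lemma rdivD (X Y : 'I_n -> K) : rdiv (fun k => X k + Y k) = rdiv X + rdiv Y.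
Proof.
rewrite -big_split; apply: eq_bigr => i _ /=; rewrite (derD (dD i)).
under eq_bigr do rewrite mulrDr.
by rewrite big_split /=; ring.
Qed.

Lemma bochner f : rlap (rip f f) = 2 * (rhess2 f + rip f (rlap f) + rRic f).
Proof.
rewrite {1}/rlap (eq_rdiv (grad_rip f)) rdiv_scale div_cov.
rewrite [X in _ + X]big1 ?addr0// => i _.
by rewrite (der_natr (dD i)) mulr0.
Qed.

Lemma rgradD f1 f2 k : rgrad (f1 + f2) k = rgrad f1 k + rgrad f2 k.
Proof. by rewrite -big_split; apply: eq_bigr => i _ /=; rewrite (derD (dD i)) mulrDr. Qed.

Lemma rgradM f1 f2 k : rgrad (f1 * f2) k = f1 * rgrad f2 k + f2 * rgrad f1 k.
Proof.
rewrite /rgrad !mulr_sumr -big_split; apply: eq_bigr => i _ /=.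
by rewrite (derM (dD i)); ring.
Qed.

Lemma rlapD f1 f2 : rlap (f1 + f2) = rlap f1 + rlap f2.
Proof. by rewrite /rlap (eq_rdiv (rgradD f1 f2)) rdivD. Qed.

Lemma rlapM f1 f2 : rlap (f1 * f2) = f1 * rlap f2 + f2 * rlap f1 + 2 * rip f1 f2.
Proof.
rewrite {1}/rlap (eq_rdiv (rgradM f1 f2)) rdivD !rdiv_scale.
rewrite -/(rip f2 f1) -/(rip f1 f2) (ripC f2 f1) -/(rlap f1) -/(rlap f2); ring.
Qed.

Lemma ripDr f f1 f2 : rip f (f1 + f2) = rip f f1 + rip f f2.
Proof. by rewrite -big_split; apply: eq_bigr => i _ /=; rewrite (derD (dD i)) mulrDr. Qed.

Lemma ripMr f f1 f2 : rip f (f1 * f2) = f1 * rip f f2 + f2 * rip f f1.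
Proof.
rewrite /rip !mulr_sumr -big_split; apply: eq_bigr => i _ /=.
by rewrite (derM (dD i)); ring.
Qed.

Section Pressure.
Variable Dt : K -> K.
Hypothesis dt : derivation Dt.
Hypothesis tD : forall i f, Dt (D i f) = D i (Dt f).
Hypothesis tg : forall i j, Dt (g i j) = 0.
Hypothesis th : forall i j, Dt (h i j) = 0.
Variables (m v w : K).
Hypothesis mC : forall i, D i m = 0.
Hypothesis mt : Dt m = 0.
Hypothesis vw : v * w = 1.

Lemma Dt_hf : Dt hf = 0.
Proof.
have e : Dt hf + Dt hf = 0 by rewrite -(derD dt) hfE (der1 dt).
by rewrite -[Dt hf]mul1r -hfE mulrDl -mulrDr e mulr0.
Qed.

Lemma Dt_Gam k i j : Dt (rGam k i j) = 0.
Proof.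
rewrite /rGam (derM dt) Dt_hf mul0r add0r (der_sum dt) big1 ?mulr0// => l _.
rewrite (derM dt) th mul0r add0r (derB dt) (derD dt) !tD !tg.
by rewrite !(der0 (dD _)) subr0 addr0 mulr0.
Qed.

Lemma Dt_grad f k : Dt (rgrad f k) = rgrad (Dt f) k.
Proof.
rewrite /rgrad (der_sum dt); apply: eq_bigr => i _.
by rewrite (derM dt) th mul0r add0r tD.
Qed.

Lemma Dt_lap f : Dt (rlap f) = rlap (Dt f).
Proof.
rewrite /rlap /rdiv (der_sum dt); apply: eq_bigr => i _.
rewrite (derD dt) tD Dt_grad (der_sum dt); congr (_ + _).
by apply: eq_bigr => j _; rewrite (derM dt) Dt_Gam mul0r add0r Dt_grad.
Qed.

Lemma Dt_rip f : Dt (rip f f) = 2 * rip f (Dt f).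
Proof.
have -> : Dt (rip f f) = rip (Dt f) f + rip f (Dt f).
  rewrite -big_split /rip (der_sum dt); apply: eq_bigr => i _ /=.
  by rewrite (derM dt) Dt_grad tD.
by rewrite (ripC (Dt f) f); ring.
Qed.

Let m1 := m - 1.
Hypothesis pde : Dt v = m1 * v * rlap v + rip v v.

Definition rz := w * Dt v.
Definition rP := m1 * rlap v.

Lemma m1D i : D i m1 = 0.
Proof. by rewrite /m1 (derB (dD i)) mC (der1 (dD i)) subr0. Qed.

Lemma rlap_cst c f : (forall i, D i c = 0) -> rlap (c * f) = c * rlap f.
Proof.
move=> cC; rewrite rlapM /rip (eq_bigr (fun=> 0)); last first.
  move=> i _; rewrite /rgrad big1 ?mul0r// => j _.
  by rewrite cC mulr0.
have -> : rlap c = 0.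
  have X0 k : rgrad c k = 0 by rewrite /rgrad big1// => j _; rewrite cC mulr0.
  rewrite /rlap /rdiv big1// => i _; rewrite X0 (der0 (dD i)) add0r big1// => j _.
  by rewrite X0 mulr0.
by rewrite big1// !mulr0 !addr0.
Qed.

Lemma rip_cst f c f2 : (forall i, D i c = 0) -> rip f (c * f2) = c * rip f f2.
Proof.
move=> cC; rewrite ripMr [X in _ + _ * X]big1 ?mulr0 ?addr0// => i _.
by rewrite cC mulr0.
Qed.

Lemma v_rz : v * rz = Dt v.
Proof. by rewrite /rz mulrA vw mul1r. Qed.

(** The pressure equation is differentiated in time after writing v_t = v z. Once |grad v|^2 is
    eliminated by the equation itself, the terms in z Lap v cancel, and the gradient terms 2 (m - 1)
    + 2 add up to 2 m. The identity comes out multiplied by [v], which [w] removes. *)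
Lemma pressure_z : Dt rz = m1 * v * rlap rz + rz ^+ 2 + 2 * m * rip v rz.
Proof.
have Dtm1 : Dt m1 = 0 by rewrite (derB dt) mt (der1 dt) subr0.
have e1 : Dt (v * rz) = m1 * (v * rz) * rlap v + m1 * v * rlap (v * rz)
     + 2 * rip v (v * rz).
  rewrite v_rz {1}pde (derD dt) Dt_rip !(derM dt) Dtm1 Dt_lap; ring.
have e2 : rip v v = v * rz - m1 * v * rlap v by rewrite v_rz pde; ring.
move: e1; rewrite (derM dt) rlapM ripMr -[Dt v]v_rz e2 => e1.
have e3 : v * Dt rz = v * (m1 * v * rlap rz + rz ^+ 2 + 2 * m * rip v rz).
  have -> : v * Dt rz = (v * rz * rz + v * Dt rz) - v * rz * rz by ring.
  by rewrite e1 /m1; ring.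
by rewrite -[Dt rz]mul1r -vw mulrAC mulrC e3 mulrA [w * v]mulrC vw mul1r.
Qed.

(** The Laplacian is applied to v_t = v P + |grad v|^2: the product rule treats the first term, the
    Bochner formula the second, and (m - 1) <grad v, grad Lap v> is <grad v, grad P>. *)
Lemma pressure_P : Dt rP = m1 * v * rlap rP + rP ^+ 2 + 2 * m * rip v rP
  + 2 * m1 * (rhess2 v + rRic v).
Proof.
have Dtm1 : Dt m1 = 0 by rewrite (derB dt) mt (der1 dt) subr0.
have e0 : Dt v = v * rP + rip v v by rewrite pde /rP; ring.
have e1 : rip v rP = m1 * rip v (rlap v) by exact: rip_cst m1D.
rewrite {1}/rP (derM dt) Dtm1 mul0r add0r Dt_lap e0 rlapD rlapM bochner.
transitivity (m1 * v * rlap rP + rP * (m1 * rlap v) + 2 * m1 * rip v rP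
  + 2 * (m1 * rip v (rlap v)) + 2 * m1 * (rhess2 v + rRic v)); first by ring.
by rewrite -e1 -/rP /m1; ring.
Qed.

End Pressure.
End DifferentialRing.

(** * The ring of smooth functions on an open set *)

Section SmoothFunctions.
Context {R : realType}.
Implicit Types V W : normedModType R.

Lemma Ck_prod V k (U : set V) (I : Type) (r : seq I) (f : I -> V -> R) :
  open U -> (forall i, Ck_on k U (f i)) ->
  Ck_on k U (fun y => \prod_(i <- r) f i y).
Proof.
move=> oU Cf; elim: r => [|i r IH].
  by apply: (Ck_ext oU _ (Ck_cst k U (1 : R))) => y _; rewrite big_nil.
by apply: (Ck_ext oU _ (Ck_mul oU (Cf i) IH)) => y _; rewrite big_cons.
Qed.

Lemma Ck_det V k n (U : set V) (A : V -> 'M[R]_n) : open U ->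
  (forall i j, Ck_on k U (fun y => A y i j)) -> Ck_on k U (fun y => \det (A y)).
Proof.
move=> oU CA; apply: Ck_sum => // s; apply: Ck_mul => //; first exact: Ck_cst.
exact: Ck_prod.
Qed.

(** Cramer's rule: the entries of the inverse are quotients of polynomials in the entries by the
    determinant. *)
Lemma Ck_invmx V k n (U : set V) (A : V -> 'M[R]_n) : open U ->
  (forall y, U y -> A y \in unitmx) -> Ck_on k U A ->
  Ck_on k U (fun y => invmx (A y)).
Proof.
move=> oU uA /(Ck_mxP _ _ oU) CA; apply: Ck_mx => // i j.
apply: (@Ck_ext _ _ _ _ _ (fun y => (\det (A y))^-1 * cofactor (A y) j i)) => //.
  by move=> y Uy; rewrite /invmx uA// !mxE.
apply: Ck_mul => //; first apply: Ck_inv => //.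
- by move=> y /uA; rewrite unitmxE unitfE.
- exact: Ck_det.
- apply: Ck_mul => //; first exact: Ck_cst.
  apply: Ck_det => // p q; apply: (Ck_ext oU _ (CA (lift j p) (lift i q))) => y _.
  by rewrite !mxE.
Qed.

Section SmoothRing.
Context {V : normedModType R} {O : set V}.

Definition cutoff (f : V -> R) y : R := if `[< O y >] then f y else 0.

Lemma cutoffE f y : O y -> cutoff f y = f y.
Proof. by move=> Oy; rewrite /cutoff; case: asboolP. Qed.

Lemma cutoff0 f y : ~ O y -> cutoff f y = 0.
Proof. by move=> Oy; rewrite /cutoff; case: asboolP. Qed.
End SmoothRing.

(* Smooth functions on O, extended by 0 outside of O so that equality on O is
   Leibniz equality; the openness proof is a parameter of the type. *)
Record smf V (O : set V) (oO : open O) := Smf {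
  smfun :> V -> R ;
  smf_smooth : smooth_on O smfun ;
  smf_out : forall y, ~ O y -> smfun y = 0 }.

Section SmoothRing.
Context {V : normedModType R} {O : set V} {oO : open O}.
Notation T := (smf oO).
Implicit Types f g : T.

Lemma smf_eq f g : (forall y, O y -> f y = g y) -> f = g.
Proof.
case: f g => [f Cf f0] [g Cg g0] /= fg.
have E : f = g.
  apply/funext => y; have [/fg//|nO] := pselect (O y).
  by rewrite f0// g0.
move: Cf f0; rewrite E => Cf f0; congr Smf; exact: Prop_irrelevance.
Qed.

Lemma smooth_cutoff (f : V -> R) : smooth_on O f -> smooth_on O (cutoff (O := O) f).
Proof. by move=> Cf k; apply: Ck_ext (Cf k) => // y Oy; rewrite cutoffE. Qed.

Definition mksmf (f : V -> R) (Cf : smooth_on O f) : T :=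
  Smf oO (smooth_cutoff Cf) (@cutoff0 _ O f).

Definition smf_cst (c : R) : T := mksmf (fun k => Ck_cst k O c).

Lemma smf_cstE c y : O y -> smf_cst c y = c.
Proof. exact: cutoffE. Qed.

(** Transparent, like the two operations that follow, so that evaluation at a point commutes with
    them by conversion ([smfD], [smfN], [smfM]). *)
Definition smf_add f g : T.
Proof.
apply: (@Smf _ _ oO (fun y => f y + g y)).
  by move=> k; apply: Ck_add => //; exact: smf_smooth.
by move=> y Oy; rewrite !smf_out// addr0.
Defined.

Definition smf_opp f : T.
Proof.
apply: (@Smf _ _ oO (fun y => - f y)).
  by move=> k; apply: Ck_opp => //; exact: smf_smooth.
by move=> y Oy; rewrite !smf_out// oppr0.
Defined.

Definition smf_mul f g : T.
Proof.
apply: (@Smf _ _ oO (fun y => f y * g y)).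
  by move=> k; apply: Ck_mul => //; exact: smf_smooth.
by move=> y Oy; rewrite !smf_out// mulr0.
Defined.

HB.instance Definition _ := gen_eqMixin T.
HB.instance Definition _ := gen_choiceMixin T.

Fact smf_addA : associative smf_add.
Proof. by move=> f g k; apply: smf_eq => y Oy /=; rewrite addrA. Qed.
Fact smf_addC : commutative smf_add.
Proof. by move=> f g; apply: smf_eq => y Oy /=; rewrite addrC. Qed.
Fact smf_add0 : left_id (smf_cst 0) smf_add.
Proof. by move=> f; apply: smf_eq => y Oy /=; rewrite cutoffE// add0r. Qed.
Fact smf_addN : left_inverse (smf_cst 0) smf_opp smf_add.
Proof. by move=> f; apply: smf_eq => y Oy /=; rewrite cutoffE// addNr. Qed.
HB.instance Definition _ :=
  GRing.isZmodule.Build T smf_addA smf_addC smf_add0 smf_addN.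

Fact smf_mulA : associative smf_mul.
Proof. by move=> f g k; apply: smf_eq => y Oy /=; rewrite mulrA. Qed.
Fact smf_mulC : commutative smf_mul.
Proof. by move=> f g; apply: smf_eq => y Oy /=; rewrite mulrC. Qed.
Fact smf_mul1 : left_id (smf_cst 1) smf_mul.
Proof. by move=> f; apply: smf_eq => y Oy /=; rewrite cutoffE// mul1r. Qed.
Fact smf_mulD : left_distributive smf_mul smf_add.
Proof. by move=> f g k; apply: smf_eq => y Oy /=; rewrite mulrDl. Qed.
HB.instance Definition _ :=
  GRing.Zmodule_isComPzRing.Build T smf_mulA smf_mulC smf_mul1 smf_mulD.

Lemma smfD f g y : (f + g) y = f y + g y. Proof. by []. Qed.
Lemma smfN f y : (- f) y = - f y. Proof. by []. Qed.
Lemma smfB f g y : (f - g) y = f y - g y. Proof. by []. Qed.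
Lemma smfM f g y : (f * g) y = f y * g y. Proof. by []. Qed.
Lemma smf1 y : O y -> (1 : T) y = 1. Proof. exact: cutoffE. Qed.
Lemma smf0 y : (0 : T) y = 0.
Proof. by have [Oy|nOy] := pselect (O y); [exact: cutoffE|exact: cutoff0]. Qed.
Lemma smf_sum (I : Type) (r : seq I) (F : I -> T) y :
  (\sum_(i <- r) F i) y = \sum_(i <- r) F i y.
Proof.
elim: r => [|i r IH]; first by rewrite !big_nil smf0.
by rewrite !big_cons smfD IH.
Qed.
Lemma smfX f k y : O y -> (f ^+ k) y = f y ^+ k.
Proof.
move=> Oy; elim: k => [|k IH]; first by rewrite !expr0 smf1.
by rewrite !exprS smfM IH.
Qed.
Lemma smf_nat k y : O y -> (k%:R : T) y = k%:R.
Proof.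
move=> Oy; elim: k => [|k IH]; first by rewrite smf0.
by rewrite -addn1 !natrD smfD IH smf1.
Qed.

Lemma smooth_derive f v : smooth_on O ('D_v f).
Proof. by move=> k; apply: (Ck_derive v (smf_smooth f k.+1)). Qed.

Definition smf_der v f : T := mksmf (smooth_derive f v).

Lemma smf_derE v f y : O y -> smf_der v f y = 'D_v f y.
Proof. exact: cutoffE. Qed.

Lemma smf_derivable f y v : O y -> derivable f y v.
Proof. by move=> Oy; exact: (Ck_derivable v (smf_smooth f 1)). Qed.

Arguments smf_derivable f {y} v.

Lemma smf_der_derivation v : derivation (smf_der v).
Proof.
split=> f g; apply: smf_eq => y Oy.
  rewrite smfD (smf_derE v f Oy) (smf_derE v g Oy) (smf_derE v (f + g) Oy).
  by rewrite -(deriveD (smf_derivable f v Oy) (smf_derivable g v Oy)).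
rewrite smfD !smfM (smf_derE v f Oy) (smf_derE v g Oy) (smf_derE v (f * g) Oy).
transitivity (f y *: 'D_v g y + g y *: 'D_v f y).
  by rewrite -(deriveM (smf_derivable f v Oy) (smf_derivable g v Oy)).
by rewrite addrC; congr (_ + _); exact: mulrC.
Qed.

Lemma smf_der_comm v w f : smf_der v (smf_der w f) = smf_der w (smf_der v f).
Proof.
apply: smf_eq => y Oy.
have E (a b : V) : smf_der a (smf_der b f) y = 'D_a ('D_b f) y.
  apply: etrans (smf_derE a _ Oy) _.
  apply: (derive_on_ext _ oO _ Oy).2 => z Oz; exact: smf_derE.
apply: etrans (E v w) (etrans _ (esym (E w v))).
exact: (Schwarz v w oO (smf_smooth f 2) Oy).
Qed.

Lemma smf_der_cst v c : smf_der v (smf_cst c) = 0.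
Proof.
apply: smf_eq => y Oy; rewrite smf_derE// smf0.
rewrite -(derive_cst c y v); apply: (derive_on_ext _ oO _ Oy).2 => z Oz.
exact: smf_cstE.
Qed.

Definition smf_inv f (f0 : forall y, O y -> f y != 0) : T :=
  mksmf (fun k => Ck_inv oO f0 (smf_smooth f k)).

End SmoothRing.
End SmoothFunctions.
Arguments smf {R V O} oO.
Arguments smf_cst {R V O} oO c.

(** * Functions on space-time in a chart, and the dictionary between the abstract and the coordinate
    formulas *)

Section SpacetimeRing.
Context {R : realType} {n : nat}.
Variables (W : set 'rV[R]_n) (G : 'rV[R]_n -> 'M[R]_n).
Hypothesis oW : open W.
Hypothesis smG : smooth_on W G.
Hypothesis symG : forall y, W y -> (G y)^T = G y.
Hypothesis unitG : forall y, W y -> G y \in unitmx.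
Variable O : set ('rV[R]_n * R)%type.
Hypothesis oO : open O.
Hypothesis OW : forall z, O z -> W z.1.
Notation T := (smf oO).

Definition spd (i : 'I_n) : T -> T := smf_der (delta_mx 0 i, 0).
Definition tmd : T -> T := smf_der ((0 : 'rV[R]_n), (1 : R)).

Lemma smooth_spatial (F : 'rV[R]_n -> R) : smooth_on W F ->
  smooth_on O (fun z : 'rV[R]_n * R => F z.1).
Proof. by move=> CF k; apply: Ck_sub (Ck_fst (CF k)) => z /OW. Qed.

Lemma smooth_entry i j : smooth_on W (fun y => G y i j).
Proof. by move=> k; exact: (Ck_mxP k G oW).1 (smG k) i j. Qed.

Lemma smooth_inv_entry i j : smooth_on W (fun y => invmx (G y) i j).
Proof.
by move=> k; exact: (Ck_mxP k _ oW).1 (Ck_invmx oW unitG (smG k)) i j.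
Qed.

Definition gg i j : T := mksmf (smooth_spatial (smooth_entry i j)).
Definition gh i j : T := mksmf (smooth_spatial (smooth_inv_entry i j)).
Definition ghalf : T := smf_cst oO 2^-1.

Lemma ggE i j z : O z -> gg i j z = G z.1 i j.
Proof. exact: cutoffE. Qed.
Lemma ghE i j z : O z -> gh i j z = invmx (G z.1) i j.
Proof. exact: cutoffE. Qed.

Lemma ggS i j : gg i j = gg j i.
Proof.
by apply: smf_eq => y Oy; rewrite !ggE// -[in LHS]symG ?mxE//; exact: OW.
Qed.

Lemma ghS i j : gh i j = gh j i.
Proof.
apply: smf_eq => y Oy; rewrite !ghE//.
by rewrite -[in LHS](symG (OW Oy)) -trmx_inv mxE.
Qed.

Lemma ggh i j : \sum_k gg i k * gh k j = (i == j)%:R.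
Proof.
apply: smf_eq => y Oy; rewrite smf_sum smf_nat//.
under eq_bigr do rewrite smfM ggE// ghE//.
have := mulmxV (unitG (OW Oy)) => /matrixP/(_ i j).
by rewrite !mxE.
Qed.

Lemma ghalfE : ghalf + ghalf = 1.
Proof.
apply: smf_eq => y Oy; rewrite smfD smf1// smf_cstE//.
by rewrite -mulr2n -[_ *+ 2]mulr_natl divff// pnatr_eq0.
Qed.

Lemma spdE i (f : T) z : O z -> spd i f z = pderiv i (fun y => f (y, z.2)) z.1.
Proof.
by move=> Oz; rewrite /spd smf_derE// /pderiv derive_slice -surjective_pairing.
Qed.

Lemma slice_nbhs z : O z -> \forall y \near z.1, O (y, z.2).
Proof.
move=> Oz; have : nbhs z O by exact: open_nbhs_nbhs.
case: z Oz => a t Oz [[A B] /= [nA nB]] AB.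
by apply: filterS nA => y Ay; apply: AB; split => //=; exact: nbhs_singleton.
Qed.

Lemma spd_near i (f : T) (F : 'rV[R]_n -> R) z : O z ->
  (forall y, O (y, z.2) -> f (y, z.2) = F y) -> spd i f z = pderiv i F z.1.
Proof.
move=> Oz E; rewrite spdE//; apply: near_eq_derive.
by apply: filterS (slice_nbhs Oz) => y; exact: E.
Qed.

Notation Gam := (rGam spd gg gh ghalf).

Lemma rGamE k i j z : O z -> Gam k i j z = christoffel G k i j z.1.
Proof.
move=> Oz; rewrite /rGam smfM smf_cstE// smf_sum; congr (_ * _).
apply: eq_bigr => l _; rewrite smfM ghE//; congr (_ * _).
rewrite smfB smfD; do !congr (_ + _); rewrite ?smfN; do ?congr (- _);
by apply: spd_near => // y Oy; rewrite ggE.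
Qed.

Lemma rgradE (f : T) k z : O z ->
  rgrad spd gh f k z = local_grad G (fun y => f (y, z.2)) z.1 0 k.
Proof.
move=> Oz; rewrite /rgrad smf_sum mxE; apply: eq_bigr => i _.
by rewrite smfM ghE// spdE.
Qed.

Lemma rlapE (f : T) z : O z ->
  rlap spd gg gh ghalf f z = local_laplacian G (fun y => f (y, z.2)) z.1.
Proof.
move=> Oz; rewrite /rlap /rdiv smf_sum; apply: eq_bigr => i _.
rewrite smfD smf_sum; congr (_ + _).
  by apply: spd_near => // y Oy; rewrite rgradE.
by apply: eq_bigr => j _; rewrite smfM rGamE// rgradE.
Qed.

Lemma rricE i j z : O z ->
  rric spd gg gh ghalf i j z = ricci_mx G z.1 i j.
Proof.
move=> Oz; rewrite /rric smf_sum mxE; apply: eq_bigr => k _.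
rewrite /rriem smfD smfB smf_sum; congr (_ - _ + _).
- by apply: spd_near => // y Oy; rewrite rGamE.
- by apply: spd_near => // y Oy; rewrite rGamE.
- have aux (a b c d a' b' c' d' : R) : a = a' -> b = b' -> c = c' -> d = d' ->
    a * b - c * d = a' * b' - c' * d' by move=> -> -> -> ->.
  by apply: eq_bigr => p _; apply: aux; exact: rGamE.
Qed.

Lemma spd_derivation i : derivation (spd i).
Proof. exact: smf_der_derivation. Qed.
Lemma spd_comm i j f : spd i (spd j f) = spd j (spd i f).
Proof. exact: smf_der_comm. Qed.
Lemma tmd_derivation : derivation tmd.
Proof. exact: smf_der_derivation. Qed.
Lemma tmd_spd i f : tmd (spd i f) = spd i (tmd f).
Proof. exact: smf_der_comm. Qed.

Lemma tmd_spatial (F : 'rV[R]_n -> R) (CF : smooth_on W F) :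
  tmd (mksmf (smooth_spatial CF)) = 0.
Proof.
apply: smf_eq => z Oz; rewrite smf_derE// smf0.
rewrite -(derive_on_ext (W := R) (f := fun z : 'rV[R]_n * R => F z.1) _ oO _ Oz).2.
  have -> : 'D_(0, 1) (fun z : 'rV[R]_n * R => F z.1) z = 'D_0 F z.1 by [].
  by rewrite derive0.
by move=> y Oy; rewrite /= cutoffE.
Qed.

Lemma tmd_gg i j : tmd (gg i j) = 0.
Proof. exact: tmd_spatial. Qed.
Lemma tmd_gh i j : tmd (gh i j) = 0.
Proof. exact: tmd_spatial. Qed.

End SpacetimeRing.

(** * Quadratic forms and orthonormal frames *)

Section MatrixForms.
Context {R : realType}.

Definition mform n (G : 'M[R]_n) (u v : 'rV[R]_n) : R := (u *m G *m v^T) 0 0.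

Section MForm.
Context {n : nat}.
Implicit Types (G : 'M[R]_n) (u v w : 'rV[R]_n).

Lemma mformE G u v : mform G u v = \sum_i \sum_j u 0 i * G i j * v 0 j.
Proof.
rewrite /mform mxE exchange_big; apply: eq_bigr => j _ /=.
by rewrite !mxE mulr_suml.
Qed.
Lemma mformDl G u v w : mform G (u + v) w = mform G u w + mform G v w.
Proof. by rewrite /mform !mulmxDl mxE. Qed.
Lemma mformDr G u v w : mform G u (v + w) = mform G u v + mform G u w.
Proof. by rewrite /mform linearD mulmxDr mxE. Qed.
Lemma mformZl G a u v : mform G (a *: u) v = a * mform G u v.
Proof. by rewrite /mform -!scalemxAl mxE. Qed.
Lemma mformZr G a u v : mform G u (a *: v) = a * mform G u v.
Proof. by rewrite /mform linearZ /= -scalemxAr mxE. Qed.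
Lemma mformNl G u v : mform G (- u) v = - mform G u v.
Proof. by rewrite -scaleN1r mformZl mulN1r. Qed.
Lemma mformNr G u v : mform G u (- v) = - mform G u v.
Proof. by rewrite -scaleN1r mformZr mulN1r. Qed.
Lemma mform0l G v : mform G 0 v = 0.
Proof. by rewrite /mform !mul0mx mxE. Qed.
Lemma mform0r G v : mform G v 0 = 0.
Proof. by rewrite /mform linear0 mulmx0 mxE. Qed.
Lemma mformC G u v : G^T = G -> mform G u v = mform G v u.
Proof.
move=> Gs; transitivity ((v *m G *m u^T)^T 0 0); last by rewrite mxE.
by rewrite !trmx_mul trmxK Gs mulmxA.
Qed.
Lemma mform_addG G G' u v : mform (G + G') u v = mform G u v + mform G' u v.
Proof. by rewrite /mform mulmxDr mulmxDl mxE. Qed.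
Lemma mform_oppG G u v : mform (- G) u v = - mform G u v.
Proof. by rewrite /mform mulmxN mulNmx mxE. Qed.
Lemma mform_suml G (I : Type) (r : seq I) (F : I -> 'rV[R]_n) v :
  mform G (\sum_(i <- r) F i) v = \sum_(i <- r) mform G (F i) v.
Proof.
elim: r => [|i r IH]; first by rewrite !big_nil mform0l.
by rewrite !big_cons mformDl IH.
Qed.
Definition posdef G := G^T = G /\ forall v, v != 0 -> 0 < mform G v v.

Lemma posdef_ge0 G v : posdef G -> 0 <= mform G v v.
Proof.
move=> [_ Gp]; have [->|v0] := eqVneq v 0; first by rewrite mform0l.
exact/ltW/Gp.
Qed.

End MForm.

Lemma mx_norm_mul m n p (A : 'M[R]_(m, n)) (B : 'M[R]_(n, p)) :
  `|A *m B| <= n%:R * (`|A| * `|B|).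
Proof.
apply: mx_norm_le => [|i j]; first by rewrite !mulr_ge0.
rewrite mxE; apply: le_trans (ler_norm_sum _ _ _) _.
apply: (@le_trans _ _ (\sum_(k < n) `|A| * `|B|)).
  by apply: ler_sum => k _; rewrite normrM ler_pM// ler_mx_entry.
by rewrite sumr_const card_ord mulr_natl.
Qed.

Lemma mx_norm_tr m n (A : 'M[R]_(m, n)) : `|A^T| = `|A|.
Proof.
apply/eqP; rewrite eq_le; apply/andP; split; apply: mx_norm_le => // i j.
  by rewrite mxE ler_mx_entry.
by rewrite -[A]trmxK mxE trmxK ler_mx_entry.
Qed.

Lemma mform_le n (G : 'M[R]_n) u v :
  `|mform G u v| <= n%:R ^+ 2 * (`|G| * `|u| * `|v|).
Proof.
apply: le_trans (ler_mx_entry _ _ _) _.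
apply: le_trans (mx_norm_mul _ _) _; rewrite mx_norm_tr.
have := mx_norm_mul u G => h.
rewrite expr2 -!mulrA ler_wpM2l//.
apply: (@le_trans _ _ (n%:R * (`|u| * `|G|) * `|v|)); first by rewrite ler_wpM2r.
by rewrite le_eqVlt; apply/orP; left; apply/eqP; ring.
Qed.

Lemma sqr_sum_le n (x : 'I_n -> R) : (\sum_i x i) ^+ 2 <= n%:R * \sum_i x i ^+ 2.
Proof.
have : 0 <= \sum_i \sum_j (x i - x j) ^+ 2.
  by apply: sumr_ge0 => i _; apply: sumr_ge0 => j _; exact: sqr_ge0.
have -> : \sum_i \sum_j (x i - x j) ^+ 2 =
    2 * (n%:R * \sum_i x i ^+ 2 - (\sum_i x i) ^+ 2).
  have e1 : \sum_i \sum_(j < n) x i ^+ 2 = n%:R * \sum_i x i ^+ 2.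
    by rewrite mulr_sumr; apply: eq_bigr => i _; rewrite sumr_const card_ord mulr_natl.
  have e2 : \sum_(i < n) \sum_j x j ^+ 2 = n%:R * \sum_i x i ^+ 2.
    by rewrite sumr_const card_ord mulr_natl.
  have e3 : \sum_i \sum_j x i * x j = (\sum_i x i) ^+ 2.
    by rewrite expr2 mulr_suml; apply: eq_bigr => i _; rewrite mulr_sumr.
  transitivity (\sum_i \sum_(j < n) x i ^+ 2 + \sum_(i < n) \sum_j x j ^+ 2
     - 2 * \sum_i \sum_j x i * x j); last by rewrite e1 e2 e3; ring.
  rewrite mulr_sumr -big_split -sumrB; apply: eq_bigr => i _.
  by rewrite mulr_sumr -big_split -sumrB; apply: eq_bigr => j _ /=; ring.
by rewrite pmulr_rge0// subr_ge0.
Qed.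

(** * Orthonormal frames by block elimination *)

Section Cholesky.

(** Elimination of the first variable: [al] is the square root of the corner entry and [A']
    orthonormalizes the Schur complement. *)
Lemma block_schur n (a : 'M[R]_1) (b : 'M[R]_(1, n)) (d A' : 'M[R]_n) (al be : R) :
  a = (al ^+ 2)%:M -> al * be = 1 ->
  A' *m (d - be ^+ 2 *: (b^T *m b)) *m A'^T = 1%:M ->
  let A := block_mx (be%:M : 'M[R]_1) 0 (- (be ^+ 2) *: (A' *m b^T)) A' in
  A *m block_mx a b b^T d *m A^T = 1%:M.
Proof.
move=> -> ab H A; rewrite /A mulmx_block tr_block_mx mulmx_block.
have e1 : be * al ^+ 2 = al by rewrite expr2 mulrA [be * al]mulrC ab mul1r.
have e2 : be ^+ 2 * al ^+ 2 = 1 by rewrite -exprMn mulrC ab expr1n.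
rewrite !mul0mx !addr0 -!scalemxAl !mul_mx_scalar !mul_scalar_mx.
rewrite !scalerA !mulNr !e2 !scaleN1r addNr !mul0mx trmx0 !mulmx0 !addr0 !add0r.
rewrite [1%:M](_ : _ = block_mx 1%:M 0 0 1%:M); last by rewrite -scalar_mx_block.
rewrite scale_scalar_mx [al ^+ 2 * be]mulrC e1 tr_scalar_mx.
congr block_mx.
- by rewrite -scalar_mxM ab.
- rewrite linearZ /= trmx_mul trmxK -scalemxAr -!scalemxAl mul_scalar_mx scalerA.
  rewrite -scalerDl.
  have -> : - be ^+ 2 * al + be = 0.
    by rewrite expr2 mulNr -mulrA [be * al]mulrC ab mulr1 addNr.
  by rewrite scale0r.
- rewrite -H; congr (_ *m _); rewrite mulmxBr -scalemxAr mulmxA addrC; congr (_ + _).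
  exact: scaleNr.
Qed.

Lemma cholesky_step n (M : 'M[R]_(1 + n)) : posdef M ->
  exists (x : R) (b : 'M[R]_(1, n)) (d : 'M[R]_n), [/\ 0 < x,
    M = block_mx x%:M b b^T d, d^T = d & posdef (d - x^-1 *: (b^T *m b))].
Proof.
move=> [Ms Mp].
have E := esym (submxK M); set a := ulsubmx M in E.
have aE : a = (a 0 0)%:M by exact: mx11_scalar.
have : (block_mx a (ursubmx M) (dlsubmx M) (drsubmx M))^T =
       block_mx a (ursubmx M) (dlsubmx M) (drsubmx M) by rewrite -E.
rewrite tr_block_mx => /eq_block_mx[_ b1 b2 d1].
have [x [ax x0]] : exists x : R, a = x%:M /\ 0 < x.
  exists (a 0 0); split => //.
    have := Mp (row_mx 1%:M 0); rewrite E /mform mul_row_block tr_row_mx mul_row_col.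
    rewrite !mul0mx !mul1mx trmx0 mulmx0 !addr0 trmx1 mulmx1; apply.
    apply/eqP => /rowP/(_ (lshift n 0)); rewrite row_mxEl !mxE eqxx => /eqP.
    by rewrite oner_eq0.
exists x, (ursubmx M), (drsubmx M); split => //.
- by rewrite -ax {1}E; congr block_mx; rewrite -b1 trmxK.
- split.
    by rewrite linearB linearZ /= trmx_mul trmxK d1.
  move=> v v0.
  have := Mp (row_mx (- (x^-1) *: (v *m dlsubmx M)) v).
  have -> : mform M (row_mx (- x^-1 *: (v *m dlsubmx M)) v)
     (row_mx (- x^-1 *: (v *m dlsubmx M)) v) =
     mform (drsubmx M - x^-1 *: ((ursubmx M)^T *m ursubmx M)) v v.
    rewrite {1}E /mform mul_row_block tr_row_mx mul_row_col ax mul_mx_scalar.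
    rewrite scalerA mulrN divff ?gt_eqF// scaleN1r addNr mul0mx add0r b2.
    congr ((_ *m _) 0 0); rewrite mulmxBr -scalemxAl -scalemxAr scaleNr addrC mulmxA.
    by rewrite -!mulmxA.
  apply; apply: contra_neq v0 => /(congr1 rsubmx).
  by rewrite row_mxKr linear0.
Qed.

(** The rows of [A] form an orthonormal frame for [M]. The Lipschitz bound near the identity is what
    later makes a transported frame turn little along a short link. Induction on the Schur
    complement, which stays at distance at most 2 e from the identity when [M] is at distance
    [e]. *)
Lemma cholesky n : exists2 C : R, 1 <= C & forall M : 'M[R]_n, posdef M ->
  exists A : 'M[R]_n, A *m M *m A^T = 1%:M /\
    forall e, `|M - 1%:M| <= e -> e <= C^-1 -> `|A - 1%:M| <= C * e.
Proof.
elim: n => [|n [C C1 IH]].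
  exists 1 => // M _; exists 1%:M; split; first by apply/matrixP => -[].
  move=> e h _; apply: mx_norm_le; last by case.
  by rewrite mul1r; apply: le_trans h.
have N0 : (0 : R) <= n%:R by exact: ler0n.
(* The nonzero blocks of [A - 1] are bounded by e, 4 n e and 2 C e; the factor 8 (C + 1) also forces
   e <= 1 / 16 and 8 C e <= 1, as the intermediate estimates need. *)
exists (8 * (C + 1) * (n%:R + 1)); first by nra.
rewrite -[n.+1]/(1 + n)%N => M pM.
have [x [b [d [x0 ME ds pS]]]] := cholesky_step pM.
have [A' [A'E A'B]] := IH _ pS.
pose al := Num.sqrt x; pose be := al^-1.
have al0 : 0 < al by rewrite sqrtr_gt0.
have alE : x%:M = (al ^+ 2)%:M :> 'M[R]_1 by rewrite sqr_sqrtr// ltW.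
have ab : al * be = 1 by rewrite divff// gt_eqF.
have beE : be ^+ 2 = x^-1 by rewrite exprVn sqr_sqrtr// ltW.
exists (block_mx be%:M 0 (- (be ^+ 2) *: (A' *m b^T)) A'); split.
  by rewrite ME; apply: (block_schur alE ab); rewrite beE.
move=> e he eC.
have e0 : 0 <= e by apply: le_trans he.
have eK : e * (8 * (C + 1) * (n%:R + 1)) <= 1.
  by rewrite -ler_pdivlMr ?mul1r//; nra.
have e16 : e * 16 <= 1.
  by apply: le_trans eK; rewrite ler_wpM2l//; nra.
have eCC : e * (8 * C) <= 1.
  by apply: le_trans eK; rewrite ler_wpM2l//; nra.
have ne0 : 0 <= n%:R * e by rewrite mulr_ge0.
have Ce0 : 0 <= C * e by rewrite mulr_ge0//; lra.
have nCe0 : 0 <= n%:R * (C * e) by rewrite mulr_ge0.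
have M1 : M - 1%:M = block_mx (x - 1)%:M b b^T (d - 1%:M).
  rewrite ME [1%:M in LHS](_ : _ = block_mx 1%:M 0 0 1%:M); last first.
    by rewrite -scalar_mx_block.
  by rewrite opp_block_mx add_block_mx !oppr0 !addr0 raddfB.
have hx : `|x - 1| <= e.
  apply: le_trans he; have := ler_mx_entry (M - 1%:M) (lshift n 0) (lshift n 0).
  by rewrite M1 block_mxEul mxE eqxx.
have hb : `|b| <= e.
  apply: mx_norm_le => // i j; apply: le_trans he.
  have := ler_mx_entry (M - 1%:M) (lshift n i) (rshift 1 j).
  by rewrite M1 block_mxEur.
have hd : `|d - 1%:M| <= e.
  apply: mx_norm_le => // i j; apply: le_trans he.
  have := ler_mx_entry (M - 1%:M) (rshift 1 i) (rshift 1 j).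
  by rewrite M1 block_mxEdr.
have x2 : 2^-1 <= x by move: hx; rewrite ler_norml => /andP[? ?]; lra.
have xi2 : x^-1 <= 2 by rewrite -[2]invrK lef_pV2// posrE invr_gt0.
have hS : `|d - x^-1 *: (b^T *m b) - 1%:M| <= 2 * e.
  have -> : d - x^-1 *: (b^T *m b) - 1%:M = (d - 1%:M) - x^-1 *: (b^T *m b).
    by rewrite addrAC.
  apply: le_trans (ler_normB _ _) _.
  have : `|x^-1 *: (b^T *m b)| <= 2 * (e * e).
    rewrite normrZ ger0_norm ?invr_ge0 ?(ltW x0)//; apply: ler_pM => //.
      by rewrite invr_ge0 ltW.
    apply: le_trans (mx_norm_mul _ _) _; rewrite mul1r mx_norm_tr.
    exact: ler_pM.
  by nra.
have hA : `|A' - 1%:M| <= C * (2 * e).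
  by apply: A'B => //; rewrite -[C^-1]mul1r ler_pdivlMr; nra.
have hA1 : `|A'| <= 2.
  have -> : A' = (A' - 1%:M) + 1%:M by rewrite subrK.
  apply: le_trans (ler_normD _ _) _.
  have : `|1%:M : 'M[R]_n| <= 1.
    by apply: mx_norm_le => // i j; rewrite mxE; case: (i == j); rewrite ?normr1 ?normr0.
  by nra.
have hbe : `|be - 1| <= e.
  have -> : be - 1 = (1 - x) * (be / (1 + al)).
    have -> : x = al ^+ 2 by rewrite sqr_sqrtr// ltW.
    by rewrite /be; field; apply/andP; split; [rewrite gt_eqF// addr_gt0|rewrite gt_eqF].
  rewrite normrM distrC -[leRHS]mulr1; apply: ler_pM => //.
  rewrite ger0_norm; last by rewrite divr_ge0 ?invr_ge0 ?addr_ge0 ?(ltW al0).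
  have al2 : 2^-1 <= al.
    rewrite -(@ler_pXn2r _ 2) ?nnegrE ?(ltW al0)// sqr_sqrtr ?(ltW x0)//.
    by apply: le_trans x2; rewrite exprVn lef_pV2 ?posrE//; nra.
  rewrite ler_pdivrMr ?addr_gt0// mul1r /be -[al^-1]mul1r ler_pdivrMr//.
  by nra.
rewrite [1%:M](_ : _ = block_mx 1%:M 0 0 1%:M); last by rewrite -scalar_mx_block.
rewrite opp_block_mx add_block_mx !oppr0 !addr0.
have hq : `|- be ^+ 2 *: (A' *m b^T)| <= 4 * (n%:R * e).
  rewrite normrZ normrN beE ger0_norm ?invr_ge0 ?(ltW x0)//.
  have -> : 4 * (n%:R * e) = 2 * (n%:R * (2 * e)) by ring.
  apply: ler_pM => //; first by rewrite invr_ge0 ltW.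
  apply: le_trans (mx_norm_mul _ _) _; rewrite mx_norm_tr ler_wpM2l//.
  exact: ler_pM.
apply: mx_norm_le => [|i j]; first by rewrite mulr_ge0//; nra.
case: (split_ordP i) => {}i ->; case: (split_ordP j) => {}j ->.
- rewrite block_mxEul !ord1 !mxE eqxx !mulr1n; apply: le_trans hbe _; lra.
- by rewrite block_mxEur mxE normr0; lra.
- rewrite block_mxEdl; apply: le_trans (ler_mx_entry _ _ _) _.
  by apply: le_trans hq _; lra.
- rewrite block_mxEdr; apply: le_trans (ler_mx_entry _ _ _) _.
  by apply: le_trans hA _; lra.
Qed.

End Cholesky.

Lemma frame_inv n (E G : 'M[R]_n) : E *m G *m E^T = 1%:M ->
  E^T *m E *m G = 1%:M /\ G *m (E^T *m E) = 1%:M.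
Proof.
move=> EE; have h : E^T *m E *m G = 1%:M by rewrite -mulmxA; exact: mulmx1C.
by split=> //; exact: mulmx1C.
Qed.

Lemma posdef_unit n (G : 'M[R]_n) : posdef G -> G \in unitmx.
Proof.
move=> pG; have [_ _ /(_ _ pG)[E [/frame_inv[h1 h2] _]]] := cholesky n.
by have [] := mulmx1_unit h2.
Qed.

(** The rows of [E] are orthonormal for [G], which amounts to E^T E = G^-1; the rest is cyclicity of
    the trace. *)
Lemma mform_trace n (E G H : 'M[R]_n) : E *m G *m E^T = 1%:M ->
  \sum_k mform H (row k E) (row k E) = \tr (invmx G *m H).
Proof.
move=> /frame_inv[h1 h2].
have [uG _] := mulmx1_unit h2.
have -> : invmx G = E^T *m E by rewrite -[RHS]mulmx1 -(mulmxV uG) mulmxA h1 mul1mx.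
rewrite -mulmxA mxtrace_mulC /mxtrace; apply: eq_bigr => k _.
rewrite /mform -[_ 0 0]/(((row k E *m H) *m (row k E)^T) 0 0) -row_mul !mxE.
by apply: eq_bigr => j _; rewrite !mxE.
Qed.

(** In an orthonormal frame for [G] the endomorphism becomes a symmetric matrix with the same
    traces, to which the Cauchy-Schwarz inequality on the diagonal applies. It serves for |Hess v|^2
    >= (Lap v)^2 / n. *)
Lemma trace_sqr_le n (G A : 'M[R]_n) : posdef G -> (G *m A)^T = G *m A ->
  (\tr A) ^+ 2 <= n%:R * \tr (A *m A).
Proof.
move=> pG GA; have [_ _ /(_ _ pG)[E [EE _]]] := cholesky n.
have [h1 h2] := frame_inv EE; pose B := E *m (G *m A) *m E^T.
have Bs : B^T = B by rewrite /B trmx_mul (trmx_mul E) GA trmxK mulmxA.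
have tB : \tr B = \tr A.
  by rewrite /B mxtrace_mulC !mulmxA h1 mul1mx.
have tBB : \tr (B *m B) = \tr (A *m A).
  rewrite /B !mulmxA -(mulmxA _ E^T E) -(mulmxA _ (E^T *m E) G) h1 mulmx1.
  by rewrite mxtrace_mulC !mulmxA h1 mul1mx.
rewrite -tB -tBB; apply: le_trans (sqr_sum_le _) _; rewrite ler_wpM2l//.
apply: ler_sum => i _; clearbody B.
have Bij j : B j i = B i j by rewrite -{1}Bs mxE.
rewrite mxE (bigD1 i) //= -expr2 lerDl; apply: sumr_ge0 => j _.
by rewrite Bij -expr2 sqr_ge0.
Qed.

End MatrixForms.

(** * Coordinate geometry and change of coordinates *)

Lemma eqD (V : zmodType) (a b c d : V) : a = c -> b = d -> a + b = c + d.
Proof. by move=> -> ->. Qed.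
Lemma eqM (K : pzRingType) (a b c d : K) : a = c -> b = d -> a * b = c * d.
Proof. by move=> -> ->. Qed.

Lemma quad_swap (K : comPzRingType) n (a : 'I_n -> K) (F : 'I_n -> 'I_n -> K) :
  \sum_i \sum_j a i * a j * F i j = \sum_i \sum_j a i * a j * F j i.
Proof.
rewrite exchange_big; apply: eq_bigr => i _; apply: eq_bigr => j _.
by rewrite [a i * _]mulrC.
Qed.

Section DeriveRules.
Context {R : realType}.
Implicit Types V W : normedModType R.

Lemma is_derive_sumr V W (I : Type) (r : seq I) (f : I -> V -> W) (df : I -> W) x v :
  (forall i, is_derive x v (f i) (df i)) ->
  is_derive x v (fun y => \sum_(i <- r) f i y) (\sum_(i <- r) df i).
Proof.
move=> H; elim: r => [|i r IH].
  rewrite big_nil; have -> : (fun y => \sum_(i <- [::]) f i y) = cst 0.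
    by apply/funext => y; rewrite big_nil.
  exact: is_derive_cst.
rewrite big_cons; have -> : (fun y => \sum_(i <- i :: r) f i y) =
    (f i + (fun y => \sum_(i <- r) f i y)).
  by apply/funext => y; rewrite big_cons.
exact: is_deriveD.
Qed.

Lemma is_derive_mulr V (f g : V -> R) x v df dg :
  is_derive x v f df -> is_derive x v g dg ->
  is_derive x v (fun y => f y * g y) (df * g x + f x * dg).
Proof.
move=> [f1 f2] [g1 g2]; split; first exact: (derivableM f1 g1).
rewrite -[LHS]/('D_v (f * g) x) (deriveM f1 g1) f2 g2 addrC.
by congr (_ + _); exact: mulrC.
Qed.

Lemma is_derive_entry V m n (f : V -> 'M[R]_(m, n)) x v df i j :
  is_derive x v f df -> is_derive x v (fun y => f y i j) (df i j).
Proof.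
move=> [f1 f2]; split; last by rewrite derive_coord// f2.
by have /derivable_mxP := f1; apply.
Qed.

Lemma is_derive_mx V m n (f : V -> 'M[R]_(m, n)) x v (df : 'M[R]_(m, n)) :
  (forall i j, is_derive x v (fun y => f y i j) (df i j)) -> is_derive x v f df.
Proof.
move=> H; have d : derivable f x v by apply/derivable_mxP => i j; have [] := H i j.
split=> //; apply/matrixP => i j; rewrite -derive_coord//.
by have [_ ->] := H i j.
Qed.

Lemma is_derive_mform V n (G : V -> 'M[R]_n) (a b : V -> 'rV[R]_n) x v dG da db :
  is_derive x v G dG -> is_derive x v a da -> is_derive x v b db ->
  is_derive x v (fun y => mform (G y) (a y) (b y))
    (mform dG (a x) (b x) + mform (G x) da (b x) + mform (G x) (a x) db).
Proof.
move=> hG ha hb.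
have -> : (fun y => mform (G y) (a y) (b y)) =
    (fun y => \sum_i \sum_j a y 0 i * G y i j * b y 0 j).
  by apply/funext => y; rewrite mformE.
have E : mform dG (a x) (b x) + mform (G x) da (b x) + mform (G x) (a x) db =
   \sum_i \sum_j ((da 0 i * G x i j + a x 0 i * dG i j) * b x 0 j
                  + a x 0 i * G x i j * db 0 j).
  rewrite !mformE -!big_split; apply: eq_bigr => i _; rewrite -!big_split.
  by apply: eq_bigr => j _ /=; ring.
rewrite E; apply: is_derive_sumr => i; apply: is_derive_sumr => j.
by apply: is_derive_mulr; [apply: is_derive_mulr|]; apply: is_derive_entry.
Qed.

Lemma is_derive_unique V W (f : V -> W) x v d1 d2 :
  is_derive x v f d1 -> is_derive x v f d2 -> d1 = d2.
Proof. by move=> [_ <-] [_ <-]. Qed.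

Lemma is_derive_on_ext V W (U : set V) (f g : V -> W) (v y : V) d : open U ->
  (forall y, U y -> f y = g y) -> U y -> is_derive y v f d -> is_derive y v g d.
Proof.
move=> oU fg Uy [h1 h2]; have [a b] := derive_on_ext v oU fg Uy.
by split; [exact: a|rewrite -b].
Qed.
End DeriveRules.

Section Coordinates.
Context {R : realType} {n : nat}.
Implicit Types (G : 'rV[R]_n -> 'M[R]_n) (F : 'rV[R]_n -> R) (u v w y : 'rV[R]_n).

Definition gam2 G y u v : 'rV[R]_n :=
  \row_k \sum_i \sum_j christoffel G k i j y * u 0 i * v 0 j.

Definition smooth_metric (W : set 'rV[R]_n) G :=
  [/\ open W, smooth_on W G & forall y, W y -> posdef (G y)].

(* The covariant Hessian of F, evaluated at (v, v). *)
Definition chess G F y v : R := 'D_v ('D_v F) y - 'D_(gam2 G y v v) F y.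

Definition dform G y h u v : R := mform ('D_h G y) u v.
Definition jac (phi : 'rV[R]_n -> 'rV[R]_n) y v : 'rV[R]_n := 'D_v phi y.
Definition jac2 (phi : 'rV[R]_n -> 'rV[R]_n) y u v : 'rV[R]_n := 'D_u ('D_v phi) y.

Lemma invmx_sym (A : 'M[R]_n) i j : A^T = A -> invmx A i j = invmx A j i.
Proof. by move=> sA; rewrite -[in LHS]sA -trmx_inv mxE. Qed.

Section Local.
Variables (W : set 'rV[R]_n) (G : 'rV[R]_n -> 'M[R]_n).
Hypothesis sG : smooth_metric W G.
Variable y : 'rV[R]_n.
Hypothesis Wy : W y.

Let oW : open W. Proof. by case: sG. Qed.
Let CG k : Ck_on k W G. Proof. by case: sG. Qed.
Let pG : posdef (G y). Proof. by case: sG => _ _; apply. Qed.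

Lemma dmetric_entry i j v :
  'D_v (fun z => G z i j) y = ('D_v G y) i j.
Proof. by rewrite derive_coord//; exact: (Ck_derivable v (CG 1)). Qed.

Lemma dmetric_lin v : 'D_v G y = \sum_i v 0 i *: 'D_(delta_mx 0 i) G y.
Proof. exact: (derive_rV_mx v oW (CG 1)). Qed.

Lemma christoffelE k i j : christoffel G k i j y =
  2^-1 * \sum_l invmx (G y) k l * (('D_(delta_mx 0 i) G y) j l
    + ('D_(delta_mx 0 j) G y) i l - ('D_(delta_mx 0 l) G y) i j).
Proof.
congr (_ * _); apply: eq_bigr => l _; congr (_ * _).
by rewrite /pderiv !dmetric_entry.
Qed.

Lemma mform_dmetric u v w : dform G y u v w =
  \sum_l \sum_i \sum_j ('D_(delta_mx 0 l) G y) i j * u 0 l * v 0 i * w 0 j.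
Proof.
rewrite /dform dmetric_lin mformE.
transitivity (\sum_i \sum_j \sum_l
    ('D_(delta_mx 0 l) G y) i j * u 0 l * v 0 i * w 0 j).
  apply: eq_bigr => i _; apply: eq_bigr => j _.
  rewrite summxE mulr_sumr mulr_suml; apply: eq_bigr => l _.
  by rewrite mxE; ring.
under eq_bigr do rewrite exchange_big /=.
by rewrite exchange_big.
Qed.

(** Koszul's formula for constant coordinate fields, whose brackets vanish. It handles [gam2]
    without the inverse matrix hidden in the Christoffel symbols. *)
Lemma koszul u v w : mform (G y) (gam2 G y u v) w =
  2^-1 * (dform G y u v w + dform G y v u w - dform G y w u v).
Proof.
pose T i j := \row_l (('D_(delta_mx 0 i) G y) j l
    + ('D_(delta_mx 0 j) G y) i l - ('D_(delta_mx 0 l) G y) i j).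
have -> : gam2 G y u v = \sum_i \sum_j (2^-1 * u 0 i * v 0 j) *: (T i j *m invmx (G y)).
  apply/rowP => k; rewrite mxE summxE; apply: eq_bigr => i _.
  rewrite summxE; apply: eq_bigr => j _; rewrite christoffelE !mxE.
  have -> : \sum_l invmx (G y) k l * (('D_(delta_mx 0 i) G y) j l
    + ('D_(delta_mx 0 j) G y) i l - ('D_(delta_mx 0 l) G y) i j) =
    \sum_j0 (T i j) 0 j0 * invmx (G y) j0 k.
    apply: eq_bigr => l _; rewrite mxE mulrC; congr (_ * _).
    exact: invmx_sym pG.1.
  by ring.
rewrite mform_suml; under eq_bigr do rewrite mform_suml.
have TE i j : mform (G y) (T i j *m invmx (G y)) w = \sum_l (T i j) 0 l * w 0 l.
  rewrite /mform mulmxKV ?posdef_unit// mxE.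
  by apply: eq_bigr => l _; rewrite [w^T _ _]mxE.
transitivity (2^-1 * \sum_i \sum_j \sum_l (T i j) 0 l * u 0 i * v 0 j * w 0 l).
  rewrite mulr_sumr; apply: eq_bigr => i _; rewrite mulr_sumr; apply: eq_bigr => j _.
  rewrite mformZl TE !mulr_sumr; apply: eq_bigr => l _; ring.
congr (_ * _); rewrite !mform_dmetric.
have -> : \sum_l \sum_i \sum_j ('D_(delta_mx 0 l) G y) i j * v 0 l * u 0 i * w 0 j =
    \sum_i \sum_l \sum_j ('D_(delta_mx 0 l) G y) i j * v 0 l * u 0 i * w 0 j.
  by rewrite exchange_big.
have -> : \sum_l \sum_i \sum_j ('D_(delta_mx 0 l) G y) i j * w 0 l * u 0 i * v 0 j =
    \sum_i \sum_j \sum_l ('D_(delta_mx 0 l) G y) i j * w 0 l * u 0 i * v 0 j.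
  by rewrite exchange_big; apply: eq_bigr => i _; rewrite exchange_big.
rewrite -big_split -sumrB; apply: eq_bigr => i _.
rewrite -big_split -sumrB; apply: eq_bigr => j _.
rewrite -big_split -sumrB; apply: eq_bigr => l _ /=.
by rewrite mxE; ring.
Qed.

Lemma mform_inj u v : (forall w, mform (G y) u w = mform (G y) v w) -> u = v.
Proof.
move=> H; apply/eqP; rewrite -subr_eq0; apply/negPn/negP => uv.
have := pG.2 _ uv; rewrite mformDl mformNl (H (u - v)) subrr.
by rewrite ltxx.
Qed.

Lemma dmetric_sym v : ('D_v G y)^T = 'D_v G y.
Proof.
apply/matrixP => i j; rewrite mxE -!dmetric_entry.
apply: (derive_on_ext _ oW _ Wy).2 => z Wz.
by have [_ _ /(_ _ Wz)[+ _]] := sG => /matrixP/(_ i j); rewrite mxE.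
Qed.

Lemma dformC h u v : dform G y h u v = dform G y h v u.
Proof. by apply: mformC; exact: dmetric_sym. Qed.

Lemma gam2C u v : gam2 G y u v = gam2 G y v u.
Proof.
have aux (a b c d : R) : c = d -> 2^-1 * (a + b - c) = 2^-1 * (b + a - d).
  by move=> ->; rewrite [a + b]addrC.
apply: mform_inj => w; apply: etrans (koszul u v w) (etrans _ (esym (koszul v u w))).
exact: aux (dformC w u v).
Qed.

Lemma metric_compat h u v : dform G y h u v =
  mform (G y) (gam2 G y h u) v + mform (G y) u (gam2 G y h v).
Proof.
rewrite (mformC u _ pG.1) !koszul (dformC h v u) (dformC u h v) (dformC v h u).
by move: (dform _ _ _ _ _) (dform _ _ _ _ _) (dform _ _ _ _ _) => a b c; field.
Qed.
End Local.

Lemma gam2Dr G y u v v' : gam2 G y u (v + v') = gam2 G y u v + gam2 G y u v'.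
Proof.
apply/rowP => k; rewrite !mxE -big_split; apply: eq_bigr => i _.
by rewrite -big_split; apply: eq_bigr => j _ /=; rewrite mxE; ring.
Qed.
Lemma gam2Zl G y a u v : gam2 G y (a *: u) v = a *: gam2 G y u v.
Proof.
apply/rowP => k; rewrite !mxE mulr_sumr; apply: eq_bigr => i _.
by rewrite mulr_sumr; apply: eq_bigr => j _ /=; rewrite mxE; ring.
Qed.
Lemma gam2Zr G y a u v : gam2 G y u (a *: v) = a *: gam2 G y u v.
Proof.
apply/rowP => k; rewrite !mxE mulr_sumr; apply: eq_bigr => i _.
by rewrite mulr_sumr; apply: eq_bigr => j _ /=; rewrite mxE; ring.
Qed.

Section LocalFunctions.
Variables (W : set 'rV[R]_n) (G : 'rV[R]_n -> 'M[R]_n).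
Hypothesis sG : smooth_metric W G.
Variable F : 'rV[R]_n -> R.
Hypothesis CF : smooth_on W F.
Variable y : 'rV[R]_n.
Hypothesis Wy : W y.

Let oW : open W. Proof. by case: sG. Qed.

Lemma local_gradE w : mform (G y) (local_grad G F y) w = 'D_w F y.
Proof.
have pG : posdef (G y) by case: sG => _ _; apply.
have -> : local_grad G F y = (\row_i pderiv i F y) *m invmx (G y).
  apply/rowP => k; rewrite !mxE; apply: eq_bigr => i _; rewrite mxE mulrC.
  by congr (_ * _); exact: invmx_sym pG.1.
rewrite /mform mulmxKV ?posdef_unit// mxE (derive_rV w oW (CF 1) Wy).
by apply: eq_bigr => i _; rewrite !mxE mulrC.
Qed.

Lemma eq_local_grad F' z : (forall z, W z -> F z = F' z) -> W z ->
  local_grad G F z = local_grad G F' z.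
Proof.
move=> E Wz; apply/rowP => k; rewrite !mxE; apply: eq_bigr => i _; congr (_ * _).
exact: (derive_on_ext _ oW E Wz).2.
Qed.

Lemma eq_local_laplacian F' : (forall z, W z -> F z = F' z) ->
  local_laplacian G F y = local_laplacian G F' y.
Proof.
move=> E; apply: eq_bigr => i _; apply: eqD.
  apply: (derive_on_ext _ oW _ Wy).2 => z Wz; by rewrite (eq_local_grad E Wz).
apply: eq_bigr => j _; apply: eqM; first by [].
by rewrite (eq_local_grad E Wy).
Qed.

Lemma second_derive v : 'D_v ('D_v F) y =
  \sum_i \sum_j v 0 i * v 0 j * pderiv i (pderiv j F) y.
Proof.
rewrite (derive_rV v oW (Ck_derive v (CF 2)) Wy); apply: eq_bigr => i _.
have E z : W z -> \sum_j v 0 j * pderiv j F z = 'D_v F z.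
  by move=> Wz; rewrite (derive_rV v oW (CF 1) Wz).
rewrite -(derive_on_ext (delta_mx 0 i) oW E Wy).2.
have [_ ->] : is_derive y (delta_mx 0 i) (fun z => \sum_j v 0 j * pderiv j F z)
    (\sum_j v 0 j * pderiv i (pderiv j F) y).
  apply: is_derive_sumr => j.
  have h1 : is_derive y (delta_mx 0 i) (pderiv j F) (pderiv i (pderiv j F) y).
    by split=> //; exact: (Ck_derivable _ (Ck_derive (delta_mx 0 j) (CF 2))).
  have := is_derive_mulr (is_derive_cst (v 0 j) y (delta_mx 0 i)) h1.
  by rewrite mul0r add0r.
by rewrite mulr_sumr; apply: eq_bigr => j _; rewrite mulrA.
Qed.

(** The identities of the abstract ring are reused with a dummy time: [F] is regarded as a
    time-independent function on the set of [(y, t)] with [y] in [W]. There the Laplacian is the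
    trace of the symmetric lowered Hessian, and [mform_trace] turns that trace into a sum over the
    frame. *)
Lemma laplacian_trace (E : 'M[R]_n) : E *m G y *m E^T = 1%:M ->
  local_laplacian G F y = \sum_k chess G F y (row k E).
Proof.
move=> EE.
have pG : posdef (G y) by case: sG => _ _; apply.
have symG z : W z -> (G z)^T = G z by move=> Wz; have [_ _ /(_ _ Wz)[]] := sG.
have unitG z : W z -> G z \in unitmx.
  by move=> Wz; apply: posdef_unit; have [_ _] := sG; exact.
have smG : smooth_on W G by case: sG.
pose O := [set z : 'rV[R]_n * R | W z.1].
have oO : open O by apply: open_comp => // z _; exact: cvg_fst.
have OW z : O z -> W z.1 by [].
pose f : smf oO := mksmf (smooth_spatial OW CF).
have fE z : O z -> f z = F z.1 by exact: cutoffE.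
pose D := @spd R n O oO; pose g := gg oW smG oO OW.
pose h := gh oW smG unitG oO OW; pose hf : smf oO := ghalf oO.
have Oy : O (y, 0) by [].
have gS i j : g i j = g j i by exact: ggS.
have hS i j : h i j = h j i by exact: ghS.
have hg i j : \sum_k g i k * h k j = (i == j)%:R by exact: ggh.
have hfE : hf + hf = 1 by exact: ghalfE.
have dD i : derivation (D i) by exact: spd_derivation.
have H1 l i : rHess D g h hf f l i = D i (D l f) - \sum_m rGam D g h hf m i l * D m f.
  rewrite (rHessE dD gS hg hfE); congr (_ + _).
  transitivity (- (\sum_m rGam D g h hf m i l * (\sum_j g m j * rgrad D h f j))).
    have -> : \sum_m rGam D g h hf m i l * (\sum_j g m j * rgrad D h f j) =
       \sum_j (\sum_m g j m * rGam D g h hf m i l) * rgrad D h f j.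
      under eq_bigr do rewrite mulr_sumr.
      rewrite exchange_big; apply: eq_bigr => j _; rewrite mulr_suml.
      by apply: eq_bigr => m _; rewrite (gS m j); ring.
    rewrite mulr_sumr -sumrN; apply: eq_bigr => j _.
    by rewrite (lower_Gam D hf hg) (gS l j); ring.
  by congr (- _); apply: eq_bigr => m _; rewrite (grad_lower D hg).
have H2 : rlap D g h hf f = \sum_i \sum_l h i l * rHess D g h hf f l i.
  apply: eq_bigr => i _.
  by rewrite -[LHS](sum_hg gS hS hg (fun i' => rcov D g h hf (rgrad D h f) i' i) i).
have H3 i l : (D i (D l f)) (y, 0) = pderiv i (pderiv l F) y.
  apply: (spd_near i (z := (y, 0)) (F := pderiv l F)) => // z Oz.
  by apply: (spd_near l (z := (z, 0)) (F := F)) => // z' Oz'; exact: fE.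
pose Hm := \matrix_(l, i) (pderiv i (pderiv l F) y -
   \sum_m christoffel G m i l y * pderiv m F y).
have -> : local_laplacian G F y = \tr (invmx (G y) *m Hm).
  transitivity (rlap D g h hf f (y, 0)).
    transitivity (local_laplacian G (fun z => f (z, 0)) y).
      by apply: eq_local_laplacian => z Wz; rewrite fE.
    exact: (esym (rlapE oW smG unitG OW f Oy)).
  rewrite H2 smf_sum /mxtrace; apply: eq_bigr => i _; rewrite smf_sum mxE.
  apply: eq_bigr => l _; rewrite smfM ghE// H1 smfB smf_sum mxE H3.
  congr (_ * (_ - _)); apply: eq_bigr => m _; rewrite smfM rGamE//; congr (_ * _).
  by apply: (spd_near m (z := (y, 0)) (F := F)) => // z' Oz'; exact: fE.
rewrite -(mform_trace Hm EE); apply: eq_bigr => k _; set v := row k E.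
rewrite /chess second_derive (derive_rV _ oW (CF 1) Wy) mformE.
have -> : \sum_i (gam2 G y v v) 0 i * 'D_(delta_mx 0 i) F y =
   \sum_i \sum_j v 0 i * v 0 j * \sum_m christoffel G m j i y * pderiv m F y.
  transitivity (\sum_m \sum_i \sum_j christoffel G m i j y * v 0 i * v 0 j * pderiv m F y).
    apply: eq_bigr => m _; rewrite mxE mulr_suml; apply: eq_bigr => i _.
    by rewrite mulr_suml.
  rewrite exchange_big /=; under eq_bigr do rewrite exchange_big /=.
  rewrite exchange_big; apply: eq_bigr => i _; apply: eq_bigr => j _.
  by rewrite mulr_sumr; apply: eq_bigr => m _; ring.
have -> : \sum_i \sum_j v 0 i * v 0 j * pderiv i (pderiv j F) y =
   \sum_i \sum_j v 0 i * v 0 j * pderiv j (pderiv i F) y.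
  exact: (quad_swap (fun i => v 0 i) (fun i j => pderiv i (pderiv j F) y)).
have aux (a b c d : R) : a * (c - d) * b = a * b * c - a * b * d by ring.
rewrite -sumrB; apply: eq_bigr => i _; rewrite -sumrB; apply: eq_bigr => j _.
apply: etrans (aux _ _ _ _); apply: eqM => //; apply: eqM => //.
by rewrite [LHS]mxE.
Unshelve. all: end_near. Qed.

End LocalFunctions.

(** * Invariance under local isometries *)

Section Isometry.
Variables (W1 W2 : set 'rV[R]_n) (G1 G2 : 'rV[R]_n -> 'M[R]_n).
Variable phi : 'rV[R]_n -> 'rV[R]_n.
Hypothesis sG1 : smooth_metric W1 G1.
Hypothesis sG2 : smooth_metric W2 G2.
Hypothesis sphi : smooth_on W1 phi.
Hypothesis phiW : forall y, W1 y -> W2 (phi y).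
Hypothesis iso : forall y, W1 y -> forall v w,
  mform (G1 y) v w = mform (G2 (phi y)) ('D_v phi y) ('D_w phi y).

Let oW1 : open W1. Proof. by case: sG1. Qed.
Let oW2 : open W2. Proof. by case: sG2. Qed.

Lemma jac_surj y w : W1 y -> exists v, 'D_v phi y = w.
Proof.
move=> Wy; pose J := \matrix_i 'D_(delta_mx 0 i) phi y.
have JE v : 'D_v phi y = v *m J.
  rewrite (derive_rV_mx v oW1 (sphi 1) Wy) mulmx_sum_row.
  by apply: eq_bigr => i _; rewrite rowK.
have GJ : G1 y = J *m G2 (phi y) *m J^T.
  apply/matrixP => i j.
  have m1 (A : 'M[R]_n) : mform A (delta_mx 0 i) (delta_mx 0 j) = A i j.
    by rewrite /mform trmx_delta -rowE -colE !mxE.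
  by rewrite -m1 iso// !JE -[RHS]m1 /mform trmx_mul !mulmxA.
have uJ : J \in unitmx.
  have : G1 y \in unitmx by apply: posdef_unit; case: sG1 => _ _; apply.
  by rewrite GJ !unitmx_mul => /andP[/andP[]].
by exists (w *m invmx J); rewrite JE mulmxKV.
Qed.

Lemma is_derive_jac y u v : W1 y ->
  is_derive y u (fun z => jac phi z v) (jac2 phi y u v).
Proof.
move=> Wy; split=> //; exact: (Ck_derivable u (Ck_derive v (sphi 2))).
Qed.

Lemma jac2C y u v : W1 y -> jac2 phi y u v = jac2 phi y v u.
Proof.
move=> Wy; apply/rowP => j.
have Cj : Ck_on 2 W1 (fun z => phi z 0 j) by exact: (Ck_mxP 2 phi oW1).1.
have E a b : (jac2 phi y a b) 0 j = 'D_a ('D_b (fun z => phi z 0 j)) y.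
  apply: etrans (esym (derive_coord 0 j (Ck_derivable a (Ck_derive b (sphi 2)) Wy))) _.
  apply: (derive_on_ext a oW1 _ Wy).2 => z Wz.
  exact: esym (derive_coord 0 j (Ck_derivable b (sphi 1) Wz)).
exact: etrans (E u v) (etrans (Schwarz u v oW1 Cj Wy) (esym (E v u))).
Qed.

Lemma dmetric_change y u v w : W1 y -> dform G1 y u v w =
  dform G2 (phi y) (jac phi y u) (jac phi y v) (jac phi y w)
  + mform (G2 (phi y)) (jac2 phi y u v) (jac phi y w)
  + mform (G2 (phi y)) (jac phi y v) (jac2 phi y u w).
Proof.
move=> Wy.
have C1G : Ck_on 1 W1 G1 by case: sG1.
have C2G : Ck_on 1 W2 G2 by case: sG2.
have h1 : is_derive y u (fun z => mform (G1 z) v w) (dform G1 y u v w).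
  have hG : is_derive y u G1 ('D_u G1 y).
    by split=> //; exact: (Ck_derivable u C1G).
  have := is_derive_mform hG (is_derive_cst v y u) (is_derive_cst w y u).
  by rewrite mform0l mform0r !addr0.
have h2 : is_derive y u (fun z => G2 (phi z)) ('D_('D_u phi y) G2 (phi y)).
  apply: (is_derive_comp oW2 C2G (phiW Wy)).
  exact: (Ck_derivable u (sphi 1)).
have := is_derive_mform h2 (is_derive_jac u v Wy) (is_derive_jac u w Wy).
apply: is_derive_unique.
exact: (is_derive_on_ext oW1 (fun z Wz => iso Wz v w) Wy h1).
Qed.

(** Koszul's formula is written on both sides. In the combination of the three derivatives of the
    metric, the second derivatives of [phi] cancel in pairs by their symmetry, except for one, the
    inhomogeneous term of the transformation law. *)
Lemma christoffel_change y u v : W1 y ->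
  jac phi y (gam2 G1 y u v) =
  jac2 phi y u v + gam2 G2 (phi y) (jac phi y u) (jac phi y v).
Proof.
move=> Wy; have pG2 : posdef (G2 (phi y)).
  by case: sG2 => _ _; apply; exact: phiW.
apply: (mform_inj sG2 (phiW Wy)) => w'.
have [w <-] := jac_surj w' Wy.
rewrite -/(jac phi y w) mformDl (koszul sG2 (phiW Wy)).
rewrite -[LHS](iso Wy) (koszul sG1 Wy) !dmetric_change//.
rewrite (jac2C v u Wy) (jac2C w u Wy) (jac2C w v Wy).
have aux (a b c d e e' f : R) : e = e' ->
    2^-1 * (a + d + e + (b + d + f) - (c + e' + f)) = d + 2^-1 * (a + b - c).
  by move=> ->; field.
exact: aux (mformC (jac phi y v) (jac2 phi y u w) pG2.1).
Qed.

(** The second derivative of [phi] produced by the chain rule is cancelled by the inhomogeneous term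
    of [christoffel_change]. *)
Lemma chess_change F y v : smooth_on W2 F -> W1 y ->
  chess G1 (fun z => F (phi z)) y v = chess G2 F (phi y) (jac phi y v).
Proof.
move=> CF Wy; have Wp := phiW Wy.
have h1 z u : W1 z -> is_derive z u (fun z => F (phi z)) ('D_('D_u phi z) F (phi z)).
  move=> Wz; apply: (is_derive_comp_scalar oW2 (CF 1) (phiW Wz)).
  exact: (Ck_derivable _ (sphi 1)).
have h2 : 'D_v ('D_v (fun z => F (phi z))) y =
   'D_('D_v phi y) ('D_('D_v phi y) F) (phi y) + 'D_('D_v ('D_v phi) y) F (phi y).
  have E z : W1 z -> \sum_i ('D_v phi z) 0 i * pderiv i F (phi z) =
      'D_v (fun z => F (phi z)) z.
    by move=> Wz; have [_ ->] := h1 z v Wz; rewrite (derive_rV _ oW2 (CF 1))//; exact: phiW.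
  rewrite -(derive_on_ext v oW1 E Wy).2.
  have [_ ->] : is_derive y v (fun z => \sum_i ('D_v phi z) 0 i * pderiv i F (phi z))
     (\sum_i (('D_v ('D_v phi) y) 0 i * pderiv i F (phi y) +
       ('D_v phi y) 0 i * 'D_('D_v phi y) (pderiv i F) (phi y))).
    apply: is_derive_sumr => i; apply: is_derive_mulr.
      by apply: is_derive_entry; exact: is_derive_jac.
    apply: (is_derive_comp_scalar oW2 (Ck_derive _ (CF 2)) Wp).
    exact: (Ck_derivable _ (sphi 1)).
  rewrite big_split /= addrC (derive_rV ('D_v ('D_v phi) y) oW2 (CF 1) Wp).
  congr (_ + _); rewrite (second_derive sG2 CF Wp) exchange_big; apply: eq_bigr => j _.
  rewrite (derive_rV _ oW2 (Ck_derive _ (CF 2)) Wp) mulr_sumr.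
  by apply: eq_bigr => i _; rewrite mulrA [X in X * _]mulrC.
rewrite /chess h2; have [_ ->] := h1 y (gam2 G1 y v v) Wy.
rewrite -/(jac phi y (gam2 G1 y v v)) (christoffel_change v v Wy).
rewrite -/(jac phi y v) -/(jac2 phi y v v).
have dD a b : 'D_(a + b) F (phi y) = 'D_a F (phi y) + 'D_b F (phi y).
  rewrite !(derive_rV _ oW2 (CF 1) Wp) -big_split; apply: eq_bigr => i _.
  by rewrite mxE mulrDl.
by rewrite dD opprD addrA addrK.
Qed.

(** An isometry carries an orthonormal frame to an orthonormal frame, so both Laplacians are sums of
    the same covariant Hessians. *)
Lemma local_laplacian_change F y : smooth_on W2 F -> W1 y ->
  local_laplacian G1 (fun z => F (phi z)) y = local_laplacian G2 F (phi y).
Proof.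
move=> CF Wy; have Wp := phiW Wy.
have pG1 : posdef (G1 y) by case: sG1 => _ _; apply.
have [_ _ /(_ _ pG1)[E [EE _]]] := @cholesky R n.
have CFp : smooth_on W1 (fun z => F (phi z)).
  by move=> k; exact: (Ck_comp oW1 oW2 phiW (CF k) (sphi k)).
rewrite (laplacian_trace sG1 CFp Wy EE).
pose E2 := \matrix_k jac phi y (row k E).
have EE2 : E2 *m G2 (phi y) *m E2^T = 1%:M.
  apply/matrixP => i j.
  have -> : (E2 *m G2 (phi y) *m E2^T) i j = mform (G2 (phi y)) (row i E2) (row j E2).
    by rewrite /mform -row_mul tr_row -[RHS]/((row i _ *m col j _) 0 0) !mxE;
      apply: eq_bigr => k _; rewrite !mxE.
  rewrite !rowK -[LHS](iso Wy) -EE.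
  by rewrite /mform -row_mul tr_row -[LHS]/((row i _ *m col j _) 0 0) !mxE;
    apply: eq_bigr => k _; rewrite !mxE.
rewrite (laplacian_trace sG2 CF Wp EE2); apply: eq_bigr => k _.
by rewrite (chess_change _ CF Wy) rowK.
Qed.

Lemma local_grad_change F y : smooth_on W2 F -> W1 y ->
  'D_(local_grad G1 (fun z => F (phi z)) y) phi y = local_grad G2 F (phi y).
Proof.
move=> CF Wy; have Wp := phiW Wy.
have CFp : smooth_on W1 (fun z => F (phi z)).
  by move=> k; exact: (Ck_comp oW1 oW2 phiW (CF k) (sphi k)).
apply: (mform_inj sG2 Wp) => w'; have [w <-] := jac_surj w' Wy.
rewrite -iso// (local_gradE sG1 CFp Wy) (local_gradE sG2 CF Wp).
have [_ ->] := is_derive_comp_scalar (v := w) oW2 (CF 1) Wp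
   (Ck_derivable w (sphi 1) Wy).
by [].
Qed.

End Isometry.
End Coordinates.

(** * Charts and curves *)

Section RealCurves.
Context {R : realType}.

Lemma is_derive_cont (W : normedModType R) (f : R -> W) (t : R) d :
  is_derive t (1 : R) f d -> {for t, continuous f}.
Proof. by move=> [h _]; apply: differentiable_continuous; exact/derivable1_diffP. Qed.

Lemma C1_real (U : set R) (f df : R -> R) : open U ->
  (forall t, U t -> is_derive t (1 : R) f (df t)) ->
  (forall t, U t -> {for t, continuous df}) -> Ck_on 1 U f.
Proof.
move=> oU d c; have dv v t : U t -> is_derive t v f (v * df t).
  move=> Ut; have [h1 h2] := d t Ut; have := is_derive_scale v h1.
  by rewrite [v *: (1 : R)]mulr1 h2.
split; first by move=> t /d; exact: is_derive_cont.
move=> v; split; first by move=> t /(dv v)[].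
apply: (@Ck_ext _ _ _ _ _ (fun t => v * df t)) => //.
  by move=> t /(dv v)[_ ->].
by split=> // t Ut; apply: continuousM; [exact: cst_continuous|exact: c].
Qed.

Lemma C1_curve_real m n (U : set R) (f df : R -> 'M[R]_(m, n)) : open U ->
  (forall t, U t -> is_derive t (1 : R) f (df t)) ->
  (forall t, U t -> {for t, continuous df}) -> Ck_on 1 U f.
Proof.
move=> oU d c; apply: Ck_mx => // i j.
apply: (@C1_real _ _ (fun t => df t i j)) => //.
  by move=> t /d; exact: is_derive_entry.
by move=> t /c /cvg_mxP; apply.
Qed.

Lemma Ck1_affine (W : normedModType R) (U : set R) (f : R -> W) (c e : R) :
  Ck_on 1 U f -> Ck_on 1 [set s | U (c + e * s)] (fun s => f (c + e * s)).
Proof.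
move=> Cf; have cont : continuous (fun s : R => c + e * s).
  move=> s; apply: continuousD; first exact: cst_continuous.
  by apply: continuousM; [exact: cst_continuous|exact: id].
have cc (h : R -> W) : (forall s, U s -> {for s, continuous h}) ->
    forall s, U (c + e * s) -> {for s, continuous (fun s => h (c + e * s))}.
  by move=> ch s Us; apply: (@continuous_comp _ _ _ _ h); [exact: cont|exact: ch].
have E v s : (fun h : R => h^-1 *: (((fun s => f (c + e * s)) \o shift s) (h *: v)
     - f (c + e * s))) =
    (fun h : R => h^-1 *: ((f \o shift (c + e * s)) (h *: (e * v)) - f (c + e * s))).
  apply/funext => h /=; congr (_ *: (f _ - _)).
  by rewrite /GRing.scale /=; ring.
split; first by apply: cc => s Us; exact: (Ck_continuous Cf).
move=> v; split; first by move=> s Us; rewrite /derivable E; exact: (Ck_derivable (e * v) Cf Us).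
have -> : 'D_v (fun s => f (c + e * s)) = (fun s => 'D_(e * v) f (c + e * s)).
  by apply/funext => s; rewrite /derive E.
split=> //; exact: (cc _ (fun s Us => Ck_continuous (Ck_derive (e * v) Cf) Us)).
Qed.

Lemma derive_affine (W : normedModType R) (f : R -> W) (c e s : R) :
  'D_1 (fun s => f (c + e * s)) s = 'D_e f (c + e * s).
Proof.
rewrite /derive; set F := fun h : R => _; set G := (X in _ = lim (X @ _)).
have -> // : F = G; apply/funext => h; rewrite /F /G /=; congr (_ *: (f _ - _)).
by rewrite /GRing.scale /=; ring.
Qed.

Lemma derive_real (m n : nat) (f : R -> 'M[R]_(m, n)) (e s : R) : derivable f s 1 ->
  'D_e f s = e *: 'D_1 f s.
Proof.
move=> df; have dij i j := (derivable_mxP f s 1).1 df i j.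
have de : derivable f s e.
  apply/derivable_mxP => i j; have [] := is_derive_scale e (dij i j).
  by rewrite [e *: (1 : R)]mulr1.
apply/matrixP => i j; rewrite mxE -!derive_coord//.
by have [_] := is_derive_scale e (dij i j); rewrite [e *: (1 : R)]mulr1 => ->.
Qed.

Lemma is_derive_affine (F : R -> R) (c e s d : R) : is_derive (c + e * s) (1 : R) F d ->
  is_derive s (1 : R) (fun s => F (c + e * s)) (e * d).
Proof.
move=> dF; have h : is_derive s (1 : R) (fun s : R => c + e * s) e.
  have := is_deriveD (is_derive_cst c s (1 : R))
    (is_derive_mulr (is_derive_cst e s (1 : R)) (is_derive_id s (1 : R))).
  by rewrite mul0r add0r mulr1 add0r.
by have := @is_derive1_comp R F (fun s : R => c + e * s) s d e dF h; rewrite mulrC.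
Qed.

Lemma ler_derive01 (f df : R -> R) :
  (forall t : R, 0 <= t <= 1 -> is_derive t (1 : R) f (df t)) ->
  (forall t : R, 0 <= t <= 1 -> df t <= 0) -> f 1 <= f 0.
Proof.
move=> d h; have [|||c] := @MVT_segment R f df 0 1.
- exact: ler01.
- by move=> t; rewrite in_itv /= => /andP[? ?]; apply: d; rewrite !ltW.
- apply: continuous_in_subspaceT => t; rewrite inE /= in_itv /= => /d.
  exact: is_derive_cont.
rewrite in_itv /= subr0 mulr1 => /h c0 E.
by rewrite -subr_le0 E.
Qed.

(** Integration starts at -1, which makes 0 an interior point: the derivative is two-sided on the
    whole of [0, 1]. *)
Lemma antiderivative (k : R -> R) : continuous k ->
  exists S : R -> R, forall x : R, -1 < x -> is_derive x (1 : R) S (k x).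
Proof.
move=> ck; exists (fun x => \int[lebesgue_measure]_(t in `[-1, x]) k t)%R => x x1.
have xu : x < x + 1 by rewrite ltrDl.
have ik : lebesgue_measure.-integrable `[-1, x + 1] (EFin \o k).
  apply: continuous_compact_integrable; first exact: segment_compact.
  exact: continuous_subspaceT.
have [d1 d2] := continuous_FTC1_closed xu ik x1 (ck x).
by split; [exact: d1 | rewrite -derive1E].
Qed.

Lemma integral_antiderivative (k S : R -> R) : {within `[0, 1], continuous k} ->
  (forall x : R, 0 <= x <= 1 -> is_derive x (1 : R) S (k x)) ->
  (\int[lebesgue_measure]_(t in `[0%R, 1%R]) (k t)%:E)%E = (S 1 - S 0)%:E.
Proof.
move=> ck d; rewrite (@continuous_FTC2 _ k S 0 1)//.
- split.
  + by move=> x; rewrite in_itv /= => /andP[? ?]; have [] := d x; rewrite // !ltW.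
  + by apply: cvg_at_right_filter; apply: (is_derive_cont (d 0 _)); rewrite lexx ler01.
  + by apply: cvg_at_left_filter; apply: (is_derive_cont (d 1 _)); rewrite lexx ler01.
- move=> x; rewrite in_itv /= => /andP[? ?]; rewrite derive1E.
  by have [|_ ->] := d x; first by rewrite !ltW.
Qed.

(** Curves are regular on [0, 1] only. Precomposing the speed with this retraction gives a function
    continuous on the whole line, to which the fundamental theorem of calculus applies without
    boundary cases. *)
Definition clamp (t : R) : R := if t < 0 then 0 else if 1 < t then 1 else t.

Lemma clamp01 t : 0 <= clamp t <= 1.
Proof.
rewrite /clamp; case: ltrP => h0; first by rewrite lexx ler01.
by case: ltrP => h1; rewrite ?ler01 ?lexx// h0.
Qed.

Lemma clamp_id t : 0 <= t <= 1 -> clamp t = t.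
Proof. by move=> /andP[t0 t1]; rewrite /clamp !ltNge t0 t1. Qed.

Lemma clamp_dist t s : `|clamp t - clamp s| <= `|t - s|.
Proof.
have cl (x : R) : [\/ x < 0 /\ clamp x = 0, 1 < x /\ clamp x = 1 |
    0 <= x <= 1 /\ clamp x = x].
  rewrite /clamp; have [h0|h0] := ltrP x 0; first by constructor 1.
  by have [h1|h1] := ltrP 1 x; [constructor 2|constructor 3].
have n1 := ler_norm (t - s); have n2 := ler_norm (- (t - s)).
rewrite normrN in n2; move: (`|t - s|) n1 n2 => N n1 n2; rewrite ler_norml.
have n0 : 0 <= N by lra.
by case: (cl t) => -[h1 ->]; case: (cl s) => -[h2 ->]; apply/andP; split; lra.
Qed.

Lemma clamp_continuous : continuous clamp.
Proof.
move=> t; apply/cvgrPdist_lt => e e0; near=> s.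
apply: le_lt_trans (clamp_dist _ _) _.
by near: s; apply: cvgr_dist_lt.
Unshelve. all: end_near. Qed.

Lemma continuous_near_eq (T U : topologicalType) (f h : T -> U) x :
  (\near x, f x = h x) -> {for x, continuous f} -> {for x, continuous h}.
Proof.
move=> fh cf; rewrite /prop_for /continuous_at -(nbhs_singleton fh).
by apply: cvg_trans cf; apply: near_eq_cvg; apply: filterS fh => y ->.
Qed.

Lemma cvg_mform (T : Type) (F : set_system T) (FF : ProperFilter F) n
    (G : T -> 'M[R]_n) (u v : T -> 'rV[R]_n) G0 u0 v0 :
  G x @[x --> F] --> G0 -> u x @[x --> F] --> u0 -> v x @[x --> F] --> v0 ->
  mform (G x) (u x) (v x) @[x --> F] --> mform G0 u0 v0.
Proof.
move=> /cvg_mxP cG /cvg_mxP cu /cvg_mxP cv; under eq_fun do rewrite mformE.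
rewrite mformE; apply: cvg_sumr => i; apply: cvg_sumr => j.
by apply: cvgM; [apply: cvgM; [exact: cu|exact: cG]|exact: cv].
Qed.

Lemma continuous_mform (T : topologicalType) n (G : T -> 'M[R]_n)
    (u v : T -> 'rV[R]_n) x : {for x, continuous G} -> {for x, continuous u} ->
  {for x, continuous v} -> {for x, continuous (fun y => mform (G y) (u y) (v y))}.
Proof. by move=> a b c; exact: (cvg_mform (nbhs_pfilter x) a b c). Qed.

End RealCurves.

Section Charts.
Context {R : realType} {n : nat} {M : topologicalType} (g : riemannian R n M).
Implicit Types (p q x z : M).

Definition cod z := chart g z @` chart_dom g z.
Definition overlap p q := [set y | cod p y /\ chart_dom g q (chart_inv g p y)].
Definition trans p q := chart g q \o chart_inv g p.

Lemma open_cod z : open (cod z). Proof. exact: chart_cod_open. Qed.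

Lemma cod_chart z x : chart_dom g z x -> cod z (chart g z x).
Proof. by move=> h; exists x. Qed.

Lemma chart_invP z y : cod z y -> chart_dom g z (chart_inv g z y).
Proof. by move=> [x zx <-]; rewrite chartK. Qed.

Lemma chart_invK z y : cod z y -> chart g z (chart_inv g z y) = y.
Proof. by move=> [x zx <-]; rewrite chartK. Qed.

Lemma overlapE p q : overlap p q = chart g p @` (chart_dom g p `&` chart_dom g q).
Proof.
apply/seteqP; split=> [y [[x px <-]]|y [x [px qx] <-]].
  by rewrite chartK// => qx; exists x.
by split; [exact: cod_chart|rewrite chartK].
Qed.

Lemma open_overlap p q : open (overlap p q).
Proof.
rewrite openE => y [py qy]; rewrite /interior.
apply: filterI; first by apply: open_nbhs_nbhs; split=> //; exact: open_cod.
have := chart_inv_continuous py; apply.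
by apply: open_nbhs_nbhs; split=> //; exact: chart_dom_open.
Qed.

Arguments open_overlap : clear implicits.

Lemma overlap_chart p q x : chart_dom g p x -> chart_dom g q x ->
  overlap p q (chart g p x).
Proof. by move=> px qx; split; [exact: cod_chart|rewrite chartK]. Qed.

Lemma trans_smooth p q : smooth_on (overlap p q) (trans p q).
Proof. by rewrite overlapE; exact: transition_smooth. Qed.

Lemma trans_cod p q y : overlap p q y -> cod q (trans p q y).
Proof. by move=> [py qy]; exact: cod_chart. Qed.

Lemma trans_chart p q x : chart_dom g p x -> trans p q (chart g p x) = chart g q x.
Proof. by move=> px; rewrite /trans /= chartK. Qed.

Lemma metric_posdefP z y : cod z y -> posdef (metric g z y).
Proof.
move=> h; have E : (metric g z y)^T = metric g z y := @Defs.metric_sym _ _ _ g z y h.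
by split; [exact: E|move=> v; exact: (@metric_posdef _ _ _ g z y h)].
Qed.

Lemma smooth_metric_cod z : smooth_metric (cod z) (metric g z).
Proof. by split; [exact: open_cod|exact: metric_smooth|exact: metric_posdefP]. Qed.

Lemma smooth_metric_sub z (W : set 'rV[R]_n) : open W -> W `<=` cod z ->
  smooth_metric W (metric g z).
Proof.
move=> oW sW; split=> //; first by move=> k; exact: Ck_sub (metric_smooth g z k).
by move=> y /sW; exact: metric_posdefP.
Qed.

Lemma trans_iso p q y : overlap p q y -> forall v w,
  mform (metric g p y) v w =
  mform (metric g q (trans p q y)) (jac (trans p q) y v) (jac (trans p q) y w).
Proof.
move=> [py qy] v w; have := metric_transition (chart_invP py) qy v w.
by rewrite chart_invK.
Qed.

Section InChart.
Variables (p x : M) (f : M -> R) (W : set 'rV[R]_n).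
Hypothesis px : chart_dom g p x.
Hypothesis oW : open W.
Hypothesis Wp : W `<=` cod p.
Hypothesis Wx : W (chart g p x).
Hypothesis Cf : smooth_on W (f \o chart_inv g p).

Let W1 := [set y | overlap x p y /\ W (trans x p y)].
Let oW1 : open W1.
Proof.
rewrite openE => y [oy Wy]; rewrite /interior; apply: filterI.
  by apply: open_nbhs_nbhs; split=> //; exact: open_overlap.
apply: (Ck_continuous (trans_smooth x p 0) oy).
by apply: open_nbhs_nbhs.
Qed.
Let W1x : W1 (chart g x x).
Proof.
split; first by apply: overlap_chart => //; exact: chart_dom_center.
by rewrite trans_chart//; exact: chart_dom_center.
Qed.
Let s1 : smooth_metric W1 (metric g x).
Proof. by apply: smooth_metric_sub => // y [[]]. Qed.
Let s2 : smooth_metric W (metric g p).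
Proof. exact: smooth_metric_sub. Qed.
Let sphi : smooth_on W1 (trans x p).
Proof. by move=> k; apply: Ck_sub (trans_smooth x p k) => y []. Qed.
Let phiW y : W1 y -> W (trans x p y). Proof. by case. Qed.
Let isoW y : W1 y -> forall v w, mform (metric g x y) v w =
  mform (metric g p (trans x p y)) ('D_v (trans x p) y) ('D_w (trans x p) y).
Proof. by move=> [oy _] v w; exact: trans_iso. Qed.
Let fE y : W1 y -> (f \o chart_inv g p) (trans x p y) = (f \o chart_inv g x) y.
Proof. by move=> [[xy py] _]; rewrite /trans /= chartK. Qed.

Lemma laplacian_chart :
  laplacian g f x = local_laplacian (metric g p) (f \o chart_inv g p) (chart g p x).
Proof.
rewrite /laplacian -(eq_local_laplacian s1 W1x fE).
rewrite (local_laplacian_change s1 s2 sphi phiW isoW Cf W1x).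
by rewrite trans_chart//; exact: chart_dom_center.
Qed.

Lemma norm_grad_chart : norm g x (grad g f x) ^+ 2 =
  let X := local_grad (metric g p) (f \o chart_inv g p) (chart g p x) in
  mform (metric g p (chart g p x)) X X.
Proof.
have cx : cod x (chart g x x) by apply: cod_chart; exact: chart_dom_center.
rewrite /norm sqr_sqrtr; last exact: (posdef_ge0 _ (metric_posdefP cx)).
rewrite /inner -/(mform _ _ _) /grad -(eq_local_grad s1 fE W1x).
rewrite -[LHS]/(mform (metric g x (chart g x x)) _ _) (isoW W1x).
rewrite (local_grad_change s1 s2 sphi phiW isoW Cf W1x).
by rewrite trans_chart//; exact: chart_dom_center.
Qed.
End InChart.

Section Speed.
Variable gam : R -> M.
Hypothesis Cgam : C1_curve g gam.

Definition speed t : R := norm g (gam t) (velocity g gam t).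

(** [C1_curve] speaks of the chart centered at the point of the curve; smoothness of the transition
    maps carries the regularity to any other chart around that point. *)
Lemma C1_local (t : R) z : 0 <= t <= 1 -> chart_dom g z (gam t) ->
  exists U : set R, [/\ open U, U t, Ck_on 1 U (chart g z \o gam) &
    forall s, U s -> chart_dom g z (gam s)].
Proof.
move=> t01 zt; have [ct [U0 [oU0 U0t CU0]]] := Cgam t01.
have N : nbhs t (gam @^-1` (chart_dom g z `&` chart_dom g (gam t))).
  apply: ct; apply: open_nbhs_nbhs; split; first by apply: openI; exact: chart_dom_open.
  by split=> //; exact: chart_dom_center.
pose U := U0 `&` (gam @^-1` (chart_dom g z `&` chart_dom g (gam t)))°.
have oU : open U by apply: openI => //; exact: open_interior.
have US s : U s -> chart_dom g z (gam s) /\ chart_dom g (gam t) (gam s).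
  by move=> [_ /interior_subset].
exists U; split; [exact: oU|by split|idtac|by move=> s /US[]].
apply: (@Ck_ext _ _ _ _ _ (fun s => trans (gam t) z ((chart g (gam t) \o gam) s)) _ oU).
  by move=> s /US[_ ts]; exact: trans_chart.
apply: (Ck_comp_mx oU (open_overlap (gam t) z) _ (trans_smooth _ _ 1)).
  by move=> s /US[zs ts]; exact: overlap_chart.
by apply: Ck_sub CU0 => s [].
Qed.

Lemma speed_chart (t : R) z : 0 <= t <= 1 -> chart_dom g z (gam t) ->
  let D := 'D_1 (chart g z \o gam) t in
  speed t = Num.sqrt (mform (metric g z (chart g z (gam t))) D D).
Proof.
move=> t01 zt D; have [U [oU Ut CU US]] := C1_local t01 zt.
have oy : overlap z (gam t) (chart g z (gam t)).
  by apply: overlap_chart => //; exact: chart_dom_center.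
have vE : velocity g gam t = jac (trans z (gam t)) (chart g z (gam t)) D.
  rewrite /velocity derive1E.
  rewrite -(derive_on_ext (f := fun s => trans z (gam t) ((chart g z \o gam) s)) _ oU _ Ut).2.
    have [_ ->] := is_derive_comp (open_overlap z (gam t)) (trans_smooth _ _ 1) oy
       (Ck_derivable (1 : R) CU Ut).
    by [].
  by move=> s /US zs; exact: trans_chart.
rewrite /speed /norm vE (trans_iso oy) trans_chart//.
Qed.

(** The chart in which the velocity is read changes with the point, so continuity is not visible on
    the definition. Near [t] the speed is expressed in the fixed chart at [gam (clamp t)]. *)
Lemma speed_clamp_continuous : continuous (fun t => speed (clamp t)).
Proof.
move=> t; set t0 := clamp t; pose z := gam t0.
have zt : chart_dom g z (gam t0) by exact: chart_dom_center.
have [U [oU Ut CU US]] := C1_local (clamp01 t) zt.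
pose f s := Num.sqrt (mform (metric g z (chart g z (gam s)))
   ('D_1 (chart g z \o gam) s) ('D_1 (chart g z \o gam) s)).
have cf : {for t0, continuous f}.
  apply: (@continuous_comp _ _ _ _ Num.sqrt); last exact: sqrt_continuous.
  apply: continuous_mform.
  - apply: (@continuous_comp _ _ _ (chart g z \o gam) (metric g z)).
      exact: (Ck_continuous CU).
    by apply: (Ck_continuous (metric_smooth g z 0)); exact: cod_chart.
  - exact: (Ck_continuous (Ck_derive (1 : R) CU) Ut).
  - exact: (Ck_continuous (Ck_derive (1 : R) CU) Ut).
have cc : {for t, continuous (fun s => f (clamp s))}.
  by apply: (@continuous_comp _ _ _ clamp f); [exact: clamp_continuous|exact: cf].
have fE s : U (clamp s) -> f (clamp s) = speed (clamp s).
  by move=> /US h; rewrite (speed_chart (clamp01 s) h).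
apply: (continuous_near_eq (f := fun s => f (clamp s))) cc.
have : nbhs t (clamp @^-1` U) by apply: clamp_continuous; exact: open_nbhs_nbhs.
by apply: filterS => s; exact: fE.
Qed.

Lemma speed_ge0 t : 0 <= speed t. Proof. exact: sqrtr_ge0. Qed.

Lemma curve_lengthE (S : R -> R) :
  (forall t : R, 0 <= t <= 1 -> is_derive t (1 : R) S (speed t)) ->
  curve_length g gam = (S 1 - S 0)%:E.
Proof.
move=> dS.
have H : (\int[lebesgue_measure]_(t in `[0%R, 1%R]) (speed (clamp t))%:E)%E
    = (S 1 - S 0)%:E.
  have h1 : {within `[0, 1], continuous (fun t => speed (clamp t))}.
    by apply: continuous_subspaceT; exact: speed_clamp_continuous.
  have h2 (t : R) : 0 <= t <= 1 -> is_derive t (1 : R) S (speed (clamp t)).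
    by move=> t01; rewrite clamp_id//; exact: dS.
  exact: (integral_antiderivative h1 h2).
refine (etrans _ H); apply: eq_integral => t; rewrite inE /= in_itv /= => t01.
by rewrite clamp_id.
Qed.

Lemma arclength : exists S : R -> R,
  (forall t : R, -1 < t -> is_derive t (1 : R) S (speed (clamp t))) /\
  curve_length g gam = (S 1 - S 0)%:E.
Proof.
have [S dS] := antiderivative speed_clamp_continuous; exists S; split=> //.
apply: curve_lengthE => t t01; rewrite -[in X in is_derive _ _ _ X](clamp_id t01).
by apply: dS; case/andP: t01 => t0 _; apply: lt_le_trans t0; rewrite ltrN10.
Qed.

Lemma C1_curve_affine (c e : R) : 0 <= c <= 1 -> 0 <= c + e <= 1 ->
  C1_curve g (fun s => gam (c + e * s)) /\
  forall s : R, 0 <= s <= 1 ->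
    norm g (gam (c + e * s)) (velocity g (fun s => gam (c + e * s)) s) =
    `|e| * speed (c + e * s).
Proof.
move=> c01 ce01; have aff s : 0 <= s <= 1 -> 0 <= c + e * s <= 1.
  by move=> ?; nra.
have cont : continuous (fun s : R => c + e * s).
  move=> s; apply: continuousD; first exact: cst_continuous.
  by apply: continuousM; [exact: cst_continuous|exact: id].
split=> s s01.
  have [ct [U [oU Ut CU]]] := Cgam (aff s s01); split.
    by apply: (@continuous_comp _ _ _ _ gam); [exact: cont|exact: ct].
  exists [set s | U (c + e * s)]; split; [idtac|exact: Ut|exact: (Ck1_affine c e CU)].
  by apply: open_comp => // x _; exact: cont.
have [ct [U [oU Ut CU]]] := Cgam (aff s s01).
have -> : velocity g (fun s => gam (c + e * s)) s = e *: velocity g gam (c + e * s).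
  rewrite /velocity !derive1E.
  rewrite -[LHS]/('D_1 (fun s' => (chart g (gam (c + e * s)) \o gam) (c + e * s')) s).
  by rewrite derive_affine derive_real//; exact: (Ck_derivable (1 : R) CU Ut).
rewrite /speed /norm /inner -!/(mform _ _ _).
rewrite -[X in Num.sqrt X]/(mform _ _ _) mformZl mformZr mulrA -expr2.
by rewrite sqrtrM ?sqr_ge0// sqrtr_sqr.
Qed.

End Speed.
End Charts.
Arguments open_overlap {R n M g} p q.

(** * The Riemannian distance *)

Section RealLemmas.
Context {R : realType}.

(** A supremum argument on the set of times [t] with [f 0 <= f t]. It replaces the mean value
    theorem where [f] has no derivative but only local inequalities at each point. *)
Lemma local_mono (f : R -> R) :
  (forall t : R, 0 <= t <= 1 -> exists2 d, 0 < d & forall s, 0 <= s <= 1 ->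
     `|s - t| < d -> (t <= s -> f t <= f s) /\ (s <= t -> f s <= f t)) ->
  f 0 <= f 1.
Proof.
move=> H; pose A := [set t : R | 0 <= t <= 1 /\ f 0 <= f t].
have A0 : A 0 by split=> //; apply/andP; split; lra.
have hA : has_sup A by split; [exists 0|exists 1 => t [/andP[]]].
pose c := sup A.
have c1 : c <= 1 by apply: ge_sup; [exists 0|move=> t [/andP[]]].
have c0 : 0 <= c by exact: sup_upper_bound hA _ A0.
have c01 : 0 <= c <= 1 by rewrite c0 c1.
have [d d0 Hd] := H c c01.
have [a [a01 fa] ca] := sup_adherent d0 hA; rewrite -/c in ca.
have ac : a <= c by exact: sup_upper_bound hA _ (conj a01 fa).
have fc : f 0 <= f c.
  have [|_ +] := Hd a a01; first by rewrite ler0_norm ?subr_le0// opprB; lra.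
  by move=> /(_ ac); exact: le_trans.
have [<-//|cn1] := eqVneq c 1.
have cl1 : c < 1 by rewrite lt_neqAle cn1.
pose s := Num.min 1 (c + d / 2).
have sc : c < s by rewrite lt_min cl1 ltrDl divr_gt0.
have s1 : s <= 1 by rewrite ge_min lexx.
have sd : s <= c + d / 2 by rewrite ge_min lexx orbT.
have s01 : 0 <= s <= 1 by rewrite s1 andbT; lra.
have [|+ _] := Hd s s01; first by rewrite gtr0_norm ?subr_gt0//; lra.
move=> /(_ (ltW sc)) fs; have : s <= c.
  exact: sup_upper_bound hA _ (conj s01 (le_trans fc fs)).
by rewrite leNgt sc.
Qed.

Lemma antiderivative_near (k S : R -> R) (t e : R) : continuous k ->
  (forall x : R, -1 < x -> is_derive x (1 : R) S (k x)) -> 0 <= t -> 0 < e ->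
  \forall s \near t, 0 <= s -> `|S s - S t - k t * (s - t)| <= e * `|s - t|.
Proof.
move=> ck dS t0 e0; have /cvgrPdist_lt/(_ _ e0)/nbhs_ballP[d /= d0 Hd] := ck t.
apply/nbhs_ballP; exists d => // s ts s0.
have key (a b : R) : 0 <= a -> a <= b ->
    exists2 c, a <= c <= b & S b - S a = k c * (b - a).
  move=> a0 ab; have [|||c] := @MVT_segment R S k a b.
  - exact: ab.
  - by move=> x; rewrite in_itv /= => /andP[? ?]; apply: dS; lra.
  - apply: continuous_in_subspaceT => x; rewrite inE /= in_itv /= => /andP[? ?].
    by apply: is_derive_cont; apply: dS; lra.
  by rewrite in_itv /= => hc E; exists c.
have fin c : ball t d c -> S s - S t = k c * (s - t) ->
    `|S s - S t - k t * (s - t)| <= e * `|s - t|.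
  move=> /Hd h ->; rewrite -mulrBl normrM ler_wpM2r// distrC; exact: ltW.
move: ts; rewrite -ball_normE /= => ts.
have [st|ts'] := leP t s.
  have [c /andP[tc cs] E] := key t s t0 st; apply: (fin c) => //.
  rewrite -ball_normE /=; move: ts; rewrite !ler0_norm ?subr_le0// !opprB.
  by move=> h; apply: le_lt_trans h; rewrite lerD2r.
have [c /andP[sc ct] E] := key s t s0 (ltW ts'); apply: (fin c).
  rewrite -ball_normE /=; move: ts; rewrite !ger0_norm ?subr_ge0// ?(ltW ts')//.
  by move=> h; apply: le_lt_trans h; rewrite lerD2l lerN2.
by rewrite -[LHS]opprB E -mulrN opprB.
Qed.

End RealLemmas.

Section Distance.
Context {R : realType} {n : nat} {M : topologicalType} (g : riemannian R n M).
Implicit Types (p q x z : M).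

Lemma arclength_mono (gam : R -> M) (S : R -> R) (s t : R) :
  (forall t : R, -1 < t -> is_derive t (1 : R) S (speed g gam (clamp t))) ->
  0 <= s -> s <= t -> S s <= S t.
Proof.
move=> dS s0 st; have [|||c] := @MVT_segment R S (fun t => speed g gam (clamp t)) s t.
- exact: st.
- by move=> x; rewrite in_itv /= => /andP[? ?]; apply: dS; lra.
- apply: continuous_in_subspaceT => x; rewrite inE /= in_itv /= => /andP[? ?].
  by apply: is_derive_cont; apply: dS; lra.
by move=> _ E; rewrite -subr_ge0 E mulr_ge0 ?subr_ge0// speed_ge0.
Qed.

Lemma curve_length_fin (gam : R -> M) : C1_curve g gam ->
  exists2 l : R, 0 <= l & curve_length g gam = l%:E.
Proof.
move=> Cg; have [S [dS ->]] := arclength Cg; exists (S 1 - S 0) => //.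
rewrite subr_ge0; exact: (arclength_mono dS (lexx 0) ler01).
Qed.

Definition path p q (l : R) := joined_by g p q l%:E.

(** The lengths in [joined_by] are extended reals, but each piece has finite length; this is the
    induction principle with real lengths. *)
Lemma path_ind (P : M -> M -> R -> Prop) :
  (forall p, P p p 0) ->
  (forall gam q (a l : R), C1_curve g gam -> 0 <= a -> curve_length g gam = a%:E ->
     path (gam 1) q l -> P (gam 1) q l -> P (gam 0) q (a + l)) ->
  forall p q l, path p q l -> P p q l.
Proof.
move=> P0 PS p q l pl.
suff : forall L, joined_by g p q L -> exists2 l : R, L = l%:E & path p q l /\ P p q l.
  by move=> /(_ _ pl)[l' [<-] []].
move=> L; elim=> {p q l pl L} [p|gam q L Cg J [l -> [pl Pl]]].
  by exists 0 => //; split=> //; exact: joined_refl.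
have [a a0 ga] := curve_length_fin Cg.
exists (a + l); first by rewrite ga -EFinD.
split; last exact: PS.
by rewrite /path EFinD -ga; apply: joined_step.
Qed.

Lemma joined_fin p q L : joined_by g p q L -> exists2 l : R, L = l%:E & path p q l.
Proof.
elim=> {p q L} [p|gam q L Cg J [l -> pl]].
  by exists 0 => //; exact: joined_refl.
have [a a0 ga] := curve_length_fin Cg.
exists (a + l); first by rewrite ga -EFinD.
by rewrite /path EFinD -ga; apply: joined_step.
Qed.

Lemma path_ge0 p q l : path p q l -> 0 <= l.
Proof.
by move: p q l; apply: path_ind => // gam q a l _ a0 _ _ l0; rewrite addr_ge0.
Qed.

Lemma path_refl p : path p p 0. Proof. exact: joined_refl. Qed.

Lemma path_curve gam (l : R) : C1_curve g gam -> curve_length g gam = l%:E ->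
  path (gam 0) (gam 1) l.
Proof.
move=> Cg gl; rewrite /path -[l]addr0 EFinD -gl; apply: joined_step => //.
exact: path_refl.
Qed.

Lemma path_trans q p r a b : path p q a -> path q r b -> path p r (a + b).
Proof.
move=> pa; move: p q a pa r b; apply: path_ind => [p r b|]; first by rewrite add0r.
move=> gam q a l Cg a0 ga _ IH r b qb; rewrite -addrA /path EFinD -ga.
by apply: joined_step => //; exact: IH.
Qed.

(** A negative [e] is allowed and traverses the arc backwards; the sign turns the increment of
    arclength into a length. Both cutting a curve and reversing it are instances. *)
Lemma subcurve (gam : R -> M) (S : R -> R) (c e : R) : C1_curve g gam ->
  0 <= c <= 1 -> 0 <= c + e <= 1 ->
  (forall t : R, -1 < t -> is_derive t (1 : R) S (speed g gam (clamp t))) ->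
  path (gam c) (gam (c + e)) (Num.sg e * (S (c + e) - S c)).
Proof.
move=> Cg c01 ce01 dS; have [C1 sp] := C1_curve_affine Cg c01 ce01.
have E : curve_length g (fun s => gam (c + e * s)) =
    (Num.sg e * (S (c + e) - S c))%:E.
  have := @curve_lengthE R n M g _ C1 (fun s => Num.sg e * S (c + e * s)).
  rewrite mulr1 mulr0 addr0 -mulrBr; apply=> s s01.
  have cs : 0 <= c + e * s <= 1 by nra.
  have -> : speed g (fun s => gam (c + e * s)) s = Num.sg e * (e * speed g gam (c + e * s)).
    by rewrite {1}/speed sp// normrEsg mulrA.
  have h : is_derive s (1 : R) (fun s => S (c + e * s)) (e * speed g gam (c + e * s)).
    apply: is_derive_affine; rewrite -[in X in is_derive _ _ _ X](clamp_id cs).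
    by apply: dS; case/andP: cs; lra.
  by have := is_derive_mulr (is_derive_cst (Num.sg e) s (1 : R)) h; rewrite mul0r add0r.
have := path_curve C1 E.
by rewrite mulr0 addr0 mulr1.
Qed.

Lemma path_sym p q l : path p q l -> path q p l.
Proof.
move: p q l; apply: path_ind => [p|gam q a l Cg a0 ga _ ql]; first exact: path_refl.
rewrite addrC; apply: path_trans ql _.
have [S [dS]] := arclength Cg; rewrite ga => -[->].
have h1 : 0 <= (1 : R) <= 1 by apply/andP; split; lra.
have h2 : 0 <= 1 + (-1 : R) <= 1 by apply/andP; split; lra.
have := subcurve Cg h1 h2 dS.
by rewrite subrr sgrN sgr1 mulN1r opprB.
Qed.

(** Arclength is continuous, so the intermediate value theorem finds the cutting point inside the
    piece that contains it. *)
Lemma path_split p q l a : path p q l -> 0 <= a -> a <= l ->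
  exists w, path p w a /\ path w q (l - a).
Proof.
move=> pl; move: p q l pl a; apply: path_ind.
  move=> p a a0 a1; have -> : a = 0 by apply/eqP; rewrite eq_le a0 a1.
  by exists p; rewrite subr0; split; exact: path_refl.
move=> gam q b l Cg b0 gb ql IH a a0 abl.
have [ab|ba] := lerP a b; last first.
  have [||w [w1 w2]] := IH (a - b); [lra|lra|].
  exists w; split.
    have -> : a = b + (a - b) by lra.
    exact: path_trans (path_curve Cg gb) w1.
  by have -> : b + l - a = l - (a - b) by lra.
have [S [dS]] := arclength Cg; rewrite gb => -[bS].
have cS : {within `[0, 1], continuous S}.
  apply: continuous_in_subspaceT => x; rewrite inE /= in_itv /= => /andP[? ?].
  by apply: is_derive_cont; apply: dS; lra.
have [|c] := @IVT R S 0 1 (S 0 + a) ler01 cS.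
  have S01 : S 0 <= S 1 by rewrite -subr_ge0 -bS.
  by rewrite (min_l S01) (max_r S01); apply/andP; split; lra.
rewrite in_itv /= => c01 Sc.
have h0 : 0 <= (0 : R) <= 1 by apply/andP; split; lra.
have c01' : 0 <= 0 + c <= 1 by rewrite add0r.
have h1 : 0 <= c + (1 - c) <= 1 by apply/andP; split; lra.
have sg0 (e d : R) : 0 <= e -> (e = 0 -> d = 0) -> Num.sg e * d = d.
  rewrite le_eqVlt => /orP[/eqP <- ->//|e0 _]; first by rewrite mulr0.
  by rewrite gtr0_sg// mul1r.
exists (gam c); split.
  have := subcurve Cg h0 c01' dS; rewrite add0r sg0.
  - by rewrite Sc addrAC subrr add0r.
  - by case/andP: c01.
  - by move=> c0; rewrite c0 subrr.
have -> : b + l - a = (S 1 - S c) + l by rewrite Sc; lra.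
apply: path_trans ql; have := subcurve Cg c01 h1 dS; rewrite subrKC sg0//.
- by case/andP: c01 => ? ?; rewrite subr_ge0.
- by move=> /eqP; rewrite subr_eq0 => /eqP ->; rewrite subrr.
Qed.

(** The distance is handled through its real upper bounds: infinite distances then need no separate
    treatment, and the infimum need not be attained. *)
Definition wd p q (l : R) := (geodist g p q <= l%:E)%E.

Lemma path_wd p q l : path p q l -> wd p q l.
Proof. by move=> pl; apply: ereal_inf_lbound. Qed.

Lemma wd_path p q l e : wd p q l -> 0 < e -> exists2 l', l' < l + e & path p q l'.
Proof.
move=> h e0; have : (geodist g p q < (l + e)%:E)%E.
  by apply: le_lt_trans h _; rewrite lte_fin ltrDl.
move=> /ereal_inf_lt[L JL]; have [l' E pl] := joined_fin JL.
by rewrite E lte_fin => h'; exists l'.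
Qed.

Lemma wd_eps p q l : (forall e, 0 < e -> wd p q (l + e)) -> wd p q l.
Proof. by move=> H; apply/lee_addgt0Pr => e e0; exact: H. Qed.

Lemma wd_le p q l l' : l <= l' -> wd p q l -> wd p q l'.
Proof. by move=> ll h; apply: le_trans h _; rewrite lee_fin. Qed.

Lemma wd_ge0 p q l : wd p q l -> 0 <= l.
Proof.
move=> h; apply/ler_addgt0Pr => e e0; have [l' l1 /path_ge0 l0] := wd_path h e0.
by apply: ltW; exact: le_lt_trans l1.
Qed.

Lemma wd_refl p l : 0 <= l -> wd p p l.
Proof. by move=> l0; apply: wd_le l0 _; apply: path_wd; exact: path_refl. Qed.

Lemma wd_sym p q l : wd p q l -> wd q p l.
Proof.
move=> h; apply: wd_eps => e e0; have [l' l1 /path_sym pl] := wd_path h e0.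
exact: wd_le (ltW l1) (path_wd pl).
Qed.

Lemma wd_trans q p r a b : wd p q a -> wd q r b -> wd p r (a + b).
Proof.
move=> h1 h2; apply: wd_eps => e e0.
have e20 : 0 < e / 2 by rewrite divr_gt0.
have [l1 L1 p1] := wd_path h1 e20; have [l2 L2 p2] := wd_path h2 e20.
by apply: wd_le (path_wd (path_trans p1 p2)); lra.
Qed.

Lemma wd_split p q a b e : 0 <= a -> 0 <= b -> 0 < e -> wd p q (a + b) ->
  exists w, wd p w a /\ wd w q (b + e).
Proof.
move=> a0 b0 e0 h; have [l l1 pl] := wd_path h e0.
have [al|la] := lerP a l.
  have [w [w1 w2]] := path_split pl a0 al; exists w; split; first exact: path_wd.
  by apply: wd_le (path_wd w2); lra.
exists q; split; first by apply: wd_le (ltW la) (path_wd pl).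
by apply: wd_refl; lra.
Qed.

Lemma geoballE p r x : geoball g p r x <-> exists2 l, l < r & wd p x l.
Proof.
split=> [h|[l lr h]]; last by apply: le_lt_trans h _; rewrite lte_fin.
have [L JL Lr] := ereal_inf_lt h; have [l E pl] := joined_fin JL.
by exists l; [rewrite -lte_fin -E|exact: path_wd].
Qed.

(** An infinitesimal Lipschitz condition along curves, suited to functions that are not
    differentiable, such as a truncated coordinate norm. *)
Definition dini (L : R) (phi : M -> R) := forall gam, C1_curve g gam ->
  forall t : R, 0 <= t <= 1 -> forall e, 0 < e -> \forall s \near t, 0 <= s <= 1 ->
    `|phi (gam s) - phi (gam t)| <= (L * speed g gam t + e) * `|s - t|.

(** For each [e > 0] the function L S(t) + e t - phi(gam t), with [S] the arclength, satisfies the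
    local inequalities of [local_mono]; then [e] tends to 0. *)
Lemma dini_curve L phi gam (l : R) : dini L phi -> C1_curve g gam ->
  curve_length g gam = l%:E -> phi (gam 1) - phi (gam 0) <= L * l.
Proof.
move=> dphi Cg gl; have [S [dS]] := arclength Cg; rewrite gl => -[lE].
apply/ler_addgt0Pr => e e0.
pose f t := L * S t + e * t - phi (gam t).
have kc := speed_clamp_continuous Cg.
suff : f 0 <= f 1 by rewrite /f lE; move: (phi _) (phi _) => x y; lra.
apply: local_mono => t t01.
have e1 : 0 < e / 2 / (`|L| + 1) by rewrite !divr_gt0// ltr_wpDl.
have [e20 t0] : 0 < e / 2 /\ 0 <= t by rewrite divr_gt0//; case/andP: t01.
have N1 := antiderivative_near kc dS t0 e1.
have N2 := dphi gam Cg t t01 _ e20.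
have [d /= d0 Hd] := (nbhs_ballP _ _).1 (filterI N1 N2); exists d => // s s01 std.
have [|h1 h2] := Hd s; first by rewrite -ball_normE /= distrC.
have := h1 (andP s01).1; have := h2 s01; rewrite clamp_id// /f.
have LE : `|L| * (e / 2 / (`|L| + 1)) <= e / 2.
  rewrite mulrCA ler_piMr ?(ltW e20)// ler_pdivrMr ?ltr_wpDl// mul1r.
  by rewrite lerDl.
move: (e / 2 / _) LE (phi (gam s)) (phi (gam t)) (S s) (S t) (speed g gam t) => e' LE ps pt Ss St k.
have nL := normr_ge0 L.
move=> hp hS; have hLS : `|L * (Ss - St - k * (s - t))| <= e / 2 * `|s - t|.
  rewrite normrM; apply: le_trans (ler_wpM2l nL hS) _.
  by rewrite mulrA ler_wpM2r.
move: hp hLS; rewrite !ler_norml => /andP[p1 p2] /andP[q1 q2].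
by split=> st; [move: p2 q1|move: p1 q2];
  [rewrite ger0_norm ?subr_ge0//|rewrite ler0_norm ?subr_le0//];
  rewrite !mulrBr !mulrDl => ? ?; lra.
Qed.

Lemma dini_wd L phi p q l : 0 <= L -> dini L phi -> wd p q l ->
  `|phi p - phi q| <= L * l.
Proof.
move=> L0 dphi; suff H p' q' l' : path p' q' l' -> phi q' - phi p' <= L * l'.
  move=> h; apply/ler_addgt0Pr => e e0.
  have e1 : 0 < e / (L + 1) by rewrite divr_gt0// ltr_wpDl.
  have [l' l1 pl] := wd_path h e1.
  apply: (@le_trans _ _ (L * l')).
    by rewrite ler_norml; apply/andP; split;
      have := H _ _ _ pl; have := H _ _ _ (path_sym pl); lra.
  apply: (@le_trans _ _ (L * (l + e / (L + 1)))); first by rewrite ler_wpM2l// ltW.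
  rewrite mulrDr lerD2l mulrCA ler_piMr ?(ltW e0)// ler_pdivrMr ?ltr_wpDl//.
  by rewrite mul1r lerDl.
move: p' q' l'; apply: path_ind => [p'|gam q' a l' Cg a0 ga _ IH].
  by rewrite subrr mulr0.
have := dini_curve dphi Cg ga; rewrite mulrDr.
by move: (phi q') (phi (gam 1)) (phi (gam 0)) IH => x y z h1 h2; lra.
Qed.

End Distance.

(** * Distances in charts *)

Section FormBounds.
Context {R : realType} {n : nat}.

Lemma min_lip (a b r : R) : `|Num.min a r - Num.min b r| <= `|a - b|.
Proof.
have n1 := ler_norm (a - b); have n2 := ler_norm (b - a); rewrite (distrC b a) in n2.
rewrite ler_norml /Num.min; move: `|a - b| n1 n2 => N n1 n2.
by case: ltP => ?; case: ltP => ?; apply/andP; split; lra.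
Qed.

Lemma posdef_lower (G : 'M[R]_n) : posdef G ->
  exists2 K : R, 0 < K & forall v : 'rV_n, `|v| ^+ 2 <= K * mform G v v.
Proof.
move=> pG; have [_ _ /(_ _ pG)[E [EE _]]] := @cholesky R n.
have [h1 h2] := frame_inv EE.
have uE : E^T \in unitmx.
  have : E *m (G *m E^T) = 1%:M by rewrite mulmxA.
  by move=> /mulmx1_unit[uE _]; rewrite unitmx_tr.
have uE' : E \in unitmx by rewrite -unitmx_tr.
have GE : G = invmx E *m invmx E^T.
  have : invmx E *m (E *m G *m E^T) *m invmx E^T = G.
    by rewrite !mulmxA mulVmx// mul1mx mulmxK.
  by rewrite EE mulmx1.
exists ((n%:R * `|E|) ^+ 2 + 1); first by rewrite ltr_wpDl// sqr_ge0.
move=> v; pose u := v *m invmx E.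
have vE : v = u *m E by rewrite mulmxKV.
have mE : mform G v v = \sum_i u 0 i ^+ 2.
  rewrite /mform GE !mulmxA -/u -mulmxA -trmx_inv -trmx_mul -/u mxE.
  by apply: eq_bigr => i _; rewrite [X in _ * X]mxE expr2.
have uu : `|u| ^+ 2 <= mform G v v.
  rewrite mE; have s0 : 0 <= \sum_i u 0 i ^+ 2 by apply: sumr_ge0 => i _; exact: sqr_ge0.
  rewrite -(sqr_sqrtr s0) ler_pXn2r ?nnegrE ?sqrtr_ge0//.
  apply: mx_norm_le => [|i j]; first exact: sqrtr_ge0.
  rewrite ord1 -sqrtr_sqr ler_wsqrtr// (bigD1 j)//= lerDl.
  by apply: sumr_ge0 => k _; exact: sqr_ge0.
apply: (@le_trans _ _ ((n%:R * `|E|) ^+ 2 * `|u| ^+ 2)).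
  rewrite -exprMn ler_pXn2r ?nnegrE ?mulr_ge0//.
  by rewrite [in leLHS]vE; apply: le_trans (mx_norm_mul _ _) _; rewrite mulrCA mulrC.
apply: (@le_trans _ _ ((n%:R * `|E|) ^+ 2 * mform G v v)).
  by rewrite ler_wpM2l// sqr_ge0.
rewrite ler_wpM2r ?lerDl//.
exact: posdef_ge0.
Qed.

Lemma mform_near (W : set 'rV[R]_n) (G : 'rV[R]_n -> 'M[R]_n) c (e : R) :
  {for c, continuous G} -> 0 < e ->
  \forall y \near c, forall u v, `|mform (G y) u v - mform (G c) u v| <= e * (`|u| * `|v|).
Proof.
move=> cG e0; have e1 : 0 < e / (n%:R ^+ 2 + 1) by rewrite divr_gt0// ltr_wpDl// sqr_ge0.
have /cvgrPdist_lt/(_ _ e1) := cG; apply: filterS => y h u v.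
rewrite -mform_oppG -mform_addG; apply: le_trans (mform_le _ _ _) _.
rewrite -mulrA mulrA ler_wpM2r ?mulr_ge0//.
rewrite -normrN opprB; apply: (@le_trans _ _ (n%:R ^+ 2 * (e / (n%:R ^+ 2 + 1)))).
  by rewrite ler_wpM2l ?sqr_ge0// ltW.
by rewrite mulrCA ler_piMr ?(ltW e0)// ler_pdivrMr ?ltr_wpDl ?sqr_ge0// mul1r lerDl.
Qed.

End FormBounds.

Section ChartDistance.
Context {R : realType} {n : nat} {M : topologicalType} (g : riemannian R n M).
Implicit Types (p q x z : M).

Lemma chart_curve z (y : R -> 'rV[R]_n) :
  (forall t : R, 0 <= t <= 1 -> cod g z (y t) /\
     exists U : set R, [/\ open U, U t & Ck_on 1 U y]) ->
  C1_curve g (chart_inv g z \o y) /\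
  forall t : R, 0 <= t <= 1 -> speed g (chart_inv g z \o y) t =
    Num.sqrt (mform (metric g z (y t)) ('D_1 y t) ('D_1 y t)).
Proof.
move=> H.
have Cg : C1_curve g (chart_inv g z \o y).
  move=> t t01; have [zt [U [oU Ut CU]]] := H t t01.
  have cy : {for t, continuous y} by exact: Ck_continuous CU Ut.
  split; first by apply: continuous_comp => //; exact: chart_inv_continuous zt.
  set x := (chart_inv g z \o y) t.
  have N : nbhs t (y @^-1` overlap g z x).
    apply: cy; apply: open_nbhs_nbhs; split; first exact: open_overlap.
    by split=> //; exact: chart_dom_center.
  have oU' : open (U `&` (y @^-1` overlap g z x)°) by apply: openI => //; exact: open_interior.
  exists (U `&` (y @^-1` overlap g z x)°); split; [exact: oU'|by split|].
  have sub s : (U `&` (y @^-1` overlap g z x)°) s -> overlap g z x (y s).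
    by move=> [_ /interior_subset].
  have CU' : Ck_on 1 (U `&` (y @^-1` overlap g z x)°) y by apply: Ck_sub CU => s [].
  exact: (Ck_comp_mx oU' (open_overlap z x) sub (trans_smooth g z x 1) CU').
split; first exact: Cg.
move=> t t01; have [zt [U [oU Ut CU]]] := H t t01.
have cy : {for t, continuous y} by exact: Ck_continuous CU Ut.
have D : 'D_1 (chart g z \o (chart_inv g z \o y)) t = 'D_1 y t.
  apply: near_eq_derive; have N : nbhs t (y @^-1` cod g z).
    by apply: cy; apply: open_nbhs_nbhs; split=> //; exact: open_cod.
  by apply: filterS N => s; exact: chart_invK.
refine (etrans (speed_chart Cg t01 (chart_invP zt)) _); cbv zeta; rewrite D.
by rewrite [chart g z _](chart_invK zt).
Qed.

Lemma arclength01 (gam : R -> M) : C1_curve g gam -> exists S : R -> R,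
  (forall t : R, 0 <= t <= 1 -> is_derive t (1 : R) S (speed g gam t)) /\
  path g (gam 0) (gam 1) (S 1 - S 0).
Proof.
move=> Cg; have [S [dS E]] := arclength Cg; exists S; split; last exact: path_curve.
move=> t t01; rewrite -[in X in is_derive _ _ _ X](clamp_id t01); apply: dS.
by case/andP: t01; lra.
Qed.

Lemma wd_speed_le (gam : R -> M) (B : R) : C1_curve g gam ->
  (forall t : R, 0 <= t <= 1 -> speed g gam t <= B) -> wd g (gam 0) (gam 1) B.
Proof.
move=> Cg hB; have [S [dS pS]] := arclength01 Cg; apply: wd_le (path_wd pS).
have : S 1 - B * 1 <= S 0 - B * 0.
  apply: (@ler_derive01 R (fun t => S t - B * t) (fun t => speed g gam t - B)).
    move=> t t01; apply: is_deriveB; first exact: dS.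
    have := is_derive_mulr (is_derive_cst B t (1 : R)) (is_derive_id t (1 : R)).
    by rewrite mul0r add0r mulr1.
  by move=> t t01; rewrite subr_le0; exact: hB.
by lra.
Qed.

Lemma wd_segment z (y1 v : 'rV[R]_n) (B : R) : 0 <= B ->
  (forall t : R, 0 <= t <= 1 -> cod g z (y1 + t *: v) /\
     mform (metric g z (y1 + t *: v)) v v <= B ^+ 2) ->
  wd g (chart_inv g z y1) (chart_inv g z (y1 + v)) B.
Proof.
move=> B0 H; pose y (t : R) := y1 + t *: v.
have dy t : is_derive t (1 : R) y v.
  have [h1 h2] : is_derive (y1 + t *: v) v (id : 'rV[R]_n -> 'rV[R]_n) v.
    exact: is_derive_id.
  by have := is_derive_line h1; rewrite h2.
have Cy t : 0 <= t <= 1 -> cod g z (y t) /\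
     exists U : set R, [/\ open U, U t & Ck_on 1 U y].
  move=> t01; split; first by have [] := H t t01.
  exists setT; split; [exact: openT|exact: I|].
  refine (C1_curve_real (U := setT) (df := fun=> v) _ _ _); first exact: openT.
  by move=> s _; exact: cst_continuous.
have [Cg sp] := chart_curve Cy.
have := @wd_speed_le _ B Cg; rewrite /= /y scale0r addr0 scale1r; apply=> t t01.
rewrite sp//; have [_ ->] := dy t; have [_ h] := H t t01.
by rewrite -(ger0_norm B0) -sqrtr_sqr ler_wsqrtr.
Qed.

Lemma metric_bounds z c : cod g z c -> exists rho C : R, [/\ 0 < rho, 0 < C,
  ball c rho `<=` cod g z & forall y, ball c rho y -> forall v,
    mform (metric g z y) v v <= C ^+ 2 * `|v| ^+ 2 /\
    `|v| ^+ 2 <= C ^+ 2 * mform (metric g z y) v v].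
Proof.
move=> zc; have pG := metric_posdefP zc.
have [K K0 HK] := posdef_lower pG.
have cG : {for c, continuous (metric g z)}.
  exact: (Ck_continuous (metric_smooth g z 0) zc).
have e0 : 0 < (2 * K)^-1 by rewrite invr_gt0 mulr_gt0.
have N1 := mform_near setT cG e0.
have N2 : nbhs c (cod g z) by apply: open_nbhs_nbhs; split=> //; exact: open_cod.
have [r /= r0 Hr] := (nbhs_ballP _ _).1 (filterI N1 N2).
pose A := n%:R ^+ 2 * `|metric g z c| + (2 * K)^-1 + 2 * K + 1.
have A1 : 1 <= A.
  rewrite /A lerDr !addr_ge0 ?mulr_ge0 ?sqr_ge0 ?(ltW e0)//.
  by rewrite ltW.
exists r, A; split=> //; first exact: lt_le_trans A1.
  by move=> y /Hr[].
move=> y /Hr[h1 yz] v; have := h1 v v; rewrite -expr2 => h.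
have nv : 0 <= `|v| ^+ 2 by exact: sqr_ge0.
have AA : A <= A ^+ 2 by rewrite expr2 ler_peMl//; exact: le_trans A1.
have B1 : n%:R ^+ 2 * `|metric g z c| + (2 * K)^-1 <= A.
  by rewrite /A -addrA lerDl addr_ge0// mulr_ge0// ltW.
have B2 : 2 * K <= A.
  have p1 : 0 <= n%:R ^+ 2 * `|metric g z c| by rewrite mulr_ge0// sqr_ge0.
  by rewrite /A; move: (n%:R ^+ 2 * _) ((2 * K)^-1) p1 e0 => a b; lra.
have up := mform_le (metric g z c) v v; have lo := HK v.
rewrite -[_ * `|v| * `|v|]mulrA -expr2 mulrA in up.
split.
  apply: (@le_trans _ _ (A * `|v| ^+ 2)); last by rewrite ler_wpM2r.
  apply: (@le_trans _ _ ((n%:R ^+ 2 * `|metric g z c| + (2 * K)^-1) * `|v| ^+ 2)).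
    have aux (a b c' d : R) : a - b <= d -> b <= c' -> a <= c' + d by lra.
    rewrite mulrDl; move: h up; rewrite !ler_norml => /andP[_ h] /andP[_ up].
    exact: aux h up.
  by rewrite ler_wpM2r.
have q : `|v| ^+ 2 <= 2 * K * mform (metric g z y) v v.
  move: h; rewrite ler_norml => /andP[h _].
  have hK : (2 * K)^-1 * `|v| ^+ 2 * (2 * K) = `|v| ^+ 2.
    by rewrite mulrAC mulVf ?mul1r// mulf_neq0// gt_eqF.
  move: (mform _ _ _) (mform _ _ _) ((2 * K)^-1 * `|v| ^+ 2) (`|v| ^+ 2) h lo hK => a b d e h lo hK.
  by nra.
apply: le_trans q _; rewrite ler_wpM2r//; last exact: le_trans B2 AA.
exact: posdef_ge0 (metric_posdefP yz).
Qed.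

Lemma wd_ray x (e : R) : 0 < e -> exists2 d, 0 < d & forall w : 'rV[R]_n, `|w| < d ->
  cod g x (chart g x x + w) /\
  wd g x (chart_inv g x (chart g x x + w))
    (Num.sqrt (mform (metric g x (chart g x x)) w w) + e * `|w|).
Proof.
move=> e0; set c := chart g x x; have xx : chart_dom g x x by exact: chart_dom_center.
have zc : cod g x c by exact: cod_chart.
have cG : {for c, continuous (metric g x)}.
  exact: (Ck_continuous (metric_smooth g x 0) zc).
have ee : 0 < e ^+ 2 by rewrite exprn_gt0.
have N1 := mform_near setT cG ee.
have N2 : nbhs c (cod g x) by apply: open_nbhs_nbhs; split=> //; exact: open_cod.
have [d /= d0 Hd] := (nbhs_ballP _ _).1 (filterI N1 N2).
exists d => // w wd_.
have inb (t : R) : 0 <= t <= 1 -> ball c d (c + t *: w).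
  move=> /andP[t0 t1]; rewrite -ball_normE /= opprD addrA subrr sub0r normrN normrZ.
  by rewrite (ger0_norm t0); apply: le_lt_trans wd_; rewrite ler_piMl.
have [_ cw] := Hd _ (inb 1 (andb_true_intro (conj ler01 (lexx 1)))).
split; first by move: cw; rewrite scale1r.
rewrite -[X in wd g X _ _](chartK xx).
have s0 := posdef_ge0 w (metric_posdefP zc).
apply: wd_segment; first by rewrite addr_ge0 ?sqrtr_ge0// mulr_ge0// ltW.
move=> t t01; have [h1 h2] := Hd _ (inb t t01); split; first exact: h2.
move: (h1 w w); rewrite ler_norml => /andP[_ h].
apply: (@le_trans _ _ (mform (metric g x c) w w + e ^+ 2 * (`|w| * `|w|))).
  by move: h; move: (mform _ _ _) (mform _ _ _) => *; lra.
rewrite -[X in X + _](sqr_sqrtr s0); have := sqrtr_ge0 (mform (metric g x c) w w).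
have := normr_ge0 w; move: (Num.sqrt _) (`|w|) => a b b0 a0.
by have := mulr_ge0 a0 b0; nra.
Qed.

Lemma deriv_lipschitz (y : R -> 'rV[R]_n) (t e : R) : derivable y t 1 -> 0 < e ->
  \forall s \near t, `|y s - y t| <= (`|'D_1 y t| + e) * `|s - t|.
Proof.
move=> dy e0; have /cvgrPdist_le/(_ _ e0) : (fun h : R => h^-1 *: ((y \o shift t) (h *: (1 : R)) - y t))
   @ 0^' --> 'D_1 y t by exact: dy.
move=> /nbhs_ballP[d /= d0 Hd]; apply/nbhs_ballP; exists d => // s.
rewrite -ball_normE /= distrC => ts; have [->|st] := eqVneq s t.
  by rewrite !subrr !normr0 mulr0.
have h0 : s - t != 0 by rewrite subr_eq0.
have := Hd (s - t); rewrite -ball_normE /= sub0r normrN => /(_ ts h0).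
rewrite [(s - t) *: (1 : R)]mulr1 subrK.
move=> h; have h2 : `|(s - t)^-1 *: (y s - y t)| <= `|'D_1 y t| + e.
  rewrite -[X in `|X|](subrKC ('D_1 y t)); apply: le_trans (ler_normD _ _) _.
  by rewrite lerD2l distrC.
have E : y s - y t = (s - t) *: ((s - t)^-1 *: (y s - y t)).
  by rewrite scalerA divff// scale1r.
by rewrite [X in `|X| <= _]E normrZ mulrC ler_wpM2r.
Qed.

(** A curve could leave the chart before reaching [x], so coordinates cannot be used along it
    directly. The coordinate distance to [y], truncated at [rho] and extended by [rho] outside the
    chart, is defined on the whole manifold and [C]-Lipschitz along curves. Its value at [x] is
    therefore at most C l < rho, which forces [x] into the chart. *)
Lemma chart_lower z c : cod g z c -> exists rho C : R, [/\ 0 < rho, 0 < C,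
  ball c rho `<=` cod g z,
  (forall y, ball c rho y -> forall v,
    mform (metric g z y) v v <= C ^+ 2 * `|v| ^+ 2 /\
    `|v| ^+ 2 <= C ^+ 2 * mform (metric g z y) v v) &
  forall y x l, ball c rho y -> wd g (chart_inv g z y) x l -> C * l < rho ->
    chart_dom g z x /\ `|chart g z x - y| <= C * l].
Proof.
move=> zc; have [r [C [r0 C0 sr Hr]]] := metric_bounds zc.
pose rho := r / 4; have rho0 : 0 < rho by rewrite divr_gt0.
exists rho, C; split=> //.
- by apply: subset_trans sr; apply: le_ball; rewrite /rho; lra.
- by move=> y By; apply: Hr; move: y By; apply: le_ball; rewrite /rho; lra.
move=> y1 x l By1 wl Cl.
pose phi q := if `[< chart_dom g z q /\ `|chart g z q - y1| < rho >]
  then `|chart g z q - y1| else rho.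
(* The truncated function is constant off [K]. As the continuous image of a compact set in a
   Hausdorff space, [K] is closed, so near a point outside [K] there is nothing to prove. *)
pose K := chart_inv g z @` [set y | `|y - y1| <= rho].
have sub y : `|y - y1| <= rho -> ball c r y.
  move=> h; move: By1; rewrite -!ball_normE /= => h1.
  have -> : c - y = (c - y1) + (y1 - y) by rewrite addrA subrK.
  apply: le_lt_trans (ler_normD _ _) _; rewrite (distrC y1).
  by move: h h1; rewrite /rho; move: `|_ - _| `|_ - _| => *; lra.
have cK : closed K.
  apply: compact_closed; first exact: (manifold_hausdorff g).
  apply: continuous_compact.
    apply: continuous_in_subspaceT => y; rewrite inE /= => /sub/sr h.
    exact: chart_inv_continuous h.
  apply: bounded_closed_compact.
    exists (`|y1| + rho); split; first exact: num_real.
    move=> N hN y /= hy; apply: le_trans (ltW hN).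
    by rewrite -[y](subrK y1) addrC; apply: le_trans (ler_normD _ _) _; rewrite lerD2l.
  have -> : [set y | `|y - y1| <= rho] = closed_ball_ Num.norm y1 rho.
    by apply/seteqP; split=> y /=; rewrite distrC.
  exact: closed_closed_ball_.
have phi_near q : ~ K q -> \forall q' \near q, phi q' = rho.
  move=> nK; have : nbhs q (~` K).
    by apply: open_nbhs_nbhs; split => //; exact: closed_openC.
  apply: filterS => q' nKq'; rewrite /phi; case: asboolP => // -[zq' lt].
  by exfalso; apply: nKq'; exists (chart g z q'); [exact: ltW|rewrite chartK].
have dphi : dini g C phi.
  move=> gam Cg t t01 e e0; have [Kt|nKt] := pselect (K (gam t)); last first.
    have ct : {for t, continuous gam} by have [] := Cg t t01.
    have : nbhs t (gam @^-1` (fun q' => phi q' = rho)) by apply: ct; exact: phi_near.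
    apply: filterS => s /= -> _; rewrite (nbhs_singleton (phi_near _ nKt)) subrr normr0.
    by rewrite mulr_ge0// addr_ge0 ?(ltW e0)// mulr_ge0 ?(ltW C0)// speed_ge0.
  have [y0 hy0 y0E] := Kt.
  have zt : chart_dom g z (gam t) by rewrite -y0E; apply: chart_invP; exact/sr/sub.
  have [U [oU Ut CU US]] := C1_local Cg t01 zt.
  have N1 := deriv_lipschitz (Ck_derivable (1 : R) CU Ut) e0.
  have N2 : nbhs t U by exact: open_nbhs_nbhs.
  apply: filterS (filterI N1 N2) => s [h Us] s01.
  have sp : `|'D_1 (chart g z \o gam) t| <= C * speed g gam t.
    rewrite (speed_chart Cg t01 zt).
    have ct : chart g z (gam t) = y0 by rewrite -y0E chart_invK//; exact/sr/sub.
    have [_ lo] := Hr _ (sub _ hy0) ('D_1 (chart g z \o gam) t).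
    rewrite ct -[leLHS]ger0_norm// -sqrtr_sqr -[C in leRHS](gtr0_norm C0) -sqrtr_sqr.
    by rewrite -sqrtrM ?sqr_ge0// ler_wsqrtr.
  apply: (@le_trans _ _ `|chart g z (gam s) - chart g z (gam t)|); last first.
    by apply: le_trans h _; rewrite ler_wpM2r// lerD2r.
  have phiE q : chart_dom g z q -> phi q = Num.min `|chart g z q - y1| rho.
    move=> zq; rewrite /phi /Num.min; case: asboolP => [[_ ->]//|H].
    by case: ifP => // lt; exfalso; apply: H.
  rewrite (phiE _ (US _ Us)) (phiE _ zt).
  have tri : `| `|chart g z (gam s) - y1| - `|chart g z (gam t) - y1| | <=
      `|chart g z (gam s) - chart g z (gam t)|.
    apply: le_trans (ler_dist_dist _ _) _.
    by rewrite opprB addrA subrK.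
  exact: le_trans (min_lip _ _ _) tri.
have zy1 : cod g z y1 by apply/sr/sub; rewrite subrr normr0 ltW.
have := dini_wd (ltW C0) dphi wl.
have -> : phi (chart_inv g z y1) = 0.
  rewrite /phi; case: asboolP => [_|[]]; first by rewrite chart_invK// subrr normr0.
  by rewrite chart_invK// subrr normr0; split=> //; exact: chart_invP.
rewrite sub0r normrN => h.
have : phi x < rho by apply: le_lt_trans (ler_norm _) (le_lt_trans h Cl).
move: h; rewrite /phi; case: asboolP => [[zx lt] h _|_ _]; last by rewrite ltxx.
by split=> //; rewrite -[leLHS]ger0_norm.
Qed.

End ChartDistance.

(** * Compactness of closed balls *)

Section HopfRinow.
Context {R : realType} {n : nat} {M : topologicalType} (g : riemannian R n M).
Implicit Types (p q x y z w : M).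

Lemma nbhs_wd x (e : R) : 0 < e -> \forall q \near x, wd g x q e.
Proof.
move=> e0; have xx : chart_dom g x x by exact: chart_dom_center.
have [d d0 Hd] := wd_ray g x ltr01; set c := chart g x x in Hd.
pose A := Num.sqrt (n%:R ^+ 2 * `|metric g x c|) + 1.
have A0 : 0 < A by rewrite ltr_wpDl// sqrtr_ge0.
have dd : 0 < Num.min d (e / A) by rewrite lt_min d0 divr_gt0.
have N1 : nbhs x (chart_dom g x).
  by apply: open_nbhs_nbhs; split=> //; exact: chart_dom_open.
have /cvgrPdist_lt/(_ _ dd) N2 := @chart_continuous _ _ _ g x x xx.
apply: filterS (filterI N1 N2) => q [xq]; rewrite distrC lt_min => /andP[h1 h2].
have [_] := Hd _ h1; rewrite /c addrC subrK chartK// => h; apply: wd_le h.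
set w := chart g x q - _ in h1 h2 *.
apply: (@le_trans _ _ (A * `|w|)); last by rewrite mulrC -ler_pdivlMr// ltW.
rewrite mulrDl lerD2r; have w0 := normr_ge0 w.
rewrite -[X in _ * X](ger0_norm w0) -sqrtr_sqr -sqrtrM ?mulr_ge0 ?sqr_ge0//.
apply: ler_wsqrtr; apply: le_trans (ler_norm _) _.
by apply: le_trans (mform_le _ _ _) _; rewrite expr2 -!mulrA.
Qed.

Lemma closed_cball p (l : R) : closed [set y | wd g p y l].
Proof.
move=> y /= cy; apply: wd_eps => e e0.
have [q [pq yq]] := cy _ (nbhs_wd y e0).
exact: wd_trans pq (wd_sym yq).
Qed.

Lemma open_geoball p r : open (geoball g p r).
Proof.
rewrite openE => x /geoballE[l lr px]; rewrite /interior /=.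
have e0 : 0 < (r - l) / 2 by rewrite divr_gt0// subr_gt0.
apply: filterS (nbhs_wd x e0) => q xq; apply/geoballE.
by exists (l + (r - l) / 2); [lra|exact: wd_trans xq].
Qed.

Lemma cball_locally_compact x : exists2 b, 0 < b & compact [set y | wd g x y b].
Proof.
have xx : chart_dom g x x by exact: chart_dom_center.
have zc := cod_chart xx; have [rho [C [rho0 C0 sub _ H]]] := chart_lower zc.
set c := chart g x x in zc sub H *.
have e0 : 0 < rho / (2 * C) by rewrite divr_gt0 ?mulr_gt0.
have CE : C * (rho / (2 * C)) = rho / 2.
  by field; rewrite gt_eqF.
exists (rho / (2 * C)) => //.
have sub2 (y : 'rV[R]_n) : `|y - c| <= rho / 2 -> ball c rho y.
  by rewrite -ball_normE /= distrC => h; lra.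
apply: (@subclosed_compact _ _ (chart_inv g x @` [set y : 'rV[R]_n | `|y - c| <= rho / 2])).
- exact: closed_cball.
- apply: continuous_compact.
    apply: continuous_in_subspaceT => y; rewrite inE /= => /sub2/sub h.
    exact: chart_inv_continuous h.
  apply: bounded_closed_compact.
    exists (`|c| + rho / 2); split; first exact: num_real.
    move=> N hN y /= hy; apply: le_trans (ltW hN).
    by rewrite -[y](subrK c) addrC; apply: le_trans (ler_normD _ _) _; rewrite lerD2l.
  have -> : [set y : 'rV[R]_n | `|y - c| <= rho / 2] = closed_ball_ Num.norm c (rho / 2).
    by apply/seteqP; split=> y /=; rewrite distrC.
  exact: closed_closed_ball_.
move=> q /= xq; have [||zq h] := H c q (rho / (2 * C)) (ballxx _ rho0).
- by rewrite /c chartK.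
- by rewrite CE; lra.
by exists (chart g x q); [rewrite -CE|rewrite chartK].
Qed.

Lemma ultra_compact (T : Type) (X : topologicalType) (F : set_system T) (f : T -> X)
  (A : set X) : UltraFilter F -> compact A -> F (f @^-1` A) ->
  exists2 w, A w & f @ F --> w.
Proof.
move=> UF cA FA; have PF : ProperFilter F by exact: ultra_proper.
have [w [Aw cw]] := cA (f @ F) _ FA; exists w => // N Nw.
have [//|FN] := in_ultra_setVsetC (f @^-1` N) UF.
by have [y [h1 h2]] := cw (~` N) N FN Nw; case: (h1 h2).
Qed.

(** Each [y] is reached from [x] through an intermediate point at distance at most [a]. These points
    lie in a compact ball, so along the ultrafilter they converge to some [w], and [w] is nearly as
    good an intermediate point for almost all [y]. *)
Lemma ultra_step (F : set_system M) x (t a e : R) : UltraFilter F ->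
  F [set y | wd g x y t] -> compact [set y | wd g x y a] -> 0 <= a -> a <= t -> 0 < e ->
  exists2 w, wd g x w a & F [set y | wd g w y (t - a + e)].
Proof.
move=> UF Ft ca a0 at_ e0; have PF : ProperFilter F by exact: ultra_proper.
have e2 : 0 < e / 2 by rewrite divr_gt0.
have : forall y, exists w, wd g x w a /\ (wd g x y t -> wd g w y (t - a + e / 2)).
  move=> y; have [h|h] := pselect (wd g x y t); last by exists x; split=> //; exact: wd_refl.
  have [||w [w1 w2]] := @wd_split _ _ _ g x y a (t - a) (e / 2) a0 _ e2.
  - by rewrite subr_ge0.
  - by rewrite addrC subrK.
  by exists w.
move=> /choice[f Hf]; have [|w xw fw] := @ultra_compact _ _ F f _ UF ca.
  by apply: filterS filterT => y _ /=; exact: (Hf y).1.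
exists w => //; have N : F [set y | wd g w (f y) (e / 2)] := fw _ (nbhs_wd w e2).
apply: filterS (filterI N Ft) => y [h1 h2].
have -> : t - a + e = e / 2 + (t - a + e / 2) by field.
exact: wd_trans h1 ((Hf y).2 h2).
Qed.

(* An ultrafilter containing a ball, but no compact ball, would allow one to walk along a
   sequence of centers at summable distances, by steps at least a quarter of the radius up to
   which the balls around the current center are compact. *)
Lemma compact_cball p (l : R) : complete_riemannian g -> compact [set y | wd g p y l].
Proof.
move=> hg; rewrite compact_ultra => F UF Fl.
have PF : ProperFilter F by exact: ultra_proper.
(* One compact ball belonging to [F], around any center, is enough: [F] converges in it, and the
   original ball is closed. *)
suff [x [a [ca Fa]]] : exists x a, compact [set y | wd g x y a] /\ F [set y | wd g x y a].
  have [w _ Fw] := @ultra_compact _ _ F id _ UF ca Fa; exists w; split; last exact: Fw.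
  by apply: closed_cball => N Nw; exact: filter_ex (filterI Fl (Fw _ Nw)).
apply: contrapT => nc.
have {}nc x a : compact [set y | wd g x y a] -> ~ F [set y | wd g x y a].
  by move=> c1 c2; apply: nc; exists x, a.
have cle x (a b : R) : a <= b -> compact [set y | wd g x y b] -> compact [set y | wd g x y a].
  move=> ab cb; apply: subclosed_compact cb _; first exact: closed_cball.
  by move=> y; exact: wd_le.
(* The states of the walk: a center and a radius whose ball belongs to [F]. *)
pose X := {z : M * R | F [set y | wd g z.1 y z.2]}.
have step (z : X) : {z' : X | [/\ wd g (sval z).1 (sval z').1 (2 * ((sval z).2 - (sval z').2)),
    (sval z').2 < (sval z).2 & forall b, b <= 1 -> compact [set y | wd g (sval z).1 y b] ->
      b <= 4 * ((sval z).2 - (sval z').2)]}.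
  apply: cid; case: z => -[x t] /= Fx.
  pose A := [set b : R | b <= 1 /\ compact [set y | wd g x y b]].
  have [b0 b00 cb0] := cball_locally_compact x.
  have Ab : A (Num.min b0 1) by split; [rewrite ge_min lexx orbT|apply: cle cb0; rewrite ge_min lexx].
  have hA : has_sup A by split; [exists (Num.min b0 1)|exists 1 => b []].
  have s0 : 0 < sup A.
    have b1 : 0 < Num.min b0 1 by rewrite lt_min b00 ltr01.
    have h : Num.min b0 1 <= sup A by exact: sup_upper_bound hA _ Ab.
    exact: lt_le_trans b1 h.
  (* Moving the center by [a] lowers the radius by a / 2, the other half of [a] being the slack in
     [ultra_step]. The distance travelled is thus at most twice the drop of the radius, hence
     summable, and the supremum of the compact radii is four times that drop. *)
  pose a := sup A / 2.
  have a0 : 0 < a by rewrite divr_gt0.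
  have [b [_ cb] ab] := sup_adherent a0 hA.
  have ca : compact [set y | wd g x y a] by apply: cle cb; rewrite /a in ab *; lra.
  have at_ : a <= t.
    rewrite leNgt; apply/negP => ta; apply: (nc _ _ ca); apply: filterS Fx => y.
    by apply: wd_le; exact: ltW.
  have e0 : 0 < a / 2 by rewrite divr_gt0.
  have [w xw Fw] := ultra_step UF Fx ca (ltW a0) at_ e0.
  have E : t - a + a / 2 = t - a / 2 by field.
  rewrite E in Fw; exists (exist (fun z : M * R => F [set y | wd g z.1 y z.2]) (w, t - a / 2) Fw).
  split=> /=.
  - by have -> : 2 * (t - (t - a / 2)) = a by field.
  - by rewrite ltrBlDr ltrDl.
  move=> b' b1 cb'; have : b' <= sup A by exact: sup_upper_bound hA _ (conj b1 cb').
  by rewrite /a; lra.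
have [f [_ Hf]] := dependent_choice step (exist (fun z : M * R => F [set y | wd g z.1 y z.2]) (p, l) Fl).
pose x k := (sval (f k)).1; pose t k := (sval (f k)).2.
have wx i j : (i <= j)%N -> wd g (x i) (x j) (2 * (t i - t j)).
  move=> /subnK <-; elim: (j - i)%N => [|k IH].
    by rewrite add0n subrr mulr0; exact: wd_refl.
  have [h _ _] := Hf (k + i)%N.
  have -> : 2 * (t i - t (k.+1 + i)%N) = 2 * (t i - t (k + i)%N) + 2 * (t (k + i)%N - t (k + i).+1).
    by rewrite addSn; move: (t _) (t _) (t _) => *; ring.
  exact: wd_trans IH h.
have t0 k : 0 <= t k.
  by have [y] := filter_ex (svalP (f k)); exact: wd_ge0.
have td : {homo t : i j / (i <= j)%N >-> j <= i}.
  by move=> i j /wx/wd_ge0; lra.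
have tl : has_lbound (range t) by exists 0 => _ [k _ <-]; exact: t0.
have tinf k : inf (range t) <= t k by apply: ge_inf => //; exists k.
have tc (e : R) : 0 < e -> exists N, forall k, (N <= k)%N -> t k < inf (range t) + e.
  move=> e0; have /cvgrPdist_lt/(_ _ e0) := nonincreasing_cvgn td tl.
  move=> [N _ HN]; exists N => k Nk; have := HN k Nk.
  by rewrite /= distrC ger0_norm ?subr_ge0// ltrBlDl.
have [e e0|w Hw] := hg x.
  have e4 : 0 < e / 4 by rewrite divr_gt0.
  have [N HN] := tc _ e4; exists N => i j Ni Nj.
  have fin i' j' : (N <= i')%N -> (i' <= j')%N -> wd g (x i') (x j') (e / 2).
    move=> Ni' ij; apply: wd_le (wx _ _ ij).
    by have := HN _ Ni'; have := tinf j'; lra.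
  apply: (@le_lt_trans _ _ (e / 2)%:E); last by rewrite lte_fin; lra.
  by case/orP: (leq_total i j) => ij; [exact: fin|apply: wd_sym; exact: fin].
have [b b0 cb] := cball_locally_compact w.
pose b1 := Num.min b 1.
have b10 : 0 < b1 by rewrite lt_min b0 ltr01.
have b12 : 0 < b1 / 2 by rewrite divr_gt0.
have b18 : 0 < b1 / 16 by rewrite divr_gt0.
have [N1 HN1] := Hw _ b12; have [N2 HN2] := tc _ b18.
pose k := maxn N1 N2; have h1 := HN1 k (leq_maxl _ _); have h2 := HN2 k (leq_maxr _ _).
(* Close to the limit [w] the balls of radius b1 / 2 are compact, so the radius must drop by at
   least b1 / 8, whereas less than b1 / 16 is left above the infimum of the radii. *)
have [_ _ /(_ (b1 / 2))] := Hf k; rewrite -/(t k) -/(t k.+1).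
have bb : b1 <= b by rewrite ge_min lexx.
have bb1 : b1 <= 1 by rewrite ge_min lexx orbT.
move=> /(_ _ _)/wrap[].
- lra.
- apply: subclosed_compact cb _; first exact: closed_cball.
  move=> y /= xy; apply: (@wd_le _ _ _ g w y (b1 / 2 + b1 / 2)); first by lra.
  by apply: wd_trans xy; apply: wd_sym; exact: ltW.
by have := tinf k.+1; lra.
Qed.

(** The approximate intermediate points of [wd_split] have a cluster point in a compact ball, where
    the excess vanishes. This exactness keeps a chain of links minimizing. *)
Lemma wd_split_exact p q (a b : R) : complete_riemannian g -> 0 <= a -> 0 <= b ->
  wd g p q (a + b) -> exists2 w, wd g p w a & wd g w q b.
Proof.
move=> hg a0 b0 pq.
have : forall k : nat, exists w, wd g p w a /\ wd g w q (b + k.+1%:R^-1).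
  by move=> k; exact: wd_split.
move=> /choice[f Hf].
have [|w [pw cw]] := @compact_cball p a hg (f @ \oo).
  by exists 0%N => // k _ /=; exact: (Hf k).1.
exists w => //; apply: wd_eps => e e0; have e2 : 0 < e / 2 by rewrite divr_gt0.
have Ff : (f @ \oo) [set y | wd g y q (b + e / 2)].
  have : \forall k \near \oo, (k.+1%:R^-1 : R) < e / 2 by exact: near_infty_natSinv_lt (PosNum e2).
  by apply: filterS => k h /=; apply: wd_le (Hf k).2; rewrite lerD2l ltW.
have [y [yq wy]] := cw _ _ Ff (nbhs_wd w e2).
by apply: wd_le (wd_trans wy yq); lra.
Qed.

(** The links of a chain all have the same length, while a link can be handled only inside a
    neighborhood whose size depends on its position. Compactness makes that size uniform. *)
Lemma lebesgue_number (K : set M) (Q : M -> M -> R -> Prop) : compact K ->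
  (forall z, K z -> exists2 rho, 0 < rho & forall x x' h, wd g z x rho ->
     wd g x x' h -> h < rho -> Q x x' h) ->
  exists2 d, 0 < d & forall x x' h, K x -> wd g x x' h -> h < d -> Q x x' h.
Proof.
move=> /compact_near_coveringP cK H.
pose P (d : R) x := forall x' h, wd g x x' h -> h < d -> Q x x' h.
have [x Kx|d /= d0 Hd] := cK R 0^'+ P _ _.
  have [rho rho0 Hr] := H x Kx.
  exists ([set y | wd g x y rho], [set d | d < rho]) => /=.
    by split; [exact: nbhs_wd|exact: nbhs_right_lt].
  move=> [y d] /= [xy dr] x' h yx' hd; apply: Hr xy yx' _; exact: lt_trans dr.
exists (d / 2); first by rewrite divr_gt0.
move=> x x' h Kx; apply: (Hd (d / 2)) Kx x' h.
  by rewrite /= sub0r normrN gtr0_norm ?divr_gt0//; lra.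
by rewrite /= divr_gt0.
Qed.

End HopfRinow.

(** * Second variation of the metric *)

Section UniformDerivatives.
Context {R : realType}.

Lemma Ck_mulmx (V : normedModType R) k m n p (U : set V) (A : V -> 'M[R]_(m, n))
  (B : V -> 'M[R]_(n, p)) : open U -> Ck_on k U A -> Ck_on k U B ->
  Ck_on k U (fun y => A y *m B y).
Proof.
move=> oU CA CB; apply: Ck_mx => // i j.
have -> : (fun y => (A y *m B y) i j) = (fun y => \sum_k A y i k * B y k j).
  by apply/funext => y; rewrite mxE.
apply: Ck_sum => // l; apply: Ck_mul => //.
  exact: ((Ck_mxP k A oU).1 CA).
exact: ((Ck_mxP k B oU).1 CB).
Qed.

Lemma Ck_trmx (V : normedModType R) k m n (U : set V) (A : V -> 'M[R]_(m, n)) :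
  open U -> Ck_on k U A -> Ck_on k U (fun y => (A y)^T).
Proof.
move=> oU CA; apply: Ck_mx => // i j.
have -> : (fun y => (A y)^T i j) = (fun y => A y j i) by apply/funext => y; rewrite mxE.
exact: ((Ck_mxP k A oU).1 CA).
Qed.

Lemma sum_cst_le N (e a : R) : 0 < e -> 0 <= a ->
  \sum_(i < N) a * (e / (N%:R + 1)) <= e * a.
Proof.
move=> e0 a0; rewrite sumr_const card_ord -[leLHS]mulr_natl mulrCA [leRHS]mulrC ler_wpM2l//.
by rewrite mulrCA ler_piMr ?(ltW e0)// ler_pdivrMr ?ltr_wpDl// mul1r lerDl.
Qed.

Context {N p q : nat}.
Variables (U : set 'rV[R]_N) (Th : 'rV[R]_N -> 'M[R]_(p, q)) (Y0 : 'rV[R]_N).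
Hypotheses (oU : open U) (UY0 : U Y0).
Implicit Types (h Y : 'rV[R]_N).

Let NU : \forall Y \near Y0, U Y. Proof. exact: open_nbhs_nbhs. Qed.

(** Uniform in the direction [h]: there are finitely many partial derivatives, and ['D_h] is linear
    in [h]. *)
Lemma derive_near e : Ck_on 1 U Th -> 0 < e ->
  \forall Y \near Y0, U Y /\ forall h, `|'D_h Th Y - 'D_h Th Y0| <= e * `|h|.
Proof.
move=> CT e0; have e1 : 0 < e / (N%:R + 1) by rewrite divr_gt0// ltr_wpDl.
have H (i : 'I_N) : \forall Y \near Y0,
    `|'D_(delta_mx 0 i) Th Y0 - 'D_(delta_mx 0 i) Th Y| < e / (N%:R + 1).
  by have /cvgrPdist_lt/(_ _ e1) := Ck_continuous (Ck_derive (delta_mx 0 i) CT) UY0.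
have {}H := @filter_forall _ _ _ (nbhs Y0) (nbhs_filter Y0) H.
refine (filterS _ (filterI NU H)) => Y [UY HY]; split=> // h.
rewrite (derive_rV_mx h oU CT UY) (derive_rV_mx h oU CT UY0) -sumrB.
apply: le_trans (ler_norm_sum _ _ _) _.
apply: (@le_trans _ _ (\sum_(i < N) `|h| * (e / (N%:R + 1)))).
  apply: ler_sum => i _; rewrite -scalerBr normrZ ler_pM//.
    exact: ler_mx_entry.
  by rewrite distrC ltW.
exact: sum_cst_le.
Qed.

End UniformDerivatives.

Section UniformSecondDerivative.
Context {R : realType} {N p q : nat}.
Variables (U : set 'rV[R]_N) (Th : 'rV[R]_N -> 'M[R]_(p, q)) (Y0 : 'rV[R]_N).
Hypotheses (oU : open U) (UY0 : U Y0).
Implicit Types (h Y : 'rV[R]_N).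

Lemma derive2_rV h Y : Ck_on 2 U Th -> U Y ->
  'D_h ('D_h Th) Y = \sum_i h 0 i *: 'D_h ('D_(delta_mx 0 i) Th) Y.
Proof.
move=> CT UY; have E Z : U Z -> \sum_i h 0 i *: 'D_(delta_mx 0 i) Th Z = 'D_h Th Z.
  by move=> UZ; rewrite (derive_rV_mx h oU (Ck_pred CT) UZ).
have D : is_derive Y h (fun Z => \sum_i h 0 i *: 'D_(delta_mx 0 i) Th Z)
    (\sum_i h 0 i *: 'D_h ('D_(delta_mx 0 i) Th) Y).
  apply: is_derive_mx => a b.
  have -> : (\sum_i h 0 i *: 'D_h ('D_(delta_mx 0 i) Th) Y) a b =
      \sum_i h 0 i * ('D_h ('D_(delta_mx 0 i) Th) Y) a b.
    by rewrite summxE; apply: eq_bigr => i _; rewrite mxE.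
  have -> : (fun Z => (\sum_i h 0 i *: 'D_(delta_mx 0 i) Th Z) a b) =
      (fun Z => \sum_i h 0 i * ('D_(delta_mx 0 i) Th Z) a b).
    by apply/funext => Z; rewrite summxE; apply: eq_bigr => i _; rewrite mxE.
  apply: is_derive_sumr => i.
  have := is_derive_mulr (is_derive_cst (h 0 i) Y h) (@is_derive_entry _ _ _ _ _ Y h _ a b
    (DeriveDef (Ck_derivable h (Ck_derive (delta_mx 0 i) CT) UY) erefl)).
  by rewrite mul0r add0r.
by have [_ ->] := is_derive_on_ext oU E UY D.
Qed.

Lemma derive2_near e : Ck_on 2 U Th -> 0 < e ->
  \forall Y \near Y0, U Y /\ forall h, `|'D_h ('D_h Th) Y - 'D_h ('D_h Th) Y0| <= e * `|h| ^+ 2.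
Proof.
move=> CT e0; have e1 : 0 < e / (N%:R + 1) by rewrite divr_gt0// ltr_wpDl.
have NU : \forall Y \near Y0, U Y by exact: open_nbhs_nbhs.
have H (i : 'I_N) : \forall Y \near Y0, U Y /\ forall h,
    `|'D_h ('D_(delta_mx 0 i) Th) Y - 'D_h ('D_(delta_mx 0 i) Th) Y0| <= e / (N%:R + 1) * `|h|.
  exact: (derive_near oU UY0 (Ck_derive (delta_mx 0 i) CT)).
have {}H := @filter_forall _ _ _ (nbhs Y0) (nbhs_filter Y0) H.
refine (filterS _ (filterI NU H)) => Y [UY HY]; split=> // h.
rewrite (derive2_rV h CT UY) (derive2_rV h CT UY0) -sumrB.
apply: le_trans (ler_norm_sum _ _ _) _.
apply: (@le_trans _ _ (\sum_(i < N) `|h| * (e / (N%:R + 1) * `|h|))).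
  apply: ler_sum => i _; rewrite -scalerBr normrZ ler_pM//.
    exact: ler_mx_entry.
  by have [_] := HY i; apply.
rewrite (eq_bigr (fun=> `|h| ^+ 2 * (e / (N%:R + 1)))).
  by apply: sum_cst_le => //; exact: sqr_ge0.
move=> i _; move: (e / _) `|h| => a b; ring.
Qed.

End UniformSecondDerivative.

Section Variation.
Context {R : realType} {n : nat}.
Variables (W : set 'rV[R]_n) (G : 'rV[R]_n -> 'M[R]_n).
Hypothesis sG : smooth_metric W G.
Implicit Types (u v w e h y : 'rV[R]_n).

Let oW : open W. Proof. by case: sG. Qed.
Let CG k : Ck_on k W G. Proof. by case: sG. Qed.

Lemma smooth_christoffel k i j : smooth_on W (christoffel G k i j).
Proof.
move=> d; apply: Ck_mul => //; first exact: Ck_cst.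
apply: Ck_sum => // l; apply: Ck_mul => //.
  apply: (Ck_mxP d (fun y => invmx (G y)) oW).1.
  apply: Ck_invmx => // y Wy; apply: posdef_unit; by case: sG => _ _; apply.
have CD a i' j' : Ck_on d W (pderiv a (fun z => G z i' j')).
  exact: Ck_derive (((Ck_mxP d.+1 G oW).1 (CG d.+1)) i' j').
apply: Ck_add => //; first exact: Ck_add.
exact: Ck_opp.
Qed.

(* The derivative of y |-> gam2 G y u v in the direction h. *)
Definition dgam2 y h u v : 'rV[R]_n :=
  \row_k \sum_i \sum_j 'D_h (christoffel G k i j) y * u 0 i * v 0 j.

Lemma is_derive_gam2 (V : normedModType R) (a b c : V -> 'rV[R]_n) (x d : V) da db dc :
  W (a x) -> is_derive x d a da -> is_derive x d b db -> is_derive x d c dc ->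
  is_derive x d (fun z => gam2 G (a z) (b z) (c z))
    (dgam2 (a x) da (b x) (c x) + gam2 G (a x) db (c x) + gam2 G (a x) (b x) dc).
Proof.
move=> Wa ha hb hc; apply: is_derive_mx => i k; rewrite ord1 {i}.
have E : (dgam2 (a x) da (b x) (c x) + gam2 G (a x) db (c x) + gam2 G (a x) (b x) dc) 0 k =
  \sum_i \sum_j (('D_da (christoffel G k i j) (a x) * b x 0 i +
     christoffel G k i j (a x) * db 0 i) * c x 0 j +
     christoffel G k i j (a x) * b x 0 i * dc 0 j).
  rewrite !mxE -!big_split; apply: eq_bigr => i _; rewrite -!big_split.
  by apply: eq_bigr => j _ /=; rewrite mulrDl.
rewrite E; have -> : (fun z => gam2 G (a z) (b z) (c z) 0 k) =
  (fun z => \sum_i \sum_j christoffel G k i j (a z) * b z 0 i * c z 0 j).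
  by apply/funext => z; rewrite mxE.
apply: is_derive_sumr => i; apply: is_derive_sumr => j.
apply: is_derive_mulr; last exact: is_derive_entry.
apply: is_derive_mulr; last exact: is_derive_entry.
have [h1 h2] := ha; have := is_derive_comp_scalar oW (smooth_christoffel k i j 1) Wa h1.
by rewrite h2.
Qed.

Lemma Ck_gam2 (V : normedModType R) d (U : set V) (a b c : V -> 'rV[R]_n) :
  open U -> (forall x, U x -> W (a x)) -> Ck_on d U a -> Ck_on d U b -> Ck_on d U c ->
  Ck_on d U (fun z => gam2 G (a z) (b z) (c z)).
Proof.
move=> oU UW Ca Cb Cc; apply: Ck_mx => // i k.
have -> : (fun z => gam2 G (a z) (b z) (c z) i k) =
  (fun z => \sum_i \sum_j christoffel G k i j (a z) * b z 0 i * c z 0 j).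
  by apply/funext => z; rewrite mxE.
apply: Ck_sum => // i'; apply: Ck_sum => // j; apply: Ck_mul => //; last first.
  exact: ((Ck_mxP d c oU).1 Cc).
apply: Ck_mul => //; last exact: ((Ck_mxP d b oU).1 Cb).
exact: (Ck_comp oU oW UW (smooth_christoffel k i' j d) Ca).
Qed.

(* g(w, R(e, w) e), where R is the curvature tensor *)
Definition curv y e w : R := mform (G y) w
  (dgam2 y e e w - dgam2 y w e e + gam2 G y e (gam2 G y e w) - gam2 G y w (gam2 G y e e)).

Section Center.
Variable c : 'rV[R]_n.
Hypothesis Wc : W c.

(** First-order approximation of the parallel transport of [e] from [c] to [y]. *)
Definition tmap y e := e - gam2 G c (y - c) e.

(* A second order approximation of the exponential map at y, applied to tmap y e. *)
Definition vmap (y e : 'rV[R]_n) : 'rV[R]_n :=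
  y + tmap y e - 2^-1 *: gam2 G y (tmap y e) (tmap y e).

(** The differential of [vmap] at the pair [(y, e)] applied to [(w, b)]; see [is_derive_vmap]. Along
    a curve of base points it gives the velocity of the varied curve. *)
Definition vmapl (y e w b : 'rV[R]_n) : 'rV[R]_n :=
  let t := tmap y e in let dt := b - gam2 G c (y - c) b - gam2 G c w e in
  w + dt - 2^-1 *: (dgam2 y w t t + gam2 G y dt t + gam2 G y t dt).

Lemma is_derive_vmap (V : normedModType R) (y e : V -> 'rV[R]_n) (x d : V) w b :
  W (y x) -> is_derive x d y w -> is_derive x d e b ->
  is_derive x d (fun z => vmap (y z) (e z)) (vmapl (y x) (e x) w b).
Proof.
move=> Wy hy he.
have hT : is_derive x d (fun z => tmap (y z) (e z)) (b - gam2 G c (y x - c) b - gam2 G c w (e x)).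
  have -> : b - gam2 G c (y x - c) b - gam2 G c w (e x) =
    b - (dgam2 c 0 (y x - c) (e x) + gam2 G c (w - 0) (e x) + gam2 G c (y x - c) b).
    have -> : dgam2 c 0 (y x - c) (e x) = 0.
      apply/rowP => k; rewrite !mxE big1// => i _; rewrite big1// => j _.
      by rewrite derive0 !mul0r.
    by rewrite add0r subr0 opprD addrA; exact: addrAC.
  have hz : is_derive x d (fun z => y z - c) (w - 0) by apply: is_deriveB.
  have hc : is_derive x d (fun=> c) (0 : 'rV[R]_n) by exact: is_derive_cst.
  have h := is_derive_gam2 (a := fun=> c) Wc hc hz he.
  exact: is_deriveB.
have h := is_derive_gam2 Wy hy hT hT.
exact: is_deriveB.
Qed.

Lemma gam20l y v : gam2 G y 0 v = 0. Proof. by have := gam2Zl G y 0 0 v; rewrite !scale0r. Qed.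
Lemma gam20r y v : gam2 G y v 0 = 0. Proof. by have := gam2Zr G y 0 v 0; rewrite !scale0r. Qed.

Lemma gam2Nl y u v : gam2 G y (- u) v = - gam2 G y u v.
Proof. by rewrite -scaleN1r gam2Zl scaleN1r. Qed.
Lemma gam2Nr y u v : gam2 G y u (- v) = - gam2 G y u v.
Proof. by rewrite -scaleN1r gam2Zr scaleN1r. Qed.

Lemma tmap_center e : tmap c e = e.
Proof. by rewrite /tmap subrr gam20l subr0. Qed.

Lemma dgam20 y u v : dgam2 y 0 u v = 0.
Proof.
apply/rowP => k; rewrite !mxE big1// => i _; rewrite big1// => j _.
by rewrite derive0 !mul0r.
Qed.

Lemma dgam2Z y h (a b : R) u v : dgam2 y h (a *: u) (b *: v) = (a * b) *: dgam2 y h u v.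
Proof.
apply/rowP => k; rewrite !mxE mulr_sumr; apply: eq_bigr => i _.
by rewrite mulr_sumr; apply: eq_bigr => j _ /=; rewrite !mxE; ring.
Qed.

Lemma dgam2_0 y h : dgam2 y h 0 0 = 0.
Proof. by have := dgam2Z y h 0 0 0 0; rewrite !scale0r mul0r scale0r. Qed.

Lemma vmap0 y : vmap y 0 = y.
Proof. by rewrite /vmap /tmap gam20r subrr gam20r scaler0 subr0 addr0. Qed.

Lemma vmap_center (s : R) e :
  vmap c (s *: e) = c + s *: e - (2^-1 * s ^+ 2) *: gam2 G c e e.
Proof. by rewrite /vmap tmap_center gam2Zl gam2Zr !scalerA expr2 mulrA. Qed.

Lemma vmapl_base (s : R) e w : vmapl c (s *: e) w 0 = w - s *: gam2 G c w e
  - (2^-1 * s ^+ 2) *: (dgam2 c w e e - 2 *: gam2 G c e (gam2 G c w e)).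
Proof.
rewrite /vmapl tmap_center gam20r subr0 sub0r gam2Zr dgam2Z; congr (_ + _ - _).
rewrite -scaleNr !gam2Zl !gam2Zr (gam2C sG Wc _ e).
rewrite !scalerA; apply/rowP => k; rewrite !mxE.
by move: (\sum_i _) (\sum_i _) => A B; ring.
Qed.

Lemma vmapl_fibre (s : R) e b : vmapl c (s *: e) 0 b = b - s *: gam2 G c e b.
Proof.
rewrite /vmapl tmap_center subrr !gam20l !subr0 dgam20 add0r add0r gam2Zl gam2Zr.
rewrite (gam2C sG Wc b e) -scalerDl scalerA; congr (_ - _ *: _).
by field.
Qed.

Lemma vmapl0 y w : vmapl y 0 w 0 = w.
Proof.
by rewrite /vmapl /tmap !gam20r !subr0 dgam2_0 !gam20l !addr0 scaler0 subr0.
Qed.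

Lemma is_derive_parabola (a b d : 'rV[R]_n) (s : R) :
  is_derive s (1 : R) (fun s => a + s *: b - (2^-1 * s ^+ 2) *: d) (b - s *: d).
Proof.
have is_derive_sq : is_derive s (1 : R) (fun s : R => 2^-1 * s ^+ 2) s.
  apply: is_derive_eq (is_derive_mulr (is_derive_cst (2^-1 : R) s (1 : R))
    (is_derive_mulr (is_derive_id s (1 : R)) (is_derive_id s (1 : R)))) _.
  by rewrite /cst; field.
apply: is_derive_mx => i j.
have -> : (b - s *: d) i j = (0 + (1 * b i j + s * 0)) - (s * d i j + 2^-1 * s ^+ 2 * 0).
  by rewrite !mxE; ring.
have -> : (fun s => (a + s *: b - (2^-1 * s ^+ 2) *: d) i j) =
    (fun s => (a i j + s * b i j) - 2^-1 * s ^+ 2 * d i j).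
  by apply/funext => t; rewrite !mxE.
apply: is_deriveB; last exact: is_derive_mulr.
apply: is_deriveD; exact: is_derive_mulr.
Qed.

Section CenterJet.
Variables e w : 'rV[R]_n.
Let Z := dgam2 c w e e - 2 *: gam2 G c e (gam2 G c w e).
Let a (s : R) := vmap c (s *: e).
Let X (s : R) := vmapl c (s *: e) w 0.
(** The covariant derivative of the field [X] along the curve [a], which is geodesic up to second
    order at [c]. The correction in [tmap] is what makes it vanish at 0. *)
Let Y (s : R) := - gam2 G c w e - s *: Z + gam2 G (a s) (e - s *: gam2 G c e e) (X s).

Let a0 : a 0 = c. Proof. by rewrite /a scale0r vmap0. Qed.
Let X0 : X 0 = w. Proof. by rewrite /X scale0r vmapl0. Qed.

Let da (s : R) : is_derive s (1 : R) a (e - s *: gam2 G c e e).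
Proof.
have -> : a = (fun s => c + s *: e - (2^-1 * s ^+ 2) *: gam2 G c e e).
  by apply/funext => t; exact: vmap_center.
exact: is_derive_parabola.
Qed.

Let dX (s : R) : is_derive s (1 : R) X (- gam2 G c w e - s *: Z).
Proof.
have -> : X = (fun s => w + s *: - gam2 G c w e - (2^-1 * s ^+ 2) *: Z).
  by apply/funext => t; rewrite scalerN; exact: vmapl_base.
exact: is_derive_parabola.
Qed.

Let Y0 : Y 0 = 0.
Proof.
by rewrite /Y a0 X0 !scale0r !subr0 (gam2C sG Wc e w) addNr.
Qed.

(** The Jacobi equation at 0: the second covariant derivative of [X] is R(e, w) e. Since [Y]
    vanishes at 0, its ordinary derivative there is also the covariant one. *)
Let dY : is_derive (0 : R) (1 : R) Y
  (dgam2 c e e w - dgam2 c w e e + gam2 G c e (gam2 G c e w) - gam2 G c w (gam2 G c e e)).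
Proof.
have h1 (u v : 'rV[R]_n) : is_derive (0 : R) (1 : R) (fun s : R => u - s *: v) (- v).
  have := is_derive_parabola u (- v) 0 0; rewrite scaler0 subr0.
  by under eq_fun do rewrite scaler0 subr0 scalerN.
have Wa0 : W (a 0) by rewrite a0.
have h2 := is_derive_gam2 Wa0 (da 0) (h1 e (gam2 G c e e)) (dX 0).
rewrite a0 X0 !scale0r !subr0 in h2.
have -> : dgam2 c e e w - dgam2 c w e e + gam2 G c e (gam2 G c e w) - gam2 G c w (gam2 G c e e) =
  - Z + (dgam2 c e e w + gam2 G c (- gam2 G c e e) w + gam2 G c e (- gam2 G c w e)).
  rewrite gam2Nl gam2Nr /Z.
  rewrite (gam2C sG Wc w e) (gam2C sG Wc w (gam2 G c e e)).
  have aux (A B C D : 'rV[R]_n) : A - B + C - D = - (B - 2 *: C) + (A - D - C).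
    by apply/rowP => k; rewrite !mxE; ring.
  exact: aux.
exact: is_deriveD (h1 _ _) h2.
Qed.

Let compat_derive (U V : R -> 'rV[R]_n) (dU dV : 'rV[R]_n) (s : R) : W (a s) ->
  is_derive s (1 : R) U dU -> is_derive s (1 : R) V dV ->
  is_derive s (1 : R) (fun s => mform (G (a s)) (U s) (V s))
   (mform (G (a s)) (dU + gam2 G (a s) (e - s *: gam2 G c e e) (U s)) (V s) +
    mform (G (a s)) (U s) (dV + gam2 G (a s) (e - s *: gam2 G c e e) (V s))).
Proof.
move=> Wa hU hV; have [d1 d2] := da s.
have hG := is_derive_comp oW (CG 1) Wa d1; rewrite d2 in hG.
have := is_derive_mform hG hU hV.
rewrite -[mform ('D_ _ G _) _ _]/(dform _ _ _ _ _) (metric_compat sG Wa) mformDl mformDr.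
have aux (A B C D : R) : A + B + C + D = C + A + (D + B) by ring.
by rewrite aux.
Qed.

(** The derivative of |X|^2 is 2 g(Y, X). As [Y] vanishes at 0, only its own derivative, the
    curvature term of [dY], contributes to the second derivative. *)
Lemma second_variation_center : exists dphi : R -> R,
  [/\ forall s : R, W (vmap c (s *: e)) -> is_derive s (1 : R)
    (fun s => mform (G (vmap c (s *: e))) (vmapl c (s *: e) w 0) (vmapl c (s *: e) w 0)) (dphi s) &
   is_derive (0 : R) (1 : R) dphi (2 * curv c e w)].
Proof.
exists (fun s => 2 * mform (G (a s)) (Y s) (X s)); split.
  move=> s Wa; have := compat_derive Wa (dX s) (dX s).
  rewrite -/(Y s) (mformC (X s) (Y s)) -?mulr2n ?mulr_natl//.
  by case: sG => _ _ /(_ _ Wa)[].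
have Wa0 : W (a 0) by rewrite a0.
have h := compat_derive Wa0 dY (dX 0).
have := is_derive_mulr (is_derive_cst (2 : R) (0 : R) (1 : R)) h.
rewrite mul0r add0r Y0 a0 X0 mform0l addr0 !scale0r subr0 gam20r addr0.
suff -> : mform (G c) (dgam2 c e e w - dgam2 c w e e + gam2 G c e (gam2 G c e w)
   - gam2 G c w (gam2 G c e e)) w = curv c e w by [].
by apply: mformC; case: sG => _ _ /(_ _ Wc)[].
Qed.

(** Both fields, coming from a displacement of the base point and of the vector, have zero covariant
    derivative at 0. *)
Lemma mixed_variation_center b : is_derive (0 : R) (1 : R)
  (fun s => mform (G (vmap c (s *: e))) (vmapl c (s *: e) w 0) (vmapl c (s *: e) 0 b)) 0.
Proof.
have Wa0 : W (a 0) by rewrite a0.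
have h1 : is_derive (0 : R) (1 : R) (fun s : R => vmapl c (s *: e) 0 b) (- gam2 G c e b).
  under eq_fun do rewrite vmapl_fibre.
  have := is_derive_parabola b (- gam2 G c e b) 0 0; rewrite scaler0 subr0.
  by under eq_fun do rewrite scaler0 subr0 scalerN.
have := compat_derive Wa0 (dX 0) h1.
rewrite -/(Y 0) Y0 mform0l add0r scale0r vmapl_fibre !scale0r !subr0 a0 addNr.
by rewrite mform0r.
Qed.

End CenterJet.
Lemma Ck_vmap (V : normedModType R) k (U : set V) (y e : V -> 'rV[R]_n) : open U ->
  (forall x, U x -> W (y x)) -> Ck_on k U y -> Ck_on k U e ->
  Ck_on k U (fun x => vmap (y x) (e x)).
Proof.
move=> oU UW Cy Ce; have CT : Ck_on k U (fun x => tmap (y x) (e x)).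
  apply: Ck_add => //; apply: Ck_opp => //; apply: (Ck_gam2 (a := fun=> c)) => //.
    exact: Ck_cst.
  by apply: Ck_add => //; exact: Ck_cst.
apply: Ck_add => //; first exact: Ck_add.
apply: Ck_opp => //.
apply: (Ck_mx (f := fun x => 2^-1 *: gam2 G (y x) (tmap (y x) (e x)) (tmap (y x) (e x)))) => // i j.
under eq_fun do rewrite mxE.
apply: Ck_mul => //; first exact: Ck_cst.
by apply: ((Ck_mxP k _ oU).1 _); exact: Ck_gam2.
Qed.

Definition VM (Y : 'rV[R]_(n + n)) : 'rV[R]_n := vmap (lsubmx Y) (rsubmx Y).
Definition VU : set 'rV[R]_(n + n) := [set Y | W (lsubmx Y) /\ W (VM Y)].
Definition vjac (Y : 'rV[R]_(n + n)) : 'M[R]_(n + n, n) :=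
  \matrix_I 'D_(delta_mx 0 I) VM Y.
(** The pull-back of the metric by [VM] to the space of pairs (base point, displacement), packed in
    one row. The squared speed of a varied curve is this form at the velocity of the pair, and
    smoothness in the pair makes the jets computed at [c] stable near [c]. *)
Definition vgram (Y : 'rV[R]_(n + n)) : 'M[R]_(n + n) :=
  vjac Y *m G (VM Y) *m (vjac Y)^T.

Let WL : set 'rV[R]_(n + n) := [set Y | W (lsubmx Y)].

Let Ck_l k (U : set 'rV[R]_(n + n)) : open U -> Ck_on k U (fun Y : 'rV[R]_(n + n) => lsubmx Y).
Proof.
move=> oU; apply: Ck_mx => // i j.
have -> : (fun Y : 'rV[R]_(n + n) => lsubmx Y i j) = (fun Y => Y i (lshift n j)).
  by apply/funext => Y; rewrite mxE.
apply: ((Ck_mxP k (fun Y : 'rV[R]_(n + n) => Y) oU).1 _).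
exact: (@Ck_linear _ _ _ k U idfun (fun x => @cvg_id _ _)).
Qed.

Let Ck_r k (U : set 'rV[R]_(n + n)) : open U -> Ck_on k U (fun Y : 'rV[R]_(n + n) => rsubmx Y).
Proof.
move=> oU; apply: Ck_mx => // i j.
have -> : (fun Y : 'rV[R]_(n + n) => rsubmx Y i j) = (fun Y => Y i (rshift n j)).
  by apply/funext => Y; rewrite mxE.
apply: ((Ck_mxP k (fun Y : 'rV[R]_(n + n) => Y) oU).1 _).
exact: (@Ck_linear _ _ _ k U idfun (fun x => @cvg_id _ _)).
Qed.

Let oWL : open WL.
Proof.
rewrite openE => Y WY; have /= := Ck_continuous (Ck_l 0 openT) (I : setT Y).
by apply; apply: open_nbhs_nbhs.
Qed.

Let Ck_VM k : Ck_on k WL VM.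
Proof. by apply: Ck_vmap => //; [exact: Ck_l|exact: Ck_r]. Qed.

Let oVU : open VU.
Proof.
rewrite openE => Y [WY VY]; apply: filterI; first exact: open_nbhs_nbhs.
have /= := Ck_continuous (Ck_VM 0) WY; apply; exact: open_nbhs_nbhs.
Qed.

Lemma derive_VM (Y h : 'rV[R]_(n + n)) : W (lsubmx Y) ->
  is_derive Y h VM (vmapl (lsubmx Y) (rsubmx Y) (lsubmx h) (rsubmx h)).
Proof.
move=> WY; apply: is_derive_vmap => //.
  exact: (is_derive_linear lsubmx).
exact: (is_derive_linear rsubmx).
Qed.

Lemma vgramE (Y u v : 'rV[R]_(n + n)) : W (lsubmx Y) -> mform (vgram Y) u v =
  mform (G (VM Y)) (vmapl (lsubmx Y) (rsubmx Y) (lsubmx u) (rsubmx u))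
    (vmapl (lsubmx Y) (rsubmx Y) (lsubmx v) (rsubmx v)).
Proof.
move=> WY; have JE (h : 'rV[R]_(n + n)) : h *m vjac Y = vmapl (lsubmx Y) (rsubmx Y) (lsubmx h) (rsubmx h).
  have [_ <-] := derive_VM h WY; rewrite (derive_rV_mx h oWL (Ck_VM 1) WY) mulmx_sum_row.
  by apply: eq_bigr => i _; rewrite rowK.
by rewrite /mform -!JE trmx_mul !mulmxA.
Qed.

Lemma vgram_sym (Y : 'rV[R]_(n + n)) : W (VM Y) -> (vgram Y)^T = vgram Y.
Proof.
move=> WV; rewrite /vgram !trmx_mul trmxK mulmxA.
by have -> // : (G (VM Y))^T = G (VM Y); case: sG => _ _ /(_ _ WV)[].
Qed.

Lemma Ck_vgram k : Ck_on k VU vgram.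
Proof.
have sub : VU `<=` WL by move=> Y [].
have CJ : Ck_on k VU vjac.
  apply: Ck_mx => // i j; under eq_fun do rewrite mxE.
  exact: ((Ck_mxP k _ oVU).1 (Ck_sub sub (Ck_derive (delta_mx 0 i) (Ck_VM k.+1)))).
apply: Ck_mulmx => //; last exact: Ck_trmx.
apply: Ck_mulmx => //; apply: (Ck_comp_mx oVU oW) => //; first by move=> Y [].
exact: Ck_sub sub (Ck_VM k).
Qed.

Let is_derive_mform_cst (u v : 'rV[R]_(n + n)) (F : R -> 'M[R]_(n + n)) (s : R) dF :
  is_derive s (1 : R) F dF -> is_derive s (1 : R) (fun s => mform (F s) u v) (mform dF u v).
Proof.
move=> hF; apply: is_derive_eq (is_derive_mform hF (is_derive_cst u s (1 : R))
  (is_derive_cst v s (1 : R))) _.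
by rewrite mform0l mform0r !addr0.
Qed.

Let row0D (y e : 'rV[R]_n) (s : R) : row_mx y 0 + s *: row_mx 0 e = row_mx y (s *: e).
Proof. by rewrite scale_row_mx add_row_mx scaler0 addr0 add0r. Qed.

Let norm_row (y e : 'rV[R]_n) (r : R) : `|y| <= r -> `|e| <= r -> `|row_mx y e| <= r.
Proof.
move=> h1 h2; apply: mx_norm_le => [|i j]; first exact: le_trans h1.
by rewrite mxE; case: splitP => k _; apply: le_trans (ler_mx_entry _ _ _) _.
Qed.

Section AtCenter.
Variables e w b : 'rV[R]_n.
Variables h u v Y0 : 'rV[R]_(n + n).
Hypotheses (hE : h = row_mx 0 e) (uE : u = row_mx w 0) (vE : v = row_mx 0 b).
Hypothesis Y0E : Y0 = row_mx c 0.
Let S := [set s : R | VU (Y0 + s *: h)].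

Let lY (s : R) : lsubmx (Y0 + s *: h) = c.
Proof. by rewrite Y0E hE row0D row_mxKl. Qed.

Let rY (s : R) : rsubmx (Y0 + s *: h) = s *: e.
Proof. by rewrite Y0E hE row0D row_mxKr. Qed.

Let VM_Y0 (s : R) : VM (Y0 + s *: h) = vmap c (s *: e).
Proof. by rewrite /VM lY rY. Qed.

Let S0 : S 0.
Proof.
by rewrite /S /= /VU /= VM_Y0 lY scale0r vmap0.
Qed.

Let oS : open S.
Proof.
apply: open_comp => // s _.
have [h1 _] : is_derive (Y0 + s *: h) h (id : 'rV[R]_(n + n) -> 'rV[R]_(n + n)) h.
  exact: is_derive_id.
exact: is_derive_cont (is_derive_line h1).
Qed.

Let gramE (s : R) p q : S s -> mform (vgram (Y0 + s *: h)) p q =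
  mform (G (vmap c (s *: e))) (vmapl c (s *: e) (lsubmx p) (rsubmx p))
    (vmapl c (s *: e) (lsubmx q) (rsubmx q)).
Proof. by move=> [Ws _]; rewrite (vgramE _ _ Ws) VM_Y0 lY rY. Qed.

Let dgram (s : R) : S s ->
  is_derive s (1 : R) (fun s : R => vgram (Y0 + s *: h)) ('D_h vgram (Y0 + s *: h)).
Proof. by move=> Ss; apply: is_derive_line; exact: (Ck_derivable h (Ck_vgram 1) Ss). Qed.

Lemma vgram_second : mform ('D_h ('D_h vgram) Y0) u u = 2 * curv c e w.
Proof.
have [dphi [d1 d2]] := second_variation_center e w.
have E (s : R) : S s -> dphi s = mform ('D_h vgram (Y0 + s *: h)) u u.
  move=> Ss; apply: is_derive_unique (is_derive_mform_cst u u (dgram Ss)).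
  apply: (is_derive_on_ext oS _ Ss (d1 s _)); last by case: Ss => _; rewrite VM_Y0.
  by move=> t St; rewrite (gramE _ _ St) uE row_mxKl row_mxKr.
have h2 := is_derive_on_ext oS E S0 d2.
have : is_derive (0 : R) (1 : R) (fun s : R => 'D_h vgram (Y0 + s *: h)) ('D_h ('D_h vgram) (Y0 + 0 *: h)).
  by apply: is_derive_line; exact: (Ck_derivable h (Ck_derive h (Ck_vgram 2)) S0).
move=> /(is_derive_mform_cst u u) h3.
by have := is_derive_unique h3 h2; rewrite scale0r addr0.
Qed.

Lemma vgram_mixed : mform ('D_h vgram Y0) u v = 0.
Proof.
have d1 := mixed_variation_center e w b.
have := is_derive_mform_cst u v (dgram S0); rewrite scale0r addr0 => h1.
apply: is_derive_unique h1 (is_derive_on_ext oS _ S0 d1).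
by move=> t St; rewrite (gramE _ _ St) uE vE !row_mxKl !row_mxKr.
Qed.

End AtCenter.

Let mform_diff (A A0 : 'M[R]_(n + n)) (u v : 'rV[R]_(n + n)) (m0 : R) :
  mform A0 u v = m0 -> mform A u v <= m0 + (n + n)%:R ^+ 2 * (`|A - A0| * `|u| * `|v|).
Proof.
move=> <-; rewrite -lerBlDl -mform_oppG -mform_addG.
exact: le_trans (ler_norm _) (mform_le _ _ _).
Qed.

Let dist_le (a b m t : R) : `|a - b| <= t -> b = m -> a <= m + t.
Proof. by move=> h <-; rewrite -lerBlDl; apply: le_trans h; exact: ler_norm. Qed.

Let unit_sym (s : R) : 0 <= s <= 1 -> -1 <= 2 * s - 1 <= 1.
Proof. by move=> /andP[? ?]; apply/andP; split; lra. Qed.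

Let variation_arith (d E A B f1 f2 k1 k2 l1 l2 cu m1 m2 : R) : 0 < d ->
  f1 + f2 - 2 * m1 <= 2 * cu + d * (E ^+ 2 * A ^+ 2) / 2 -> k1 - k2 <= d * E * A * B ->
  l1 <= m2 + d / 2 * B ^+ 2 -> l2 <= m2 + d / 2 * B ^+ 2 ->
  2^-1 * (f1 + 2 * 1 * k1 + 1 * l1 + (f2 + 2 * -1 * k2 + 1 * l2)) <=
  m1 + m2 + cu + d * (E ^+ 2 * A ^+ 2 + B ^+ 2).
Proof.
move=> d0 F K L1 L2; have sq := mulr_ge0 (ltW d0) (sqr_ge0 (E * A - B)).
have q : d * E * A * B <= d * (E ^+ 2 * A ^+ 2) / 2 + d / 2 * B ^+ 2.
  have -> : d * E * A * B = (d * (E ^+ 2 * A ^+ 2) + d * B ^+ 2 - d * (E * A - B) ^+ 2) / 2.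
    by field.
  by lra.
have q1 := mulr_ge0 (ltW d0) (mulr_ge0 (sqr_ge0 E) (sqr_ge0 A)).
have q2 := mulr_ge0 (ltW d0) (sqr_ge0 B).
by clear sq; lra.
Qed.

(** Averaging over [e] and [- e] removes what is odd in [e]. The pulled-back form is split into a
    base block, a mixed block and a fibre block, and each is compared with its jet at the center:
    the curvature for the second difference of the first, zero for the derivative of the second, the
    metric for the value of the third. The error is quadratic in the data, with a factor [d] as
    small as desired. *)
Lemma variation_estimate (d : R) : 0 < d -> exists2 r : R, 0 < r &
  forall y e, `|y - c| <= r -> `|e| <= r -> [/\ W y, W (vmap y e) &
  forall w b, 2^-1 * (mform (G (vmap y e)) (vmapl y e w b) (vmapl y e w b) +
      mform (G (vmap y (- e))) (vmapl y (- e) w (- b)) (vmapl y (- e) w (- b)))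
    <= mform (G y) w w + mform (G c) b b + curv c e w + d * (`|e| ^+ 2 * `|w| ^+ 2 + `|b| ^+ 2)].
Proof.
move=> d0; have [Y0 Y0E] : exists Y0 : 'rV[R]_(n + n), Y0 = row_mx c 0 by exists (row_mx c 0).
have UY0 : VU Y0 by rewrite Y0E; split; rewrite /= ?/VM ?row_mxKl ?row_mxKr ?vmap0.
pose K : R := (n + n)%:R ^+ 2 + 1; have K0 : 0 < K by rewrite ltr_wpDl// sqr_ge0.
have d1 : 0 < d / (2 * K) by rewrite divr_gt0// mulr_gt0.
have N1 := mform_near setT (Ck_continuous (Ck_vgram 0) UY0) (divr_gt0 d0 (ltr0n R 2)).
have N2 := derive_near oVU UY0 (Ck_vgram 1) d1.
have N3 := derive2_near oVU UY0 (Ck_vgram 2) d1.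
have [r /= r0 Hr] := (nbhs_ballP _ _).1 (filterI N1 (filterI N2 N3)).
exists (r / 2); first by rewrite divr_gt0.
move=> y e hy he.
have [Y YE] : exists Y : 'rV[R]_(n + n), Y = row_mx y 0 by exists (row_mx y 0).
have [h hE] : exists h : 'rV[R]_(n + n), h = row_mx 0 e by exists (row_mx 0 e).
have lY (s : R) : lsubmx (Y + s *: h) = y by rewrite YE hE row0D row_mxKl.
have rY (s : R) : rsubmx (Y + s *: h) = s *: e by rewrite YE hE row0D row_mxKr.
have he' : `|h| <= `|e| by rewrite hE; apply: norm_row; rewrite ?normr0.
have inb (s : R) : -1 <= s <= 1 -> ball Y0 r (Y + s *: h).
  move=> s1; rewrite -ball_normE /= distrC.
  have -> : Y + s *: h - Y0 = row_mx (y - c) (s *: e).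
    by rewrite YE hE row0D Y0E opp_row_mx add_row_mx subr0.
  apply: (@le_lt_trans _ _ (r / 2)); last by lra.
  apply: norm_row => //; rewrite normrZ; apply: le_trans he.
  by rewrite ler_piMl// ler_norml.
have i1 : -1 <= (1 : R) <= 1 by apply/andP; split; lra.
have i0 : -1 <= (0 : R) <= 1 by apply/andP; split; lra.
have im1 : -1 <= (-1 : R) <= 1 by apply/andP; split; lra.
have [_ [[Uy1 _] _]] := Hr _ (inb _ i1).
have [Wy Vy] := Uy1; rewrite /VM lY rY scale1r in Vy.
rewrite lY in Wy; split=> // w b.
have [u uE] : exists u : 'rV[R]_(n + n), u = row_mx w 0 by exists (row_mx w 0).
have [v vE] : exists v : 'rV[R]_(n + n), v = row_mx 0 b by exists (row_mx 0 b).
have hu : `|u| <= `|w| by rewrite uE; apply: norm_row; rewrite ?normr0.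
have hv : `|v| <= `|b| by rewrite vE; apply: norm_row; rewrite ?normr0.
pose f (s : R) := mform (vgram (Y + s *: h)) u u.
pose k (s : R) := mform (vgram (Y + s *: h)) u v.
pose l (s : R) := mform (vgram (Y + s *: h)) v v.
(* Displacement s e and its velocity s b are scaled together, so that s = 1 and s = -1 give the two
   terms of the average. *)
have QE (s : R) : -1 <= s <= 1 ->
    mform (G (vmap y (s *: e))) (vmapl y (s *: e) w (s *: b)) (vmapl y (s *: e) w (s *: b)) =
    f s + 2 * s * k s + s ^+ 2 * l s.
  move=> /inb/Hr[_ [[_ _] [[Ws Vs] _]]].
  have sym : (vgram (Y + s *: h))^T = vgram (Y + s *: h).
    by apply: vgram_sym.
  have -> : f s + 2 * s * k s + s ^+ 2 * l s =
      mform (vgram (Y + s *: h)) (u + s *: v) (u + s *: v).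
    rewrite mformDl !mformDr !mformZl !mformZr (mformC v u sym) /f /k /l.
    by move: (mform _ _ _) (mform _ _ _) (mform _ _ _) => a1 a2 a3; ring.
  rewrite (vgramE _ _ Ws) /VM lY rY.
  by rewrite uE vE scale_row_mx add_row_mx scaler0 addr0 add0r row_mxKl row_mxKr.
have := QE 1 i1; rewrite !scale1r => ->.
have := QE (-1) im1; rewrite !scaleN1r => ->.
have f0 : f 0 = mform (G y) w w.
  have := QE 0 i0; rewrite !scale0r vmap0 vmapl0 => ->; ring.
have F2 : f 1 + f (-1) - 2 * f 0 <= 2 * curv c e w + d * (`|e| ^+ 2 * `|w| ^+ 2) / 2.
  apply: (@second_diff_le R f (fun s => mform ('D_h vgram (Y + s *: h)) u u)
     (fun s => mform ('D_h ('D_h vgram) (Y + s *: h)) u u)).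
  - move=> s s1; have [_ [[Us _] _]] := Hr _ (inb s s1).
    apply: is_derive_mform_cst; apply: is_derive_line; exact: (Ck_derivable h (Ck_vgram 1) Us).
  - move=> s s1; have [_ [[Us _] _]] := Hr _ (inb s s1).
    apply: is_derive_mform_cst; apply: is_derive_line.
    exact: (Ck_derivable h (Ck_derive h (Ck_vgram 2)) Us).
  move=> s s1; have [_ [_ [_ /(_ h) D2]]] := Hr _ (inb s s1).
  have M0 : mform ('D_h ('D_h vgram) Y0) u u = 2 * curv c e w by exact: (vgram_second hE uE Y0E).
  apply: le_trans (mform_diff ('D_h ('D_h vgram) (Y + s *: h)) M0) _.
  apply: lerD; first exact: lexx.
  apply: (@le_trans _ _ ((n + n)%:R ^+ 2 * (d / (2 * K) * `|e| ^+ 2 * `|w| * `|w|))).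
    rewrite ler_wpM2l ?sqr_ge0// !ler_pM ?mulr_ge0//.
    by apply: le_trans D2 _; rewrite ler_wpM2l ?(ltW d1)// ler_sqr ?nnegrE.
  have -> : (n + n)%:R ^+ 2 * (d / (2 * K) * `|e| ^+ 2 * `|w| * `|w|) =
      ((n + n)%:R ^+ 2 / K) * (d * (`|e| ^+ 2 * `|w| ^+ 2) / 2).
    by field; rewrite gt_eqF.
  rewrite ler_piMl// ?ler_pdivrMr ?mul1r ?lerDl//.
  by rewrite divr_ge0// !mulr_ge0// ?sqr_ge0// ltW.
(* Only the difference of the mixed terms occurs in the average, and the derivative of the mixed
   block along [h] vanishes at the center. *)
have K1 : k 1 - k (-1) <= d * `|e| * `|w| * `|b|.
  have [s s1|s s1] := @line_MVT R _ (fun Z => mform (vgram Z) u v) (Y - h) (2 *: h).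
    have s2 := unit_sym s1.
    have := Hr _ (inb _ s2); have -> : Y - h + s *: (2 *: h) = Y + (2 * s - 1) *: h.
      by rewrite scalerBl scale1r scalerA mulrC -addrA [- h + _]addrC.
    move=> [_ [[Us _] _]].
    have [+ _] := is_derive_mform (DeriveDef (Ck_derivable (2 *: h) (Ck_vgram 1) Us) erefl)
      (is_derive_cst u _ (2 *: h)) (is_derive_cst v _ (2 *: h)).
    exact.
  have s2 := unit_sym s1.
  have -> : Y - h + s *: (2 *: h) = Y + (2 * s - 1) *: h.
    by rewrite scalerBl scale1r scalerA mulrC -addrA [- h + _]addrC.
  have -> : Y - h + 2 *: h = Y + 1 *: h by rewrite scale1r scaler_nat mulr2n addrA subrK.
  have -> : Y - h = Y + (-1) *: h by rewrite scaleN1r.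
  move=> KE; have {}KE : k 1 - k (-1) = _ := KE; rewrite KE {KE}.
  have [_ [[Us /(_ h) D1] _]] := Hr _ (inb _ s2).
  have dm : is_derive (Y + (2 * s - 1) *: h) h (fun Z => mform (vgram Z) u v)
      (mform ('D_h vgram (Y + (2 * s - 1) *: h)) u v).
    apply: is_derive_eq (is_derive_mform (DeriveDef (Ck_derivable h (Ck_vgram 1) Us) erefl)
      (is_derive_cst u _ h) (is_derive_cst v _ h)) _.
    by rewrite mform0l mform0r !addr0.
  have [dm1 dm2] := dm; have [_ ->] := is_derive_scale 2 dm1; rewrite dm2.
  have M0 : mform ('D_h vgram Y0) u v = 0 by exact: (vgram_mixed hE uE vE Y0E).
  have D3 := mform_diff ('D_h vgram (Y + (2 * s - 1) *: h)) M0.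
  apply: (@le_trans _ _ (2 * ((n + n)%:R ^+ 2 * (d / (2 * K) * `|e| * `|w| * `|b|)))).
    rewrite ler_wpM2l//; apply: le_trans D3 _; rewrite add0r.
    rewrite ler_wpM2l ?sqr_ge0// !ler_pM ?mulr_ge0//.
    by apply: le_trans D1 _; rewrite ler_wpM2l ?(ltW d1).
  have -> : 2 * ((n + n)%:R ^+ 2 * (d / (2 * K) * `|e| * `|w| * `|b|)) =
      ((n + n)%:R ^+ 2 / K) * (d * `|e| * `|w| * `|b|).
    by field; rewrite gt_eqF.
  rewrite ler_piMl// ?ler_pdivrMr ?mul1r ?lerDl//.
  by rewrite !mulr_ge0// ltW.
have L (s : R) : -1 <= s <= 1 -> l s <= mform (G c) b b + d / 2 * `|b| ^+ 2.
  move=> s1; have [/(_ v v) h1 _] := Hr _ (inb s s1).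
  have E : mform (vgram Y0) v v = mform (G c) b b.
    have [Wc' _] := UY0; rewrite vgramE// /VM Y0E vE !row_mxKl !row_mxKr vmap0.
    by have := vmapl_fibre 0 0 b; rewrite !scale0r subr0 => ->.
  apply: le_trans (dist_le h1 E) _; apply: lerD; first exact: lexx.
  by rewrite ler_wpM2l ?divr_ge0 ?(ltW d0)// expr2 ler_pM.
rewrite sqrrN expr1n; rewrite f0 in F2.
exact: variation_arith d0 F2 K1 (L 1 i1) (L _ im1).
Qed.

End Center.
End Variation.

(** * Variations of curves *)

Section CurveVariation.
Context {R : realType} {n : nat} {M : topologicalType} (g : riemannian R n M).
Variable z : M.
Let c := chart g z z.
Let W := cod g z.
Let G := metric g z.
Let sG : smooth_metric W G := smooth_metric_cod g z.
Let Wc : W c. Proof. exact/cod_chart/chart_dom_center. Qed.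

Definition vpt (y e : 'rV[R]_n) : M := chart_inv g z (vmap G c y e).

(** The mean of the 2 n speeds is at most their quadratic mean, and n (n + K) <= (n + K / 2)^2. This
    is the passage from energies to lengths. *)
Lemma mean_speed_le (x y : 'I_n -> R) (rho K : R) : 0 <= rho -> 0 <= K ->
  \sum_k 2^-1 * (x k ^+ 2 + y k ^+ 2) <= rho ^+ 2 * (n%:R + K) ->
  \sum_k 2^-1 * (x k + y k) <= rho * (n%:R + K / 2).
Proof.
move=> r0 K0 H; have nn : 0 <= n%:R :> R by [].
apply: le_trans (ler_norm _) _; rewrite -sqrtr_sqr.
have h0 : 0 <= rho * (n%:R + K / 2) by rewrite mulr_ge0// addr_ge0// divr_ge0.
rewrite -[leRHS](ger0_norm h0) -[leRHS]sqrtr_sqr; apply: ler_wsqrtr.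
apply: le_trans (sqr_sum_le _) _.
apply: (@le_trans _ _ (n%:R * (rho ^+ 2 * (n%:R + K)))).
  apply: ler_wpM2l => //; apply: le_trans H; apply: ler_sum => k _.
  move: (x k) (y k) => a b; rewrite -subr_ge0.
  have -> : 2^-1 * (a ^+ 2 + b ^+ 2) - (2^-1 * (a + b)) ^+ 2 = (2^-1 * (a - b)) ^+ 2 by field.
  exact: sqr_ge0.
rewrite exprMn mulrCA ler_wpM2l ?sqr_ge0// -subr_ge0.
have -> : (n%:R + K / 2) ^+ 2 - n%:R * (n%:R + K) = (K / 2) ^+ 2 by field.
exact: sqr_ge0.
Qed.

Section Piece.
Variables (r : R) (gam : R -> M) (S : R -> R).
Hypothesis Cg : C1_curve g gam.
Hypothesis dS : forall t : R, -1 < t -> is_derive t (1 : R) S (speed g gam (clamp t)).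
Hypothesis hz : forall t : R, 0 <= t <= 1 ->
  chart_dom g z (gam t) /\ `|chart g z (gam t) - c| <= r.
Hypothesis hr : forall y e, `|y - c| <= r -> `|e| <= r -> W y /\ W (vmap G c y e).

Lemma varied_curve (A D : 'rV[R]_n) (l0 : R) :
  let e t := A + (l0 + S t - S 0) *: D in
  (forall t : R, 0 <= t <= 1 -> `|e t| <= r) ->
  let gam' t := vpt (chart g z (gam t)) (e t) in
  C1_curve g gam' /\ forall t : R, 0 <= t <= 1 ->
    let w := 'D_1 (chart g z \o gam) t in mform (G (chart g z (gam t))) w w = speed g gam t ^+ 2 /\
    let X := vmapl G c (chart g z (gam t)) (e t) w (speed g gam t *: D) in
    speed g gam' t ^+ 2 = mform (G (vmap G c (chart g z (gam t)) (e t))) X X.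
Proof.
move=> e he; set gam' := fun t => _.
pose y := chart g z \o gam.
have posQ q u : W q -> 0 <= mform (G q) u u by move=> Wq; exact: posdef_ge0 (metric_posdefP Wq).
have de (t : R) : -1 < t -> is_derive t (1 : R) e (speed g gam (clamp t) *: D).
  move=> t1; apply: is_derive_mx => i j.
  have -> : (fun t => e t i j) = (fun t => A i j + (l0 + S t - S 0) * D i j).
    by apply/funext => s; rewrite !mxE.
  have h1 : is_derive t (1 : R) (fun t => l0 + S t - S 0) (speed g gam (clamp t)).
    apply: is_derive_eq (is_deriveB (is_deriveD (is_derive_cst l0 t (1 : R)) (dS t1))
      (is_derive_cst (S 0) t (1 : R))) _.
    by rewrite add0r subr0.
  apply: is_derive_eq (is_deriveD (is_derive_cst (A i j) t (1 : R))
    (is_derive_mulr h1 (is_derive_cst (D i j) t (1 : R)))) _.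
  by rewrite mulr0 addr0 add0r mxE.
have oV : open [set t : R | -1 < t] by exact: open_gt.
have Ce : Ck_on 1 [set t : R | -1 < t] e.
  refine (C1_curve_real oV (df := fun t => speed g gam (clamp t) *: D) _ _).
  move=> t _; suff H : speed g gam (clamp x) *: D @[x --> t] --> speed g gam (clamp t) *: D by exact: H.
  apply: cvgZr_tmp; exact: speed_clamp_continuous.
have loc (t : R) : 0 <= t <= 1 -> exists U : set R, [/\ open U, U t, Ck_on 1 U y, Ck_on 1 U e &
    forall s, U s -> W (y s)].
  move=> t01; have [zt _] := hz t01; have [U [oU Ut CU US]] := C1_local Cg t01 zt.
  exists (U `&` [set t : R | -1 < t]); split.
  - exact: openI.
  - by split=> //=; move/andP: t01 => [? ?]; lra.
  - by apply: Ck_sub CU => s [].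
  - by apply: Ck_sub Ce => s [].
  by move=> s [/US Us _]; exact: cod_chart.
have W' (t : R) : 0 <= t <= 1 -> W (vmap G c (y t) (e t)).
  by move=> t01; have [_ h] := hz t01; have [_] := hr h (he t t01).
have CC : forall t : R, 0 <= t <= 1 -> cod g z (vmap G c (y t) (e t)) /\
     exists U : set R, [/\ open U, U t & Ck_on 1 U (fun t => vmap G c (y t) (e t))].
  move=> t t01; split; first exact: W'.
  have [U [oU Ut Cy CeU UW]] := loc t t01; exists U; split; [exact: oU|exact: Ut|idtac].
  exact: (Ck_vmap sG Wc oU UW Cy CeU).
have [C1 sp] := chart_curve CC; split; first exact: C1.
move=> t t01; have [U [oU Ut Cy CeU UW]] := loc t t01.
have [zt _] := hz t01.
have dy : is_derive t (1 : R) y ('D_1 y t).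
  by split; [exact: (Ck_derivable (1 : R) Cy Ut)|].
split.
  by rewrite (speed_chart Cg t01 zt) sqr_sqrtr//; apply: posQ; exact: UW.
have t1 : -1 < t by move/andP: t01 => [? ?]; lra.
have := de t t1; rewrite clamp_id// => de'.
have [_ D1] := is_derive_vmap sG Wc (UW _ Ut) dy de'.
rewrite /gam' /vpt sp//= D1 sqr_sqrtr//.
by apply: posQ; exact: W'.
Qed.

End Piece.

Variables (r d0 d1 : R).
Hypothesis hr : forall y e, `|y - c| <= r -> `|e| <= r -> W y /\ W (vmap G c y e).
Hypothesis hd : forall x l, wd g z x l -> l <= d1 -> chart_dom g z x /\ `|chart g z x - c| <= r.
Variables (A D : 'I_n -> 'rV[R]_n) (L K : R).
Let e k (l : R) := A k + l *: D k.
Hypothesis K0 : 0 <= K.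
Hypothesis he : forall k (l : R), 0 <= l <= L -> `|e k l| <= r.
Hypothesis var : forall y w (l rho : R), `|y - c| <= r -> 0 <= l <= L -> 0 <= rho ->
  mform (G y) w w = rho ^+ 2 ->
  let X s k := vmapl G c y (s *: e k l) w (s *: (rho *: D k)) in
  \sum_k 2^-1 * (mform (G (vmap G c y (1 *: e k l))) (X 1 k) (X 1 k)
     + mform (G (vmap G c y ((-1) *: e k l))) (X (-1) k) (X (-1) k)) <= rho ^+ 2 * (n%:R + K).
Let X (s : R) k (x : M) (l : R) := vpt (chart g z x) (s *: e k l).

Let sgn_scale (s : R) k (l : R) : s *: e k l = s *: A k + l *: (s *: D k).
Proof. by rewrite /e scalerDr !scalerA mulrC. Qed.

(** The pointwise inequality [var], converted to speeds by [mean_speed_le], says that the mean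
    length of the varied arcs minus n + K / 2 times the arclength is nonincreasing in time. *)
Lemma vary_curve (gam : R -> M) (a dl l0 : R) : C1_curve g gam -> curve_length g gam = a%:E ->
  wd g z (gam 0) dl -> dl + a <= d1 -> 0 <= l0 -> l0 + a <= L ->
  exists l1 l2 : 'I_n -> R,
   (forall k, wd g (X 1 k (gam 0) l0) (X 1 k (gam 1) (l0 + a)) (l1 k) /\
      wd g (X (-1) k (gam 0) l0) (X (-1) k (gam 1) (l0 + a)) (l2 k)) /\
   \sum_k 2^-1 * (l1 k + l2 k) <= a * (n%:R + K / 2).
Proof.
move=> Cg ga zg da l00 l0a; have [S [dS]] := arclength Cg; rewrite ga => -[aE].
have S01 (t : R) : 0 <= t <= 1 -> 0 <= S t - S 0 <= a.
  move=> /andP[t0 t1]; rewrite aE subr_ge0 lerD2r.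
  by rewrite (arclength_mono dS (lexx 0) t0) (arclength_mono dS t0 t1).
have hz (t : R) : 0 <= t <= 1 -> chart_dom g z (gam t) /\ `|chart g z (gam t) - c| <= r.
  move=> t01; apply: (hd (l := dl + a)) => //.
  have /andP[t0 t1] := t01; have /andP[S0 S1] := S01 t t01.
  have [t00|tn0] := eqVneq t 0.
    by rewrite t00; apply: wd_le zg; rewrite lerDl; exact: le_trans S1.
  have h0 : 0 <= (0 : R) <= 1 by apply/andP; split; lra.
  have := subcurve Cg h0 _ dS; rewrite -[in X in _ -> X](add0r t) => /(_ t).
  rewrite add0r gtr0_sg ?mul1r ?lt_def ?tn0// => /(_ t01)/path_wd h.
  by apply: wd_le (wd_trans zg h); rewrite lerD2l.
have es (s : R) k (t : R) : `|s| = 1 -> 0 <= t <= 1 ->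
    `|s *: A k + (l0 + S t - S 0) *: (s *: D k)| <= r.
  move=> s1 t01; rewrite -sgn_scale normrZ s1 mul1r; apply: he.
  by have /andP[] := S01 t t01; move: (S t) (S 0) => *; apply/andP; split; lra.
pose cv (s : R) k t := vpt (chart g z (gam t)) (s *: A k + (l0 + S t - S 0) *: (s *: D k)).
have V (s : R) k (s1 : `|s| = 1) := varied_curve Cg dS hz hr (fun t => @es s k t s1).
have T (s : R) k : `|s| = 1 -> exists T : R -> R,
    (forall t : R, 0 <= t <= 1 -> is_derive t (1 : R) T (speed g (cv s k) t)) /\
    wd g (X s k (gam 0) l0) (X s k (gam 1) (l0 + a)) (T 1 - T 0).
  move=> s1; have [C1 _] := V s k s1; have [T [dT /path_wd h]] := arclength01 C1.
  exists T; split; first exact: dT.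
  have E0 : X s k (gam 0) l0 = cv s k 0 by rewrite /X /cv sgn_scale addrK.
  have E1 : X s k (gam 1) (l0 + a) = cv s k 1 by rewrite /X /cv sgn_scale aE addrA.
  by rewrite E0 E1.
have n1 : `|1 : R| = 1 by rewrite normr1.
have nm1 : `|-1 : R| = 1 by rewrite normrN1.
have /choice[T1 H1] := fun k => T 1 k n1; have /choice[T2 H2] := fun k => T (-1) k nm1.
exists (fun k => T1 k 1 - T1 k 0), (fun k => T2 k 1 - T2 k 0).
split; first by move=> k; split; [exact: (H1 k).2|exact: (H2 k).2].
pose f t := \sum_k 2^-1 * (T1 k t + T2 k t) - S t * (n%:R + K / 2).
suff : f 1 <= f 0.
  rewrite /f aE mulrBl.
  have -> : \sum_k 2^-1 * (T1 k 1 - T1 k 0 + (T2 k 1 - T2 k 0)) =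
     \sum_k 2^-1 * (T1 k 1 + T2 k 1) - \sum_k 2^-1 * (T1 k 0 + T2 k 0).
    by rewrite -sumrB; apply: eq_bigr => k _; ring.
  by move: (\sum_k _) (\sum_k _) (_ * _) (_ * _) => *; lra.
pose sp s k t := speed g (cv s k) t.
apply: (@ler_derive01 R f (fun t => \sum_k 2^-1 * (sp 1 k t + sp (-1) k t) - speed g gam t * (n%:R + K / 2))).
  move=> t t01; have t1 : -1 < t by move/andP: t01 => [? ?]; lra.
  have := dS t t1; rewrite clamp_id// => dSt.
  apply: is_deriveB.
    apply: is_derive_sumr => k.
    apply: is_derive_eq (is_derive_mulr (is_derive_cst (2^-1 : R) t (1 : R))
      (is_deriveD ((H1 k).1 t t01) ((H2 k).1 t t01))) _.
    by rewrite mul0r add0r.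
  apply: is_derive_eq (is_derive_mulr dSt (is_derive_cst (n%:R + K / 2) t (1 : R))) _.
  by rewrite mulr0 addr0.
move=> t t01; rewrite subr_le0; apply: mean_speed_le => //; first exact: speed_ge0.
have hl : 0 <= l0 + S t - S 0 <= L.
  by have /andP[] := S01 t t01; move: (S t) (S 0) => *; apply/andP; split; lra.
have [zt ht] := hz t t01.
pose w := 'D_1 (chart g z \o gam) t.
have ww : mform (G (chart g z (gam t))) w w = speed g gam t ^+ 2.
  rewrite (speed_chart Cg t01 zt) sqr_sqrtr//.
  exact: posdef_ge0 (metric_posdefP (cod_chart zt)).
apply: le_trans (var ht hl (speed_ge0 _ _ _) ww).
  apply: ler_sum => k _; rewrite ler_wpM2l ?invr_ge0//.
  have sE (s : R) : `|s| = 1 -> sp s k t ^+ 2 =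
      let X := vmapl G c (chart g z (gam t)) (s *: e k (l0 + S t - S 0)) w
         (s *: (speed g gam t *: D k)) in
      mform (G (vmap G c (chart g z (gam t)) (s *: e k (l0 + S t - S 0)))) X X.
    move=> s1; have [_ /(_ t t01)[_ ->]] := V s k s1.
    by rewrite sgn_scale !scalerA [s * _]mulrC.
  have aux (x y : R) : x = y -> x <= y by move->.
  by apply: lerD; [exact: (aux _ _ (sE 1 n1))|exact: (aux _ _ (sE (-1) nm1))].
Qed.

(** In the induction over the pieces, [l0] is the arclength already travelled, which fixes the
    displacement at the joints, and [dl] bounds the distance from the chart center. *)
Lemma vary_path p q a : path g p q a -> forall dl l0,
  wd g z p dl -> dl + a <= d1 -> 0 <= l0 -> l0 + a <= L ->
  exists l1 l2 : 'I_n -> R,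
   (forall k, wd g (X 1 k p l0) (X 1 k q (l0 + a)) (l1 k) /\
      wd g (X (-1) k p l0) (X (-1) k q (l0 + a)) (l2 k)) /\
   \sum_k 2^-1 * (l1 k + l2 k) <= a * (n%:R + K / 2).
Proof.
move: p q a; apply: path_ind.
  move=> p dl l0 _ _ _ _; exists (fun=> 0), (fun=> 0); rewrite addr0; split.
    by move=> k; split; exact: wd_refl.
  by rewrite big1 ?mul0r// => k _; rewrite addr0 mulr0.
move=> gam q a b Cg a0 ga pq IH dl l0 zg dab l00 lab.
have b0 := path_ge0 pq.
have [||l1 [l2 [H1 S1]]] := vary_curve Cg ga zg _ l00 _; [lra|lra|].
have zg1 : wd g z (gam 1) (dl + a).
  by apply: wd_trans zg _; exact/path_wd/path_curve.
have [|||m1 [m2 [H2 S2]]] := IH _ (l0 + a) zg1; [lra|lra|lra|].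
exists (fun k => l1 k + m1 k), (fun k => l2 k + m2 k); split.
  move=> k; rewrite addrA; have [h1 h2] := H1 k; have [h3 h4] := H2 k.
  by split; [exact: wd_trans h1 h3|exact: wd_trans h2 h4].
rewrite mulrDl; apply: le_trans (lerD S1 S2); rewrite -big_split /=.
by apply: ler_sum => k _; rewrite -mulrDr addrACA.
Qed.
End CurveVariation.

(** * Curvature *)

Section Curvature.
Context {R : realType} {n : nat}.
Variables (W : set 'rV[R]_n) (G : 'rV[R]_n -> 'M[R]_n).
Hypothesis sG : smooth_metric W G.
Variable c : 'rV[R]_n.
Hypothesis Wc : W c.
Implicit Types (u v w e y : 'rV[R]_n).

Let oW : open W. Proof. by case: sG. Qed.
Let CG k : Ck_on k W G. Proof. by case: sG. Qed.
Let pG : posdef (G c). Proof. by case: sG => _ _; apply. Qed.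

Lemma christoffelC y k i j : W y -> christoffel G k i j y = christoffel G k j i y.
Proof.
move=> Wy; rewrite /christoffel; congr (_ * _); apply: eq_bigr => l _; congr (_ * _).
have -> : pderiv l (fun z => G z i j) y = pderiv l (fun z => G z j i) y.
  apply: (derive_on_ext _ oW _ Wy).2 => z Wz.
  by have [_ _ /(_ _ Wz)[+ _]] := sG => /matrixP/(_ i j); rewrite mxE.
by rewrite [X in X - _]addrC.
Qed.

Lemma dgam2C h u v : dgam2 G c h u v = dgam2 G c h v u.
Proof.
apply/rowP => k; rewrite !mxE exchange_big; apply: eq_bigr => i _; apply: eq_bigr => j _ /=.
have -> : 'D_h (christoffel G k j i) c = 'D_h (christoffel G k i j) c.
  by apply: (derive_on_ext _ oW _ Wc).2 => z Wz; exact: christoffelC.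
by rewrite mulrAC.
Qed.

(* R(e, w) u *)
Definition rvec e w u : 'rV[R]_n := dgam2 G c e w u - dgam2 G c w e u
  + gam2 G c e (gam2 G c w u) - gam2 G c w (gam2 G c e u).

Lemma curv_rvec e w : curv G c e w = mform (G c) w (rvec e w e).
Proof. by rewrite /curv /rvec (dgam2C e w e) (gam2C sG Wc w e). Qed.

Lemma dgam2E h u v q : dgam2 G c h u v 0 q =
  \sum_k \sum_j \sum_i h 0 k * u 0 j * v 0 i * pderiv k (christoffel G q j i) c.
Proof.
rewrite mxE exchange_big /=.
transitivity (\sum_j \sum_k \sum_i h 0 k * u 0 j * v 0 i * pderiv k (christoffel G q j i) c); last first.
  exact: exchange_big.
rewrite exchange_big; apply: eq_bigr => j _ /=; rewrite exchange_big; apply: eq_bigr => i _ /=.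
rewrite (derive_rV h oW (smooth_christoffel sG q j i 1) Wc) !mulr_suml.
by apply: eq_bigr => k _; rewrite /pderiv; ring.
Qed.

Lemma gam2gam2E e w u q : gam2 G c e (gam2 G c w u) 0 q =
  \sum_k \sum_j \sum_i e 0 k * w 0 j * u 0 i *
    \sum_p christoffel G q k p c * christoffel G p j i c.
Proof.
rewrite mxE; apply: eq_bigr => k _.
transitivity (\sum_p \sum_j \sum_i e 0 k * w 0 j * u 0 i * (christoffel G q k p c * christoffel G p j i c)).
  apply: eq_bigr => p _; rewrite mxE mulr_sumr; apply: eq_bigr => j _.
  by rewrite mulr_sumr; apply: eq_bigr => i _; ring.
rewrite exchange_big; apply: eq_bigr => j _ /=; rewrite exchange_big; apply: eq_bigr => i _ /=.
by rewrite mulr_sumr.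
Qed.

Lemma rvecE e w u q : rvec e w u 0 q =
  \sum_k \sum_j \sum_i e 0 k * w 0 j * u 0 i * riemann G q i k j c.
Proof.
have sw (F : 'I_n -> 'I_n -> 'I_n -> R) :
    \sum_k \sum_j \sum_i w 0 k * e 0 j * u 0 i * F k j i =
    \sum_k \sum_j \sum_i e 0 k * w 0 j * u 0 i * F j k i.
  rewrite exchange_big; apply: eq_bigr => k _; apply: eq_bigr => j _; apply: eq_bigr => i _.
  by ring.
have -> : rvec e w u 0 q = dgam2 G c e w u 0 q - dgam2 G c w e u 0 q
  + gam2 G c e (gam2 G c w u) 0 q - gam2 G c w (gam2 G c e u) 0 q.
  by rewrite /rvec; move: (dgam2 _ _ _ _ _) (dgam2 _ _ _ _ _) (gam2 _ _ _ _) (gam2 _ _ _ _) => *; rewrite !mxE.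
rewrite !dgam2E !gam2gam2E.
rewrite (sw (fun k j i => pderiv k (christoffel G q j i) c)).
rewrite (sw (fun k j i => \sum_p christoffel G q k p c * christoffel G p j i c)).
rewrite -!sumrB -big_split -sumrB; apply: eq_bigr => k _ /=.
rewrite -!sumrB -big_split -sumrB; apply: eq_bigr => j _ /=.
rewrite -!sumrB -big_split -sumrB; apply: eq_bigr => i _ /=.
rewrite /riemann sumrB.
by move: (\sum_p _) (\sum_p _) (pderiv _ _ _) (pderiv _ _ _) => *; ring.
Qed.

(** The function g(u, v), for constant [u] and [v], has symmetric second derivatives. Expanding both
    orders by metric compatibility leaves exactly the two curvature terms. *)
Lemma rvec_antisym e w u v : mform (G c) (rvec e w u) v = - mform (G c) u (rvec e w v).
Proof.
pose f y := mform (G y) u v.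
have df y h : W y -> is_derive y h f (mform (G y) (gam2 G y h u) v + mform (G y) u (gam2 G y h v)).
  move=> Wy; have dG := DeriveDef (Ck_derivable h (CG 1) Wy) erefl.
  apply: is_derive_eq (is_derive_mform dG (is_derive_cst u y h) (is_derive_cst v y h)) _.
  by rewrite mform0l mform0r !addr0; exact: (metric_compat sG Wy).
have dgam h p q : is_derive c h (fun y => gam2 G y p q) (dgam2 G c h p q).
  apply: is_derive_eq (is_derive_gam2 sG Wc (is_derive_id c h) (is_derive_cst p c h) (is_derive_cst q c h)) _.
  by rewrite gam20l gam20r !addr0.
have d2 h k : 'D_h ('D_k f) c =
    mform (G c) (gam2 G c h (gam2 G c k u)) v + mform (G c) (gam2 G c k u) (gam2 G c h v)
    + mform (G c) (dgam2 G c h k u) v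
    + (mform (G c) (gam2 G c h u) (gam2 G c k v) + mform (G c) u (gam2 G c h (gam2 G c k v))
    + mform (G c) u (dgam2 G c h k v)).
  have E y : W y -> mform (G y) (gam2 G y k u) v + mform (G y) u (gam2 G y k v) = 'D_k f y.
    by move=> Wy; have [_ ->] := df y k Wy.
  have dG := DeriveDef (Ck_derivable h (CG 1) Wc) erefl.
  have h1 := is_derive_mform dG (dgam h k u) (is_derive_cst v c h).
  have h2 := is_derive_mform dG (is_derive_cst u c h) (dgam h k v).
  have [_ e2] := is_derive_on_ext oW E Wc (is_deriveD h1 h2).
  apply: etrans e2 _; rewrite /cst -!/(dform _ _ _ _ _) !(metric_compat sG Wc) mform0l mform0r !addr0.
  by [].
have CF : Ck_on 2 W f.
  apply: (@Ck_ext _ _ _ _ _ (fun y => \sum_i \sum_j u 0 i * G y i j * v 0 j)) => //.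
    by move=> y _; rewrite /f mformE.
  apply: Ck_sum => // i; apply: Ck_sum => // j.
  apply: Ck_mul => //; last exact: Ck_cst.
  apply: Ck_mul => //; first exact: Ck_cst.
  exact: ((Ck_mxP 2 G oW).1 (CG 2)).
have := Schwarz e w oW CF Wc; rewrite !d2.
rewrite /rvec !mformDl !mformDr !mformNl !mformNr.
move: (mform _ _ _) (mform _ _ _) (mform _ _ _) (mform _ _ _) (mform _ _ _) (mform _ _ _)
  (mform _ _ _) (mform _ _ _) (mform _ _ _) (mform _ _ _) => *; lra.
Qed.

Definition rmat w : 'M[R]_n := \matrix_(k, q) \sum_j \sum_i w 0 j * w 0 i * riemann G q i k j c.

Lemma rvec_rmat e w : rvec e w w = e *m rmat w.
Proof.
apply/rowP => q; rewrite rvecE mxE; apply: eq_bigr => k _; rewrite mxE mulr_sumr.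
by apply: eq_bigr => j _; rewrite mulr_sumr; apply: eq_bigr => i _; ring.
Qed.

Definition curvmx w : 'M[R]_n := - (G c *m (rmat w)^T).

(** Antisymmetry moves [e] out of the last argument of the curvature. What remains, [rvec e w w], is
    linear in [e], so the expression is a bilinear form in [e] and can be traced over a frame. *)
Lemma curv_form e w : curv G c e w = mform (curvmx w) e e.
Proof.
rewrite curv_rvec mformC; last exact: pG.1.
rewrite rvec_antisym rvec_rmat /curvmx mform_oppG; congr (- _).
by rewrite /mform trmx_mul !mulmxA.
Qed.

Lemma curv_trace (E : 'M[R]_n) w : E *m G c *m E^T = 1%:M ->
  \sum_k curv G c (row k E) w = - mform (ricci_mx G c) w w.
Proof.
move=> EE; under eq_bigr do rewrite curv_form.
have trN (A : 'M[R]_n) : \tr (- A) = - \tr A by exact: raddfN.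
rewrite (mform_trace _ EE) /curvmx mulmxN trN mulmxA mulVmx ?posdef_unit//.
rewrite mul1mx mxtrace_tr; congr (- _); rewrite mformE.
transitivity (\sum_k \sum_j \sum_i w 0 j * w 0 i * riemann G k i k j c).
  by apply: eq_bigr => k _; rewrite mxE.
rewrite exchange_big [RHS]exchange_big; apply: eq_bigr => j _ /=.
rewrite exchange_big; apply: eq_bigr => i _ /=.
by rewrite mxE mulr_sumr mulr_suml; apply: eq_bigr => k _; ring.
Qed.

Lemma curvmx_le : exists2 K : R, 0 <= K & forall w, `|curvmx w| <= K * `|w| ^+ 2.
Proof.
pose K0 : R := \sum_q \sum_k \sum_j \sum_i `|riemann G q i k j c|.
have K00 : 0 <= K0.
  by apply: sumr_ge0 => q _; apply: sumr_ge0 => k _; apply: sumr_ge0 => j _; apply: sumr_ge0.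
exists (n%:R * (`|G c| * K0)); first by rewrite !mulr_ge0.
move=> w; rewrite /curvmx normrN; apply: le_trans (mx_norm_mul _ _) _.
rewrite mx_norm_tr -mulrA ler_wpM2l// -mulrA ler_wpM2l//.
apply: mx_norm_le => [|k q]; first by rewrite mulr_ge0// sqr_ge0.
rewrite mxE; apply: (@le_trans _ _ (\sum_j \sum_i `|riemann G q i k j c| * `|w| ^+ 2)).
  apply: le_trans (ler_norm_sum _ _ _) _; apply: ler_sum => j _.
  apply: le_trans (ler_norm_sum _ _ _) _; apply: ler_sum => i _.
  by rewrite normrM mulrC ler_wpM2l// normrM expr2 ler_pM//; exact: ler_mx_entry.
under eq_bigr do rewrite -mulr_suml.
rewrite -mulr_suml ler_wpM2r ?sqr_ge0//.
have term_le (F : 'I_n -> R) i0 : (forall i, 0 <= F i) -> F i0 <= \sum_i F i.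
  by move=> F0; rewrite (bigD1 i0) //= lerDl; exact: sumr_ge0.
pose A q k := \sum_j \sum_i `|riemann G q i k j c|.
have A0 q' k' : 0 <= A q' k' by apply: sumr_ge0 => j _; exact: sumr_ge0.
apply: le_trans (term_le (A q) k (A0 q)) _.
by apply: (term_le (fun q => \sum_k A q k) q) => q'; exact: sumr_ge0.
Qed.

End Curvature.

(** * Transport of frames *)

Section Frames.
Context {R : realType} {n : nat}.
Implicit Types (A E G : 'M[R]_n) (u v w e y h : 'rV[R]_n).

Lemma frameP G E : E *m G *m E^T = 1%:M <->
  forall k l, mform G (row k E) (row l E) = (k == l)%:R.
Proof.
have H k l : mform G (row k E) (row l E) = (E *m G *m E^T) k l.
  have -> : (E *m G *m E^T) k l = (row k (E *m G) *m (row l E)^T) 0 0.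
    by rewrite !mxE; apply: eq_bigr => i _; rewrite !mxE.
  by rewrite row_mul.
split=> [EE k l|HE]; first by rewrite H EE mxE.
by apply/matrixP => k l; rewrite -H HE mxE.
Qed.

Lemma mform_diff_le A v v' : `|mform A v v - mform A v' v'| <=
  n%:R ^+ 2 * (`|A| * `|v - v'| * (`|v| + `|v'|)).
Proof.
have -> : mform A v v - mform A v' v' = mform A (v - v') v + mform A v' (v - v').
  by rewrite mformDl mformDr mformNl mformNr addrA subrK.
apply: le_trans (ler_normD _ _) _; rewrite mulrDr mulrDr.
apply: lerD; first exact: mform_le.
by apply: le_trans (mform_le _ _ _) _; rewrite -!mulrA [`|v'| * _]mulrC.
Qed.

Lemma posdef_congr G A : posdef G -> A \in unitmx -> posdef (A *m G *m A^T).
Proof.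
move=> pG uA; split; first by rewrite !trmx_mul trmxK mulmxA pG.1.
move=> v v0; have -> : mform (A *m G *m A^T) v v = mform G (v *m A) (v *m A).
  by rewrite /mform trmx_mul !mulmxA.
apply: pG.2; apply: contra v0 => /eqP h; apply/eqP.
by rewrite -[v](mulmxK uA) h mul0mx.
Qed.

Lemma half_absorb (K a b e f : R) : 0 <= K -> f <= K * a -> - e <= b - a ->
  K * e = f / 2 -> f <= 2 * K * b.
Proof.
by move=> K0 i1 i2 i3; have i4 : K * a <= K * (b + e) by [rewrite ler_wpM2l//; lra]; lra.
Qed.

Lemma le_inv_of_mul (C a t : R) : 0 < C -> C * a * t <= 1 -> a * t <= C^-1.
Proof. by move=> C0 h; rewrite -[leRHS]mul1r ler_pdivlMr// mulrC mulrA. Qed.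

Lemma frame_norm G E (K : R) : 0 <= K -> (forall v, `|v| ^+ 2 <= K * mform G v v) ->
  E *m G *m E^T = 1%:M -> `|E| <= K + 1.
Proof.
move=> K0 HK /frameP HE; apply: mx_norm_le => [|k l]; first by rewrite addr_ge0.
apply: (@le_trans _ _ `|row k E|).
  by apply: le_trans (ler_mx_entry (row k E) 0 l); rewrite mxE.
have := HK (row k E); rewrite HE eqxx mulr1 => h.
have := normr_ge0 (row k E); move: `|row k E| h => x h x0; nra.
Qed.

Variables (W : set 'rV[R]_n) (G : 'rV[R]_n -> 'M[R]_n).
Hypothesis sG : smooth_metric W G.
Variable c : 'rV[R]_n.
Hypothesis Wc : W c.

Let oW : open W. Proof. by case: sG. Qed.
Let CG k : Ck_on k W G. Proof. by case: sG. Qed.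
Let pG : posdef (G c). Proof. by case: sG => _ _; apply. Qed.

Definition pmat y : 'M[R]_n := \matrix_i tmap G c y (delta_mx 0 i).
(** The metric at [y] seen from the center through the approximate transport [tmap], which lets
    frames at different points be compared as matrices. *)
Definition wmat y : 'M[R]_n := pmat y *m G y *m (pmat y)^T.

Lemma pmatE y e : e *m pmat y = tmap G c y e.
Proof.
rewrite mulmx_sum_row; have -> : \sum_i e 0 i *: row i (pmat y) =
    \sum_i (e 0 i *: delta_mx 0 i - gam2 G c (y - c) (e 0 i *: delta_mx 0 i)).
  by apply: eq_bigr => i _; rewrite rowK /tmap scalerBr gam2Zr.
have gs (r : seq 'I_n) (F : 'I_n -> 'rV[R]_n) :
    \sum_(i <- r) gam2 G c (y - c) (F i) = gam2 G c (y - c) (\sum_(i <- r) F i).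
  elim: r => [|i r IH]; first by rewrite !big_nil gam20r.
  by rewrite !big_cons IH gam2Dr.
by rewrite sumrB gs -row_sum_delta.
Qed.

Lemma wmatE y u v : mform (wmat y) u v = mform (G y) (tmap G c y u) (tmap G c y v).
Proof. by rewrite /mform -!pmatE trmx_mul !mulmxA. Qed.

Lemma pmat_center : pmat c = 1%:M.
Proof. by apply/row_matrixP => i; rewrite rowK tmap_center row1. Qed.

Lemma wmat_center : wmat c = G c.
Proof. by rewrite /wmat pmat_center trmx1 mul1mx mulmx1. Qed.

Lemma Ck_pmat k (U : set 'rV[R]_n) : open U -> Ck_on k U pmat.
Proof.
move=> oU; apply: Ck_mx => // i j; under eq_fun do rewrite mxE.
apply: ((Ck_mxP k (fun y => tmap G c y (delta_mx 0 i)) oU).1 _).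
have Cid : Ck_on k U (fun y : 'rV[R]_n => y).
  exact: (@Ck_linear _ _ _ k U idfun (fun x => @cvg_id _ _)).
apply: Ck_add => //; first exact: Ck_cst.
apply: Ck_opp => //; apply: (Ck_gam2 sG (a := fun=> c)) => //.
- exact: Ck_cst.
- by apply: Ck_add => //; exact: Ck_cst.
exact: Ck_cst.
Qed.

Lemma Ck_wmat k : Ck_on k W wmat.
Proof.
apply: Ck_mulmx => //; last by apply: Ck_trmx => //; exact: Ck_pmat.
by apply: Ck_mulmx => //; exact: Ck_pmat.
Qed.

Lemma wmat_posdef_unit y : W y -> pmat y \in unitmx -> posdef (wmat y).
Proof.
move=> Wy uP; have pGy : posdef (G y) by case: sG => _ _; apply.
exact: posdef_congr.
Qed.

(** Metric compatibility: the derivative of the metric is cancelled by the Christoffel terms in the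
    transport. Transport is isometric to first order. *)
Lemma dwmat h : 'D_h wmat c = 0.
Proof.
have d1 : is_derive c h wmat ('D_h wmat c).
  by split=> //; exact: (Ck_derivable h (Ck_wmat 1) Wc).
have E u v : mform ('D_h wmat c) u v = 0.
  have := is_derive_mform d1 (is_derive_cst u c h) (is_derive_cst v c h).
  rewrite mform0l mform0r !addr0 => d2.
  have dt e : is_derive c h (fun y => tmap G c y e) (- gam2 G c h e).
    have hz : is_derive c h (fun y : 'rV[R]_n => y - c) h.
      by apply: is_derive_eq (is_deriveB (is_derive_id c h) (is_derive_cst c c h)) _; rewrite subr0.
    have h1 := is_derive_gam2 sG Wc (is_derive_cst c c h) hz (is_derive_cst e c h).
    apply: is_derive_eq (is_deriveB (is_derive_cst e c h) h1) _.
    have aux (a : 'rV[R]_n) : 0 - (0 + a + 0) = - a by rewrite sub0r add0r addr0.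
    by rewrite dgam20 gam20r; exact: aux.
  have d3 := is_derive_mform (DeriveDef (Ck_derivable h (CG 1) Wc) erefl) (dt u) (dt v).
  have d4 : is_derive c h (fun y => mform (wmat y) (cst u y) (cst v y))
    (mform ('D_h G c) (tmap G c c u) (tmap G c c v) + mform (G c) (- gam2 G c h u) (tmap G c c v)
     + mform (G c) (tmap G c c u) (- gam2 G c h v)).
    have -> : (fun y => mform (wmat y) (cst u y) (cst v y)) =
      (fun y => mform (G y) (tmap G c y u) (tmap G c y v)) by apply/funext => y; exact: wmatE.
    exact: d3.
  rewrite (is_derive_unique d2 d4) !tmap_center -/(dform _ _ _ _ _) (metric_compat sG Wc).
  rewrite mformNl mformNr; move: (mform _ _ _) (mform _ _ _) => a b; ring.
apply/matrixP => i j; have := E (delta_mx 0 i) (delta_mx 0 j).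
rewrite /mform -rowE trmx_delta -colE mxE mxE => ->.
by rewrite mxE.
Qed.

(** As [wmat] is stationary at [c], its Lipschitz constant is as small as desired in a small enough
    neighborhood. *)
Lemma wmat_lip (d : R) : 0 < d -> exists2 r : R, 0 < r & forall y y',
  `|y - c| <= r -> `|y' - c| <= r -> `|wmat y' - wmat y| <= d * `|y' - y|.
Proof.
move=> d0; have N := derive_near oW Wc (Ck_wmat 1) d0.
have [r /= r0 Hr] := (nbhs_ballP _ _).1 N; exists (r / 2); first by rewrite divr_gt0.
move=> y y' hy hy'; apply: mx_norm_le => [|i j]; first by apply: mulr_ge0; [exact: ltW|exact: normr_ge0].
have inb (s : R) : 0 <= s <= 1 -> ball c r (y + s *: (y' - y)).
  move=> /andP[s0 s1]; rewrite -ball_normE /= distrC.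
  have -> : y + s *: (y' - y) - c = (1 - s) *: (y - c) + s *: (y' - c).
    by rewrite !scalerBr scalerBl scale1r [(1 - s) *: c]scalerBl scale1r;
       apply/rowP => k; rewrite !mxE; ring.
  apply: le_lt_trans (ler_normD _ _) _; rewrite !normrZ (ger0_norm s0) ger0_norm ?subr_ge0//.
  apply: (@le_lt_trans _ _ ((1 - s) * (r / 2) + s * (r / 2))).
    by apply: lerD; rewrite ler_wpM2l// subr_ge0.
  by rewrite -mulrDl subrK mul1r ltr_pdivrMr// ltr_pMr// ltr1n.
have CE := (Ck_mxP 1 wmat oW).1 (Ck_wmat 1) i j.
have [s s01|s s01] := @line_MVT R _ (fun y => wmat y i j) y (y' - y).
  by have [Ws _] := Hr _ (inb s s01); exact: (Ck_derivable _ CE Ws).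
rewrite subrKC !mxE => ->; have [Ws /(_ (y' - y))] := Hr _ (inb s s01).
rewrite dwmat subr0 derive_coord; last exact: (Ck_derivable _ (Ck_wmat 1) Ws).
by apply: le_trans; exact: ler_mx_entry.
Qed.

Lemma wmat_near (e : R) : 0 < e -> exists2 r : R, 0 < r & forall y, `|y - c| <= r ->
  [/\ W y, pmat y \in unitmx & `|wmat y - G c| <= e].
Proof.
move=> e0; have NW : \forall y \near c, W y by exact: open_nbhs_nbhs.
have /cvgrPdist_lt/(_ _ e0) N1 := Ck_continuous (Ck_wmat 0) Wc.
have Cdet : Ck_on 0 W (fun y => \det (pmat y)).
  by apply: Ck_det => // i j; exact: ((Ck_mxP 0 pmat oW).1 (Ck_pmat 0 oW)).
have /cvgrPdist_lt/(_ _ ltr01) N2 := Ck_continuous Cdet Wc.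
have [r /= r0 Hr] := (nbhs_ballP _ _).1 (filterI NW (filterI N1 N2)).
exists (r / 2); first by rewrite divr_gt0.
move=> y hy; have [|Wy [h1 h2]] := Hr y.
  rewrite -ball_normE /= distrC; apply: le_lt_trans hy _.
  by rewrite ltr_pdivrMr// ltr_pMr// ltr1n.
split; first exact: Wy.
  rewrite unitmxE unitfE; apply/eqP => d0; move: h2.
  by rewrite d0 subr0 pmat_center det1 normr1 ltxx.
by move: h1; rewrite wmat_center distrC => /ltW.
Qed.

(** A frame [A] orthonormal for [wmat y] is almost orthonormal for [wmat y']; the Cholesky factor of
    its Gram matrix corrects it, at a cost of [d] per unit of coordinate distance. Since [d] is
    arbitrary, the corrections do not matter in the limit. The bound [N] on frames is fixed before
    [d], because later constants depend on it. *)
Lemma frame_transport : exists2 N : R, 0 < N & forall d : R, 0 < d -> exists2 r : R, 0 < r &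
  forall y, `|y - c| <= r -> [/\ W y, pmat y \in unitmx, `|wmat y - G c| <= d &
   forall A, A *m wmat y *m A^T = 1%:M -> `|A| <= N /\
   forall y', `|y' - c| <= r -> exists2 A', A' *m wmat y' *m A'^T = 1%:M &
     `|A' - A| <= d * `|y' - y|].
Proof.
have [K K0 HK] := posdef_lower pG.
have [C C1 HC] := @cholesky R n.
pose N := 2 * K + 1; have N0 : 0 < N by rewrite addr_gt0// mulr_gt0.
exists N => // d d0.
pose q : R := n%:R ^+ 2 + 1; have q0 : 0 < q by rewrite ltr_wpDl// sqr_ge0.
pose e1 := Num.min d (2 * K * q)^-1.
have e10 : 0 < e1 by rewrite lt_min d0 invr_gt0 !mulr_gt0.
have [r1 r10 H1] := wmat_near e10.
pose P := C * n%:R ^+ 3 * N ^+ 3 + 1.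
have C0 : 0 < C by exact: lt_le_trans C1.
have P0 : 0 < P by rewrite ltr_wpDl// !mulr_ge0 ?exprn_ge0// ltW.
have d2 : 0 < d / P by rewrite divr_gt0.
have [r2 r20 H2] := wmat_lip d2.
pose e3 := C^-1 * P / d; have e30 : 0 < e3 by rewrite divr_gt0 ?mulr_gt0 ?invr_gt0.
(* Within distance Q^-1 the Gram matrix of [A] at [y'] differs from the identity by at most C^-1,
   the range where the Cholesky estimate applies. *)
pose Q := C * (n%:R ^+ 2 * N ^+ 2 * (d / P)) + 1.
have [Nge [Cge dge]] : 0 <= N /\ 0 <= C /\ 0 <= d / P by split; [exact: ltW|split; exact: ltW].
have Q1 : 0 <= C * (n%:R ^+ 2 * N ^+ 2 * (d / P)).
  by apply: mulr_ge0 => //; apply: mulr_ge0 => //; apply: mulr_ge0; exact: sqr_ge0.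
have Q0 : 0 < Q by rewrite ltr_wpDl.
pose r := Num.min r1 (Num.min r2 (Q^-1 / 2)).
have r0 : 0 < r by rewrite !lt_min r10 r20 divr_gt0 ?invr_gt0.
exists r => // y hy.
have rr1 : r <= r1 by rewrite ge_min lexx.
have rr2 : r <= r2 by rewrite /r minCA ge_min lexx.
have rrQ : r <= Q^-1 / 2 by rewrite /r minA ge_min lexx orbT.
have [Wy uy ey] := H1 y (le_trans hy rr1).
split; [exact: Wy|exact: uy|by apply: le_trans ey _; rewrite ge_min lexx|].
have lowy y' v : `|y' - c| <= r -> `|v| ^+ 2 <= 2 * K * mform (wmat y') v v.
  move=> hy'; have [_ _ ey'] := H1 y' (le_trans hy' rr1).
  have h1 := HK v; have h2 := mform_le (wmat y' - G c) v v.
  rewrite mform_addG mform_oppG -mulrA mulrA -expr2 in h2.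
  have h3 : n%:R ^+ 2 * `|wmat y' - G c| <= (2 * K)^-1.
    apply: (@le_trans _ _ (q * (2 * K * q)^-1)).
      apply: ler_pM => //; first by rewrite /q lerDl.
      by apply: le_trans ey' _; rewrite ge_min lexx orbT.
    by rewrite invfM mulrCA divff ?mulr1// gt_eqF.
  have h4 : `|mform (wmat y') v v - mform (G c) v v| <= (2 * K)^-1 * `|v| ^+ 2.
    by apply: le_trans h2 _; rewrite ler_wpM2r// sqr_ge0.
  move: h4; rewrite ler_norml => /andP[h4 _].
  have h5 : K * ((2 * K)^-1 * `|v| ^+ 2) = `|v| ^+ 2 / 2 by field; rewrite gt_eqF.
  exact: half_absorb (ltW K0) h1 h4 h5.
move=> A EA; have nA : `|A| <= N.
  by apply: frame_norm (fun v => lowy y v hy) EA; rewrite mulr_ge0// ltW.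
split=> // y' hy'.
have [Wy' uy' _] := H1 y' (le_trans hy' rr1).
have pw' := wmat_posdef_unit Wy' uy'.
have uA : A \in unitmx.
  by have : A *m (wmat y *m A^T) = 1%:M by [rewrite mulmxA]; move=> /mulmx1_unit[].
pose M := A *m wmat y' *m A^T.
have pM : posdef M by exact: posdef_congr.
have [B [EB HB]] := HC _ pM.
have lip := H2 y y' (le_trans hy rr2) (le_trans hy' rr2).
have M1 : `|M - 1%:M| <= n%:R ^+ 2 * N ^+ 2 * (d / P) * `|y' - y|.
  have -> : M - 1%:M = A *m (wmat y' - wmat y) *m A^T by rewrite mulmxBr mulmxBl EA.
  apply: le_trans (mx_norm_mul _ _) _; rewrite mx_norm_tr.
  have h := mx_norm_mul A (wmat y' - wmat y).
  have -> : n%:R ^+ 2 * N ^+ 2 * (d / P) * `|y' - y| =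
    n%:R * ((n%:R * (N * ((d / P) * `|y' - y|))) * N) by ring.
  rewrite ler_wpM2l//; apply: ler_pM => //.
  by apply: le_trans h _; rewrite ler_wpM2l//; apply: ler_pM.
have yy : `|y' - y| <= Q^-1.
  have -> : y' - y = (y' - c) - (y - c) by rewrite opprB addrA subrK.
  apply: le_trans (ler_normB _ _) _.
  apply: (@le_trans _ _ (r + r)); first exact: lerD.
  by move: rrQ; move: (Q^-1) => Qi; lra.
have small : n%:R ^+ 2 * N ^+ 2 * (d / P) * `|y' - y| <= C^-1.
  have h7 : C * (n%:R ^+ 2 * N ^+ 2 * (d / P)) * `|y' - y| <= 1.
    apply: (@le_trans _ _ (Q * `|y' - y|)); first by rewrite ler_wpM2r// /Q lerDl.
    by rewrite mulrC -ler_pdivlMr// mul1r.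
  exact: le_inv_of_mul.
have B1 := HB _ M1 small.
exists (B *m A).
  by rewrite trmx_mul -[RHS]EB /M !mulmxA.
have -> : B *m A - A = (B - 1%:M) *m A by rewrite mulmxBl mul1mx.
apply: le_trans (mx_norm_mul _ _) _.
apply: (@le_trans _ _ (n%:R * (C * (n%:R ^+ 2 * N ^+ 2 * (d / P) * `|y' - y|) * N))).
  by rewrite ler_wpM2l// ler_pM.
have -> : n%:R * (C * (n%:R ^+ 2 * N ^+ 2 * (d / P) * `|y' - y|) * N) =
   (C * n%:R ^+ 3 * N ^+ 3 / P) * (d * `|y' - y|) by ring.
rewrite ler_piMl ?mulr_ge0 ?(ltW d0)// ler_pdivrMr// mul1r /P lerDl.
exact: ler01.
Qed.

Section RicciBound.
Variable kp : R.
Hypothesis kp0 : 0 <= kp.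
Hypothesis hRic : forall w, - kp * mform (G c) w w <= mform (ricci_mx G c) w w.

(** The vectors [E k] are close to [t] times a frame that is almost orthonormal at [c]. For an exact
    frame the sum of curvatures is - Ric(w, w), which the lower Ricci bound controls; the two
    discrepancies are absorbed by [mu]. *)
Lemma curv_sum_le (N d : R) : 0 < N -> 0 < d -> exists2 mu : R, 0 < mu &
  forall A H (E : 'I_n -> 'rV[R]_n) (t : R) w, A *m H *m A^T = 1%:M -> `|H - G c| <= mu ->
    `|A| <= N -> 0 <= t <= 1 -> (forall k, `|E k - t *: row k A| <= mu) ->
    \sum_k curv G c (E k) w <= kp * mform (G c) w w + d * `|w| ^+ 2.
Proof.
move=> N0 d0; have [K K0 HK] := curvmx_le G c.
have [_ _ /(_ _ pG)[F [FF _]]] := @cholesky R n.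
pose P1 := n%:R * (n%:R * (n%:R * (n%:R * (N * N)) * `|invmx (G c)|) * n%:R) * K.
pose P2 := n%:R * (n%:R ^+ 2 * (2 * N + 1)) * K.
have Nge := ltW N0.
have P10 : 0 <= P1 by rewrite !mulr_ge0.
have P20 : 0 <= P2 by rewrite !mulr_ge0// addr_ge0// mulr_ge0.
pose mu := Num.min 1 (d / (P1 + P2 + 1)).
have PP : 0 < P1 + P2 + 1 by rewrite ltr_wpDl// addr_ge0.
have mu0 : 0 < mu by rewrite lt_min ltr01 divr_gt0.
have mu1 : mu <= 1 by rewrite ge_min lexx.
have mu2 : mu * (P1 + P2) <= d.
  apply: (@le_trans _ _ (d / (P1 + P2 + 1) * (P1 + P2))).
    by rewrite ler_wpM2r ?addr_ge0// ge_min lexx orbT.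
  rewrite mulrAC ler_pdivrMr// ler_wpM2l ?(ltW d0)//.
  by rewrite lerDl.
exists mu => // A H E t w EA hH hA /andP[t0 t1] hE.
pose B := curvmx G c w; have hB : `|B| <= K * `|w| ^+ 2 by exact: HK.
have Kw : 0 <= K * `|w| ^+ 2 by rewrite mulr_ge0// sqr_ge0.
have [AH _] := frame_inv EA.
have uH : H \in unitmx by have [_ h] := frame_inv EA; have [] := mulmx1_unit h.
have uG : G c \in unitmx by exact: posdef_unit.
have trle (X : 'M[R]_n) : `|\tr X| <= n%:R * `|X|.
  apply: le_trans (ler_norm_sum _ _ _) _.
  apply: (@le_trans _ _ (\sum_(i < n) `|X|)); first by apply: ler_sum => i _; exact: ler_mx_entry.
  by rewrite sumr_const card_ord mulr_natl.
have S1 : \sum_k mform B (row k A) (row k A) <= kp * mform (G c) w w + mu * P1 * `|w| ^+ 2.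
  rewrite (mform_trace _ EA).
  have -> : invmx H *m B = invmx (G c) *m B + A^T *m A *m (G c - H) *m invmx (G c) *m B.
    rewrite -mulmxDl; congr (_ *m _).
    have <- : A^T *m A = invmx H by rewrite -[LHS](mulmxK uH) AH mul1mx.
    by rewrite mulmxBr mulmxBl mulmxK// AH mul1mx addrC subrK.
  have trD (X Y : 'M[R]_n) : \tr (X + Y) = \tr X + \tr Y by exact: raddfD.
  rewrite trD -(mform_trace _ FF).
  have -> : \sum_k mform B (row k F) (row k F) = - mform (ricci_mx G c) w w.
    by rewrite -(curv_trace sG Wc w FF); apply: eq_bigr => k _; rewrite (curv_form sG Wc).
  apply: lerD; first by rewrite lerNl -mulNr.
  apply: le_trans (ler_norm _) (le_trans (trle _) _).
  have h1 := mx_norm_mul A^T A; rewrite mx_norm_tr in h1.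
  have h2 := mx_norm_mul (A^T *m A) (G c - H).
  have h3 := mx_norm_mul (A^T *m A *m (G c - H)) (invmx (G c)).
  have h4 := mx_norm_mul (A^T *m A *m (G c - H) *m invmx (G c)) B.
  have nn : 0 <= n%:R :> R by [].
  have e1 : `|A^T *m A| <= n%:R * (N * N).
    by apply: le_trans h1 _; rewrite ler_wpM2l// ler_pM.
  have e2 : `|A^T *m A *m (G c - H)| <= n%:R * (n%:R * (N * N) * mu).
    apply: le_trans h2 _; rewrite ler_wpM2l//; apply: ler_pM => //.
    by rewrite distrC.
  have e3 : `|A^T *m A *m (G c - H) *m invmx (G c)| <=
      n%:R * (n%:R * (n%:R * (N * N) * mu) * `|invmx (G c)|).
    by apply: le_trans h3 _; rewrite ler_wpM2l//; apply: ler_pM.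
  apply: (@le_trans _ _ (n%:R * (n%:R * (n%:R * (n%:R * (n%:R * (N * N) * mu) * `|invmx (G c)|) * (K * `|w| ^+ 2))))).
    by rewrite ler_wpM2l//; apply: le_trans h4 _; rewrite ler_wpM2l//; apply: ler_pM.
  by rewrite le_eqVlt; apply/orP; left; apply/eqP; rewrite /P1; ring.
have S2 : \sum_k curv G c (E k) w <= t ^+ 2 * (\sum_k mform B (row k A) (row k A)) + mu * P2 * `|w| ^+ 2.
  rewrite mulr_sumr; have -> : mu * P2 * `|w| ^+ 2 =
      \sum_(k < n) n%:R ^+ 2 * (K * `|w| ^+ 2 * mu * (2 * N + 1)).
    by rewrite sumr_const card_ord -[RHS]mulr_natl /P2; ring.
  rewrite -big_split /=; apply: ler_sum => k _; rewrite (curv_form sG Wc).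
  have -> : t ^+ 2 * mform B (row k A) (row k A) = mform B (t *: row k A) (t *: row k A).
    by rewrite mformZl mformZr mulrA.
  rewrite -lerBlDl; apply: le_trans (ler_norm _) (le_trans (mform_diff_le _ _ _) _).
  rewrite ler_wpM2l ?sqr_ge0//.
  have nr : `|row k A| <= N.
    apply: mx_norm_le => // i j; rewrite mxE; apply: le_trans (ler_mx_entry _ _ _) hA.
  have n2 : `|t *: row k A| <= N.
    by rewrite normrZ ger0_norm//; apply: le_trans nr; rewrite ler_piMl.
  have n3 : `|E k| <= N + 1.
    rewrite -[E k](subrK (t *: row k A)) addrC; apply: le_trans (ler_normD _ _) _.
    by apply: lerD => //; exact: le_trans (hE k) mu1.
  rewrite !ler_pM ?mulr_ge0 ?addr_ge0//.
  by apply: le_trans (lerD n3 n2) _; lra.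
have w0 := sqr_ge0 `|w|; have g0 := posdef_ge0 w pG.
have t2 : t ^+ 2 <= 1 by rewrite expr_le1.
have t20 := sqr_ge0 t.
(* The sum of curvatures may have any sign. It is the nonnegative upper bound that absorbs the
   factor t^2 <= 1. *)
have q1 : 0 <= kp * mform (G c) w w + mu * P1 * `|w| ^+ 2.
  by rewrite addr_ge0// !mulr_ge0// ltW.
apply: le_trans S2 _.
apply: (@le_trans _ _ (kp * mform (G c) w w + mu * P1 * `|w| ^+ 2 + mu * P2 * `|w| ^+ 2)).
  rewrite lerD2r; apply: le_trans (_ : t ^+ 2 * (kp * mform (G c) w w + mu * P1 * `|w| ^+ 2) <= _).
    by rewrite ler_wpM2l.
  by rewrite ler_piMl.
by rewrite -addrA -mulrDl -mulrDr lerD2l ler_wpM2r.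
Qed.

End RicciBound.

End Frames.

(** * The variation along one short link *)

Section LinkVariation.
Context {R : realType} {n : nat}.
Variables (W : set 'rV[R]_n) (G : 'rV[R]_n -> 'M[R]_n).
Hypothesis sG : smooth_metric W G.
Variable c : 'rV[R]_n.
Hypothesis Wc : W c.
Variables (kp rr : R).
Hypotheses (kp0 : 0 <= kp) (rr0 : 0 < rr).
Hypothesis hRic : forall w, - kp * mform (G c) w w <= mform (ricci_mx G c) w w.
Implicit Types (A : 'M[R]_n) (w y : 'rV[R]_n).

Let oW : open W. Proof. by case: sG. Qed.
Let CG k : Ck_on k W G. Proof. by case: sG. Qed.
Let pG : posdef (G c). Proof. by case: sG => _ _; apply. Qed.

Lemma eq_le_R (a b : R) : a = b -> a <= b. Proof. by move->. Qed.

Lemma mformZZ (a b : R) A w : mform A (a *: (b *: w)) (a *: (b *: w)) = b ^+ 2 * (a ^+ 2 * mform A w w).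
Proof. by rewrite !mformZl !mformZr; ring. Qed.

Lemma sum_affine (a b : R) (f : 'I_n -> R) : \sum_k (a + b * f k) = n%:R * a + b * \sum_k f k.
Proof. by rewrite big_split /= -mulr_sumr sumr_const card_ord mulr_natl. Qed.

Lemma variation_sum_arith (m q E T V k d S ir : R) : 0 <= q -> 0 <= E ->
  S <= k * q + d / 4 * q + d / 4 * q -> m * T <= d / 4 -> m * V <= d / 4 ->
  m * (q + E * (q * (ir + T)) + E * (V * q)) + E * S <= q * (m + E * (m * ir + k + d)).
Proof.
move=> q0 E0 hS hT hV; have h1 := ler_wpM2l E0 hS.
have h2 := ler_wpM2l (mulr_ge0 E0 q0) hT; have h3 := ler_wpM2l (mulr_ge0 E0 q0) hV.
by lra.
Qed.

Lemma row_norm_le A N k : 0 <= N -> `|A| <= N -> `|row k A| <= N.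
Proof.
move=> N0 h; apply: mx_norm_le => // i j; rewrite mxE.
by apply: le_trans h; exact: ler_mx_entry.
Qed.

(* The variation field along a link interpolates between [s] times the frame [A] and
   [s + h / rr] times the frame [A']; [l] is the arclength. *)
Definition vfield A A' (s s' L : R) k : 'rV[R]_n := L^-1 *: (s' *: row k A' - s *: row k A).

(** The displacement at arclength [l], affine in [l], with slope [vfield]; it runs from s times the
    row of [A] at l = 0 to s' times the row of [A'] at l = L. *)
Definition vpos A A' (s s' L : R) k (l : R) : 'rV[R]_n := s *: row k A + l *: vfield A A' s s' L k.

Definition vsquare y (e w b : 'rV[R]_n) : R :=
  mform (G (vmap G c y e)) (vmapl G c y e w b) (vmapl G c y e w b).

Lemma vfield_split A A' s s' L k l : L != 0 ->
  s *: row k A + l *: vfield A A' s s' L k =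
  (s + l / L * (s' - s)) *: row k A + (l / L * s') *: (row k A' - row k A).
Proof. by move=> L0; apply/rowP => j; rewrite !mxE; field. Qed.

Lemma vfield_split0 A A' s s' L k : vfield A A' s s' L k =
  ((s' - s) / L) *: row k A + (s' / L) *: (row k A' - row k A).
Proof. by apply/rowP => j; rewrite !mxE; ring. Qed.

(** [variation_estimate] is summed over the rows of the frame. The growth of the amplitude from [s]
    to [s'] costs n / rr^2, the curvature costs [kp], and everything else, including the change from
    [A] to [A'], is absorbed in [d]. The length [L] of the curve is left free above [h], since
    minimizing curves need not be available. *)
Lemma pointwise_variation (C0 d : R) : 0 < C0 -> 0 < d ->
  exists2 N : R, 0 < N & exists2 r : R, 0 < r &
  (forall y e, `|y - c| <= r -> `|e| <= r -> W y /\ W (vmap G c y e)) /\ forall y1, `|y1 - c| <= r ->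
  [/\ W y1, pmat G c y1 \in unitmx & forall A, A *m wmat G c y1 *m A^T = 1%:M ->
  forall y2, `|y2 - c| <= r -> [/\ W y2, pmat G c y2 \in unitmx &
  exists2 A', A' *m wmat G c y2 *m A'^T = 1%:M &
  forall L h s s' : R, 0 < h -> h <= L -> L <= r -> `|y2 - y1| <= C0 * L -> 0 <= s ->
  s' = s + h / rr -> s' <= 1 ->
  (forall k (l : R), 0 <= l <= L -> `|vpos A A' s s' L k l| <= N) /\
  forall (ep : R), 0 < ep -> ep * N <= r ->
  forall y w (l rho : R), `|y - c| <= r -> 0 <= l <= L -> 0 <= rho ->
    mform (G y) w w = rho ^+ 2 ->
    \sum_k 2^-1 *
      (vsquare y (1 *: (ep *: vpos A A' s s' L k l)) w (1 *: (rho *: (ep *: vfield A A' s s' L k)))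
     + vsquare y ((-1) *: (ep *: vpos A A' s s' L k l)) w ((-1) *: (rho *: (ep *: vfield A A' s s' L k))))
    <= rho ^+ 2 * (n%:R + ep ^+ 2 * (n%:R * rr ^- 2 + kp + d))]].
Proof.
move=> C00 d0.
have [N0 N00 HN] := frame_transport sG Wc.
have [K K0 HK] := posdef_lower pG.
pose N := N0 + 1; pose ND := N0 / rr + 1.
have Npos : 0 < N by rewrite addr_gt0.
have NDpos : 0 < ND by rewrite ltr_wpDl// divr_ge0// ltW.
pose dv := d / (4 * (n%:R * (N ^+ 2 * (2 * K) + ND ^+ 2) + 1)).
have dv0 : 0 < dv.
  by rewrite divr_gt0// mulr_gt0// ltr_wpDl// mulr_ge0// addr_ge0// ?mulr_ge0 ?sqr_ge0// ltW.
have [rv rv0 Hv] := variation_estimate sG Wc dv0.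
pose dr := d / (8 * K).
have dr0 : 0 < dr by rewrite divr_gt0// mulr_gt0.
have [mu mu0 Hmu] := curv_sum_le sG Wc kp0 hRic N00 dr0.
pose ds := Num.min (2 * K)^-1 (d / (8 * K * (kp + 1))).
have ds0 : 0 < ds by rewrite lt_min invr_gt0 mulr_gt0//= divr_gt0// mulr_gt0 ?mulr_gt0// ltr_wpDl.
have N1 := mform_near setT (Ck_continuous (CG 0) Wc) ds0.
have [rm /= rm0 Hm] := (nbhs_ballP _ _).1 N1.
pose P1 := n%:R ^+ 2 * N0 ^+ 2 / rr ^+ 2; pose P2 := n%:R ^+ 2 * `|G c| * C0 * (2 * ND).
have P10 : 0 <= P1 by rewrite divr_ge0 ?sqr_ge0// mulr_ge0 ?sqr_ge0.
have P20 : 0 <= P2 by rewrite !mulr_ge0 ?sqr_ge0 ?(ltW C00) ?(ltW NDpos).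
(* The rate of change of the frame: small enough for the rows to stay within 1 and within [mu] of
   the model field along a link ([edist]), for the slopes to stay bounded, and for the metric error
   to be at most d / 4 after summation. *)
pose dt := Num.min (Num.min mu (C0^-1)) (Num.min (mu / C0) (d / (4 * (n%:R * (P1 + P2) + 1)))).
have PP0 : 0 < 4 * (n%:R * (P1 + P2) + 1) by rewrite mulr_gt0// ltr_wpDl// mulr_ge0// addr_ge0.
have dt0 : 0 < dt by rewrite !lt_min mu0 invr_gt0 C00 divr_gt0//= divr_gt0.
have dtmu : dt <= mu by rewrite /dt ge_min ge_min lexx.
have dtC : dt * C0 <= 1.
  by rewrite -ler_pdivlMr// mul1r /dt ge_min ge_min lexx orbT.
have dtmuC : dt * C0 <= mu.
  by rewrite -ler_pdivlMr// /dt minCA -minA minCA ge_min ge_min lexx ?orbT.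
have dtP : n%:R * (dt * (P1 + P2)) <= d / 4.
  apply: (@le_trans _ _ (n%:R * (d / (4 * (n%:R * (P1 + P2) + 1)) * (P1 + P2)))).
    rewrite ler_wpM2l// ler_wpM2r ?addr_ge0//.
    by rewrite /dt ge_min [X in _ || X]ge_min lexx !orbT.
  have -> : n%:R * (d / (4 * (n%:R * (P1 + P2) + 1)) * (P1 + P2)) =
     (d / 4) * ((n%:R * (P1 + P2)) / (n%:R * (P1 + P2) + 1)).
    by rewrite invfM; ring.
  rewrite ler_piMr ?divr_ge0 ?(ltW d0)// ler_pdivrMr ?mul1r ?lerDl//.
  by rewrite ltr_wpDl// mulr_ge0// addr_ge0.
have [rt rt0 Ht] := HN dt dt0.
pose r := Num.min (Num.min rv 1) (Num.min (rm / 2) rt).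
have r0 : 0 < r by rewrite !lt_min rv0 ltr01 divr_gt0//= rt0.
have r_v : r <= rv by rewrite /r !ge_min lexx.
have r_1 : r <= 1 by rewrite /r !ge_min lexx !orbT.
have r_m : r <= rm / 2 by rewrite /r !ge_min lexx !orbT.
have r_t : r <= rt by rewrite /r !ge_min lexx !orbT.
exists N => //; exists r => //; split.
  by move=> y e hy he; have [] := Hv y e (le_trans hy r_v) (le_trans he r_v).
move=> y1 hy1.
have [W1 u1 ew1 HA] := Ht y1 (le_trans hy1 r_t).
split=> // A EA y2 hy2.
have [W2 u2 ew2 _] := Ht y2 (le_trans hy2 r_t).
have [nA /(_ y2 (le_trans hy2 r_t))[A' EA' dA]] := HA A EA.
split; [exact: W2|exact: u2|exists A'; first exact: EA'].
move=> L h s s' h0 hL Lr yL s0 s'E s1.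
pose D := vfield A A' s s' L; pose e := vpos A A' s s' L.
have L0 : 0 < L by exact: lt_le_trans hL.
have Ln0 : L != 0 by rewrite gt_eqF.
have hrr : 0 <= h / rr by rewrite divr_ge0// ltW.
have s'0 : 0 <= s' by rewrite s'E addr_ge0.
have aA k : `|row k A| <= N0 by exact: row_norm_le (ltW N00) nA.
have dA' k : `|row k A' - row k A| <= dt * C0 * L.
  rewrite -linearB; apply: row_norm_le; first by rewrite !mulr_ge0// ltW.
  by apply: le_trans dA _; rewrite -mulrA ler_wpM2l ?(ltW dt0).
pose tt l := s + l / L * (s' - s).
have tt01 l : 0 <= l <= L -> 0 <= tt l <= 1.
  move=> /andP[l0 l1]; have q1 : l / L <= 1 by rewrite ler_pdivrMr// mul1r.
  have q0 : 0 <= l / L by rewrite divr_ge0// ltW.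
  have ss : 0 <= s' - s by rewrite s'E addrC addKr.
  apply/andP; split; first by rewrite /tt addr_ge0// mulr_ge0.
  apply: le_trans s1; rewrite /tt.
  by rewrite -[X in _ <= X](subrKC s) lerD2l ler_piMl.
have edist k l : 0 <= l <= L -> `|e k l - tt l *: row k A| <= dt * C0 * L.
  move=> /andP[l0 l1]; rewrite /e /vpos vfield_split// addrAC subrr add0r normrZ.
  apply: le_trans (dA' k); rewrite ler_piMl// normrM !ger0_norm ?divr_ge0// ?(ltW L0)//.
  by rewrite mulr_ile1 ?divr_ge0// ?(ltW L0)// ler_pdivrMr// mul1r.
have small1 : dt * C0 * L <= 1.
  rewrite -[leRHS]mulr1; apply: ler_pM => //; first by rewrite mulr_ge0// ltW.
    exact: ltW.
  exact: le_trans r_1.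
have smallmu : dt * C0 * L <= mu.
  rewrite -[leRHS]mulr1; apply: ler_pM => //; first by rewrite mulr_ge0// ltW.
    exact: ltW.
  exact: le_trans r_1.
have ebnd k l : 0 <= l <= L -> `|e k l| <= N.
  move=> hl; rewrite -[e k l](subrK (tt l *: row k A)) addrC.
  apply: le_trans (ler_normD _ _) _; apply: lerD; last exact: le_trans (edist k l hl) small1.
  have /andP[t0 t1] := tt01 l hl.
  by rewrite normrZ ger0_norm//; apply: le_trans (aA k); rewrite ler_piMl.
split; first exact: ebnd.
(* The amplitude increases by h / rr over a length L >= h. *)
have sL : (s' - s) / L <= rr^-1.
  have -> : s' - s = h / rr by rewrite s'E addrC addKr.
  rewrite mulrAC ler_piMl ?invr_ge0 ?(ltW rr0)//.
  by rewrite ler_pdivrMr// mul1r.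
have sL0 : 0 <= (s' - s) / L by rewrite s'E addrC addKr !divr_ge0// ltW.
pose pa k := ((s' - s) / L) *: row k A.
have npa k : `|pa k| <= N0 / rr.
  by rewrite normrZ ger0_norm// mulrC; apply: ler_pM.
have nDp k : `|D k - pa k| <= dt * C0.
  rewrite /D vfield_split0 addrAC subrr add0r normrZ ger0_norm ?divr_ge0// ?(ltW L0)//.
  apply: (@le_trans _ _ (L^-1 * (dt * C0 * L))).
    rewrite ler_pM ?divr_ge0// ?(ltW L0)//.
    by rewrite ler_piMl ?invr_ge0// ltW.
  by rewrite mulrC mulfK.
have nD k : `|D k| <= ND.
  rewrite -[D k](subrK (pa k)) addrC; apply: le_trans (ler_normD _ _) _.
  by apply: lerD => //; exact: le_trans (nDp k) dtC.
have GD k : mform (G c) (D k) (D k) <= rr ^- 2 + dt * (P1 + P2).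
  have q1 : mform (G c) (D k) (D k) - mform (G c) (pa k) (pa k) <= dt * P2.
    apply: le_trans (ler_norm _) (le_trans (mform_diff_le _ _ _) _).
    have -> : dt * P2 = n%:R ^+ 2 * (`|G c| * (dt * C0) * (2 * ND)) by rewrite /P2; ring.
    rewrite ler_wpM2l ?sqr_ge0// !ler_pM ?mulr_ge0 ?addr_ge0//.
    apply: le_trans (lerD (nD k) (npa k)) _.
    by rewrite mulr_natl mulr2n lerD2l /ND lerDl.
  have q2 : mform (G c) (row k A) (row k A) <= 1 + n%:R ^+ 2 * (dt * N0 * N0).
    have m1 : mform (wmat G c y1) (row k A) (row k A) = 1.
      by have /frameP -> := EA; rewrite eqxx.
    have dd := le_trans (ler_norm _) (mform_le (G c - wmat G c y1) (row k A) (row k A)).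
    rewrite mform_addG mform_oppG m1 lerBlDl in dd; apply: le_trans dd _; rewrite lerD2l.
    by rewrite ler_wpM2l ?sqr_ge0// !ler_pM ?mulr_ge0// distrC.
  have q3 : mform (G c) (pa k) (pa k) <= rr ^- 2 * (1 + n%:R ^+ 2 * (dt * N0 * N0)).
    rewrite mformZl mformZr mulrA -expr2; apply: ler_pM => //.
    - exact: sqr_ge0.
    - exact: posdef_ge0.
    - by rewrite -exprVn ler_pXn2r ?nnegrE ?invr_ge0// ltW.
  have -> : rr ^- 2 + dt * (P1 + P2) = rr ^- 2 * (1 + n%:R ^+ 2 * (dt * N0 * N0)) + dt * P2.
    by rewrite /P1; ring.
  by rewrite -lerBlDr; apply: le_trans q3; rewrite lerBlDr -lerBlDl.
move=> ep ep0 epN y w l rho hy hl rho0 ww; rewrite -/D -/e.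
clearbody D e.
have yb : ball c rm y.
  by rewrite -ball_normE /= distrC; apply: le_lt_trans hy _; apply: le_lt_trans r_m _; lra.
have h3 := Hm y yb w w; rewrite -expr2 in h3.
have w2 : `|w| ^+ 2 <= 2 * K * rho ^+ 2.
  rewrite -ww; apply: half_absorb (ltW K0) (HK w) _ (_ : K * ((2 * K)^-1 * `|w| ^+ 2) = _).
    have : `|mform (G y) w w - mform (G c) w w| <= (2 * K)^-1 * `|w| ^+ 2.
      by apply: le_trans h3 _; rewrite ler_wpM2r ?sqr_ge0// ge_min lexx.
    by rewrite ler_norml => /andP[].
  by field; rewrite gt_eqF.
have gc : kp * mform (G c) w w <= kp * rho ^+ 2 + d / 4 * rho ^+ 2.
  have q : mform (G c) w w <= rho ^+ 2 + d / (8 * K * (kp + 1)) * `|w| ^+ 2.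
    rewrite -lerBlDl -ww; apply: le_trans (ler_norm _) _; rewrite distrC.
    by apply: le_trans h3 _; rewrite ler_wpM2r ?sqr_ge0// ge_min lexx orbT.
  apply: le_trans (ler_wpM2l kp0 q) _; rewrite mulrDr lerD2l.
  apply: (@le_trans _ _ (kp * (d / (8 * K * (kp + 1)) * (2 * K * rho ^+ 2)))).
    by rewrite ler_wpM2l// ler_wpM2l// divr_ge0 ?(ltW d0)// !mulr_ge0 ?addr_ge0 ?(ltW K0).
  have -> : kp * (d / (8 * K * (kp + 1)) * (2 * K * rho ^+ 2)) =
      (kp / (kp + 1)) * (d / 4 * rho ^+ 2).
    by field; rewrite !gt_eqF// ltr_wpDl.
  rewrite ler_piMl ?mulr_ge0 ?divr_ge0 ?sqr_ge0 ?(ltW d0)//.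
  by rewrite ler_pdivrMr ?mul1r ?lerDl// ltr_wpDl.
have CS : \sum_k curv G c (e k l) w <= kp * rho ^+ 2 + d / 4 * rho ^+ 2 + d / 4 * rho ^+ 2.
  apply: le_trans (Hmu A (wmat G c y1) (e^~ l) (tt l) w EA (le_trans ew1 dtmu) nA (tt01 l hl) _) _.
    by move=> k; exact: le_trans (edist k l hl) smallmu.
  apply: lerD => //; apply: le_trans (ler_wpM2l (ltW dr0) w2) _.
  by rewrite /dr; apply: eq_le_R; field; rewrite gt_eqF.
have term k : 2^-1 * (vsquare y (1 *: (ep *: e k l)) w (1 *: (rho *: (ep *: D k)))
     + vsquare y ((-1) *: (ep *: e k l)) w ((-1) *: (rho *: (ep *: D k)))) <=
   rho ^+ 2 + ep ^+ 2 * (rho ^+ 2 * (rr ^- 2 + dt * (P1 + P2)))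
   + ep ^+ 2 * (dv * (N ^+ 2 * (2 * K) + ND ^+ 2) * rho ^+ 2)
   + ep ^+ 2 * curv G c (e k l) w.
  have hep : `|ep *: e k l| <= rv.
    rewrite normrZ gtr0_norm//; apply: le_trans r_v; apply: le_trans epN.
    by rewrite ler_wpM2l ?(ltW ep0)//; exact: ebnd.
  have [_ _ /(_ w (rho *: (ep *: D k)))] := Hv y (ep *: e k l) (le_trans hy r_v) hep.
  rewrite !scale1r !scaleN1r => h4; apply: le_trans h4 _.
  rewrite ww [X in _ <= X]addrAC -!addrA lerD2l; apply: lerD.
    by rewrite mformZZ; do 2 (rewrite ler_wpM2l ?sqr_ge0//); exact: GD.
  apply: lerD.
    by rewrite (curv_form sG Wc) (curv_form sG Wc (e k l)) mformZl mformZr mulrA.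
  rewrite !normrZ (gtr0_norm ep0) (ger0_norm rho0) !exprMn.
  have ne := ebnd k l hl; have nDk := nD k.
  have q1 : `|e k l| ^+ 2 * `|w| ^+ 2 <= N ^+ 2 * (2 * K * rho ^+ 2).
    by apply: ler_pM; rewrite ?sqr_ge0// ler_pXn2r ?nnegrE// ltW.
  have q2 : rho ^+ 2 * `|D k| ^+ 2 <= rho ^+ 2 * ND ^+ 2.
    by rewrite ler_wpM2l ?sqr_ge0// ler_pXn2r ?nnegrE// ltW.
  have ep2 := sqr_ge0 ep.
  have -> : dv * (ep ^+ 2 * `|e k l| ^+ 2 * `|w| ^+ 2 + rho ^+ 2 * (ep ^+ 2 * `|D k| ^+ 2)) =
     ep ^+ 2 * (dv * (`|e k l| ^+ 2 * `|w| ^+ 2 + rho ^+ 2 * `|D k| ^+ 2)).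
    by move: (`|e k l|) `|w| `|D k| => x1 x2 x3; ring.
  rewrite ler_wpM2l// -mulrA ler_wpM2l ?(ltW dv0)//.
  apply: le_trans (lerD q1 q2) _; apply: eq_le_R; ring.
apply: le_trans (ler_sum _ (fun k _ => term k)) _.
rewrite sum_affine.
have dvn : n%:R * (dv * (N ^+ 2 * (2 * K) + ND ^+ 2)) <= d / 4.
  pose q := n%:R * (N ^+ 2 * (2 * K) + ND ^+ 2).
  have q0 : 0 <= q by rewrite mulr_ge0// addr_ge0// ?mulr_ge0 ?sqr_ge0// ltW.
  have -> : n%:R * (dv * (N ^+ 2 * (2 * K) + ND ^+ 2)) = (d / 4) * (q / (q + 1)).
    by rewrite /dv -/q invfM; rewrite /q; ring.
  rewrite ler_piMr ?divr_ge0 ?(ltW d0)// ler_pdivrMr ?mul1r ?lerDl//.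
  by rewrite ltr_wpDl.
have R0 := sqr_ge0 rho; have E0 := sqr_ge0 ep.
exact: variation_sum_arith.
Qed.

End LinkVariation.

(** * Distances between varied points *)

Section Taylor.
Context {R : realType}.

Lemma is_derive_near0 (f : R -> R) (a e : R) : is_derive (0 : R) (1 : R) f a -> 0 < e ->
  \forall s \near (0 : R), `|f s - f 0 - s * a| <= e * `|s|.
Proof.
move=> [d1 d2] e0.
have : (fun h : R => h^-1 *: ((f \o shift 0) (h *: (1 : R)) - f 0)) @ 0^' --> 'D_1 f 0 by exact: d1.
rewrite d2 => /cvgrPdist_le/(_ _ e0)/nbhs_ballP[d /= d0 Hd]; apply/nbhs_ballP; exists d => // s.
rewrite -ball_normE /= sub0r normrN => sd; have [->|s0] := eqVneq s 0.
  by rewrite subrr sub0r mul0r oppr0 normr0 mulr0.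
have := Hd s; rewrite -ball_normE /= sub0r normrN => /(_ sd s0).
rewrite [s *: (1 : R)]mulr1 addr0 => h.
have -> : f s - f 0 - s * a = s * (s^-1 * (f s - f 0) - a) by field.
by rewrite normrM mulrC ler_wpM2r// distrC.
Qed.

(** Peano's form of the remainder: [df] need only be derivable at 0, and the mean value theorem is
    applied once, to [f] minus its Taylor polynomial. *)
Lemma taylor2 (f df : R -> R) (a e : R) :
  (\forall s \near (0 : R), is_derive s (1 : R) f (df s)) -> is_derive (0 : R) (1 : R) df a ->
  0 < e -> \forall s \near (0 : R), `|f s - f 0 - s * df 0 - 2^-1 * s ^+ 2 * a| <= e * s ^+ 2.
Proof.
move=> Nf ddf e0; have N := is_derive_near0 ddf e0.
have [d /= d0 Hd] := (nbhs_ballP _ _).1 (filterI Nf N).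
apply/nbhs_ballP; exists d => // s; rewrite -ball_normE /= sub0r normrN => sd.
pose g (t : R) := f t - t * df 0 - 2^-1 * t ^+ 2 * a.
have dg (t : R) : `|t| <= `|s| -> is_derive t (1 : R) g (df t - df 0 - t * a).
  move=> ts; have [|dft _] := Hd t.
    by rewrite -ball_normE /= sub0r normrN; exact: le_lt_trans sd.
  have h1 := is_derive_mulr (is_derive_id t (1 : R)) (is_derive_cst (df 0) t (1 : R)).
  have h2 := is_derive_mulr (is_derive_mulr (is_derive_cst (2^-1 : R) t (1 : R))
    (is_derive_mulr (is_derive_id t (1 : R)) (is_derive_id t (1 : R)))) (is_derive_cst a t (1 : R)).
  apply: is_derive_eq (is_deriveB (is_deriveB dft h1) h2) _.
  by rewrite /cst; field.
have sc (t : R) : 0 <= t <= 1 -> `|0 + t *: s| <= `|s|.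
  by move=> /andP[t0 t1]; rewrite add0r normrZ ger0_norm// ler_piMl.
have [t t01|t t01] := @line_MVT R _ g 0 s.
  have [h1 h2] := dg _ (sc t t01); have := is_derive_scale s h1; rewrite [s *: (1 : R)]mulr1.
  by case.
have [h1 h2] := dg _ (sc t t01); have := is_derive_scale s h1; rewrite [s *: (1 : R)]mulr1.
move=> [_ ->]; rewrite h2 add0r /g !mul0r !subr0 expr0n /= mulr0 mul0r subr0 => E.
have -> : f s - f 0 - s * df 0 - 2^-1 * s ^+ 2 * a = f s - s * df 0 - 2^-1 * s ^+ 2 * a - f 0 by ring.
rewrite E normrM; have [|_ h3] := Hd (0 + t *: s).
  by rewrite -ball_normE /= sub0r normrN; apply: le_lt_trans sd; exact: sc.
apply: le_trans (ler_wpM2l (normr_ge0 s) h3) _.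
rewrite -[s ^+ 2]ger0_norm ?sqr_ge0// normrX expr2 mulrCA ler_wpM2l ?(ltW e0)//.
by rewrite ler_wpM2l//; exact: sc.
Qed.

End Taylor.

Lemma scale_line (R : realType) (n : nat) (ep l : R) (a d : 'rV[R]_n) :
  ep *: a + l *: (ep *: d) = ep *: (a + l *: d).
Proof. by apply/rowP => j; rewrite !mxE; ring. Qed.

Lemma end_line (R : realType) (n : nat) (L : R) (a b : 'rV[R]_n) : L != 0 ->
  a + L *: (L^-1 *: (b - a)) = b.
Proof. by move=> L0; rewrite scalerA divff// scale1r subrKC. Qed.

Lemma frac_le (R : realType) (nn Kt eta : R) : 0 <= nn -> 0 <= Kt -> 0 < eta ->
  eta / 4 * ((nn + Kt / 2) / (nn + Kt + 1)) <= eta / 4.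
Proof.
move=> n0 K0 e0; rewrite ler_piMr//; first by lra.
by rewrite ler_pdivrMr; lra.
Qed.

Lemma link_arith (R : realType) (m e1 e2 eta ep L h Kt : R) : 0 <= Kt -> ep <= 1 -> 0 < ep -> 0 <= m ->
  L < h + ep ^+ 2 * e1 -> 0 < e1 -> m * (2 * e2) <= eta / 4 -> e1 * (m + Kt / 2) <= eta / 4 ->
  m * (2 * e2 * ep ^+ 2) + L * (m + ep ^+ 2 * Kt / 2) <= m * h + ep ^+ 2 / 2 * (h * Kt + eta).
Proof.
move=> K0 ep1 ep0 m0 hL e10 f1 f2.
have E0 : 0 <= ep ^+ 2 by exact: sqr_ge0.
have E1 : ep ^+ 2 <= 1 by rewrite expr_le1// ltW.
have g1 : L * (m + ep ^+ 2 * Kt / 2) <= (h + ep ^+ 2 * e1) * (m + ep ^+ 2 * Kt / 2).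
  by rewrite ler_wpM2r ?(ltW hL)// addr_ge0// divr_ge0// mulr_ge0.
have g2 : ep ^+ 2 * (e1 * (m + ep ^+ 2 * Kt / 2)) <= ep ^+ 2 * (eta / 4).
  rewrite ler_wpM2l//; apply: le_trans f2; rewrite ler_wpM2l ?(ltW e10)// lerD2l.
  by rewrite ler_wpM2r// ler_piMl.
have g3 := ler_wpM2l E0 f1.
by lra.
Qed.

Section Mismatch.
Context {R : realType} {n : nat} {M : topologicalType} (g : riemannian R n M).
Implicit Types (p q x z : M).

(** The approximate exponential map at [x], in the chart centered at [x]. All displacements are
    expressed through it at the ends of links, so that links handled in different charts can be
    joined. *)
Definition apt x (v : 'rV[R]_n) : M := vpt g x (chart g x x) v.

Lemma vmap_line (G : 'rV[R]_n -> 'M[R]_n) c y a (s : R) : vmap G c y (s *: a) =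
  y + s *: tmap G c y a - (2^-1 * s ^+ 2) *: gam2 G y (tmap G c y a) (tmap G c y a).
Proof.
have -> : vmap G c y (s *: a) = y + s *: tmap G c y a - 2^-1 *: gam2 G y (s *: tmap G c y a) (s *: tmap G c y a).
  by rewrite /vmap /tmap gam2Zr scalerBr.
by rewrite gam2Zl gam2Zr !scalerA expr2 mulrA.
Qed.

Lemma wd_chart x : exists r C : R, [/\ 0 < r, 0 < C & forall y1 y2,
  `|y1 - chart g x x| < r -> `|y2 - chart g x x| < r ->
  wd g (chart_inv g x y1) (chart_inv g x y2) (C * `|y2 - y1|)].
Proof.
have zc := cod_chart (chart_dom_center g x); set c := chart g x x in zc *.
have [rho [C [rho0 C0 sub H]]] := metric_bounds zc.
exists rho, C; split=> // y1 y2 h1 h2.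
suff : wd g (chart_inv g x y1) (chart_inv g x (y1 + (y2 - y1))) (C * `|y2 - y1|).
  by rewrite subrKC.
apply: wd_segment; first by rewrite mulr_ge0// ltW.
move=> t /andP[t0 t1]; have inb : ball c rho (y1 + t *: (y2 - y1)).
  rewrite -ball_normE /= distrC.
  have -> : y1 + t *: (y2 - y1) - c = (1 - t) *: (y1 - c) + t *: (y2 - c).
    by apply/rowP => k; rewrite !mxE; ring.
  apply: le_lt_trans (ler_normD _ _) _; rewrite !normrZ (ger0_norm t0) ger0_norm ?subr_ge0//.
  have := t0; rewrite le_eqVlt => /predU1P[<-|t0'].
    by rewrite subr0 mul1r mul0r addr0.
  have -> : rho = (1 - t) * rho + t * rho by ring.
  by apply: ler_ltD; [rewrite ler_wpM2l ?subr_ge0// ltW|rewrite ltr_pM2l].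
split; first exact: sub.
by rewrite exprMn; have [] := H _ inb (y2 - y1).
Qed.

(** Both curves start at [x] with the same velocity and with zero covariant acceleration. By the
    transformation law of the connection their second-order jets agree in the chart of [x], so they
    separate by o(s^2), which is invisible in a second variation. *)
Lemma ray_mismatch z x a (e : R) : chart_dom g z x -> 0 < e ->
  let y := chart g z x in let c := chart g z z in
  let v := jac (trans g z x) y (tmap (metric g z) c y a) in
  \forall s \near (0 : R), wd g (vpt g z y (s *: a)) (apt x (s *: v)) (e * s ^+ 2).
Proof.
move=> zx e0 y c; pose t := tmap (metric g z) c y a; rewrite -/t => v.
have xx := chart_dom_center g x.
have oy : overlap g z x y by exact: overlap_chart.
set O := overlap g z x in oy; have oO : open O by exact: open_overlap.
pose phi := trans g z x; have Cphi : smooth_on O phi by exact: trans_smooth.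
have pe : phi y = chart g x x by exact: trans_chart.
pose G := metric g z; pose G' := metric g x.
pose p (s : R) := y + s *: t - (2^-1 * s ^+ 2) *: gam2 G y t t.
pose dp (s : R) := t - s *: gam2 G y t t.
have hp (s : R) : is_derive s (1 : R) p (dp s) by exact: is_derive_parabola.
have p0 : p 0 = y by rewrite /p scale0r expr0n mulr0 scale0r subr0 addr0.
have Np : \forall s \near (0 : R), O (p s).
  have := is_derive_cont (hp 0); apply; rewrite p0; exact: open_nbhs_nbhs.
have dphi Y u : O Y -> derivable phi Y u by move=> OY; exact: (Ck_derivable u (Cphi 1) OY).
pose gvv := gam2 G' (chart g x x) v v.
have lin Y (s : R) : O Y -> 'D_(dp s) phi Y = 'D_t phi Y - s *: 'D_(gam2 G y t t) phi Y.
  move=> OY; rewrite !(derive_rV_mx _ oO (Cphi 1) OY) scaler_sumr -sumrB.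
  by apply: eq_bigr => i _; rewrite !mxE scalerBl scalerA.
(* In the chart of [x], the acceleration of the transported curve is the one prescribed by the
   connection there. *)
have second : 'D_t ('D_t phi) y - 'D_(gam2 G y t t) phi y = - gvv.
  have s1 : smooth_metric O (metric g z) by apply: smooth_metric_sub => // Y [].
  have iso Y : O Y -> forall v w, mform (metric g z Y) v w =
     mform (metric g x (trans g z x Y)) ('D_v (trans g z x) Y) ('D_w (trans g z x) Y).
    by move=> OY v' w'; exact: trans_iso.
  have := christoffel_change s1 (smooth_metric_cod g x) Cphi (@trans_cod _ _ _ g z x) iso t t oy.
  rewrite pe -/gvv => E.
  rewrite -[X in _ - X]/(jac phi y (gam2 G y t t)) E.
  by rewrite -[X in X - _]/(jac2 phi y t t) opprD addrA subrr sub0r.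
have coord (j : 'I_n) (e1 : R) : 0 < e1 -> \forall s \near (0 : R),
    `|(phi (p s) - (chart g x x + s *: v - (2^-1 * s ^+ 2) *: gvv)) 0 j| <= e1 * s ^+ 2.
  move=> e10.
  have H1 : \forall s \near (0 : R), is_derive s (1 : R) (fun s => phi (p s) 0 j) (('D_(dp s) phi (p s)) 0 j).
    apply: filterS Np => s Os; apply: is_derive_entry.
    have [h1 h2] := hp s; have := is_derive_comp oO (Cphi 1) Os h1; by rewrite h2.
  have H2 : is_derive (0 : R) (1 : R) (fun s : R => ('D_(dp s) phi (p s)) 0 j) ((- gvv) 0 j).
    rewrite -second; apply: is_derive_entry.
    have Op0 : O (p 0) by rewrite p0.
    have [h1 h2] := hp 0; have dp0 : dp 0 = t by rewrite /dp scale0r subr0.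
    have k1 := is_derive_comp oO (Ck_derive t (Cphi 2)) Op0 h1; rewrite h2 dp0 p0 in k1.
    have k2 := is_derive_comp oO (Ck_derive (gam2 G y t t) (Cphi 2)) Op0 h1; rewrite h2 dp0 p0 in k2.
    have k3 : is_derive (0 : R) (1 : R) (fun s : R => s *: 'D_(gam2 G y t t) phi (p s)) ('D_(gam2 G y t t) phi y).
      apply: is_derive_mx => i l.
      have -> : (fun s : R => (s *: 'D_(gam2 G y t t) phi (p s)) i l) =
        (fun s : R => s * ('D_(gam2 G y t t) phi (p s)) i l) by apply/funext => s; rewrite mxE.
      apply: is_derive_eq (is_derive_mulr (is_derive_id (0 : R) (1 : R)) (is_derive_entry i l k2)) _.
      by rewrite p0 mul1r mul0r addr0.
    pose SO := [set s : R | O (p s)].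
    have oS : open SO by apply: open_comp => // s _; exact: is_derive_cont (hp s).
    apply: (is_derive_on_ext oS _ Op0 (is_deriveB k1 k3)).
    by move=> s Os; rewrite lin.
  have := taylor2 H1 H2 e10; apply: filterS => s.
  have -> : 'D_(dp 0) phi (p 0) = v by rewrite /dp scale0r subr0 p0.
  rewrite p0 pe; congr (`|_| <= _); rewrite !mxE.
  by move: (phi (p s) 0 j) => w; ring.
have [r [C [r0 C0 HC]]] := wd_chart x.
have e1 : 0 < e / C by rewrite divr_gt0.
have N1 := @filter_forall _ _ _ (nbhs (0 : R)) (nbhs_filter (0 : R)) (fun j => coord j _ e1).
have cq (w u : 'rV[R]_n) : \forall s \near (0 : R), `|chart g x x + s *: w - (2^-1 * s ^+ 2) *: u - chart g x x| < r.
  have := is_derive_cont (is_derive_parabola (chart g x x) w u (0 : R)).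
  move=> /cvgrPdist_lt/(_ _ r0); apply: filterS => s.
  by rewrite scale0r expr0n mulr0 scale0r subr0 addr0 distrC.
have cphi : \forall s \near (0 : R), `|phi (p s) - chart g x x| < r.
  have := is_derive_comp oO (Cphi 1) (_ : O (p 0)) (proj1 (conj (ex_derive) I)).
  have [h1 _] := hp 0; have Op0 : O (p 0) by rewrite p0.
  move=> _; have := is_derive_cont (is_derive_comp oO (Cphi 1) Op0 h1).
  move=> /cvgrPdist_lt/(_ _ r0); apply: filterS => s.
  by rewrite p0 pe distrC.
apply: filterS (filterI (filterI N1 Np) (filterI (cq v gvv) cphi)) => s [[h1 Os] [h2 h3]].
have -> : vpt g z y (s *: a) = chart_inv g x (phi (p s)).
  have [_ h4] := Os; rewrite /vpt vmap_line.
  by rewrite -[LHS](chartK h4).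
have -> : apt x (s *: v) = chart_inv g x (chart g x x + s *: v - (2^-1 * s ^+ 2) *: gvv).
  by rewrite /apt /vpt vmap_center.
apply: wd_le (HC _ _ h3 h2).
rewrite distrC; have h4 : `|phi (p s) - (chart g x x + s *: v - (2^-1 * s ^+ 2) *: gvv)| <= e / C * s ^+ 2.
  apply: mx_norm_le => [|i j]; first by rewrite mulr_ge0 ?sqr_ge0 ?(ltW e1).
  by rewrite ord1; exact: h1.
apply: le_trans (ler_wpM2l (ltW C0) h4) _.
by rewrite mulrA [C * _]mulrC divfK ?gt_eqF.
Qed.

Section Link.
Variable z : M.
Let c := chart g z z.
Let G := metric g z.
Variables (kp rr : R).
Hypotheses (kp0 : 0 <= kp) (rr0 : 0 < rr).
Hypothesis hRic : forall v, - kp * inner g z v v <= ricci g z v v.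

Lemma jac_tmap x : chart_dom g z x -> pmat G c (chart g z x) \in unitmx ->
  let F a := jac (trans g z x) (chart g z x) (tmap G c (chart g z x) a) in
  [/\ forall a (t : R), F (t *: a) = t *: F a,
    forall a b, mform (metric g x (chart g x x)) (F a) (F b) =
      mform (wmat G c (chart g z x)) a b &
    forall u, exists a, F a = u].
Proof.
move=> zx up F; have xx := chart_dom_center g x.
have oy := overlap_chart zx xx; have oO := open_overlap (g := g) z x.
have C1 := @trans_smooth _ _ _ g z x 1.
have sO : smooth_metric (overlap g z x) G by apply: smooth_metric_sub => // Y [].
have iso Y : overlap g z x Y -> forall v w, mform (metric g z Y) v w =
   mform (metric g x (trans g z x Y)) ('D_v (trans g z x) Y) ('D_w (trans g z x) Y).
  by move=> OY v' w'; exact: trans_iso.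
split.
- move=> a t; rewrite /F -!pmatE -scalemxAl /jac !(derive_rV_mx _ oO C1 oy) scaler_sumr.
  by apply: eq_bigr => i _; rewrite mxE scalerA.
- by move=> a b; rewrite wmatE (trans_iso oy) trans_chart.
move=> u; have [w ew] := jac_surj sO (trans_smooth g z x) iso u oy.
by exists (w *m invmx (pmat G c (chart g z x))); rewrite /F -pmatE mulmxKV.
Qed.

(* A nearly minimizing curve from x to x' is varied by the field interpolating between s E and
   s' E': the interpolation costs n / rr^2 per unit of length and the curvature costs kp. *)
Lemma link_step (d : R) : 0 < d -> exists2 rho : R, 0 < rho & forall x x' h,
  wd g z x rho -> 0 < h -> h < rho -> wd g x x' h -> (forall l, wd g x x' l -> h <= l) ->
  forall (E : 'M[R]_n) (s s' : R), E *m metric g x (chart g x x) *m E^T = 1%:M ->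
  0 <= s -> s' = s + h / rr -> s' <= 1 ->
  exists2 E' : 'M[R]_n, E' *m metric g x' (chart g x' x') *m E'^T = 1%:M &
  forall eta : R, 0 < eta -> \forall ep \near (0 : R)^'+, exists l1 l2 : 'I_n -> R,
    (forall k, wd g (apt x (ep *: (s *: row k E))) (apt x' (ep *: (s' *: row k E'))) (l1 k) /\
      wd g (apt x ((- ep) *: (s *: row k E))) (apt x' ((- ep) *: (s' *: row k E'))) (l2 k)) /\
    \sum_k 2^-1 * (l1 k + l2 k) <=
      n%:R * h + ep ^+ 2 / 2 * (h * (n%:R * rr ^- 2 + kp + d) + eta).
Proof.
move=> d0; have zc : cod g z c := cod_chart (chart_dom_center g z).
have sG := smooth_metric_cod g z.
have [rho0 [C [rho00 C0 sub _ low]]] := chart_lower zc.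
have [N N0 [r r0 [hr HP]]] := pointwise_variation sG zc kp0 rr0 hRic C0 d0.
(* Points within 3 q of [z] lie in the chart, with coordinates within [r] of [c], after the metric
   comparison factor [C]; this leaves room for [q], for the link, and for the excess length of the
   curve chosen below. *)
pose q := Num.min (Num.min rho0 r) (C * r) / (4 * C).
have q0 : 0 < q by rewrite divr_gt0 ?mulr_gt0// !lt_min rho00 r0 mulr_gt0.
have qE : C * (4 * q) = Num.min (Num.min rho0 r) (C * r).
  by rewrite /q; field; rewrite gt_eqF.
have q1 : C * (4 * q) <= rho0 by rewrite qE !ge_min lexx.
have q2 : C * (4 * q) <= r by rewrite qE !ge_min lexx orbT.
have q3 : 4 * q <= r by rewrite -(ler_pM2l C0) qE !ge_min lexx !orbT.
exists q => // x x' h zx h0 hq xx' exact_h E s s' EE s0 s'E s'1.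
have cz y l : wd g z y l -> wd g (chart_inv g z c) y l.
  by rewrite /c chartK//; exact: chart_dom_center.
have Cq (k : R) : k < 4 * q -> C * k < rho0.
  by move=> kq; apply: lt_le_trans q1; rewrite ltr_pM2l.
have [qq [q4 q5]] : q <= 3 * q /\ q < 4 * q /\ 2 * q < 4 * q by split; [|split]; lra.
have qh : q + h <= 3 * q by lra.
have near_c y l : wd g z y l -> l <= 3 * q -> chart_dom g z y /\ `|chart g z y - c| <= r.
  move=> zy lq; have Cl : C * l < rho0.
    apply: lt_le_trans q1; rewrite ltr_pM2l//; lra.
  have [zdy hy] := low c y l (ballxx _ rho00) (cz _ _ zy) Cl.
  split=> //; apply: le_trans hy _; apply: le_trans q2; rewrite ler_pM2l//; lra.
have [zx1 hy1] := near_c x q zx qq.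
have zx' : wd g z x' (q + h) := wd_trans zx xx'.
have [zx1' hy2] := near_c x' _ zx' qh.
set y1 := chart g z x in hy1; set y2 := chart g z x' in hy2.
have [W1 u1 HA] := HP y1 hy1.
have [_ F1 F1s] := jac_tmap zx1 u1.
(* The frame at [x] is pulled back to the chart center through the transport. There it becomes
   orthonormal for [wmat] and can be moved to [x']. *)
have /choice[a Ha] : forall k, exists a, jac (trans g z x) y1 (tmap G c y1 a) = row k E.
  by move=> k; exact: F1s.
pose A : 'M[R]_n := \matrix_k a k.
have EA : A *m wmat G c y1 *m A^T = 1%:M.
  apply/frameP => k l; rewrite !rowK -F1 !Ha.
  by have /frameP := EE; apply.
have [W2 u2 [A' EA' HA']] := HA A EA y2 hy2.
have [F2l F2 _] := jac_tmap zx1' u2; have [F1l _ _] := jac_tmap zx1 u1.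
(* The moved frame [A'] is pushed forward to [x'], where it is orthonormal for the metric. *)
pose b k := jac (trans g z x') y2 (tmap G c y2 (row k A')).
exists (\matrix_k b k).
  apply/frameP => k l; rewrite !rowK F2.
  by have /frameP := EA'; apply.
move=> eta eta0.
pose Kt := n%:R * rr ^- 2 + kp + d.
have Kt0 : 0 <= Kt by rewrite !addr_ge0 ?(ltW d0)// mulr_ge0// invr_ge0 sqr_ge0.
pose e1 := eta / (4 * (n%:R + Kt + 1)); pose e2 := eta / (8 * (n%:R + 1)).
have e10 : 0 < e1 by rewrite divr_gt0// mulr_gt0// ltr_wpDl// addr_ge0.
have e20 : 0 < e2 by rewrite divr_gt0// mulr_gt0// ltr_wpDl.
have M1 k := ray_mismatch (s *: a k) zx1 e20.
have M2 k := ray_mismatch (s' *: row k A') zx1' e20.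
have {}M1 := @filter_forall _ _ _ (nbhs (0 : R)) (nbhs_filter (0 : R)) M1.
have {}M2 := @filter_forall _ _ _ (nbhs (0 : R)) (nbhs_filter (0 : R)) M2.
have [d1 /= d10 Hd] := (nbhs_ballP _ _).1 (filterI M1 M2).
pose ep0 := Num.min (Num.min d1 1) (Num.min (r / N) (q / (e1 + 1))).
have e11 : 0 < e1 + 1 by rewrite addr_gt0.
have ep00 : 0 < ep0 by rewrite !lt_min d10 ltr01 /=; apply/andP; split; exact: divr_gt0.
near=> ep.
have ep_gt : 0 < ep by near: ep; exact: nbhs_right_gt.
have ep_lt : ep < ep0 by near: ep; exact: nbhs_right_lt.
have ep1 : ep < d1 by apply: lt_le_trans ep_lt _; rewrite !ge_min lexx.
have ep2 : ep <= 1 by apply: ltW; apply: lt_le_trans ep_lt _; rewrite !ge_min lexx orbT.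
have ep3 : ep * N <= r.
  by rewrite -ler_pdivlMr//; apply: ltW; apply: lt_le_trans ep_lt _; rewrite !ge_min lexx !orbT.
have ep4 : ep ^+ 2 * e1 <= q.
  apply: (@le_trans _ _ (ep * (e1 + 1))).
    by apply: ler_pM => //; rewrite ?sqr_ge0 ?(ltW e10)// ?expr2 ?ler_piMr ?(ltW ep_gt)// lerDl.
  by rewrite -ler_pdivlMr//; apply: ltW; apply: lt_le_trans ep_lt _; rewrite !ge_min lexx !orbT.
have tau0 : 0 < ep ^+ 2 * e1 by rewrite mulr_gt0// exprn_gt0.
(* The curve depends on [ep]: its excess length is below ep^2 e1, so that non-attainment of the
   distance only contributes to [eta]. Its length is at least [h] since [h] is the exact
   distance. *)
have [L Lh pL] := wd_path xx' tau0.
have hL : h <= L by apply: exact_h; exact: path_wd.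
have L0 : 0 < L by exact: lt_le_trans hL.
have L2q : L <= 2 * q.
  by apply: ltW; apply: lt_le_trans Lh _; rewrite mulr_natl mulr2n lerD// ltW.
have yL : `|y2 - y1| <= C * L.
  have [_ hh] := low c x q (ballxx _ rho00) (cz _ _ zx) (Cq _ q4).
  have By1 : ball c rho0 y1.
    by rewrite -ball_normE /= distrC; apply: le_lt_trans hh (Cq _ q4).
  have xL : wd g (chart_inv g z y1) x' L by rewrite /y1 chartK//; exact: path_wd.
  by have [] := low y1 x' L By1 xL (Cq _ (le_lt_trans L2q q5)).
have Lr : L <= r by apply: le_trans q3; apply: le_trans L2q _; exact: ltW.
have [eb var] := HA' L h s s' h0 hL Lr yL s0 s'E s'1.
pose A1 k := ep *: (s *: row k A); pose D1 k := ep *: vfield A A' s s' L k.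
have AD k l : A1 k + l *: D1 k = ep *: vpos A A' s s' L k l.
  exact: scale_line.
have K0 : 0 <= ep ^+ 2 * Kt by rewrite mulr_ge0// sqr_ge0.
have he k (l : R) : 0 <= l <= L -> `|A1 k + l *: D1 k| <= r.
  move=> hl; rewrite AD normrZ gtr0_norm//; apply: le_trans ep3.
  by rewrite ler_wpM2l ?(ltW ep_gt)//; exact: eb.
have var' y w (l rho : R) : `|y - c| <= r -> 0 <= l <= L -> 0 <= rho ->
    mform (G y) w w = rho ^+ 2 ->
    let X s k := vmapl G c y (s *: (A1 k + l *: D1 k)) w (s *: (rho *: D1 k)) in
    \sum_k 2^-1 * (mform (G (vmap G c y (1 *: (A1 k + l *: D1 k)))) (X 1 k) (X 1 k)
     + mform (G (vmap G c y ((-1) *: (A1 k + l *: D1 k)))) (X (-1) k) (X (-1) k))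
    <= rho ^+ 2 * (n%:R + ep ^+ 2 * Kt).
  move=> hy hl rr' ww; have := var ep ep_gt ep3 y w l rho hy hl rr' ww.
  by under eq_bigr do rewrite -AD.
have qL : q + L <= 3 * q.
  by rewrite [leRHS]mulr_natl mulrS lerD2l -mulr_natl.
have L00 : 0 + L <= L by rewrite add0r.
have [l1 [l2 [Hl Sl]]] := vary_path hr near_c K0 he var' pL zx qL (lexx 0) L00.
(* The two terms e2 ep^2 pay for replacing the chart displacements by [apt] at both ends. *)
exists (fun k => e2 * ep ^+ 2 + l1 k + e2 * ep ^+ 2), (fun k => e2 * ep ^+ 2 + l2 k + e2 * ep ^+ 2).
split.
  have Af k : A1 k + 0 *: D1 k = ep *: (s *: a k).
    by rewrite scale0r addr0 /A1 rowK.
  have Al k : A1 k + (0 + L) *: D1 k = ep *: (s' *: row k A').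
    rewrite add0r AD; congr (_ *: _); apply: end_line.
    by rewrite gt_eqF.
  have epb (t : R) : `|t| = ep -> ball (0 : R) d1 t.
    by move=> te; rewrite -ball_normE /= sub0r normrN te.
  have join (t : R) k l : `|t| = ep ->
      wd g (vpt g z y1 (t *: (s *: a k))) (vpt g z y2 (t *: (s' *: row k A'))) l ->
      wd g (apt x (t *: (s *: row k E))) (apt x' (t *: (s' *: row k (\matrix_k b k))))
        (e2 * ep ^+ 2 + l + e2 * ep ^+ 2).
    move=> te hl; have [/(_ k) m1 /(_ k) m2] := Hd t (epb t te).
    have t2 : t ^+ 2 = ep ^+ 2 by rewrite -te -normrX ger0_norm// sqr_ge0.
    rewrite F1l Ha t2 in m1; rewrite F2l t2 in m2.
    by rewrite rowK; exact: wd_trans (wd_trans (wd_sym m1) hl) m2.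
  have np : `|ep| = ep by rewrite gtr0_norm.
  have nn : `|- ep| = ep by rewrite normrN.
  move=> k; have [] := Hl k; rewrite Af Al !scale1r !scaleN1r -!scaleNr => h1 h2.
  by split; exact: join.
have -> : \sum_k 2^-1 * (e2 * ep ^+ 2 + l1 k + e2 * ep ^+ 2 + (e2 * ep ^+ 2 + l2 k + e2 * ep ^+ 2)) =
    n%:R * (2 * e2 * ep ^+ 2) + 1 * \sum_k 2^-1 * (l1 k + l2 k).
  by rewrite -sum_affine; apply: eq_bigr => k _; field.
rewrite mul1r; apply: le_trans (_ : n%:R * (2 * e2 * ep ^+ 2) + L * (n%:R + ep ^+ 2 * Kt / 2) <= _).
  by rewrite lerD2l.
have f1 : n%:R * (2 * e2) <= eta / 4.
  have -> : n%:R * (2 * e2) = eta / 4 * (n%:R / (n%:R + 1)).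
    by rewrite /e2; field; rewrite gt_eqF// ltr_wpDl.
  by rewrite ler_piMr ?divr_ge0 ?(ltW eta0)// ler_pdivrMr ?ltr_wpDl// mul1r lerDl.
have f2 : e1 * (n%:R + Kt / 2) <= eta / 4.
  have -> : e1 * (n%:R + Kt / 2) = eta / 4 * ((n%:R + Kt / 2) / (n%:R + Kt + 1)).
    by rewrite /e1; field; rewrite gt_eqF// ltr_wpDl// addr_ge0.
  exact: frac_le.
rewrite -/Kt.
exact: (link_arith Kt0 ep2 ep_gt _ Lh e10 f1 f2).
Unshelve. all: by end_near.
Qed.

End Link.
End Mismatch.

(** * Comparison along a minimizing chain *)

Lemma step_frac (R : realType) (k r j : R) : k != 0 -> r != 0 ->
  (j + 1) / k = j / k + r / k / r.
Proof. by move=> k0 r0; field; rewrite k0 r0. Qed.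

Section Radial.
Context {R : realType} {n : nat} {M : topologicalType} (g : riemannian R n M).
Implicit Types (p q x z : M).

Lemma wd0_eq p q : wd g p q 0 -> q = p.
Proof.
have zc := cod_chart (chart_dom_center g p); have [rho [C [rho0 C0 _ _ H]]] := chart_lower zc.
move=> pq; have [] := H (chart g p p) q 0 (ballxx _ rho0); rewrite ?mulr0//.
  by rewrite chartK//; exact: chart_dom_center.
move=> pdq; rewrite normr_le0 subr_eq0 => /eqP E.
by rewrite -(chartK pdq) E chartK//; exact: chart_dom_center.
Qed.

Lemma apt0 x : apt g x 0 = x.
Proof. by rewrite /apt /vpt vmap0 chartK//; exact: chart_dom_center. Qed.

Lemma frame_exists x : exists E : 'M[R]_n, E *m metric g x (chart g x x) *m E^T = 1%:M.
Proof.
have [C _ H] := @cholesky R n; have [E [EE _]] := H _ (metric_posdefP (cod_chart (chart_dom_center g x))).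
by exists E.
Qed.

(* The mean, over the directions +- E_k, of the distances from q of the points reached from x by
   displacements of size ep s is at most b + ep^2 c / (2 n) up to o(ep^2). *)
Definition spread q x (E : 'M[R]_n) (s b c : R) := forall eta : R, 0 < eta ->
  \forall ep \near (0 : R)^'+, exists l1 l2 : 'I_n -> R,
    (forall k, wd g q (apt g x (ep *: (s *: row k E))) (l1 k) /\
      wd g q (apt g x ((- ep) *: (s *: row k E))) (l2 k)) /\
    \sum_k 2^-1 * (l1 k + l2 k) <= n%:R * b + ep ^+ 2 / 2 * (c + eta).

Lemma spread_step q x x' (E E' : 'M[R]_n) (s s' b c h C : R) : spread q x E s b c ->
  (forall eta : R, 0 < eta -> \forall ep \near (0 : R)^'+, exists l1 l2 : 'I_n -> R,
    (forall k, wd g (apt g x (ep *: (s *: row k E))) (apt g x' (ep *: (s' *: row k E'))) (l1 k) /\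
      wd g (apt g x ((- ep) *: (s *: row k E))) (apt g x' ((- ep) *: (s' *: row k E'))) (l2 k)) /\
    \sum_k 2^-1 * (l1 k + l2 k) <= n%:R * h + ep ^+ 2 / 2 * (h * C + eta)) ->
  spread q x' E' s' (b + h) (c + h * C).
Proof.
move=> H1 H2 eta eta0; have e0 : 0 < eta / 2 by rewrite divr_gt0.
apply: filterS (filterI (H1 _ e0) (H2 _ e0)) => ep [[l1 [l2 [L1 L2]]] [k1 [k2 [K1 K2]]]].
exists (fun k => l1 k + k1 k), (fun k => l2 k + k2 k); split.
  move=> k; have [a1 a2] := L1 k; have [b1 b2] := K1 k.
  by split; [exact: wd_trans a1 b1|exact: wd_trans a2 b2].
have -> : \sum_k 2^-1 * (l1 k + k1 k + (l2 k + k2 k)) =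
    \sum_k 2^-1 * (l1 k + l2 k) + \sum_k 2^-1 * (k1 k + k2 k).
  by rewrite -big_split; apply: eq_bigr => k _ /=; ring.
apply: le_trans (lerD L2 K2) _; apply: eq_le_R.
by field.
Qed.

(** The segment from [q] to [x0] is cut into equal links shorter than the Lebesgue number of the
    closed ball around [q]. The amplitude grows from 0 at [q] to 1 at [x0], so the varied chains
    start at [q] itself and their lengths bound distances from [q]. *)
Lemma radial_spread q x0 (rr kp d : R) : complete_riemannian g ->
  0 < rr -> 0 <= kp -> 0 < d -> wd g q x0 rr -> (forall l, wd g q x0 l -> rr <= l) ->
  (forall z, wd g q z rr -> forall v, - kp * inner g z v v <= ricci g z v v) ->
  exists2 E : 'M[R]_n, E *m metric g x0 (chart g x0 x0) *m E^T = 1%:M &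
    spread q x0 E 1 rr (rr * (n%:R * rr ^- 2 + kp + d)).
Proof.
move=> hg rr0 kp0 d0 qx0 ex hRic.
pose C := n%:R * rr ^- 2 + kp + d.
pose Q x x' h := 0 < h -> (forall l, wd g x x' l -> h <= l) ->
  forall (E : 'M[R]_n) (s s' : R), E *m metric g x (chart g x x) *m E^T = 1%:M ->
  0 <= s -> s' = s + h / rr -> s' <= 1 ->
  exists2 E' : 'M[R]_n, E' *m metric g x' (chart g x' x') *m E'^T = 1%:M &
  forall eta : R, 0 < eta -> \forall ep \near (0 : R)^'+, exists l1 l2 : 'I_n -> R,
    (forall k, wd g (apt g x (ep *: (s *: row k E))) (apt g x' (ep *: (s' *: row k E'))) (l1 k) /\
      wd g (apt g x ((- ep) *: (s *: row k E))) (apt g x' ((- ep) *: (s' *: row k E'))) (l2 k)) /\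
    \sum_k 2^-1 * (l1 k + l2 k) <= n%:R * h + ep ^+ 2 / 2 * (h * C + eta).
have [z Kz|dl dl0 HQ] := @lebesgue_number _ _ _ g [set y | wd g q y rr] Q (@compact_cball _ _ _ g q rr hg).
  have [rho rho0 H] := link_step kp0 rr0 (hRic z Kz) d0.
  by exists rho => // x x' h zx xx' hr h0 ex' E s s'; exact: H.
have [N Nd] : exists N : nat, rr / N.+1%:R < dl.
  have [N hN] : exists N : nat, rr / dl < N%:R.
    by exists (Num.bound (rr / dl)); apply: archi_boundP; rewrite divr_ge0// ltW.
  exists N; rewrite ltr_pdivrMr// mulrC -ltr_pdivrMr//; apply: lt_trans hN _.
  by rewrite ltr_nat.
set h := rr / N.+1%:R in Nd; have h0 : 0 < h by rewrite divr_gt0.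
have hN : h * N.+1%:R = rr by rewrite /h divfK// pnatr_eq0.
(* The second bound, on the remaining distance to [x0], is what allows the chain to be continued
   without loss. *)
have chain : forall j : nat, (j <= N.+1)%N -> exists x, [/\ wd g q x (h * j%:R),
    wd g x x0 (rr - h * j%:R) & exists2 E : 'M[R]_n, E *m metric g x (chart g x x) *m E^T = 1%:M &
    spread q x E (j%:R / N.+1%:R) (h * j%:R) (h * j%:R * C)].
  elim=> [|j IH] jN.
    have [E EE] := frame_exists q; exists q; split.
    - by rewrite mulr0; exact: wd_refl.
    - by rewrite mulr0 subr0.
    exists E => // eta eta0; near=> ep.
    exists (fun=> 0), (fun=> 0); split.
      move=> k; rewrite !mul0r !scale0r !scaler0 apt0.
      by split; exact: wd_refl.
    rewrite big1; last by move=> k _; rewrite addr0 mulr0.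
    rewrite !mulr0 !mul0r !add0r.
    by rewrite mulr_ge0 ?(ltW eta0)// divr_ge0// sqr_ge0.
  have [x [qx xx0 [E EE HE]]] := IH (ltnW jN).
  have hj : h * j.+1%:R = h * j%:R + h by rewrite -[in LHS]natr1 mulrDr mulr1.
  have rest : 0 <= rr - h * j.+1%:R.
    by rewrite subr_ge0 -hN ler_pM2l// ler_nat.
  have [|x' xx' x'x0] := wd_split_exact hg (ltW h0) rest (_ : wd g x x0 _).
    by rewrite hj opprD addrA; apply: wd_le xx0; apply: eq_le_R; ring.
  have qxr : wd g q x rr.
    by apply: wd_le qx; rewrite -hN ler_pM2l// ler_nat ltnW.
  (* A shorter link would shorten the whole chain below the exact distance [rr]. *)
  have ex' l : wd g x x' l -> h <= l.
    move=> hl; have := ex _ (wd_trans (wd_trans qx hl) x'x0).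
    by rewrite hj; lra.
  have sE : j.+1%:R / N.+1%:R = j%:R / N.+1%:R + h / rr :> R.
    by rewrite /h -[j.+1%:R]natr1; apply: step_frac; rewrite ?pnatr_eq0 ?gt_eqF.
  have s0 : 0 <= j%:R / N.+1%:R :> R by rewrite divr_ge0.
  have s1 : j.+1%:R / N.+1%:R <= 1 :> R by rewrite ler_pdivrMr// mul1r ler_nat.
  have [E' EE' HE'] := HQ x x' h qxr xx' Nd h0 ex' E _ _ EE s0 sE s1.
  exists x'; split=> //.
    by rewrite hj; exact: wd_trans qx xx'.
  exists E' => //; rewrite hj [_ * C]mulrDl.
  exact: spread_step HE HE'.
have [x [_ xx0 [E EE HE]]] := chain N.+1 (leqnn _).
rewrite hN subrr in xx0 HE; rewrite divff ?pnatr_eq0// in HE.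
by have -> := wd0_eq xx0; exists E.
Unshelve. all: by end_near.
Qed.

End Radial.

(** * Hessian comparison for lower test functions of the squared distance *)

Section ParabolaTaylor.
Context {R : realType} {n : nat}.

(** For [u = gam2 G c v v] the second-order coefficient along the parabola is the covariant Hessian
    [chess], since the parabola is then geodesic to second order. *)
Lemma parabola_taylor (O : set 'rV[R]_n) (S : 'rV[R]_n -> R) (c v u : 'rV[R]_n) (e : R) :
  open O -> smooth_on O S -> O c -> 0 < e -> \forall s \near (0 : R),
  `|S (c + s *: v - (2^-1 * s ^+ 2) *: u) - S c - s * 'D_v S c
    - 2^-1 * s ^+ 2 * ('D_v ('D_v S) c - 'D_u S c)| <= e * s ^+ 2.
Proof.
move=> oO CS Oc e0.
pose p (s : R) := c + s *: v - (2^-1 * s ^+ 2) *: u.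
pose dp (s : R) := v - s *: u.
have hp (s : R) : is_derive s (1 : R) p (dp s) by exact: is_derive_parabola.
have p0 : p 0 = c by rewrite /p scale0r expr0n mulr0 scale0r subr0 addr0.
have dp0 : dp 0 = v by rewrite /dp scale0r subr0.
have Op0 : O (p 0) by rewrite p0.
have oS : open [set s : R | O (p s)].
  by apply: open_comp => // s _; exact: is_derive_cont (hp s).
have Np : \forall s \near (0 : R), O (p s) by exact: (open_nbhs_nbhs (conj oS Op0)).
have lin Y (s : R) : O Y -> 'D_(dp s) S Y = 'D_v S Y - s * 'D_u S Y.
  move=> OY; rewrite !(derive_rV _ oO (CS 1) OY) mulr_sumr -sumrB.
  by apply: eq_bigr => i _; rewrite !mxE; ring.
have H1 : \forall s \near (0 : R), is_derive s (1 : R) (fun s => S (p s)) ('D_(dp s) S (p s)).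
  apply: filterS Np => s Os.
  by have [h1 h2] := hp s; have := is_derive_comp_scalar oO (CS 1) Os h1; rewrite h2.
have H2 : is_derive (0 : R) (1 : R) (fun s : R => 'D_(dp s) S (p s)) ('D_v ('D_v S) c - 'D_u S c).
  have [h1 h2] := hp 0.
  have k1 := is_derive_comp_scalar oO (Ck_derive v (CS 2)) Op0 h1; rewrite h2 dp0 p0 in k1.
  have k2 := is_derive_comp_scalar oO (Ck_derive u (CS 2)) Op0 h1; rewrite h2 dp0 p0 in k2.
  have k3 : is_derive (0 : R) (1 : R) (fun s : R => s * 'D_u S (p s)) ('D_u S c).
    apply: is_derive_eq (is_derive_mulr (is_derive_id (0 : R) (1 : R)) k2) _.
    by rewrite p0 mul1r mul0r addr0.
  apply: (is_derive_on_ext oS _ Op0 (is_deriveB k1 k3)).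
  by move=> s Os; rewrite lin.
have := taylor2 H1 H2 e0; apply: filterS => s.
by rewrite dp0 p0.
Qed.

End ParabolaTaylor.

Section AptRay.
Context {R : realType} {n : nat} {M : topologicalType} (g : riemannian R n M).
Variable x : M.
Let c := chart g x x.
Let G := metric g x c.

Definition mnorm (v : 'rV[R]_n) : R := Num.sqrt (mform G v v).

Lemma aptE (s : R) (v : 'rV[R]_n) :
  apt g x (s *: v) = chart_inv g x (c + s *: v - (2^-1 * s ^+ 2) *: gam2 (metric g x) c v v).
Proof. by rewrite /apt /vpt vmap_center. Qed.

(** The displacement is [s *: w s] with [w s] tending to [v], so the quadratic correction disappears
    in the first-order bound. *)
Lemma wd_apt (v : 'rV[R]_n) (e : R) : 0 < e ->
  \forall s \near (0 : R), wd g x (apt g x (s *: v)) (`|s| * (mnorm v + e)).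
Proof.
move=> e0; set u := gam2 (metric g x) c v v.
pose e1 := e / (2 * (`|v| + 1)).
have v1 : 0 < `|v| + 1 by rewrite ltr_wpDl.
have e10 : 0 < e1 by rewrite divr_gt0// mulr_gt0.
have [d d0 Hd] := wd_ray g x e10.
pose w (s : R) := v - (2^-1 * s) *: u.
have hw : is_derive (0 : R) (1 : R) w (- (2^-1 *: u)).
  apply: is_derive_mx => i j.
  have -> : (fun s : R => (w s) i j) = (fun s : R => v i j + (- (2^-1 * u i j)) * s).
    by apply/funext => s; rewrite !mxE; ring.
  apply: is_derive_eq (is_deriveD (is_derive_cst (v i j) (0 : R) (1 : R))
    (is_derive_mulr (is_derive_cst (- (2^-1 * u i j)) (0 : R) (1 : R)) (is_derive_id (0 : R) (1 : R)))) _.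
  by rewrite /cst !mxE; ring.
have w0 : w 0 = v by rewrite /w mulr0 scale0r subr0.
have cw := is_derive_cont hw.
have cm : {for (0 : R), continuous (fun s : R => mform G (w s) (w s))}.
  exact: is_derive_cont (is_derive_mform (is_derive_cst G (0 : R) (1 : R)) hw hw).
have cphi : (fun s : R => mnorm (w s) + e1 * `|w s|) @ (0 : R) --> mnorm v + e1 * `|v|.
  apply: cvgD.
    rewrite -w0; exact: (continuous_comp cm (@sqrt_continuous R _)).
  apply: cvgM; first exact: cvg_cst.
  rewrite -w0; exact: cvg_norm cw.
have lt1 : mnorm v + e1 * `|v| < mnorm v + e.
  rewrite ltrD2l; apply: (@le_lt_trans _ _ (e / 2)); last by lra.
  have -> : e1 * `|v| = e / 2 * (`|v| / (`|v| + 1)) by rewrite /e1; field; rewrite gt_eqF.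
  by rewrite ler_piMr ?divr_ge0 ?(ltW e0)// ler_pdivrMr// mul1r lerDl.
have N1 : \forall s \near (0 : R), mnorm (w s) + e1 * `|w s| < mnorm v + e.
  exact: (cvgr_lt _ cphi _ lt1).
have N2 : \forall s \near (0 : R), `|s *: v - (2^-1 * s ^+ 2) *: u| < d.
  have := is_derive_cont (is_derive_parabola 0 v u (0 : R)).
  move=> /cvgrPdist_lt/(_ _ d0); apply: filterS => s.
  by rewrite scale0r expr0n mulr0 scale0r !add0r oppr0 sub0r normrN.
apply: filterS (filterI N1 N2) => s [h1 /Hd[_ h2]].
rewrite aptE -addrA; apply: wd_le h2.
have E : s *: v - (2^-1 * s ^+ 2) *: u = s *: w s.
  by rewrite /w scalerBr scalerA; congr (_ - _ *: _); ring.
rewrite E mformZl mformZr mulrA -expr2 sqrtrM ?sqr_ge0// sqrtr_sqr normrZ mulrCA -mulrDr.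
by rewrite ler_wpM2l// ltW.
Qed.

End AptRay.

Lemma nbhs_at_right (R : realType) (P : R -> Prop) (a : R) :
  (\forall s \near a, P s) -> \forall s \near a^'+, P s.
Proof. exact: cvg_within. Qed.

Lemma near_opp (R : realType) (P : R -> Prop) :
  (\forall s \near (0 : R), P s) -> \forall s \near (0 : R), P (- s).
Proof.
move=> /nbhs_ballP[d /= d0 H]; apply/nbhs_ballP; exists d => // s.
by rewrite -ball_normE /= sub0r => sd; apply: H; rewrite -ball_normE /= sub0r normrN.
Qed.

Lemma grad_arith (R : realType) (s r k e D H : R) : 0 < s -> 0 < e ->
  s * ((k + e) ^+ 2 + e + 2^-1 * `|H|) <= e ->
  r ^+ 2 + s * D + 2^-1 * s ^+ 2 * H - e * s ^+ 2 <= (r + s * (k + e)) ^+ 2 ->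
  D <= 2 * r * k + (2 * r + 1) * e.
Proof.
move=> s0 e0 h1 h2; rewrite -(ler_pM2l s0).
have hH : - (2^-1 * s ^+ 2 * H) <= 2^-1 * s ^+ 2 * `|H|.
  rewrite -mulrN ler_wpM2l; first by [].
    by rewrite mulr_ge0// sqr_ge0.
  by rewrite -(normrN H) ler_norm.
have h3 := ler_wpM2l (ltW s0) h1.
by move: (`|H|) h3 hH => A h3 hH; nra.
Qed.

Lemma lap_sum_arith (R : realType) (m e ep Sc L B eta X Y : R) : 0 < ep ->
  m * Sc + 2^-1 * ep ^+ 2 * L - m * (e * ep ^+ 2) <= X -> X <= Y ->
  Y <= m * Sc + ep ^+ 2 / 2 * (B + eta) -> m * e <= eta -> L <= B + 3 * eta.
Proof.
move=> ep0 h1 h2 h3 h4.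
have e2 : 0 < ep ^+ 2 by rewrite exprn_gt0.
rewrite -(ler_pM2l e2); have := ler_wpM2l (ltW e2) h4; lra.
Qed.

(** A bound of the square that is linear in [l] requires l' - rr to stay within [d]. From below this
    is the hypothesis; from above [l] is capped at rr + d, a bound that the triangle inequality also
    provides where the lemma is used. *)
Lemma quad_arith (R : realType) (r rr l d : R) : 0 <= r -> rr <= r -> 0 <= d -> rr - d <= l -> 0 <= l ->
  exists2 l', l' = Num.min l (rr + d) &
  (r - rr + l') ^+ 2 <= r ^+ 2 + 2 * r * (l - rr) + d ^+ 2.
Proof.
move=> r0 rrr d0 h l0; exists (Num.min l (rr + d)) => //.
have [h1|h1] := leP l (rr + d).
  have : (l - rr) ^+ 2 <= d ^+ 2.
    by nra.
  by nra.
have := mulr_ge0 r0 (ltW (_ : 0 < l - (rr + d))); rewrite subr_gt0 => /(_ h1); nra.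
Qed.

Lemma lap_final_arith (R : realType) (r rr m ep e eta et kp d X : R) : 0 <= r -> 0 < rr -> 0 <= m ->
  0 < ep ^+ 2 -> 0 < e -> e <= 1 -> e * (12 * (m + 1)) <= eta -> 0 < et -> et * (4 * (r + 1)) = eta ->
  X <= m * rr + ep ^+ 2 / 2 * (rr * (m * rr ^- 2 + kp + d) + et) ->
  m * (r ^+ 2 - 2 * r * rr + (ep * (1 + e)) ^+ 2) + 2 * r * X <=
  m * r ^+ 2 + ep ^+ 2 / 2 * (2 * (m + r * (m / rr + kp * rr)) + 2 * r * rr * d + eta).
Proof.
move=> r0 rr0 m0 ep2 e0 e1 h1 et0 h2 hX.
have h3 : 2 * r * X <= 2 * r * (m * rr + ep ^+ 2 / 2 * (rr * (m * rr ^- 2 + kp + d) + et)).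
  by rewrite ler_wpM2l// mulr_ge0.
have rrE : rr * (m * rr ^- 2 + kp + d) = m / rr + kp * rr + rr * d.
  by field; rewrite gt_eqF.
rewrite rrE in h3.
have h4 : m * (1 + e) ^+ 2 <= m + eta / 4.
  have h4 : (1 + e) ^+ 2 <= 1 + 3 * e by nra.
  by apply: le_trans (ler_wpM2l m0 h4) _; lra.
have h5 : 2 * r * et <= eta / 2 by nra.
apply: (@le_trans _ _ (m * (r ^+ 2 - 2 * r * rr + (ep * (1 + e)) ^+ 2) +
  2 * r * (m * rr + ep ^+ 2 / 2 * (m / rr + kp * rr + rr * d + et)))).
  by rewrite lerD2l.
have -> : m * (r ^+ 2 - 2 * r * rr + (ep * (1 + e)) ^+ 2) +
    2 * r * (m * rr + ep ^+ 2 / 2 * (m / rr + kp * rr + rr * d + et)) =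
  m * r ^+ 2 + ep ^+ 2 / 2 * (2 * (m * (1 + e) ^+ 2) + 2 * r * (m / rr + kp * rr) + 2 * r * rr * d + 2 * r * et).
  by field; rewrite gt_eqF.
rewrite lerD2l ler_wpM2l ?divr_ge0 ?(ltW ep2)//.
by move: (m / rr) => q; lra.
Qed.

Section Comparison.
Context {R : realType} {n : nat} {M : topologicalType} (g : riemannian R n M).
Variables (p x0 : M) (r : R) (O : set 'rV[R]_n) (S : 'rV[R]_n -> R).
Let c := chart g x0 x0.
Let G := metric g x0.
Hypotheses (oO : open O) (sub : O `<=` cod g x0) (Oc : O c) (CS : smooth_on O S).
Hypothesis hS : forall y l, O y -> wd g p (chart_inv g x0 y) l -> S y <= l ^+ 2.
Hypotheses (Sc : S c = r ^+ 2) (px0 : wd g p x0 r) (exact0 : forall l, wd g p x0 l -> r <= l).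

Let r0 : 0 <= r. Proof. exact: wd_ge0 px0. Qed.

Let pt (s : R) (v : 'rV[R]_n) := c + s *: v - (2^-1 * s ^+ 2) *: gam2 G c v v.

Lemma near_pt v (e : R) : 0 < e -> \forall s \near (0 : R), [/\ O (pt s v),
  S c + s * 'D_v S c + 2^-1 * s ^+ 2 * chess G S c v - e * s ^+ 2 <= S (pt s v) &
  wd g x0 (apt g x0 (s *: v)) (`|s| * (mnorm g x0 v + e))].
Proof.
move=> e0; have N1 := parabola_taylor v (gam2 G c v v) oO CS Oc e0.
have N2 := wd_apt g x0 v e0.
have N3 : \forall s \near (0 : R), O (pt s v).
  have := is_derive_cont (is_derive_parabola c v (gam2 G c v v) (0 : R)); apply.
  rewrite scale0r expr0n mulr0 scale0r subr0 addr0; exact: open_nbhs_nbhs.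
apply: filterS (filterI N1 (filterI N2 N3)) => s [h1 [h2 h3]]; split=> //.
move: h1; rewrite -/(pt s v) -/(chess G S c v) ler_norml => /andP[h1 _]; lra.
Qed.

Lemma near_small (A e : R) : 0 < e -> \forall s \near (0 : R)^'+, s * A <= e.
Proof.
move=> e0; have d0 : 0 < e / (`|A| + 1) by rewrite divr_gt0// ltr_wpDl.
near=> s; have s0 : 0 < s by near: s; exact: nbhs_right_gt.
have sd : s < e / (`|A| + 1) by near: s; exact: nbhs_right_lt.
apply: (@le_trans _ _ (s * (`|A| + 1))).
  by rewrite ler_pM2l// (le_trans (ler_norm A))// lerDl.
by rewrite -ler_pdivlMr ?ltr_wpDl// ltW.
Unshelve. all: by end_near.
Qed.

(** Along a ray from [x0] the distance from [p] grows at most by the length travelled, and [S] lies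
    below its square with equality at [x0]; only first-order terms survive. *)
Lemma grad_comparison v : 'D_v S c <= 2 * r * mnorm g x0 v.
Proof.
apply/ler_addgt0Pr => eta eta0; set k := mnorm g x0 v.
have r1 : 0 < 2 * r + 1 by rewrite ltr_wpDl// mulr_ge0.
pose e := eta / (2 * r + 1); have e0 : 0 < e by rewrite divr_gt0.
have N1 := nbhs_at_right (near_pt v e0).
have N2 := near_small ((k + e) ^+ 2 + e + 2^-1 * `|chess G S c v|) e0.
have [s [[[h1 h2 h3] h4] s0]] := @filter_ex _ _ (at_right_proper_filter (0 : R)) _ (filterI (filterI N1 N2) (nbhs_right_gt (0 : R))).
have -> : eta = (2 * r + 1) * e by rewrite /e mulrC divfK// gt_eqF.
apply: (grad_arith s0 e0 h4); rewrite -Sc; apply: le_trans h2 _.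
rewrite gtr0_norm// in h3; rewrite aptE in h3.
by apply: hS => //; exact: wd_trans px0 h3.
Qed.

(** The Laplacian is the sum of the covariant Hessians over a frame, each being a symmetric second
    difference along a parabola. Averaging over opposite directions removes the gradient, so bounds
    for the mean are sufficient. *)
Lemma laplacian_le (E : 'M[R]_n) (B : R) : E *m G c *m E^T = 1%:M ->
  (forall eta : R, 0 < eta -> \forall ep \near (0 : R)^'+, exists b1 b2 : 'I_n -> R,
    (forall k, S (pt ep (row k E)) <= b1 k /\ S (pt (- ep) (row k E)) <= b2 k) /\
    \sum_k 2^-1 * (b1 k + b2 k) <= n%:R * S c + ep ^+ 2 / 2 * (B + eta)) ->
  local_laplacian G S c <= B.
Proof.
move=> EE H; apply/ler_addgt0Pr => eta eta0.
have n1 : 0 < n%:R + 1 :> R by rewrite ltr_wpDl.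
pose eta' := eta / 3; have eta'0 : 0 < eta' by rewrite divr_gt0.
pose e := eta' / (n%:R + 1); have e0 : 0 < e by rewrite divr_gt0.
have N0 := @filter_forall _ _ _ (nbhs (0 : R)) (nbhs_filter (0 : R)) (fun k => near_pt (row k E) e0).
have N1 : \forall s \near (0 : R), (forall k, [/\ O (pt s (row k E)),
  S c + s * 'D_(row k E) S c + 2^-1 * s ^+ 2 * chess G S c (row k E) - e * s ^+ 2 <= S (pt s (row k E)) &
  wd g x0 (apt g x0 (s *: row k E)) (`|s| * (mnorm g x0 (row k E) + e))]) by exact: N0.
have N2 := near_opp N1.
have [ep [[[h1 h2] [b1 [b2 [h3 h4]]]] ep0]] :=
  @filter_ex _ _ (at_right_proper_filter (0 : R)) _ (filterI (filterI (nbhs_at_right (filterI N1 N2)) (H _ eta'0)) (nbhs_right_gt (0 : R))).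
have sGO : smooth_metric O G by exact: smooth_metric_sub.
rewrite (laplacian_trace sGO CS Oc EE).
have -> : eta = 3 * eta' by rewrite /eta'; field.
apply: (@lap_sum_arith _ n%:R e ep (S c) _ B eta'
  (\sum_k 2^-1 * (S (pt ep (row k E)) + S (pt (- ep) (row k E)))) _ ep0 _ _ h4).
- have -> : n%:R * S c + 2^-1 * ep ^+ 2 * (\sum_k chess G S c (row k E)) - n%:R * (e * ep ^+ 2) =
     \sum_k (S c - e * ep ^+ 2 + 2^-1 * ep ^+ 2 * chess G S c (row k E)).
    by rewrite sum_affine; ring.
  apply: ler_sum => k _; have [_ a1 _] := h1 k; have [_ a2 _] := h2 k.
  by move: a1 a2; rewrite mulNr sqrrN; lra.
- apply: ler_sum => k _; have [a1 a2] := h3 k.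
  by rewrite ler_wpM2l// lerD.
rewrite /e mulrA ler_pdivrMr// mulrC ler_wpM2l// ?ltW//.
by rewrite ltrDl.
Qed.

Lemma laplacian_comparison0 : r = 0 -> local_laplacian G S c <= 2 * n%:R.
Proof.
move=> rz; have [E EE] := frame_exists g x0; apply: (laplacian_le EE) => eta eta0.
have n1 : 0 < 6 * (n%:R + 1) :> R by rewrite mulr_gt0// ltr_wpDl.
pose e := Num.min 1 (eta / (6 * (n%:R + 1))).
have e0 : 0 < e by rewrite lt_min ltr01 divr_gt0.
have e1 : e <= 1 by rewrite ge_min lexx.
have e2 : e * (6 * (n%:R + 1)) <= eta by rewrite -ler_pdivlMr// ge_min lexx orbT.
have N0 := @filter_forall _ _ _ (nbhs (0 : R)) (nbhs_filter (0 : R)) (fun k => near_pt (row k E) e0).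
have N2 := near_opp N0.
have frame k : mnorm g x0 (row k E) = 1.
  by have /frameP/(_ k k) := EE; rewrite eqxx /mnorm => ->; rewrite sqrtr1.
apply: filterS (filterI (nbhs_at_right (filterI N0 N2)) (nbhs_right_gt (0 : R))) => ep [[h1 h2] ep0].
exists (fun=> (ep * (1 + e)) ^+ 2), (fun=> (ep * (1 + e)) ^+ 2); split.
  have px y l : wd g x0 y l -> wd g p y l.
    by move=> h; rewrite -[l]add0r; apply: wd_trans h; rewrite -rz.
  move=> k; have [a1 _ a3] := h1 k; have [b1 _ b3] := h2 k.
  rewrite frame aptE in a3; rewrite frame aptE in b3.
  rewrite normrN in b3; rewrite gtr0_norm// in a3 b3.
  by split; apply: hS => //; exact: px.
rewrite Sc rz sumr_const card_ord -mulr_natl.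
have ep2 : 0 < ep ^+ 2 by rewrite exprn_gt0.
apply: (@le_trans _ _ (ep ^+ 2 * (n%:R * (1 + e) ^+ 2))).
  by apply: eq_le_R; field.
rewrite expr0n mulr0 add0r -mulrA ler_wpM2l ?(ltW ep2)//.
by move: (n%:R : R) (ler0n R n) n1 e2 => m m0 n1 e2; nra.
Qed.

(** Calabi's device: d_p <= (r - rr) + d_q, with equality at [x0], so the second variation is only
    needed from the intermediate point [q]. A smaller [rr] lowers the curvature term kp rr at the
    expense of n / rr. *)
Lemma laplacian_comparison (rr kp : R) : complete_riemannian g -> 0 < rr -> rr <= r -> 0 <= kp ->
  (forall z, wd g p z r -> forall v, - kp * inner g z v v <= ricci g z v v) ->
  local_laplacian G S c <= 2 * (n%:R + r * (n%:R / rr + kp * rr)).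
Proof.
move=> hg rr0 rrr kp0 hRic.
have rr1 : 0 <= r - rr by rewrite subr_ge0.
have [q pq qx0] : exists2 q, wd g p q (r - rr) & wd g q x0 rr.
  by apply: wd_split_exact => //; [exact: ltW|rewrite subrK].
have exq l : wd g q x0 l -> rr <= l.
  by move=> h; have := exact0 (wd_trans pq h); lra.
have hR z : wd g q z rr -> forall v, - kp * inner g z v v <= ricci g z v v.
  by move=> qz; apply: hRic; have := wd_trans pq qz; rewrite subrK.
apply/ler_addgt0Pr => eta0 eta00.
have rp : 0 < 2 * r * rr + 1 by rewrite ltr_wpDl// !mulr_ge0// ltW.
pose d := eta0 / (2 * r * rr + 1); have d0 : 0 < d by rewrite divr_gt0.
have dE : 2 * r * rr * d <= eta0.
  by rewrite /d mulrA ler_pdivrMr// [leRHS]mulrC ler_wpM2r ?(ltW eta00)// lerDl.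
have [E EE sp] := radial_spread hg rr0 kp0 d0 qx0 exq hR.
suff : local_laplacian G S c <= 2 * (n%:R + r * (n%:R / rr + kp * rr)) + 2 * r * rr * d.
  by move=> h; apply: le_trans h _; rewrite lerD2l.
apply: (laplacian_le EE) => eta eta_gt0.
have n1 : 0 < 12 * (n%:R + 1) :> R by rewrite mulr_gt0// ltr_wpDl.
have r1 : 0 < 4 * (r + 1) by rewrite mulr_gt0// ltr_wpDl.
pose e := Num.min 1 (eta / (12 * (n%:R + 1))).
have e0 : 0 < e by rewrite lt_min ltr01 divr_gt0.
have e1 : e <= 1 by rewrite ge_min lexx.
have e2 : e * (12 * (n%:R + 1)) <= eta by rewrite -ler_pdivlMr// ge_min lexx orbT.
pose et := eta / (4 * (r + 1)); have et0 : 0 < et by rewrite divr_gt0.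
have et2 : et * (4 * (r + 1)) = eta by rewrite /et divfK// gt_eqF.
have N0 := @filter_forall _ _ _ (nbhs (0 : R)) (nbhs_filter (0 : R)) (fun k => near_pt (row k E) e0).
have N2 := near_opp N0.
have frame k : mnorm g x0 (row k E) = 1.
  by have /frameP/(_ k k) := EE; rewrite eqxx /mnorm => ->; rewrite sqrtr1.
apply: filterS (filterI (filterI (nbhs_at_right (filterI N0 N2)) (sp _ et0)) (nbhs_right_gt (0 : R))).
move=> ep [[[h1 h2] [l1 [l2 [H1 H2]]]] ep0].
pose b l := r ^+ 2 + 2 * r * (l - rr) + (ep * (1 + e)) ^+ 2.
(* The point is reached from [p] through [q], at cost r - rr plus the better of two distances from
   [q]: the given [l], or [rr] plus the displacement from [x0]. *)
have bound s k l : `|s| = ep -> O (pt s (row k E)) ->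
    wd g x0 (apt g x0 (s *: row k E)) (`|s| * (mnorm g x0 (row k E) + e)) ->
    wd g q (apt g x0 (s *: row k E)) l -> S (pt s (row k E)) <= b l.
  move=> se Os; rewrite frame se => a1 a2.
  have de : 0 <= ep * (1 + e) by rewrite mulr_ge0 ?(ltW ep0)// addr_ge0// ltW.
  have low : rr - ep * (1 + e) <= l.
    by rewrite lerBlDr; exact: exq (wd_trans a2 (wd_sym a1)).
  have [l' l'E] := quad_arith r0 rrr de low (wd_ge0 a2).
  apply: le_trans; apply: hS => //; rewrite -aptE.
  apply: wd_trans pq _; rewrite l'E /Num.min; case: ifP => // _.
  exact: wd_trans qx0 a1.
exists (fun k => b (l1 k)), (fun k => b (l2 k)); split.
  move=> k; have [a1 _ a3] := h1 k; have [b1 _ b3] := h2 k; have [c1 c2] := H1 k.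
  rewrite !scale1r in c1 c2.
  by split; [apply: bound a1 a3 c1; rewrite gtr0_norm|apply: bound b1 b3 c2; rewrite normrN gtr0_norm].
have -> : \sum_k 2^-1 * (b (l1 k) + b (l2 k)) =
    n%:R * (r ^+ 2 - 2 * r * rr + (ep * (1 + e)) ^+ 2) + 2 * r * \sum_k 2^-1 * (l1 k + l2 k).
  by rewrite -sum_affine; apply: eq_bigr => k _; rewrite /b; field.
have ep2 : 0 < ep ^+ 2 by rewrite exprn_gt0.
rewrite Sc; exact: (lap_final_arith r0 rr0 (ler0n R n) ep2 e0 e1 e2 et0 et2 H2).
Qed.

End Comparison.

(** * Evolution of the Harnack quantity *)

Lemma pair_continuous (R : realType) (V : normedModType R) (t : R) (y : V) :
  {for y, continuous (fun y : V => (y, t))}.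
Proof.
rewrite /prop_for /continuous_at.
by apply: (@cvg_pair _ _ _ _ (nbhs y) (nbhs t)); [exact: cvg_id|exact: cvg_cst].
Qed.

Lemma flow_ring (K : comPzRingType) (al z P dz dP lz lP iz iP m v H : K) :
  dz = (m - 1) * v * lz + z ^+ 2 + 2 * m * iz ->
  dP = (m - 1) * v * lP + P ^+ 2 + 2 * m * iP + 2 * (m - 1) * H ->
  dP + (0 * z + (al - 1) * dz) = (m - 1) * v * (lP + (al - 1) * lz)
    + 2 * m * (iP + (al - 1) * iz) + (P ^+ 2 + 2 * (m - 1) * H) - (1 - al) * z ^+ 2.
Proof. by move=> -> ->; ring. Qed.

Lemma flow_eval (R : realType) (V : normedModType R) (O : set V) (oO : open O)
    (M p L c I P H Rc k z : smf oO) y : O y ->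
  (M * p * L + 2 * c * I + (P ^+ 2 + 2 * M * (H + Rc)) - (1 - k) * z ^+ 2) y =
  M y * p y * L y + 2 * c y * I y + (P y ^+ 2 + 2 * M y * (H y + Rc y)) - (1 - k y) * z y ^+ 2.
Proof.
move=> Oy; have E2 : (2%:R : smf oO) y = 2%:R by exact: smf_nat.
transitivity (M y * p y * L y + (2%:R : smf oO) y * c y * I y + ((P ^+ 2) y +
  (2%:R : smf oO) y * M y * (H y + Rc y)) - ((1 : smf oO) y - k y) * (z ^+ 2) y); first by [].
by rewrite E2 smf1// !smfX.
Qed.

(** The origin of [a_const]: 1 / a = 1 + 2 / (n (m - 1)), so that P^2 + 2 (m - 1) (Lap v)^2 / n =
    P^2 / a for P = (m - 1) Lap v. *)
Lemma flow_le (R : realType) (nn m pv LF L I2 H Rc ze Y dF I al kp : R) : 0 < nn -> m < 1 ->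
  0 < nn * (m - 1) + 2 -> (m - 1) * L = ze + Y -> L ^+ 2 <= nn * H -> - kp * I2 <= Rc ->
  dF = (m - 1) * pv * LF + 2 * m * I + ((ze + Y) ^+ 2 + 2 * (m - 1) * (H + Rc)) - (1 - al) * ze ^+ 2 ->
  dF - (m - 1) * pv * LF <= 2 * m * I + (ze + Y) ^+ 2 / (nn * (m - 1) / (nn * (m - 1) + 2))
    - (1 - al) * ze ^+ 2 + 2 * (1 - m) * kp * I2.
Proof.
move=> n0 m1 nm LE hH hR ->; rewrite -LE.
have m1' : m - 1 < 0 by rewrite subr_lt0.
have -> : ((m - 1) * L) ^+ 2 / (nn * (m - 1) / (nn * (m - 1) + 2)) =
    ((m - 1) * L) ^+ 2 + 2 * (m - 1) * (L ^+ 2 / nn).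
  by field; rewrite (lt_eqF m1') !gt_eqF.
have h1 : 2 * (m - 1) * H <= 2 * (m - 1) * (L ^+ 2 / nn).
  rewrite ler_wnM2l//; first by lra.
  by rewrite ler_pdivrMr// mulrC.
have h2 : 2 * (m - 1) * Rc <= 2 * (m - 1) * (- kp * I2).
  by rewrite ler_wnM2l//; lra.
lra.
Qed.

Section FlowRing.
Context {R : realType} {n : nat}.
Variables (W : set 'rV[R]_n) (G : 'rV[R]_n -> 'M[R]_n).
Hypothesis sG : smooth_metric W G.
Variable O : set ('rV[R]_n * R)%type.
Hypotheses (oO : open O) (OW : forall z, O z -> W z.1).

Let oW : open W. Proof. by case: sG. Qed.
Let smG : smooth_on W G. Proof. by case: sG. Qed.
Let posG y : W y -> posdef (G y). Proof. by have [_ _] := sG; exact. Qed.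
Let symG y : W y -> (G y)^T = G y. Proof. by move=> /posG[]. Qed.
Let unitG y : W y -> G y \in unitmx. Proof. by move=> /posG; exact: posdef_unit. Qed.

Notation T := (smf oO).
Local Notation D := (spd (oO := oO)).
Local Notation gl := (gg oW smG oO OW).
Local Notation gu := (gh oW smG unitG oO OW).
Local Notation hf := (ghalf oO).
Local Notation Dt := (tmd (oO := oO)).
Local Notation lap := (rlap D gl gu hf).
Local Notation ip := (rip D gu).
Let dD i : derivation (D i). Proof. exact: spd_derivation. Qed.
Let dt : derivation Dt. Proof. exact: tmd_derivation. Qed.
Let gS := ggS oW smG symG oO OW.
Let hS := ghS oW smG symG unitG oO OW.
Let ghI := ggh oW smG unitG oO OW.
Let hfE : hf + hf = 1. Proof. exact: ghalfE. Qed.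

Definition slice (f : 'rV[R]_n * R -> R) (t : R) (y : 'rV[R]_n) : R := f (y, t).

Lemma open_slice t : open [set y : 'rV[R]_n | O (y, t)].
Proof.
apply: (@open_comp _ _ (fun y : 'rV[R]_n => (y, t))) => // y _.
exact: pair_continuous.
Qed.

Lemma smooth_slice (f : T) t : smooth_on [set y | O (y, t)] (slice f t).
Proof. by move=> k; exact: Ck_slice (smf_smooth f k). Qed.

Lemma sG_slice t : smooth_metric [set y | O (y, t)] G.
Proof.
split; [exact: open_slice| |by move=> y /OW; exact: posG].
by move=> k; apply: Ck_sub (smG k) => y /OW.
Qed.

Lemma tmdE (f : T) z : O z -> Dt f z = 'D_((0 : 'rV[R]_n), (1 : R)) f z.
Proof. exact: smf_derE. Qed.

Lemma ip_derive (f1 f2 : T) z : O z ->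
  ip f1 f2 z = 'D_(local_grad G (slice f1 z.2) z.1) (slice f2 z.2) z.1.
Proof.
move=> Oz; have Oz' : O (z.1, z.2) by rewrite -surjective_pairing.
rewrite (derive_rV _ (@open_slice z.2) (@smooth_slice f2 z.2 1) Oz').
rewrite /rip smf_sum; apply: eq_bigr => i _.
by rewrite smfM rgradE// spdE.
Qed.

Lemma ip_self (f : T) z : O z -> let X := local_grad G (slice f z.2) z.1 in
  ip f f z = mform (G z.1) X X.
Proof.
move=> Oz X; have Oz' : O (z.1, z.2) by rewrite -surjective_pairing.
by rewrite ip_derive// -(local_gradE (sG_slice z.2) (smooth_slice f z.2) Oz').
Qed.

Lemma lap_slice (f : T) z : O z -> lap f z = local_laplacian G (slice f z.2) z.1.
Proof. exact: rlapE. Qed.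

Lemma rRic_slice (f : T) z : O z -> let X := local_grad G (slice f z.2) z.1 in
  rRic D gl gu hf f z = mform (ricci_mx G z.1) X X.
Proof.
move=> Oz X; rewrite mformE /rRic smf_sum; apply: eq_bigr => i _.
rewrite smf_sum; apply: eq_bigr => j _.
by rewrite !smfM rricE// !rgradE// -/X; ring.
Qed.

Lemma rhess2_ge (f : T) z : O z -> (lap f z) ^+ 2 <= n%:R * rhess2 D gl gu hf f z.
Proof.
move=> Oz; pose A : 'M[R]_n := \matrix_(i, l) rcov D gl gu hf (rgrad D gu f) i l z.
have -> : lap f z = \tr A.
  by rewrite /rlap /rdiv smf_sum; apply: eq_bigr => i _; rewrite mxE.
have -> : rhess2 D gl gu hf f z = \tr (A *m A).
  rewrite /rhess2 smf_sum; apply: eq_bigr => i _; rewrite smf_sum mxE.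
  by apply: eq_bigr => l _; rewrite smfM !mxE.
apply: trace_sqr_le (posG (OW Oz)) _.
have E l i : (G z.1 *m A) l i = rHess D gl gu hf f l i z.
  rewrite /rHess smf_sum mxE; apply: eq_bigr => k _.
  by rewrite smfM ggE// mxE.
have S l i : rHess D gl gu hf f l i = rHess D gl gu hf f i l.
  exact: (rHessS dD (@spd_comm _ _ _ oO) gS ghI hfE).
by apply/matrixP => i l; rewrite mxE !E S.
Qed.

Section Pressure.
Variables (U : 'rV[R]_n * R -> R) (m al : R).
Hypotheses (CU : smooth_on O U) (U0 : forall z, O z -> 0 < U z).
Hypotheses (m0 : 0 < m) (m1 : m < 1).

Let m1n : m - 1 != 0. Proof. by rewrite lt_eqF// subr_lt0. Qed.

Definition pres : T := mksmf (f := fun z => m / (m - 1) * U z `^ (m - 1))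
  (fun k => Ck_mul oO (Ck_cst k O _) (Ck_powR (m - 1) oO U0 (CU k))).

Lemma presE z : O z -> pres z = m / (m - 1) * U z `^ (m - 1).
Proof. exact: cutoffE. Qed.

Lemma pres_lt0 z : O z -> pres z < 0.
Proof.
move=> Oz; rewrite presE// pmulr_llt0; first by rewrite pmulr_rlt0// invr_lt0 subr_lt0.
by rewrite powR_gt0// U0.
Qed.

Definition ipres : T := smf_inv (f := pres) (fun z Oz => ltr0_neq0 (pres_lt0 Oz)).

Lemma ipresE z : O z -> ipres z = (pres z)^-1.
Proof. exact: cutoffE. Qed.

Lemma pres_ipres : pres * ipres = 1.
Proof.
by apply: smf_eq => z Oz; rewrite smfM ipresE// smf1// divff// ltr0_neq0// pres_lt0.
Qed.

Definition zet : T := ipres * Dt pres.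
(* With z = v_t / v and P = (m - 1) Lap v this is P - (1 - al) z, by the pressure equation. *)
Definition har : T := smf_cst oO al * zet - ipres * ip pres pres.

Let uu : T := mksmf CU.
Let um : T := mksmf (fun k => Ck_powR m oO U0 (CU k)).
(** The derivative of the pressure with respect to [u]. *)
Let qq : T := mksmf (f := fun z => m * U z `^ (m - 2))
  (fun k => Ck_mul oO (Ck_cst k O _) (Ck_powR (m - 2) oO U0 (CU k))).

Let uuE z : O z -> uu z = U z. Proof. exact: cutoffE. Qed.
Let umE z : O z -> um z = U z `^ m. Proof. exact: cutoffE. Qed.
Let qqE z : O z -> qq z = m * U z `^ (m - 2). Proof. exact: cutoffE. Qed.

Let der_powR e b z : O z -> 'D_e (fun z => U z `^ b) z = b * U z `^ (b - 1) * 'D_e U z.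
Proof. by move=> Oz; have [] := is_derive_powR b (U0 Oz) (Ck_derivable e (CU 1) Oz). Qed.

Let der_uu e z : O z -> smf_der e uu z = 'D_e U z.
Proof.
move=> Oz; rewrite smf_derE//; apply: (derive_on_ext _ oO _ Oz).2 => y Oy.
exact: cutoffE.
Qed.

Let der_pres e : smf_der e pres = qq * smf_der e uu.
Proof.
apply: smf_eq => z Oz; rewrite smfM der_uu// qqE// smf_derE//.
rewrite (derive_on_ext (g := fun z => m / (m - 1) * U z `^ (m - 1)) _ oO _ Oz).2; last exact: presE.
have dU := is_derive_powR (m - 1) (U0 Oz) (Ck_derivable e (CU 1) Oz).
have [_ ->] := is_derive_mulr (is_derive_cst (m / (m - 1)) z e) dU.
have -> : m - 1 - 1 = m - 2 by ring.
by rewrite /cst; field.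
Qed.

Let powU a b z : O z -> U z `^ a * U z `^ b = U z `^ (a + b).
Proof. by move=> Oz; rewrite -powRD// (gt_eqF (U0 Oz)) implybT. Qed.

(** grad u^m = u grad v, whence the form u_t = div (u grad v) of the fast diffusion equation. *)
Let der_um e : smf_der e um = uu * smf_der e pres.
Proof.
apply: smf_eq => z Oz; rewrite der_pres !smfM der_uu// uuE// qqE// smf_derE//.
rewrite (derive_on_ext (g := fun z => U z `^ m) _ oO _ Oz).2; last by move=> y Oy; exact: cutoffE.
rewrite der_powR//.
have -> : U z `^ (m - 1) = U z * U z `^ (m - 2).
  rewrite -[X in X * _](powRr1 (ltW (U0 Oz))) powU//; congr (_ `^ _); ring.
by ring.
Qed.

Let qu : qq * uu = (smf_cst oO m - 1) * pres.
Proof.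
apply: smf_eq => z Oz; rewrite !smfM smfB smf1// smf_cstE// uuE// qqE// presE//.
have -> : m * U z `^ (m - 2) * U z = m * U z `^ (m - 1).
  rewrite -[X in _ * X = _](powRr1 (ltW (U0 Oz))) -mulrA powU//; congr (_ * _ `^ _); ring.
by field.
Qed.

Lemma harE z : O z -> let X := local_grad G (slice pres z.2) z.1 in
  har z = al * ('D_((0 : 'rV[R]_n), (1 : R)) pres z / pres z) - mform (G z.1) X X / pres z.
Proof.
move=> Oz X; rewrite /har smfB !smfM smf_cstE// ipresE// tmdE// ip_self// -/X.
by rewrite [(pres z)^-1 * _]mulrC [(pres z)^-1 * _]mulrC.
Qed.

Section Flow.
Hypothesis fde : forall z, O z ->
  'D_((0 : 'rV[R]_n), (1 : R)) U z = local_laplacian G (fun y => U (y, z.2) `^ m) z.1.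

Let M1 : T := smf_cst oO m - 1.

(** u_t = div (u grad v) = u Lap v + <grad u, grad v> is multiplied by [qq]; then [qu] and
    [der_pres] convert the two terms. *)
Let pde : Dt pres = M1 * pres * lap pres + ip pres pres.
Proof.
have E : Dt uu = lap um.
  apply: smf_eq => z Oz; have Oz' : O (z.1, z.2) by rewrite -surjective_pairing.
  rewrite lap_slice// der_uu// fde//.
  by apply: (eq_local_laplacian (sG_slice z.2) Oz') => y Oy; rewrite /slice umE.
have L : lap um = uu * lap pres + \sum_i D i uu * rgrad D gu pres i.
  rewrite (eq_bigr (fun i => rgrad D gu pres i * D i uu)); last by move=> i _; rewrite mulrC.
  rewrite -[RHS](rdiv_scale gl gu hf dD uu (rgrad D gu pres)).
  apply: eq_rdiv => k; rewrite /rgrad mulr_sumr; apply: eq_bigr => i _.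
  by rewrite [D i um]der_um mulrCA.
rewrite [LHS]der_pres -[smf_der _ uu]/(Dt uu) E L mulrDr mulrA qu; congr (_ + _).
rewrite /rip mulr_sumr; apply: eq_bigr => i _.
have -> : D i pres = qq * D i uu := der_pres _.
ring.
Qed.

Let cC (c : R) i : D i (smf_cst oO c) = 0. Proof. exact: smf_der_cst. Qed.
Let ct (c : R) : Dt (smf_cst oO c) = 0. Proof. exact: smf_der_cst. Qed.
Let har_flow : Dt har = M1 * pres * lap har + 2 * smf_cst oO m * ip pres har
  + ((zet - ipres * ip pres pres) ^+ 2
     + 2 * M1 * (rhess2 D gl gu hf pres + rRic D gl gu hf pres))
  - (1 - smf_cst oO al) * zet ^+ 2.
Proof.
have pres_i : pres * ipres = 1 := pres_ipres.
have hP : rP D gl gu hf (smf_cst oO m) pres = zet - ipres * ip pres pres.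
  rewrite /rP -/M1 /zet pde mulrDr addrK.
  have -> : ipres * (M1 * pres * lap pres) = pres * ipres * (M1 * lap pres) by ring.
  by rewrite pres_i mul1r.
have zP := pressure_z dD gS ghI hfE dt (@tmd_spd _ _ _ oO)
  (tmd_gg oW smG oO OW) (tmd_gh oW smG unitG oO OW) (ct m) pres_i pde.
have PP := pressure_P dD (@spd_comm _ _ _ oO) gS hS ghI hfE dt (@tmd_spd _ _ _ oO)
  (tmd_gg oW smG oO OW) (tmd_gh oW smG unitG oO OW) (cC m) (ct m) pde.
rewrite -[rz _ _ _]/zet in zP; rewrite hP in PP.
set P := zet - _ in PP *; pose c := smf_cst oO al - 1.
have cD i : D i c = 0 by rewrite /c (derB (dD i)) cC (der1 (dD i)) subr0.
have cDt : Dt c = 0 by rewrite /c (derB dt) ct (der1 dt) subr0.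
have harE : har = P + c * zet by rewrite /har /P /c; ring.
have lapD f1 f2 : lap (f1 + f2) = lap f1 + lap f2 by apply: rlapD.
have lapc f : lap (c * f) = c * lap f by apply: rlap_cst.
have ipD f f1 f2 : ip f (f1 + f2) = ip f f1 + ip f f2 by apply: ripDr.
have ipc f f2 : ip f (c * f2) = c * ip f f2 by apply: rip_cst.
rewrite harE (derD dt) (derM dt) cDt lapD lapc ipD ipc.
exact: flow_ring zP PP.
Qed.

(* Since m < 1, the bound |Hess v|^2 >= (Lap v)^2 / n has the favourable sign. *)
Lemma har_evolution (kp : R) z : (0 < n)%N -> 0 < n%:R * (m - 1) + 2 -> O z ->
  let X := local_grad G (slice pres z.2) z.1 in
  - kp * mform (G z.1) X X <= mform (ricci_mx G z.1) X X ->
  let ze := 'D_((0 : 'rV[R]_n), (1 : R)) pres z / pres z in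
  let Y := - (mform (G z.1) X X / pres z) in
  har z = al * ze + Y /\
  'D_((0 : 'rV[R]_n), (1 : R)) har z - (m - 1) * pres z * local_laplacian G (slice har z.2) z.1 <=
    2 * m * 'D_X (slice har z.2) z.1 + (ze + Y) ^+ 2 / a_const n m - (1 - al) * ze ^+ 2
    + 2 * (1 - m) * kp * mform (G z.1) X X.
Proof.
move=> n0 nm Oz X hRic ze Y.
have zetE : zet z = ze by rewrite smfM ipresE// tmdE// mulrC.
have ipE : (ipres * ip pres pres) z = - Y by rewrite smfM ipresE// ip_self// mulrC opprK.
split; first exact: harE.
have := congr1 (fun f : T => f z) har_flow.
rewrite (flow_eval _ _ _ _ _ _ _ _ _ _ Oz) tmdE// !smf_cstE//.
have M1E : M1 z = m - 1 by rewrite smfB smf1// smf_cstE.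
have PE : (zet - ipres * ip pres pres) z = ze + Y by rewrite smfB zetE ipE opprK.
rewrite PE zetE M1E (rRic_slice _ Oz) (ip_derive _ _ Oz) (lap_slice har Oz) -/X => E.
have nn0 : 0 < n%:R :> R by rewrite ltr0n.
apply: (flow_le nn0 m1 nm _ (rhess2_ge pres Oz) hRic E).
have p0 : pres z != 0 by rewrite ltr0_neq0// pres_lt0.
have := congr1 (fun f : T => f z) pde; rewrite smfD !smfM M1E tmdE// ip_self// -/X => E2.
by rewrite /ze /Y E2; field.
Qed.
End Flow.
End Pressure.
End FlowRing.

(** * The spatial barrier at a maximum point *)

Section PowerBarrier.
Context {R : realType} {n : nat}.
Variables (O : set 'rV[R]_n) (f : 'rV[R]_n -> R) (e k : R).
Hypotheses (oO : open O) (Cf : smooth_on O f) (f0 : forall y, O y -> 0 < f y).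

(* f (e - barrier)^2 is constant: if f has a weighted maximum, barrier touches the squared distance from below. *)
Definition barrier (y : 'rV[R]_n) : R := e - k * f y `^ (- 2^-1).

Lemma powR_pred (x b : R) : 0 < x -> x `^ (b - 1) = x `^ b / x.
Proof.
move=> x0; have xn : x != 0 by rewrite gt_eqF.
have <- : x `^ (b - 1) * x = x `^ b.
  by rewrite -[X in _ * X](powRr1 (ltW x0)) -powRD ?xn ?implybT// subrK.
by rewrite mulfK.
Qed.

Lemma powR_half_sqr (x : R) : 0 < x -> (x `^ (- 2^-1)) ^+ 2 * x = 1.
Proof.
move=> x0; have xn : x != 0 by rewrite gt_eqF.
rewrite expr2 -powRD ?xn ?implybT//.
have -> : - 2^-1 + - 2^-1 = 0 - 1 :> R by field.
by rewrite powR_pred// powRr0 divfK.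
Qed.

Lemma smooth_barrier : smooth_on O barrier.
Proof.
move=> j; apply: Ck_add => //; first exact: Ck_cst.
apply: Ck_opp => //; apply: Ck_mul => //; first exact: Ck_cst.
exact: Ck_powR.
Qed.

Lemma is_derive_barrier y v : O y ->
  is_derive y v barrier (k / 2 * (f y `^ (- 2^-1 - 1) * 'D_v f y)).
Proof.
move=> Oy; have h := is_derive_powR (- 2^-1) (f0 Oy) (Ck_derivable v (Cf 1) Oy).
apply: is_derive_eq (is_deriveB (is_derive_cst e y v) (is_derive_mulr (is_derive_cst k y v) h)) _.
by rewrite /cst; field.
Qed.

Lemma barrier_derive y v : O y -> 'D_v barrier y = k * f y `^ (- 2^-1) / (2 * f y) * 'D_v f y.
Proof.
move=> Oy; have [_ ->] := is_derive_barrier v Oy.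
by rewrite powR_pred ?f0//; field; rewrite gt_eqF// f0.
Qed.

Lemma barrier_chess G y v : O y -> chess G barrier y v =
  k * f y `^ (- 2^-1) / (2 * f y) * chess G f y v
  - 3 / 4 * (k * f y `^ (- 2^-1) / f y ^+ 2) * ('D_v f y) ^+ 2.
Proof.
move=> Oy; rewrite /chess barrier_derive//.
have h1 := is_derive_powR (- 2^-1 - 1) (f0 Oy) (Ck_derivable v (Cf 1) Oy).
have h2 : is_derive y v ('D_v f) ('D_v ('D_v f) y).
  by split=> //; exact: (Ck_derivable v (Ck_derive v (Cf 2)) Oy).
have h3 := is_derive_mulr (is_derive_cst (k / 2) y v) (is_derive_mulr h1 h2).
have [|_ ->] := is_derive_on_ext (g := 'D_v barrier) oO _ Oy h3.
  by move=> z Oz; have [_ ->] := is_derive_barrier v Oz.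
rewrite /cst mul0r add0r !powR_pred ?f0//.
by move: ('D_v ('D_v f) y) ('D_v f y) ('D_(gam2 G y v v) f y) (f y `^ (- 2^-1)) => a b c d;
  field; rewrite gt_eqF// f0.
Qed.

End PowerBarrier.

Lemma frame_parseval (R : realType) (n : nat) (E G : 'M[R]_n) (X : 'rV[R]_n) : G^T = G ->
  E *m G *m E^T = 1%:M -> \sum_k mform G X (row k E) ^+ 2 = mform G X X.
Proof.
move=> Gs EE; pose H : 'M[R]_n := (X *m G)^T *m (X *m G).
have HE (v : 'rV[R]_n) : mform H v v = mform G X v ^+ 2.
  rewrite /mform /H.
  have -> : v *m ((X *m G)^T *m (X *m G)) *m v^T = (X *m G *m v^T)^T *m (X *m G *m v^T).
    by rewrite [X in _ = X *m _]trmx_mul trmxK !mulmxA.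
  by move: (X *m G *m v^T) => a; rewrite mxE big_ord1 mxE expr2.
rewrite -(eq_bigr _ (fun k _ => HE (row k E))) (mform_trace H EE) /H.
have [_ h2] := frame_inv EE; have [uG _] := mulmx1_unit h2.
rewrite (mulmxA (invmx G)) mxtrace_mulC /mxtrace big_ord1 trmx_mul Gs.
by rewrite [invmx G *m _]mulmxA mulVmx// mul1mx.

Qed.

Lemma barrier_lap_arith (R : realType) (F S1 LS LF N D2 : R) : 0 < F -> 0 < S1 ->
  LS = S1 / (2 * F) * LF - 3 / 4 * (S1 / F ^+ 2) * D2 -> D2 = (2 * F / S1) ^+ 2 * N ->
  LF = 2 * F / S1 * LS + 6 * F / S1 ^+ 2 * N.
Proof. by move=> F0 S0 -> ->; field; rewrite !gt_eqF. Qed.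

Lemma sqrt_bound (R : realType) (N r : R) : 0 <= N -> 0 <= r ->
  N <= 2 * r * Num.sqrt N -> N <= 4 * r ^+ 2.
Proof.
move=> N0 r0; have := sqr_sqrtr N0; have := sqrtr_ge0 N.
by move: (Num.sqrt N) => s s0 <- h; nra.
Qed.

Lemma barrier_test (R : realType) (fy fc a b rho h0 l : R) : 0 < fy -> 0 < fc -> 0 < a -> 0 < b ->
  a ^+ 2 * fy = 1 -> b ^+ 2 * fc = 1 -> 0 < h0 -> 0 < rho -> 0 < rho ^+ 2 * h0 / b * a ->
  (1 - l ^+ 2 / rho ^+ 2) ^+ 2 * fy <= h0 ^+ 2 * fc -> rho ^+ 2 - l ^+ 2 <= rho ^+ 2 * h0 / b * a.
Proof.
move=> fy0 fc0 a0 b0 e1 e2 h0p rho0 K0 h.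
set K := rho ^+ 2 * h0 / b * a in K0 *.
have rho2 : 0 < rho ^+ 2 by rewrite exprn_gt0.
have KE : K ^+ 2 * fy = rho ^+ 2 ^+ 2 * (h0 ^+ 2 * fc).
  have -> : fc = b ^- 2 by rewrite -[fc]mul1r -[1](mulVf (_ : b ^+ 2 != 0)) ?expf_neq0 ?gt_eqF// -mulrA e2 mulr1.
  have -> : fy = a ^- 2 by rewrite -[fy]mul1r -[1](mulVf (_ : a ^+ 2 != 0)) ?expf_neq0 ?gt_eqF// -mulrA e1 mulr1.
  by rewrite /K; field; rewrite !gt_eqF.
have h1 : (rho ^+ 2 - l ^+ 2) ^+ 2 <= K ^+ 2.
  rewrite -(ler_pM2r fy0) KE; have := ler_wpM2l (sqr_ge0 (rho ^+ 2)) h; apply: le_trans.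
  by apply: eq_le_R; field; rewrite gt_eqF.
apply: le_trans (ler_norm _) _.
by rewrite -[leRHS]ger0_norm ?(ltW K0)// -(ler_sqr (normr_ge0 _)) ?nnegrE// !real_normK// num_real.
Qed.

Section MaximumPoint.
Context {R : realType} {n : nat} {M : topologicalType} (g : riemannian R n M).
Variables (p x0 : M) (r rho : R) (O : set 'rV[R]_n) (f : 'rV[R]_n -> R).
Let c := chart g x0 x0.
Let G := metric g x0.
Let h0 := 1 - r ^+ 2 / rho ^+ 2.
Hypotheses (oO : open O) (sub : O `<=` cod g x0) (Oc : O c).
Hypotheses (Cf : smooth_on O f) (f0 : forall y, O y -> 0 < f y).
Hypotheses (px0 : wd g p x0 r) (exact0 : forall l, wd g p x0 l -> r <= l).
Hypotheses (rho0 : 0 < rho) (h00 : 0 < h0).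
Hypothesis fmax : forall y l, O y -> wd g p (chart_inv g x0 y) l -> l <= rho ->
  (1 - l ^+ 2 / rho ^+ 2) ^+ 2 * f y <= h0 ^+ 2 * f c.

Let F0 : 0 < f c. Proof. exact: f0. Qed.
(** The normalization for which the barrier equals r^2 at [c]. *)
Let k := rho ^+ 2 * h0 / f c `^ (- 2^-1).
Let S := barrier f (rho ^+ 2) k.
Let q0 y : O y -> 0 < f y `^ (- 2^-1). Proof. by move=> Oy; rewrite powR_gt0 ?f0. Qed.
Let S1c : k * f c `^ (- 2^-1) = rho ^+ 2 * h0.
Proof. by rewrite /k divfK// gt_eqF// q0. Qed.
Let S10 : 0 < rho ^+ 2 * h0. Proof. by rewrite mulr_gt0// exprn_gt0. Qed.
Let k0 : 0 < k. Proof. by rewrite divr_gt0// q0. Qed.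
Let CS : smooth_on O S. Proof. exact: smooth_barrier. Qed.

Let Sc : S c = r ^+ 2.
Proof. by rewrite /S /barrier S1c /h0; field; rewrite gt_eqF. Qed.

(** For l > rho the barrier is below rho^2 by construction. Otherwise maximality of the weighted
    function gives the inequality after taking square roots. *)
Let hS y l : O y -> wd g p (chart_inv g x0 y) l -> S y <= l ^+ 2.
Proof.
move=> Oy pl; have l0 := wd_ge0 pl; rewrite /S /barrier lerBlDr.
have K0 : 0 < k * f y `^ (- 2^-1) by rewrite mulr_gt0// q0.
have [lr|lr] := leP l rho; last first.
  apply: (@le_trans _ _ (l ^+ 2)); last by rewrite lerDl ltW.
  by rewrite ler_sqr ?nnegrE// ltW.
have := fmax Oy pl lr; rewrite -lerBlDl.
have e1 := powR_half_sqr (f0 Oy); have e2 := powR_half_sqr F0.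
move: K0; rewrite /k; move: (f y `^ _) (q0 Oy) e1 (f c `^ _) (q0 Oc) e2 => a a0 e1 b b0 e2.
exact: (barrier_test (f0 Oy) F0 a0 b0 e1 e2 h00 rho0).
Qed.

Lemma max_derive v : 'D_v f c <= 4 * r * f c / (rho ^+ 2 * h0) * mnorm g x0 v.
Proof.
have := grad_comparison oO Oc CS hS Sc px0 v.
rewrite -/S (barrier_derive _ _ Cf f0 v Oc) S1c => h.
have P0 : 0 < 2 * f c / (rho ^+ 2 * h0) by rewrite divr_gt0// mulr_gt0.
have := ler_wpM2l (ltW P0) h.
have -> : 2 * f c / (rho ^+ 2 * h0) * (rho ^+ 2 * h0 / (2 * f c) * 'D_v f c) = 'D_v f c.
  by field; rewrite !gt_eqF.
move=> h1; apply: le_trans h1 _; apply: eq_le_R.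
by field; rewrite !gt_eqF.
Qed.

(** [f] is k^2 (rho^2 - S)^-2, so its Laplacian is bounded through that of [S], given by the
    comparison hypothesis, and through |grad S|^2 <= 4 r^2. *)
Lemma max_laplacian (B : R) :
  (forall S : 'rV[R]_n -> R, smooth_on O S -> (forall y l, O y -> wd g p (chart_inv g x0 y) l -> S y <= l ^+ 2) ->
     S c = r ^+ 2 -> local_laplacian G S c <= 2 * B) ->
  local_laplacian G f c <= f c * (4 * B / (rho ^+ 2 * h0) + 24 * r ^+ 2 / (rho ^+ 2 * h0) ^+ 2).
Proof.
move=> /(_ S CS hS Sc) HB.
have sGO : smooth_metric O G by exact: smooth_metric_sub.
have [E EE] := frame_exists g x0.
have pG : posdef (G c) by exact: metric_posdefP (sub Oc).
pose X := local_grad G S c.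
have XE v : mform (G c) X v = 'D_v S c := local_gradE sGO CS Oc v.
have N4 : mform (G c) X X <= 4 * r ^+ 2.
  have := grad_comparison oO Oc CS hS Sc px0 X; rewrite -XE /mnorm.
  exact: sqrt_bound (posdef_ge0 X pG) (wd_ge0 px0).
have LS : local_laplacian G S c = rho ^+ 2 * h0 / (2 * f c) * local_laplacian G f c
    - 3 / 4 * (rho ^+ 2 * h0 / f c ^+ 2) * \sum_k ('D_(row k E) f c) ^+ 2.
  rewrite (laplacian_trace sGO CS Oc EE) (laplacian_trace sGO Cf Oc EE) !mulr_sumr -sumrB.
  by apply: eq_bigr => j _; rewrite (barrier_chess _ _ oO Cf f0 G _ Oc) S1c.
have D2 : \sum_k ('D_(row k E) f c) ^+ 2 = (2 * f c / (rho ^+ 2 * h0)) ^+ 2 * mform (G c) X X.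
  rewrite -(frame_parseval X pG.1 EE) mulr_sumr; apply: eq_bigr => j _.
  rewrite XE (barrier_derive _ _ Cf f0 _ Oc) S1c -exprMn; congr (_ ^+ 2).
  by field; rewrite !gt_eqF.
rewrite (barrier_lap_arith F0 S10 LS D2).
have P0 : 0 <= 2 * f c / (rho ^+ 2 * h0) by rewrite divr_ge0 ?(ltW S10)// mulr_ge0// ltW.
have P1 : 0 <= 6 * f c / (rho ^+ 2 * h0) ^+ 2 by rewrite divr_ge0 ?sqr_ge0// mulr_ge0// ltW.
apply: le_trans (lerD (ler_wpM2l P0 HB) (ler_wpM2l P1 N4)) _; apply: eq_le_R.
by field; rewrite !gt_eqF.
Qed.

End MaximumPoint.

(** * Solutions in charts *)

Section TimeDerivative.
Context {R : realType}.
Variables (T t : R).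
Hypotheses (T0 : 0 < T) (tT : t \in `[0, T]).

Lemma within_punctured_proper : ProperFilter (within `[0, T] t^').
Proof.
apply: Build_ProperFilter => /nbhs_ballP[e /= e0 H]; move: tT; rewrite in_itv /= => /andP[t0 t1].
have pick (d s : R) : 0 < d -> `|s - t| < e -> s != t -> 0 <= s <= T -> False.
  move=> d0 se st sT; apply: (H s) => //.
  by rewrite -ball_normE /= distrC.
have [tlt|tge] := ltP t T.
  pose d := Num.min (e / 2) (T - t).
  have d0 : 0 < d by rewrite lt_min divr_gt0//= subr_gt0.
  have de : d <= e / 2 by rewrite ge_min lexx.
  have dT : d <= T - t by rewrite ge_min lexx orbT.
  apply: (pick d (t + d)) => //.
  - by rewrite addrC addKr gtr0_norm//; lra.
  - by rewrite -subr_eq0 addrC addKr gt_eqF.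
  - by apply/andP; split; lra.
have tE : t = T by apply/eqP; rewrite eq_le t1.
pose d := Num.min (e / 2) T.
have d0 : 0 < d by rewrite lt_min divr_gt0//=.
have de : d <= e / 2 by rewrite ge_min lexx.
have dT : d <= T by rewrite ge_min lexx orbT.
apply: (pick d (t - d)) => //.
- by rewrite addrC addKr normrN gtr0_norm//; lra.
- by rewrite -subr_eq0 addrC addKr oppr_eq0 gt_eqF.
- by apply/andP; split; lra.
Qed.

(** The punctured neighborhoods within [0, T] form a proper filter even at the endpoints, so the
    possibly one-sided limit is that of the difference quotients of the extension [h]. *)
Lemma time_derivE (f h : R -> R) (d : R) : is_derive t (1 : R) h d ->
  (\forall s \near t, s \in `[0, T] -> f s = h s) -> time_deriv T f t = d.
Proof.
move=> [d1 d2] fh; have PF := within_punctured_proper.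
have ft : f t = h t by exact: (nbhs_singleton fh tT).
apply: cvg_lim => //; apply/cvgrPdist_lt => e e0.
have : (fun s : R => s^-1 *: ((h \o shift t) (s *: (1 : R)) - h t)) @ 0^' --> 'D_1 h t by exact: d1.
rewrite d2 => /cvgrPdist_lt/(_ _ e0)/nbhs_ballP[r /= r0 H].
have [r' /= r'0 H'] := (nbhs_ballP _ _).1 fh.
apply/nbhs_ballP; exists (Num.min r r') => /=; first by rewrite lt_min r0.
move=> s; rewrite -ball_normE /= distrC lt_min => /andP[sr sr'] st sT.
have s't : `|t - s| < r' by rewrite distrC.
have s'b : ball t r' s by rewrite -ball_normE.
rewrite ft (H' s s'b sT).
have := H (s - t); rewrite -ball_normE /= sub0r normrN => /(_ sr).
rewrite subr_eq0 => /(_ st).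
have -> : (s - t) *: (1 : R) + t = s by rewrite [(s - t) *: (1 : R)]mulr1 subrK.
by rewrite [(s - t)^-1 *: _]mulrC.
Qed.
End TimeDerivative.

Section TimeSlice.
Context {R : realType} {V : normedModType R}.

Lemma time_continuous (z : V * R) : (fun s : R => (z.1, s)) @ z.2 --> z.
Proof.
rewrite [X in _ --> X]surjective_pairing.
by apply: (@cvg_pair _ _ _ _ (nbhs z.1) (nbhs z.2)); [exact: cvg_cst|exact: cvg_id].
Qed.

Lemma is_derive_time (F : V * R -> R) (z : V * R) (d : R) : is_derive z ((0 : V), (1 : R)) F d ->
  is_derive z.2 (1 : R) (fun s => F (z.1, s)) d.
Proof.
move=> [h1 h2].
have E : (fun h : R => h^-1 *: (((fun s => F (z.1, s)) \o shift z.2) (h *: (1 : R)) - F (z.1, z.2))) =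
    (fun h : R => h^-1 *: ((F \o shift z) (h *: ((0 : V), (1 : R))) - F z)).
  apply/funext => h /=; rewrite -surjective_pairing.
  by rewrite -[h *: ((0 : V), (1 : R))]/(h *: (0 : V), h *: (1 : R)) scaler0 [X in F (_ + X)]surjective_pairing
    -[(_, _) + _]/(_, _) /= add0r.
split; first by rewrite /derivable E.
by rewrite -h2 /derive E.
Qed.
End TimeSlice.

Section ChartFlow.
Context {R : realType} {n : nat} {M : topologicalType} (g : riemannian R n M).
Variables (B : set M) (T m al : R) (u : M -> R -> R).
Hypotheses (oB : open B) (T0 : 0 < T) (m0 : 0 < m) (m1 : m < 1).
Hypothesis hu : fde_solution g B T m u.
Variable x0 : M.
Let G := metric g x0.

Section Local.
Variables (W : set ('rV[R]_n * R)%type) (U : 'rV[R]_n * R -> R).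
Hypotheses (oW : open W) (CU : smooth_on W U).
Hypothesis hU : forall q s, chart_dom g x0 q -> B q -> s \in `[0, T] ->
  W (chart g x0 q, s) -> U (chart g x0 q, s) = u q s.

(** The local extension [U] agrees with [u] for times in [0, T] only and may lose its sign
    elsewhere; positivity is therefore part of the domain. *)
Definition flow_dom : set ('rV[R]_n * R)%type :=
  [set z | W z /\ 0 < U z /\ cod g x0 z.1 /\ B (chart_inv g x0 z.1)].

Lemma open_flow_dom : open flow_dom.
Proof.
rewrite openE => z [Wz [Uz [cz Bz]]]; rewrite /interior.
have N1 : nbhs z W by exact: open_nbhs_nbhs.
have N2 : \forall y \near z, 0 < U y.
  exact: (cvgr_gt _ (Ck_continuous (CU 0) Wz) _ Uz).
have N3 : \forall y \near z, cod g x0 y.1 /\ B (chart_inv g x0 y.1).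
  have N : nbhs z.1 [set y | cod g x0 y /\ B (chart_inv g x0 y)].
    apply: filterI; first by apply: open_nbhs_nbhs; split=> //; exact: open_cod.
    by apply: (chart_inv_continuous cz); apply: open_nbhs_nbhs.
  exact: (@cvg_fst _ _ (nbhs z.1) (nbhs z.2) _ _ N).
by apply: filterS (filterI (filterI N1 N2) N3) => y [[h1 h2] [h3 h4]].
Qed.

Variable O : set ('rV[R]_n * R)%type.
Hypotheses (oO : open O) (OF : O `<=` flow_dom).

Let CO : smooth_on O U. Proof. by move=> k; apply: Ck_sub (CU k) => z /OF[]. Qed.
Let U0 z : O z -> 0 < U z. Proof. by move=> /OF[_ []]. Qed.
Let Oc z : O z -> cod g x0 z.1. Proof. by move=> /OF[_ [_ []]]. Qed.
Let OB z : O z -> B (chart_inv g x0 z.1). Proof. by move=> /OF[_ [_ []]]. Qed.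
Let sG : smooth_metric (cod g x0) G. Proof. exact: smooth_metric_cod. Qed.

Definition fpres := pres oO m CO U0.
Definition fhar := har sG oO Oc al CO U0 m0 m1.

Let UE z : O z -> z.2 \in `[0, T] -> U z = u (chart_inv g x0 z.1) z.2.
Proof.
move=> Oz zT; have [Wz [_ [cz Bz]]] := OF Oz.
have := hU (chart_invP cz) Bz zT; rewrite chart_invK// -surjective_pairing.
by move=> /(_ Wz).
Qed.

Lemma pressure_flow z : O z -> z.2 \in `[0, T] -> pressure m u (chart_inv g x0 z.1) z.2 = fpres z.
Proof. by move=> Oz zT; rewrite /fpres presE// /pressure -UE. Qed.

Let tslice (F : 'rV[R]_n * R -> R) (f : M -> R -> R) z : smooth_on O F -> O z -> z.2 \in `[0, T] ->
  (forall y, O y -> y.2 \in `[0, T] -> f (chart_inv g x0 y.1) y.2 = F y) ->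
  time_deriv T (f (chart_inv g x0 z.1)) z.2 = 'D_((0 : 'rV[R]_n), (1 : R)) F z.
Proof.
move=> CF Oz zT fF; have h := Ck_derivable ((0 : 'rV[R]_n), (1 : R)) (CF 1) Oz.
apply: (time_derivE T0 zT (h := fun s => F (z.1, s))).
  have d : is_derive z ((0 : 'rV[R]_n), (1 : R)) F ('D_((0 : 'rV[R]_n), (1 : R)) F z) by split.
  exact: is_derive_time d.
have NO : nbhs z O by exact: open_nbhs_nbhs.
have N2 : \forall s \near z.2, O (z.1, s) by exact: (@time_continuous _ _ z _ NO).
apply: filterS N2 => s Os sT.
by rewrite -fF.
Qed.

Let slice_smooth (F : 'rV[R]_n * R -> R) s : smooth_on O F -> smooth_on [set y | O (y, s)] (slice F s).
Proof. by move=> CF k; exact: Ck_slice (CF k). Qed.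

Let chart_slice (F : 'rV[R]_n * R -> R) (f : M -> R -> R) z : smooth_on O F -> O z -> z.2 \in `[0, T] ->
  (forall y, O y -> y.2 \in `[0, T] -> f (chart_inv g x0 y.1) y.2 = F y) ->
  let q := chart_inv g x0 z.1 in
  laplacian g (fun y => f y z.2) q = local_laplacian G (slice F z.2) z.1 /\
  norm g q (grad g (fun y => f y z.2) q) ^+ 2 =
    let X := local_grad G (slice F z.2) z.1 in mform (G z.1) X X.
Proof.
move=> CF Oz zT fF q; have Oz' : O (z.1, z.2) by rewrite -surjective_pairing.
have qd : chart_dom g x0 q by exact: chart_invP (Oc Oz).
have qE : chart g x0 q = z.1 by exact: chart_invK (Oc Oz).
pose Os := [set y : 'rV[R]_n | O (y, z.2)].
have oOs : open Os by exact: open_slice.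
have Os_cod : Os `<=` cod g x0 by move=> y /Oc.
have Osq : Os (chart g x0 q) by rewrite qE.
have fE y : Os y -> ((fun y => f y z.2) \o chart_inv g x0) y = slice F z.2 y.
  by move=> Oy; rewrite /= (fF (y, z.2)).
have Cf : smooth_on Os ((fun y => f y z.2) \o chart_inv g x0).
  move=> k; apply: Ck_ext (slice_smooth z.2 CF k) => // y Oy; by rewrite fE.
have sGs : smooth_metric Os G by exact: smooth_metric_sub.
rewrite (laplacian_chart qd oOs Os_cod Osq Cf) (norm_grad_chart qd oOs Os_cod Osq Cf) qE.
rewrite (eq_local_laplacian sGs Oz' fE); split=> //.
by rewrite (eq_local_grad sGs fE Oz').
Qed.

Lemma harnack_flow z : O z -> z.2 \in `[0, T] ->
  harnack g T al (pressure m u) (chart_inv g x0 z.1) z.2 = - fhar z.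
Proof.
move=> Oz zT; have Cp := smf_smooth fpres.
rewrite /harnack (chart_slice Cp Oz zT pressure_flow).2 (tslice Cp Oz zT pressure_flow) (pressure_flow Oz zT).
by rewrite /fhar (harE sG oO Oc al CO U0 m0 m1 Oz) opprB.
Qed.

Lemma fde_flow z : O z -> z.2 \in `[0, T] ->
  'D_((0 : 'rV[R]_n), (1 : R)) U z = local_laplacian G (fun y => U (y, z.2) `^ m) z.1.
Proof.
move=> Oz zT; have [_ _ /(_ _ _ (OB Oz) zT)] := hu.
have UE' y : O y -> y.2 \in `[0, T] -> u (chart_inv g x0 y.1) y.2 = U y.
  by move=> Oy yT; rewrite UE.
rewrite (tslice CO Oz zT UE') => ->.
pose Um (z : 'rV[R]_n * R) := U z `^ m.
have CUm : smooth_on O Um by move=> k; exact: Ck_powR (CO k).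
have UmE y : O y -> y.2 \in `[0, T] -> (u (chart_inv g x0 y.1) y.2) `^ m = Um y.
  by move=> Oy yT; rewrite /Um UE.
exact: (chart_slice (f := fun y s => u y s `^ m) CUm Oz zT UmE).1.
Qed.

Lemma flow_evolution (kp : R) z : (forall z, O z -> z.2 \in `[0, T]) -> (0 < n)%N ->
  0 < n%:R * (m - 1) + 2 -> O z ->
  let X := local_grad G (slice fpres z.2) z.1 in
  - kp * mform (G z.1) X X <= mform (ricci_mx G z.1) X X ->
  let ze := 'D_((0 : 'rV[R]_n), (1 : R)) fpres z / fpres z in
  let Y := - (mform (G z.1) X X / fpres z) in
  fhar z = al * ze + Y /\
  'D_((0 : 'rV[R]_n), (1 : R)) fhar z - (m - 1) * fpres z * local_laplacian G (slice fhar z.2) z.1 <=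
    2 * m * 'D_X (slice fhar z.2) z.1 + (ze + Y) ^+ 2 / a_const n m - (1 - al) * ze ^+ 2
    + 2 * (1 - m) * kp * mform (G z.1) X X.
Proof.
move=> OT n0 nm Oz.
exact: (har_evolution sG Oc al m0 m1 (fun y Oy => fde_flow Oy (OT y Oy)) n0 nm Oz).
Qed.

End Local.

Lemma flow_chart (t0 : R) : B x0 -> t0 \in `[0, T] -> (0 < n)%N -> 0 < n%:R * (m - 1) + 2 ->
  exists (O : set ('rV[R]_n * R)%type) (pr F : 'rV[R]_n * R -> R),
  let c := chart g x0 x0 in
  [/\ open O, O (c, t0), forall z, O z -> cod g x0 z.1, smooth_on O F &
  [/\ forall z, O z -> pr z < 0,
    forall q s, chart_dom g x0 q -> s \in `[0, T] -> O (chart g x0 q, s) ->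
      [/\ B q, pressure m u q s = pr (chart g x0 q, s) &
        harnack g T al (pressure m u) q s = - F (chart g x0 q, s)] &
    0 < t0 < T -> forall kp, (forall v, - kp * inner g x0 v v <= ricci g x0 v v) ->
      let X := local_grad G (slice pr t0) c in
      let ze := 'D_((0 : 'rV[R]_n), (1 : R)) pr (c, t0) / pr (c, t0) in
      let Y := - (mform (G c) X X / pr (c, t0)) in
      F (c, t0) = al * ze + Y /\
      'D_((0 : 'rV[R]_n), (1 : R)) F (c, t0) - (m - 1) * pr (c, t0) * local_laplacian G (slice F t0) c <=
        2 * m * 'D_X (slice F t0) c + (ze + Y) ^+ 2 / a_const n m - (1 - al) * ze ^+ 2
        + 2 * (1 - m) * kp * mform (G c) X X]].
Proof.
move=> Bx t0T n0 nm; set c := chart g x0 x0; have [su u0 _] := hu.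
have [W [U [oW Wc CU hU]]] := su _ _ Bx t0T.
have oF := open_flow_dom oW CU.
have cx : chart_dom g x0 x0 by exact: chart_dom_center.
have Fc : flow_dom W U (c, t0).
  split=> //; rewrite (hU _ _ cx Bx t0T Wc); split; first exact: u0.
  by split; [exact: cod_chart|rewrite /= chartK].
(* At an interior time the domain is cut down to interior times, where [U] solves the equation. At
   the endpoints the condition is vacuous, and only continuity of the extension will be used. *)
pose I := [set z : 'rV[R]_n * R | 0 < t0 < T -> 0 < z.2 < T].
have oI : open I.
  have [h|h] := boolP (0 < t0 < T).
    have -> : I = snd @^-1` `]0, T[%classic.
      by apply/seteqP; split=> [z /(_ h)|z]; rewrite /= in_itv //= => hz _.
    apply: open_comp; first by move=> z _; exact: cvg_snd.
    exact: itv_open.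
  have -> : I = setT.
    apply/seteqP; split=> [z _|z _ h']; first by [].
    by move: h; rewrite h'.
  exact: openT.
have oO : open (flow_dom W U `&` I) by exact: openI.
have OF : flow_dom W U `&` I `<=` flow_dom W U by move=> z [].
exists (flow_dom W U `&` I), (fpres CU oO OF), (fhar CU oO OF); split=> //.
- by split.
- by move=> z [[_ [_ []]]].
- exact: smf_smooth.
split.
- by move=> z Oz; exact: pres_lt0.
- move=> q s qd sT Oqs; have [[_ [_ [_ Bq]]] _] := Oqs.
  rewrite /= chartK// in Bq; split=> //.
    by have := pressure_flow CU hU oO OF Oqs sT; rewrite /= chartK.
  have := harnack_flow CU hU oO OF Oqs sT; by rewrite /= chartK.
move=> t0i kp hRic X ze Y.
have Oc0 : (flow_dom W U `&` I) (c, t0) by split.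
have OT z : (flow_dom W U `&` I) z -> z.2 \in `[0, T].
  by move=> [_ /(_ t0i)/andP[h1 h2]]; rewrite in_itv /= !ltW.
have ev := flow_evolution (CU := CU) (oO := oO) (OF := OF) (kp := kp) hU OT n0 nm Oc0.
exact: (ev (hRic X)).
Qed.

End ChartFlow.

(** * The maximum of the localized Harnack quantity *)

Section Distance.
Context {R : realType} {n : nat} {M : topologicalType} (g : riemannian R n M).
Implicit Types (p q x y : M).

Definition rdist p q : R := fine (geodist g p q).

Lemma wd_rdist p q l : wd g p q l -> wd g p q (rdist p q) /\ rdist p q <= l.
Proof.
rewrite /rdist /wd => h.
have nn : (geodist g p q != -oo)%E.
  apply/eqP => e; have : wd g p q (-1) by rewrite /wd e leNye.
  by move=> /wd_ge0; rewrite ler0N1.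
move: h nn; case: (geodist g p q) => [d| |] /=.
- by rewrite lee_fin => h _; split.
- by rewrite leye_eq.
- by [].
Qed.

Lemma rdist_le p q l : wd g p q l -> rdist p q <= l.
Proof. by move=> /wd_rdist[]. Qed.

Lemma rdist_wd p q l : wd g p q l -> wd g p q (rdist p q).
Proof. by move=> /wd_rdist[]. Qed.

Lemma rdist_lip p x y a b e : wd g p x a -> wd g p y b -> wd g x y e ->
  `|rdist p x - rdist p y| <= e.
Proof.
move=> px py xy; rewrite ler_distl; apply/andP; split.
  by rewrite lerBlDr; apply: rdist_le; exact: wd_trans (rdist_wd px) xy.
by apply: rdist_le; exact: wd_trans (rdist_wd py) (wd_sym xy).
Qed.

End Distance.

Lemma pos_factors (R : realType) (t h F : R) : 0 <= t -> 0 < t * (h ^+ 2 * F) ->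
  [/\ 0 < t, h != 0 & 0 < F].
Proof.
move=> t0 h0; have t_gt : 0 < t.
  by rewrite lt_neqAle t0 andbT; apply: contraTneq h0 => <-; rewrite mul0r ltxx.
move: h0; rewrite pmulr_rgt0// => h0; have hn : h != 0.
  by apply: contraTneq h0 => ->; rewrite expr0n mul0r ltxx.
by split=> //; move: h0; rewrite pmulr_rgt0// exprn_even_gt0.
Qed.

Lemma weight_mono (R : realType) (d l rho : R) : 0 <= d -> d <= l -> l <= rho -> 0 < rho ->
  (1 - l ^+ 2 / rho ^+ 2) ^+ 2 <= (1 - d ^+ 2 / rho ^+ 2) ^+ 2.
Proof.
move=> d0 dl lr rho0; have r2 : 0 < rho ^+ 2 by rewrite exprn_gt0.
have h1 : d ^+ 2 / rho ^+ 2 <= l ^+ 2 / rho ^+ 2.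
  by rewrite ler_pM2r ?invr_gt0// ler_sqr ?nnegrE// (le_trans d0).
have h2 : l ^+ 2 / rho ^+ 2 <= 1.
  by rewrite ler_pdivrMr// mul1r ler_sqr ?nnegrE ?(ltW rho0)// (le_trans d0).
by rewrite ler_sqr ?nnegrE; lra.
Qed.

Lemma left_max_arith (R : realType) (t0 h e d F0 Fh : R) : 0 < h -> h < t0 -> 0 < e ->
  - (e * h) <= Fh - F0 + h * d -> (t0 - h) * Fh <= t0 * F0 -> h * (`|d| + e) <= e ->
  0 <= F0 + t0 * d + e * (t0 + 1).
Proof.
move=> h0 ht e0 h1 h2 h3.
have k1 : F0 - h * d - e * h <= Fh by lra.
have k2 : (t0 - h) * (F0 - h * d - e * h) <= t0 * F0.
  by apply: le_trans h2; rewrite ler_wpM2l// subr_ge0 ltW.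
have k3 : 0 <= h * (F0 + t0 * (d + e) - h * (d + e)) by nra.
rewrite pmulr_rge0// in k3; have k4 := ler_norm (- d); rewrite normrN in k4.
have k5 : h * (- d - e) <= e.
  by apply: le_trans h3; rewrite ler_pM2l// lerD// (le_trans _ (ltW e0))// oppr_le0 ltW.
lra.
Qed.

(** With P = z + Y, the identities al z = F - Y and al P = F - (1 - al) Y turn the quadratic part of
    the evolution inequality into the two squares on the left, after multiplication by (- a)
    al^2. *)
Lemma core_arith (R : realType) (al a m V F0 Y ze t0 d L Q D q kp : R) : 0 < al -> 0 < - a ->
  0 < m -> m < 1 -> 0 < - V -> F0 = al * ze + Y -> - (F0 / t0) <= d -> L <= F0 * Q ->
  D <= q * Num.sqrt (- V * Y) ->
  d - (m - 1) * V * L <= 2 * m * D + (ze + Y) ^+ 2 / a - (1 - al) * ze ^+ 2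
    + 2 * (1 - m) * kp * (- V * Y) ->
  (F0 - (1 - al) * Y) ^+ 2 + - a * (1 - al) * (F0 - Y) ^+ 2 <=
   - a * al ^+ 2 * (F0 / t0 + (1 - m) * - V * (F0 * Q) + 2 * m * (q * Num.sqrt (- V * Y))
     + 2 * (1 - m) * kp * (- V * Y)).
Proof.
move=> al0 a0 m0 m1 V0 FE hd hL hD h; rewrite FE.
have an : a != 0 by move: a0; rewrite oppr_gt0 => /ltr0_neq0.
have -> : (al * ze + Y - (1 - al) * Y) ^+ 2 + - a * (1 - al) * (al * ze + Y - Y) ^+ 2 =
    - a * al ^+ 2 * ((1 - al) * ze ^+ 2 - (ze + Y) ^+ 2 / a) by field.
rewrite -FE; apply: ler_wpM2l; first by rewrite mulr_ge0 ?sqr_ge0// ltW.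
have k1 : (1 - m) * - V * L <= (1 - m) * - V * (F0 * Q).
  by rewrite ler_wpM2l// mulr_ge0 ?(ltW V0)// subr_ge0 ltW.
have k2 : 2 * m * D <= 2 * m * (q * Num.sqrt (- V * Y)).
  by rewrite ler_wpM2l// mulr_ge0// ltW.
move: (F0 / t0) ((ze + Y) ^+ 2 / a) ((1 - m) * - V * (F0 * Q)) (2 * m * (q * Num.sqrt (- V * Y))) hd h k1 k2.
by move=> ft P2 QQ SQ hd h k1 k2; lra.
Qed.

(** The maximum is taken over times up to [t] only, possibly with t0 = t. Comparison with earlier
    times gives that the derivative of s F is nonnegative at [t0], hence F_t >= - F / t0. *)
Lemma left_max_time (R : realType) (V : normedModType R) (O : set (V * R)) (Fs : V * R -> R) (c : V) (t0 : R) :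
  open O -> O (c, t0) -> smooth_on O Fs -> 0 < t0 ->
  (forall s, 0 < s -> s <= t0 -> O (c, s) -> s * Fs (c, s) <= t0 * Fs (c, t0)) ->
  - (Fs (c, t0) / t0) <= 'D_((0 : V), (1 : R)) Fs (c, t0).
Proof.
move=> oO Oc CF t00 H; set d := 'D_ _ _ _; set F0 := Fs (c, t0).
suff : 0 <= F0 + t0 * d.
  by move=> h; rewrite -(ler_pM2l t00) mulrN mulrC divfK ?gt_eqF// -subr_ge0 opprK addrC.
have dF : is_derive t0 (1 : R) (fun s => Fs (c, s)) d.
  have h : is_derive (c, t0) ((0 : V), (1 : R)) Fs d.
    by split=> //; exact: (Ck_derivable _ (CF 1) Oc).
  exact: is_derive_time h.
have dF0 : is_derive (0 : R) (1 : R) (fun h : R => Fs (c, t0 + h)) d.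
  have [k1 k2] := dF; have := @is_derive_line _ _ _ (fun s => Fs (c, s)) t0 (1 : R) 0.
  rewrite scale0r addr0 k2 => /(_ k1).
  have -> // : (fun h : R => Fs (c, t0 + h *: (1 : R))) = (fun h : R => Fs (c, t0 + h)).
  by apply/funext => h; rewrite [h *: (1 : R)]mulr1.
apply/ler_addgt0Pr => e0 e00; pose e := e0 / (t0 + 1).
have t1 : 0 < t0 + 1 by rewrite ltr_wpDl// ltW.
have e_gt : 0 < e by rewrite divr_gt0.
have N1 := nbhs_at_right (near_opp (is_derive_near0 dF0 e_gt)).
have NO : \forall s \near t0, O (c, s).
  have No : nbhs (c, t0) O by exact: open_nbhs_nbhs.
  exact: (@time_continuous _ _ (c, t0) _ No).
have N2 : \forall s \near (0 : R)^'+, O (c, t0 - s).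
  apply: nbhs_at_right; have [r /= r0 Hr] := (nbhs_ballP _ _).1 NO.
  apply/nbhs_ballP; exists r => // s; rewrite -ball_normE /= sub0r normrN => sr.
  by apply: Hr; rewrite -ball_normE /= opprB addrC subrK.
have N3 := near_small (`|d| + e) e_gt.
have N4 : \forall s \near (0 : R)^'+, s < t0 by exact: nbhs_right_lt.
have [h [[[[h1 h2] h3] h4] h5]] := @filter_ex _ _ (at_right_proper_filter (0 : R)) _
  (filterI (filterI (filterI (filterI N1 N2) N3) N4) (nbhs_right_gt (0 : R))).
rewrite addr0 normrN (gtr0_norm h5) mulNr opprK -/F0 in h1.
have t0h : 0 < t0 - h by rewrite subr_gt0.
have := H _ t0h _ h2; rewrite gerBl (ltW h5) => /(_ isT); rewrite -/F0 => h6.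
have -> : e0 = e * (t0 + 1) by rewrite /e divfK// gt_eqF.
move: h1; rewrite ler_norml => /andP[h1 _].
exact: left_max_arith h5 h4 e_gt h1 h6 h3.
Qed.

Section Maximum.
Context {R : realType} {n : nat} {M : topologicalType} (g : riemannian R n M).
Variables (o p : M) (rad T m al : R) (u : M -> R -> R).
Hypotheses (n0 : (0 < n)%N) (hg : complete_riemannian g) (rad0 : 0 < rad) (T0 : 0 < T).
Hypotheses (m0 : 0 < m) (m1 : m < 1) (nm : 0 < n%:R * (m - 1) + 2).
Let B := geoball g o rad.
Hypothesis hu : fde_solution g B T m u.
Hypothesis op : geoball g o (rad / 2) p.
Let rho := rad / 2.
Let F (x : M) (s : R) : R := - harnack g T al (pressure m u) x s.

Let rho0 : 0 < rho. Proof. by rewrite divr_gt0. Qed.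

Lemma ball_in_B y l : wd g p y l -> l <= rho -> B y.
Proof.
move=> py lr; have /geoballE[l0 l0r op'] := op; apply/geoballE.
by exists (l0 + l); [rewrite [rad]splitr; exact: ltr_leD|exact: wd_trans op' py].
Qed.

Lemma harnack_cvg x (t : R) : B x -> t \in `[0, T] ->
  F z.1 z.2 @[z --> within [set z : M * R | z.2 \in `[0, T]] (nbhs (x, t))] --> F x t.
Proof.
move=> Bx tT; have oB : open B by exact: open_geoball.
have [Q [pr [Fs [oQ Qc _ CF [_ HF _]]]]] := flow_chart al oB T0 m0 m1 hu Bx tT n0 nm.
have xx : chart_dom g x x by exact: chart_dom_center.
pose k (z : M * R) := (chart g x z.1, z.2).
have ck : k @ (x, t) --> k (x, t).
  apply: (@cvg_pair _ _ _ _ (nbhs (chart g x x)) (nbhs t)); last exact: cvg_snd.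
  apply: (@cvg_comp _ _ _ fst (chart g x) _ (nbhs x)); first exact: cvg_fst.
  exact: chart_continuous.
have Ft : F x t = Fs (k (x, t)).
  by have [_ _ E] := HF x t xx tT Qc; rewrite /F E opprK.
rewrite Ft; have c1 : (fun z => Fs (k z)) @ (x, t) --> Fs (k (x, t)).
  apply: (@cvg_comp _ _ _ k Fs _ (nbhs (k (x, t)))) => //.
  exact: (Ck_continuous (CF 0) Qc).
have N1 : \forall z \near (x, t), chart_dom g x z.1.
  apply: (@cvg_fst _ _ (nbhs x) (nbhs t)); apply: open_nbhs_nbhs; split=> //.
  exact: chart_dom_open.
have N2 : \forall z \near (x, t), Q (k z) by apply: ck; exact: open_nbhs_nbhs.
have : (fun z => Fs (k z)) @ within [set z : M * R | z.2 \in `[0, T]] (nbhs (x, t)) --> Fs (k (x, t)).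
  exact: cvg_within_filter c1.
apply: cvg_trans; apply: near_eq_cvg.
apply: filterS (filterI N1 N2) => z [h1 h2] zT.
by have [_ _ E] := HF z.1 z.2 h1 zT h2; rewrite /F E opprK.
Qed.

Lemma rdist_cvg x (A : set (M * R)) (t : R) : wd g p x rho ->
  (forall z, A z -> wd g p z.1 rho) ->
  rdist g p z.1 @[z --> within A (nbhs (x, t))] --> rdist g p x.
Proof.
move=> px HA; apply/cvgrPdist_le => e e0.
have N : \forall z \near (x, t), wd g x z.1 e.
  exact: (@cvg_fst _ _ (nbhs x) (nbhs t) _ _ (nbhs_wd g x e0)).
apply: filterS N => z xz Az; exact: rdist_lip px (HA z Az) xz.
Qed.

Let phi (z : M * R) : R := z.2 * ((1 - rdist g p z.1 ^+ 2 / rho ^+ 2) ^+ 2 * F z.1 z.2).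

Lemma max_point (t : R) : 0 < t <= T -> 0 < F p t -> exists x0 t0 r, [/\ 0 < t0 <= t,
  wd g p x0 r /\ (forall l, wd g p x0 l -> r <= l), r < rho,
  0 < F x0 t0 /\ t * F p t <= t0 * ((1 - r ^+ 2 / rho ^+ 2) ^+ 2 * F x0 t0) &
  (forall y l, wd g p y l -> l <= rho ->
    (1 - l ^+ 2 / rho ^+ 2) ^+ 2 * F y t0 <= (1 - r ^+ 2 / rho ^+ 2) ^+ 2 * F x0 t0) /\
  (forall s, 0 <= s <= t -> s * F x0 s <= t0 * F x0 t0)].
Proof.
move=> /andP[t_gt tT] Fp.
pose K := [set y | wd g p y rho] `*` `[0, t]%classic.
have cK : compact K by apply: compact_setX; [exact: compact_cball|exact: segment_compact].
have pp : wd g p p 0 by exact: wd_refl.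
have dpp : rdist g p p = 0.
  by apply/eqP; rewrite eq_le (rdist_le pp)/=; exact: wd_ge0 (rdist_wd pp).
have Kpt : K (p, t).
  by split; [exact: wd_le (ltW rho0) pp|rewrite /= in_itv /= lexx (ltW t_gt)].
have cphi : {within K, continuous phi}.
  apply/subspace_continuousP => -[x s] [/= px]; rewrite in_itv /= => /andP[s0 st].
  have KA z : K z -> wd g p z.1 rho by case.
  have h1 : rdist g p z.1 @[z --> within K (nbhs (x, s))] --> rdist g p x by exact: rdist_cvg.
  have sT : s \in `[0, T] by rewrite in_itv /= s0 (le_trans st).
  have h2 := harnack_cvg (ball_in_B px (lexx _)) sT.
  have h3 : F z.1 z.2 @[z --> within K (nbhs (x, s))] --> F x s.
    apply: cvg_trans h2; apply: cvg_fmap2; apply: within_subset => z [_ /=].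
    by rewrite !in_itv /= => /andP[-> h]; rewrite (le_trans h).
  have h4 : (fun z : M * R => z.2) @ within K (nbhs (x, s)) --> s.
    exact: cvg_within_filter cvg_snd.
  rewrite /phi /=; apply: cvgM; first exact: h4.
  apply: cvgM; last exact: h3.
  have sq (f : M * R -> R) (l : R) : f @ within K (nbhs (x, s)) --> l ->
      (fun z => f z ^+ 2) @ within K (nbhs (x, s)) --> l ^+ 2.
    by move=> h; exact: (cvgM h h).
  apply: (sq _ _ _); apply: cvgB; first exact: cvg_cst.
  by apply: cvgM; [exact: sq|exact: cvg_cst].
have [|[x0 t0] /set_mem[/= px0 t0t] Hmax] := compact_EVT_max _ cK cphi; first by exists (p, t).
rewrite in_itv /= in t0t; have /andP[t00 t0t'] := t0t.
have {}Hmax y s : wd g p y rho -> 0 <= s <= t -> phi (y, s) <= phi (x0, t0).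
  by move=> py st; apply: Hmax; apply/mem_set; split=> //=; rewrite in_itv.
set r := rdist g p x0.
have pr : wd g p x0 r := rdist_wd px0; have r0 := wd_ge0 pr.
have rr : r <= rho := rdist_le px0.
have phi_p : phi (p, t) = t * F p t.
  by rewrite /phi /= dpp expr0n mul0r subr0 expr1n mul1r.
have phi_max : t * F p t <= phi (x0, t0).
  by rewrite -phi_p; apply: Hmax; [exact: wd_le (ltW rho0) pp|rewrite lexx ltW].
have phi0 : 0 < phi (x0, t0) by apply: lt_le_trans phi_max; rewrite mulr_gt0.
have [t0_gt h0_gt F_gt] := pos_factors t00 phi0.
have r_lt : r < rho.
  rewrite lt_neqAle rr andbT; apply/eqP => E; move: h0_gt; rewrite -/r E divff ?subrr ?eqxx//.
  by rewrite expf_neq0// gt_eqF.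
exists x0, t0, r; split=> //.
- by rewrite t0_gt.
- by split=> // l; exact: rdist_le.
split.
  move=> y l py lr; have [Fy|Fy] := leP (F y t0) 0.
    apply: (@le_trans _ _ 0); first by rewrite mulr_ge0_le0// sqr_ge0.
    by rewrite mulr_ge0 ?sqr_ge0// ltW.
  have := Hmax y t0 (wd_le lr py) t0t; rewrite /phi /= -/r ler_pM2l//; apply: le_trans.
  rewrite ler_pM2r// ; exact: weight_mono (wd_ge0 (rdist_wd py)) (rdist_le py) lr rho0.
move=> s st; have := Hmax x0 s px0 st; rewrite /phi /= -/r.
by rewrite mulrCA [leRHS]mulrCA ler_pM2l// exprn_even_gt0.
Qed.

(** As t < T, the time of the maximum is interior, where the local extension solves the equation.
    The bound [Bc] leaves the choice of the comparison radius [rr] to each of the two curvature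
    assumptions. *)
Lemma max_core (kp Bc t : R) : 0 < al -> 0 <= kp ->
  (forall x, B x -> forall v, - kp * inner g x v v <= ricci g x v v) -> n%:R <= Bc ->
  (forall r, 0 < r -> r < rho -> exists rr, [/\ 0 < rr, rr <= r & n%:R + r * (n%:R / rr + kp * rr) <= Bc]) ->
  0 < t < T -> 0 < F p t -> exists x0 t0 r Y, let F0 := F x0 t0 in let V := - pressure m u x0 t0 in
  let h0 := 1 - r ^+ 2 / rho ^+ 2 in let A := - a_const n m in
  [/\ 0 < t0 <= t, 0 <= r < rho, B x0 /\ 0 < V, 0 <= Y /\ 0 < F0 &
  t * F p t <= t0 * (h0 ^+ 2 * F0) /\
  (F0 - (1 - al) * Y) ^+ 2 + A * (1 - al) * (F0 - Y) ^+ 2 <=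
   A * al ^+ 2 * (F0 / t0
     + (1 - m) * V * (F0 * (4 * Bc / (rho ^+ 2 * h0) + 24 * r ^+ 2 / (rho ^+ 2 * h0) ^+ 2))
     + 2 * m * (4 * r * F0 / (rho ^+ 2 * h0) * Num.sqrt (V * Y))
     + 2 * (1 - m) * kp * (V * Y))].
Proof.
move=> al0 kp0 hRic nB HB /andP[t_gt tT] Fp.
have tT' : 0 < t <= T by rewrite t_gt ltW.
have [x0 [t0 [r [/andP[t00 t0t] [pr0 exr] rr [F0 Hp] [Hm Ht]]]]] := max_point tT' Fp.
have t0i : 0 < t0 < T by rewrite t00 (le_lt_trans t0t).
have t0T : t0 \in `[0, T] by rewrite in_itv /= (ltW t00) ltW// (le_lt_trans t0t).
have Bx := ball_in_B pr0 (ltW rr).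
have oB : open B by exact: open_geoball.
have [Q1 [pr [Fs [oO Oc Ocod CF [pneg HF /(_ t0i kp (hRic _ Bx))]]]]] := flow_chart al oB T0 m0 m1 hu Bx t0T n0 nm.
move=> hev; set c := chart g x0 x0 in Oc hev.
pose X := local_grad (metric g x0) (slice pr t0) c.
pose ze := 'D_((0 : 'rV[R]_n), (1 : R)) pr (c, t0) / pr (c, t0).
pose Y := - (mform (metric g x0 c) X X / pr (c, t0)).
have [FE evo] : Fs (c, t0) = al * ze + Y /\
  'D_((0 : 'rV[R]_n), (1 : R)) Fs (c, t0) - (m - 1) * pr (c, t0) * local_laplacian (metric g x0) (slice Fs t0) c <=
    2 * m * 'D_X (slice Fs t0) c + (ze + Y) ^+ 2 / a_const n m - (1 - al) * ze ^+ 2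
    + 2 * (1 - m) * kp * mform (metric g x0 c) X X := hev.
have xx : chart_dom g x0 x0 by exact: chart_dom_center.
have [_ pE FE'] := HF x0 t0 xx t0T Oc; rewrite -/c in pE FE'.
have Fc : F x0 t0 = Fs (c, t0) by rewrite /F FE' opprK.
pose f := slice Fs t0.
have fc : f c = F x0 t0 by rewrite Fc.
(* The barrier involves the power -1/2 of [f], so the neighborhood is restricted to where [f] is
   positive. *)
pose O' := [set y | Q1 (y, t0) /\ 0 < f y].
have CfO : smooth_on [set y | Q1 (y, t0)] f by move=> k; exact: Ck_slice (CF k).
have oOs : open [set y | Q1 (y, t0)] by exact: open_slice.
have oO' : open O'.
  rewrite openE => y [Oy fy]; rewrite /interior; apply: filterI.
    by apply: open_nbhs_nbhs; split=> //.
  exact: (cvgr_gt _ (Ck_continuous (CfO 0) Oy) _ fy).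
have subO : O' `<=` cod g x0 by move=> y [/Ocod].
have O'c : O' c by split=> //; rewrite fc.
have Cf : smooth_on O' f by move=> k; apply: Ck_sub (CfO k) => y [].
have f0 y : O' y -> 0 < f y by case.
have h00 : 0 < 1 - r ^+ 2 / rho ^+ 2.
  rewrite subr_gt0 ltr_pdivrMr ?exprn_gt0// mul1r ltr_sqr ?nnegrE ?(ltW rho0)//.
  exact: wd_ge0 pr0.
have fmax y l : O' y -> wd g p (chart_inv g x0 y) l -> l <= rho ->
    (1 - l ^+ 2 / rho ^+ 2) ^+ 2 * f y <= (1 - r ^+ 2 / rho ^+ 2) ^+ 2 * f c.
  move=> [Oy fy] py lr; have cy : cod g x0 y by exact: (Ocod _ Oy).
  have := Hm _ _ py lr; rewrite fc; congr (_ * _ <= _).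
  have := HF _ t0 (chart_invP cy) t0T; rewrite chart_invK// => /(_ Oy)[_ _ E].
  by rewrite /F E opprK.
have D1 := max_derive oO' O'c Cf f0 pr0 rho0 h00 fmax X.
have L1 : local_laplacian (metric g x0) f c <=
    f c * (4 * Bc / (rho ^+ 2 * (1 - r ^+ 2 / rho ^+ 2)) + 24 * r ^+ 2 / (rho ^+ 2 * (1 - r ^+ 2 / rho ^+ 2)) ^+ 2).
  apply: (max_laplacian oO' subO O'c Cf f0 pr0 rho0 h00 fmax) => S CS hS Sc.
  have := wd_ge0 pr0; rewrite le_eqVlt => /predU1P[rz|r_gt].
    apply: le_trans (laplacian_comparison0 oO' subO O'c CS hS Sc pr0 (esym rz)) _.
    by rewrite ler_pM2l.
  have [rr' [h1 h2 h3]] := HB r r_gt rr.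
  have hR z : wd g p z r -> forall v, - kp * inner g z v v <= ricci g z v v.
    by move=> pz; apply: hRic; exact: ball_in_B pz (ltW rr).
  apply: le_trans (laplacian_comparison oO' subO O'c CS hS Sc pr0 exr hg h1 h2 kp0 hR) _.
  by rewrite ler_pM2l.
have T1 : - (F x0 t0 / t0) <= 'D_((0 : 'rV[R]_n), (1 : R)) Fs (c, t0).
  rewrite Fc; apply: (left_max_time oO Oc CF t00) => s s0 st Os.
  rewrite -Fc; have sT : s \in `[0, T].
    by rewrite in_itv /= (ltW s0) (le_trans st) ?(le_trans t0t) ?ltW.
  have [_ _ E] := HF x0 s xx sT Os.
  have := Ht s; rewrite (ltW s0) (le_trans st t0t) => /(_ isT).
  by rewrite /F E opprK.
have V0 : 0 < - pr (c, t0) by rewrite oppr_gt0; exact: pneg.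
have Gp := metric_posdefP (subO _ O'c).
have I0 : 0 <= mform (metric g x0 c) X X by exact: posdef_ge0.
have YE : mform (metric g x0 c) X X = - pr (c, t0) * Y.
  by rewrite /Y mulrNN mulrC divfK// lt_eqF// pneg.
have Y0 : 0 <= Y by rewrite -(pmulr_rge0 _ V0) -YE.
exists x0, t0, r, Y; split=> //.
- by rewrite t00.
- by rewrite (wd_ge0 pr0).
- by rewrite pE.
split=> //; rewrite pE; rewrite /mnorm YE in D1; rewrite YE in evo; rewrite fc in D1 L1.
rewrite -Fc in FE.
have A0 : 0 < - a_const n m.
  rewrite oppr_gt0 /a_const pmulr_llt0 ?invr_gt0// pmulr_rlt0 ?ltr0n// subr_lt0//.
exact: (core_arith al0 A0 m0 m1 V0 FE T1 L1 D1 evo).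
Qed.

End Maximum.

(** * The final estimate *)

Section RealEstimates.
Context {R : realType}.

(** The left-hand side is minimized over [Y]: the square of (1 - a + e1) F - D Y, with weight b / D,
    is completed and dropped. The remaining coefficient of F^2 is the constant of the theorem. *)
Lemma quad_eliminate (F Y a b e1 dl x Z : R) : 0 < b -> 0 < b - a - b * dl ->
  F ^+ 2 * (1 - a * b) - 2 * b * (1 - a + e1) * F * Y + b * (b - a) * Y ^+ 2 <=
    F * x + b ^+ 2 * dl * Y ^+ 2 + Z ^+ 2 ->
  (1 + - a * b - b * ((1 - a + e1) ^+ 2 / (b - a - b * dl))) * F ^+ 2 <= F * x + Z ^+ 2.
Proof.
move=> b0; set D := b - a - b * dl => D0 h.
have sq : 0 <= b / D * ((1 - a + e1) * F - D * Y) ^+ 2.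
  by rewrite mulr_ge0 ?sqr_ge0// divr_ge0 ?ltW.
have E : b / D * ((1 - a + e1) * F - D * Y) ^+ 2 =
   b * ((1 - a + e1) ^+ 2 / D) * F ^+ 2 - 2 * b * (1 - a + e1) * F * Y + b * D * Y ^+ 2.
  by field; rewrite gt_eqF.
have E2 : b * D * Y ^+ 2 = b * (b - a) * Y ^+ 2 - b ^+ 2 * dl * Y ^+ 2 by rewrite /D; ring.
move: sq; rewrite E E2; set q := (1 - a + e1) ^+ 2 / D => sq.
lra.
Qed.

(** The source of the factor sqrt(C1') in the curvature term: the larger root of C F^2 = F x + Z^2
    is at most (x + sqrt(C) Z) / C. *)
Lemma quad_root (F C x Z : R) : 0 < F -> 0 < C -> 0 <= x -> 0 <= Z -> C * F ^+ 2 <= F * x + Z ^+ 2 ->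
  F <= (x + Num.sqrt C * Z) / C.
Proof.
move=> F0 C0 x0 Z0 h; rewrite ler_pdivlMr// mulrC leNgt; apply/negP => lt.
have s0 : 0 < Num.sqrt C by rewrite sqrtr_gt0.
have sE : Num.sqrt C ^+ 2 = C by rewrite sqr_sqrtr// ltW.
move: (Num.sqrt C) s0 sE lt => s s0 sE lt; rewrite -sE in h lt.
have h1 : Z <= s * F by nra.
have h2 : s * Z * Z <= s * Z * (s * F) by rewrite ler_wpM2l// mulr_ge0// ltW.
nra.
Qed.

Lemma young_sqrt (k e V Y : R) : 0 < e -> 0 <= k -> 0 <= V -> 0 <= Y ->
  k * Num.sqrt (V * Y) <= 2 * e * Y + k ^+ 2 / (8 * e) * V.
Proof.
move=> e0 k0 V0 Y0; have VY : 0 <= V * Y by exact: mulr_ge0.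
have := sqr_sqrtr VY; have := sqrtr_ge0 (V * Y); move: (Num.sqrt (V * Y)) => s s0 sE.
have P : 0 <= 2 * e * Y + k ^+ 2 / (8 * e) * V.
  apply: addr_ge0; first by rewrite !mulr_ge0// ltW.
  by rewrite mulr_ge0// divr_ge0 ?sqr_ge0// mulr_ge0// ltW.
rewrite -(@ler_sqr _ (k * s)) ?nnegrE ?mulr_ge0// exprMn sE -subr_ge0.
have -> : (2 * e * Y + k ^+ 2 / (8 * e) * V) ^+ 2 - k ^+ 2 * (V * Y) = (2 * e * Y - k ^+ 2 / (8 * e) * V) ^+ 2.
  by field; rewrite gt_eqF.
exact: sqr_ge0.
Qed.

(** The gradient term is split by Young's inequality, the curvature term by the hypothesis with [dl]
    and [c4]; then [Y] is eliminated and the quadratic inequality in [F] solved. *)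
Lemma core_solve (F Y a al e1 dl c4 m kp V h0 r rho t0 Bc C : R) : 0 < F -> 0 <= Y -> 0 < - a -> 0 < al -> al < 1 ->
  0 < e1 -> 0 < m -> m < 1 -> 0 < V -> 0 < h0 -> 0 <= r -> 0 < rho -> 0 < t0 -> 0 <= Bc -> 0 <= c4 ->
  0 < 1 - al - a - (1 - al) * dl ->
  C = 1 + - a * (1 - al) - (1 - al) * ((1 - a + e1) ^+ 2 / (1 - al - a - (1 - al) * dl)) -> 0 < C ->
  2 * (- a * al ^+ 2 * ((1 - m) * kp * (V * Y))) <= (1 - al) ^+ 2 * dl * Y ^+ 2 + (- a * al ^+ 2 * c4 * V) ^+ 2 ->
  (F - (1 - al) * Y) ^+ 2 + - a * (1 - al) * (F - Y) ^+ 2 <=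
   - a * al ^+ 2 * (F / t0
     + (1 - m) * V * (F * (4 * Bc / (rho ^+ 2 * h0) + 24 * r ^+ 2 / (rho ^+ 2 * h0) ^+ 2))
     + 2 * m * (4 * r * F / (rho ^+ 2 * h0) * Num.sqrt (V * Y))
     + 2 * (1 - m) * kp * (V * Y)) ->
  F <= - a * al ^+ 2 / C * (1 / t0
    + (1 - m) * V * (4 * Bc / (rho ^+ 2 * h0) + 24 * r ^+ 2 / (rho ^+ 2 * h0) ^+ 2)
    + 8 * m ^+ 2 * r ^+ 2 * (- a * al ^+ 2) / (e1 * (1 - al) * (rho ^+ 2 * h0) ^+ 2) * V
    + Num.sqrt C * c4 * V).
Proof.
move=> F0 Y0 a0 al0 al1 e10 m0 m1 V0 h00 r0 rho0 t00 B0 c40 D0 CE C0 hK h.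
have b0 : 0 < 1 - al by rewrite subr_gt0.
have P0 : 0 < rho ^+ 2 * h0 by rewrite mulr_gt0// exprn_gt0.
pose A2 := - a * al ^+ 2; have A20 : 0 < A2 by rewrite mulr_gt0// exprn_gt0.
pose k := A2 * (8 * m * r / (rho ^+ 2 * h0)).
have k0 : 0 <= k by rewrite mulr_ge0 ?(ltW A20)// divr_ge0 ?(ltW P0)// !mulr_ge0// ltW.
have be0 : 0 < (1 - al) * e1 by rewrite mulr_gt0.
(* With parameter (1 - al) e1, the part in [Y] is exactly what changes the cross coefficient from 1
   - a to 1 - a + e1. *)
have yg := young_sqrt be0 k0 (ltW V0) Y0.
pose S := Num.sqrt (V * Y); rewrite -/S in h yg.
pose Q := 4 * Bc / (rho ^+ 2 * h0) + 24 * r ^+ 2 / (rho ^+ 2 * h0) ^+ 2; rewrite -/Q in h *.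
have Q0 : 0 <= Q.
  by rewrite addr_ge0// divr_ge0 ?sqr_ge0 ?(ltW P0)// mulr_ge0// sqr_ge0.
pose x := A2 * (1 / t0 + (1 - m) * V * Q) + k ^+ 2 / (8 * ((1 - al) * e1)) * V.
have x0 : 0 <= x.
  apply: addr_ge0.
    apply: mulr_ge0; first exact: ltW.
    by rewrite addr_ge0 ?divr_ge0 ?(ltW t00)// !mulr_ge0 ?subr_ge0// ltW.
  by rewrite mulr_ge0 ?(ltW V0)// divr_ge0 ?sqr_ge0// mulr_ge0// ltW.
have Z0 : 0 <= A2 * c4 * V by rewrite !mulr_ge0// ltW.
have key : F ^+ 2 * (1 - a * (1 - al)) - 2 * (1 - al) * (1 - a + e1) * F * Y + (1 - al) * (1 - al - a) * Y ^+ 2 <=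
    F * x + (1 - al) ^+ 2 * dl * Y ^+ 2 + (A2 * c4 * V) ^+ 2.
  have yg' := ler_wpM2l (ltW F0) yg.
  have E1 : - a * al ^+ 2 * (2 * m * (4 * r * F / (rho ^+ 2 * h0) * S)) = F * (k * S).
    by rewrite /k /A2; field; rewrite gt_eqF// gt_eqF.
  have E2 : (F - (1 - al) * Y) ^+ 2 + - a * (1 - al) * (F - Y) ^+ 2 =
    F ^+ 2 * (1 - a * (1 - al)) - 2 * (1 - al) * (1 - a) * F * Y + (1 - al) * (1 - al - a) * Y ^+ 2 by ring.
  have Edist (q1 q2 q3 q4 : R) : - a * al ^+ 2 * (q1 + q2 + q3 + q4) =
    A2 * q1 + A2 * q2 + - a * al ^+ 2 * q3 + A2 * q4 by rewrite /A2; ring.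
  move: h; rewrite E2 Edist E1 => h.
  have E3 : F * x = A2 * (F / t0) + A2 * ((1 - m) * V * (F * Q)) + F * (k ^+ 2 / (8 * ((1 - al) * e1)) * V).
    by rewrite /x; field; rewrite !gt_eqF.
  rewrite E3; move: hK yg' h; rewrite -/A2.
  move: (A2 * (F / t0)) (A2 * ((1 - m) * V * (F * Q))) (k ^+ 2 / (8 * ((1 - al) * e1)) * V) (k * S) (A2 * c4 * V) => p1 p2 p3 p4 p5.
  move=> hK yg' h.
  have E4 : 2 * (A2 * ((1 - m) * kp * (V * Y))) = A2 * (2 * (1 - m) * kp * (V * Y)) by ring.
  rewrite E4 in hK; move: (A2 * (2 * (1 - m) * kp * (V * Y))) hK h => p6 hK h.
  move: ((1 - al) ^+ 2 * dl * Y ^+ 2) hK => p7 hK.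
  lra.
have := quad_eliminate b0 D0 key; rewrite -CE => /(quad_root F0 C0 x0 Z0) fin.
apply: le_trans fin _; apply: eq_le_R.
rewrite /x /k /A2; move: (Num.sqrt C) => s.
by field; rewrite !gt_eqF.
Qed.

(** Multiplication by h0^2 <= 1 clears the inverse powers of the weight. As r^2 / rho^2 = 1 - h0,
    the sum 4 Bc h0 + 24 (1 - h0) is at most CC / 4, which explains 16 Bc <= CC and 96 <= CC. The
    gradient term has coefficient 8 m^2, where [C2] provides 200 m^2. *)
Lemma weight_solve (a al m C V F h0 r rho t0 t Bc CC e1 c4 Fp : R) : 0 < - a -> 0 < al -> al < 1 -> 0 < m -> m < 1 ->
  0 < C -> 0 < V -> 0 < h0 -> 0 < rho -> 0 < t0 -> t0 <= t -> 0 <= c4 -> 0 < e1 ->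
  h0 = 1 - r ^+ 2 / rho ^+ 2 -> 16 * Bc <= CC -> 96 <= CC ->
  t * Fp <= t0 * (h0 ^+ 2 * F) ->
  F <= - a * al ^+ 2 / C * (1 / t0
    + (1 - m) * V * (4 * Bc / (rho ^+ 2 * h0) + 24 * r ^+ 2 / (rho ^+ 2 * h0) ^+ 2)
    + 8 * m ^+ 2 * r ^+ 2 * (- a * al ^+ 2) / (e1 * (1 - al) * (rho ^+ 2 * h0) ^+ 2) * V
    + Num.sqrt C * c4 * V) ->
  Fp <= - a * al ^+ 2 / C * (t^-1 + Num.sqrt C * c4 * V + V * (2 * rho) ^- 2 * (C2 m a al e1 + (1 - m) * CC)).
Proof.
move=> a0 al0 al1 m0 m1 C0 V0 h00 rho0 t00 tt c40 e10 hE hB hC hF h.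
have t_gt : 0 < t by exact: lt_le_trans tt.
have b0 : 0 < 1 - al by rewrite subr_gt0.
have r2 : 0 < rho ^+ 2 by rewrite exprn_gt0.
pose w := r ^+ 2 / rho ^+ 2; have w0 : 0 <= w by rewrite divr_ge0 ?sqr_ge0// ltW.
have h01 : h0 <= 1 by rewrite hE gerBl.
have rE : r ^+ 2 = w * rho ^+ 2 by rewrite /w divfK// gt_eqF.
have wE : w = 1 - h0 by rewrite hE -/w; ring.
pose A2 := - a * al ^+ 2; have A20 : 0 < A2 by rewrite mulr_gt0// exprn_gt0.
pose k := A2 / C; have k0 : 0 < k by rewrite divr_gt0.
pose G1 := (1 - m) * V * (4 * Bc * h0 + 24 * w) / rho ^+ 2.
pose G2 := 8 * m ^+ 2 * w * A2 / (e1 * (1 - al)) * V / rho ^+ 2.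
have S0 : 0 <= Num.sqrt C * c4 * V by rewrite !mulr_ge0 ?sqrtr_ge0// ltW.
have step1 : h0 ^+ 2 * F <= k * (1 / t0 + G1 + G2 + Num.sqrt C * c4 * V).
  have := ler_wpM2l (sqr_ge0 h0) h; rewrite -/A2 rE => h1; apply: le_trans h1 _.
  have -> : h0 ^+ 2 * (A2 / C * (1 / t0 + (1 - m) * V * (4 * Bc / (rho ^+ 2 * h0)
      + 24 * (w * rho ^+ 2) / (rho ^+ 2 * h0) ^+ 2)
      + 8 * m ^+ 2 * (w * rho ^+ 2) * A2 / (e1 * (1 - al) * (rho ^+ 2 * h0) ^+ 2) * V
      + Num.sqrt C * c4 * V)) = k * (h0 ^+ 2 * (1 / t0) + G1 + G2 + h0 ^+ 2 * (Num.sqrt C * c4 * V)).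
    by rewrite /k /G1 /G2; move: (Num.sqrt C) => s; field; rewrite !gt_eqF.
  have h2 : h0 ^+ 2 <= 1 by rewrite expr_le1// ltW.
  rewrite ler_pM2l//; apply: lerD; last by rewrite ler_piMl.
  by rewrite !lerD2r ler_piMl// divr_ge0// ltW.
have G1b : G1 <= V * (2 * rho) ^- 2 * ((1 - m) * CC).
  have -> : V * (2 * rho) ^- 2 * ((1 - m) * CC) = (1 - m) * V * (CC / 4) / rho ^+ 2.
    by field; rewrite gt_eqF.
  rewrite ler_pM2r ?invr_gt0// ler_wpM2l ?mulr_ge0 ?subr_ge0 ?(ltW m1) ?(ltW V0)//.
  by rewrite wE; nra.
have G2b : G2 <= V * (2 * rho) ^- 2 * C2 m a al e1.
  have -> : V * (2 * rho) ^- 2 * C2 m a al e1 = 200 * m ^+ 2 * 1 * A2 / (e1 * (1 - al)) * V / rho ^+ 2.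
    by rewrite /C2 /A2; field; rewrite !gt_eqF.
  rewrite ler_pM2r ?invr_gt0// ler_pM2r// ler_pM2r ?invr_gt0 ?mulr_gt0// ler_pM2r//.
  have m2 : 0 < m ^+ 2 by rewrite exprn_gt0.
  have w1 : w <= 1 by rewrite wE; lra.
  by nra.
rewrite -(ler_pM2l t_gt); apply: le_trans hF _.
apply: le_trans (ler_wpM2l (ltW t00) step1) _; rewrite -/A2 -/k.
have -> : V * (2 * rho) ^- 2 * (C2 m a al e1 + (1 - m) * CC) =
  V * (2 * rho) ^- 2 * C2 m a al e1 + V * (2 * rho) ^- 2 * ((1 - m) * CC) by rewrite mulrDr.
have -> : t0 * (k * (1 / t0 + G1 + G2 + Num.sqrt C * c4 * V)) = k * (1 + t0 * (G1 + G2 + Num.sqrt C * c4 * V)).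
  by field; rewrite gt_eqF.
have -> : t * (k * (t^-1 + Num.sqrt C * c4 * V + (V * (2 * rho) ^- 2 * C2 m a al e1 + V * (2 * rho) ^- 2 * ((1 - m) * CC)))) =
  k * (1 + t * (Num.sqrt C * c4 * V + V * (2 * rho) ^- 2 * C2 m a al e1 + V * (2 * rho) ^- 2 * ((1 - m) * CC))).
  by move: (C2 m a al e1) (V * _) => q1 q2; field; rewrite gt_eqF.
rewrite ler_pM2l// lerD2l.
have G20 : 0 <= G2.
  apply: mulr_ge0; last by rewrite invr_ge0 ltW.
  apply: mulr_ge0; last exact: ltW.
  apply: divr_ge0; last by rewrite mulr_ge0// ltW.
  apply: mulr_ge0; last exact: ltW.
  by apply: mulr_ge0 => //; rewrite mulr_ge0// sqr_ge0.
have N0 : 0 <= Num.sqrt C * c4 * V + V * (2 * rho) ^- 2 * C2 m a al e1 + V * (2 * rho) ^- 2 * ((1 - m) * CC).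
  apply: addr_ge0; first by apply: addr_ge0 => //; exact: le_trans G2b.
  rewrite !mulr_ge0 ?invr_ge0 ?sqr_ge0 ?(ltW V0) ?subr_ge0 ?(ltW m1)//; lra.
apply: le_trans (ler_wpM2r N0 tt); rewrite ler_pM2l//.
by move: (Num.sqrt C * c4 * V) => q; lra.
Qed.

End RealEstimates.

Lemma time_near (R : realType) (M : topologicalType) (z : M * R) (P : M * R -> Prop) :
  (\forall y \near z, P y) -> \forall s \near z.2, P (z.1, s).
Proof.
have c : (fun s : R => (z.1, s)) @ z.2 --> z.
  rewrite [X in _ --> X]surjective_pairing.
  by apply: (@cvg_pair _ _ _ _ (nbhs z.1) (nbhs z.2)); [exact: cvg_cst|exact: cvg_id].
by move=> N; exact: (c _ N).
Qed.

Lemma C2_ge0 (R : realType) (m a al e1 : R) : 0 < - a -> al < 1 -> 0 < e1 -> 0 <= C2 m a al e1.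
Proof.
move=> a0 al1 e0; apply: mulr_ge0; first by apply: mulr_ge0; [exact: ler0n|exact: sqr_ge0].
apply: divr_ge0; first by apply: mulr_ge0; [exact: ltW|exact: sqr_ge0].
apply: mulr_ge0; first by apply: mulr_ge0; [exact: ler0n|exact: ltW].
by rewrite subr_ge0 ltW.
Qed.

Section Estimate.
Context {R : realType} {n : nat} {M : topologicalType} (g : riemannian R n M).
Variables (o p : M) (rad T m al : R) (u : M -> R -> R).
Hypotheses (n0 : (0 < n)%N) (hg : complete_riemannian g) (rad0 : 0 < rad) (T0 : 0 < T).
Hypotheses (m0 : 0 < m) (m1 : m < 1) (nm : 0 < n%:R * (m - 1) + 2).
Let B := geoball g o rad.
Hypothesis hu : fde_solution g B T m u.
Hypothesis op : geoball g o (rad / 2) p.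
Let F (x : M) (s : R) : R := - harnack g T al (pressure m u) x s.
Let a := a_const n m.

Let Bp : B p.
Proof.
have /geoballE[l l1 l2] := op; apply/geoballE; exists l => //.
by apply: lt_le_trans l1 _; rewrite ler_pdivrMr// ler_peMr ?ler1n// ltW.
Qed.

Variables (kp Bc CC dl c4 e1 vm : R).
Let C := 1 + - a * (1 - al) - (1 - al) * ((1 - a + e1) ^+ 2 / (1 - al - a - (1 - al) * dl)).
Hypotheses (al0 : 0 < al) (al1 : al < 1) (kp0 : 0 <= kp) (e10 : 0 < e1) (c40 : 0 <= c4).
Hypothesis hRic : ricci_ge g B (- kp).
Hypotheses (nB : n%:R <= Bc) (BC : 16 * Bc <= CC) (C96 : 96 <= CC).
Hypothesis HB : forall r, 0 < r -> r < rad / 2 ->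
  exists rr, [/\ 0 < rr, rr <= r & n%:R + r * (n%:R / rr + kp * rr) <= Bc].
Hypotheses (D0 : 0 < 1 - al - a - (1 - al) * dl) (C0 : 0 < C).
Hypothesis young : forall V Y : R, 0 <= V -> 0 <= Y ->
  2 * (- a * al ^+ 2 * ((1 - m) * kp * (V * Y))) <=
  (1 - al) ^+ 2 * dl * Y ^+ 2 + (- a * al ^+ 2 * c4 * V) ^+ 2.
Hypothesis vmP : forall x s, B x -> s \in `[0, T] -> - pressure m u x s <= vm.

Let E0 := Num.sqrt C * c4 * vm + vm * rad ^- 2 * (C2 m a al e1 + (1 - m) * CC).

Lemma a_lt0 : 0 < - a.
Proof. by rewrite oppr_gt0 /a /a_const pmulr_llt0 ?invr_gt0// pmulr_rlt0 ?ltr0n// subr_lt0. Qed.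

Lemma vm_ge0 : 0 <= vm.
Proof.
apply: le_trans (vmP Bp (_ : 0 \in `[0, T])); last by rewrite in_itv /= lexx ltW.
rewrite /pressure -mulNr mulr_ge0 ?powR_ge0//.
by rewrite -mulrN -invrN opprB divr_ge0 ?subr_ge0// ltW.
Qed.

Lemma harnack_interior (t : R) : 0 < t < T -> F p t <= - a * al ^+ 2 / C * (t^-1 + E0).
Proof.
move=> tT; have /andP[t_gt _] := tT; have A0 := a_lt0; have v0 := vm_ge0.
have CC0 : 0 <= (1 - m) * CC.
  by rewrite mulr_ge0 ?subr_ge0 ?(ltW m1)//; apply: le_trans C96.
have S0 : 0 <= Num.sqrt C * c4 by rewrite mulr_ge0// sqrtr_ge0.
have r20 : 0 <= rad ^- 2 by rewrite invr_ge0 sqr_ge0.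
have CS0 : 0 <= C2 m a al e1 + (1 - m) * CC by apply: addr_ge0 => //; exact: C2_ge0.
have k0 : 0 <= - a * al ^+ 2 / C by rewrite divr_ge0 ?(ltW C0)// mulr_ge0 ?sqr_ge0// ltW.
have [Fp|Fp] := leP (F p t) 0.
  apply: le_trans Fp _; rewrite mulr_ge0// addr_ge0 ?invr_ge0 ?(ltW t_gt)//.
  by rewrite addr_ge0 ?mulr_ge0.
have [x0 [t0 [r [Y [/andP[t00 t0t] /andP[r0 rr] [Bx V0] [Y0 F0] [h1 h2]]]]]] :=
  max_core n0 hg rad0 T0 m0 m1 nm hu op al0 kp0 hRic nB HB tT Fp.
have rho0 : 0 < rad / 2 by rewrite divr_gt0.
have h00 : 0 < 1 - r ^+ 2 / (rad / 2) ^+ 2.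
  by rewrite subr_gt0 ltr_pdivrMr ?exprn_gt0// mul1r ltr_sqr ?nnegrE ?(ltW rho0).
have Bc0 : 0 <= Bc by exact: le_trans nB.
have s1 := core_solve F0 Y0 A0 al0 al1 e10 m0 m1 V0 h00 r0 rho0 t00 Bc0 c40 D0 (erefl C) C0
  (young (ltW V0) Y0) h2.
have s2 := weight_solve A0 al0 al1 m0 m1 C0 V0 h00 rho0 t00 t0t c40 e10 (erefl _) BC C96 h1 s1.
apply: le_trans s2 _; apply: ler_wpM2l; first exact: k0.
have Vle : - pressure m u x0 t0 <= vm.
  apply: vmP => //; rewrite in_itv /= (ltW t00) (le_trans t0t)//.
  by have /andP[_ /ltW] := tT.
have -> : 2 * (rad / 2) = rad by field.
rewrite -addrA lerD2l; apply: lerD; first exact: ler_wpM2l.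
by rewrite ler_wpM2r// ler_wpM2r.
Qed.

(** At t = T the extension is not known to solve the equation on both sides, so the estimate is
    carried over from earlier times by continuity. *)
Lemma harnack_bound (t : R) : 0 < t -> t <= T -> F p t <= - a * al ^+ 2 / C * (t^-1 + E0).
Proof.
move=> t_gt; rewrite le_eqVlt => /predU1P[->|tT]; last by apply: harnack_interior; rewrite t_gt.
have TT : T \in `[0, T] by rewrite in_itv /= lexx ltW.
have cF := harnack_cvg (al := al) n0 T0 m0 m1 nm hu Bp TT.
have A0 := a_lt0; set k := - a * al ^+ 2 / C.
have k0 : 0 <= k by rewrite divr_ge0 ?(ltW C0)// mulr_ge0 ?sqr_ge0// ltW.
apply/ler_addgt0Pr => e e0; have e20 : 0 < e / 2 by rewrite divr_gt0.
have N1 : \forall s \near T, s \in `[0, T] -> F p T <= F p s + e / 2.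
  move: cF => /cvgrPdist_le/(_ _ e20) cF.
  have := @time_near _ _ (p, T) _ cF; apply: filterS => s /= h sT.
  by have := h sT; rewrite ler_norml -/(F p T) -/(F p s) => /andP[_]; lra.
have N2 : \forall s \near T, k * s^-1 <= k * T^-1 + e / 2.
  have c : (fun s : R => k * s^-1) @ T --> k * T^-1.
    by apply: cvgM; [exact: cvg_cst|apply: cvgV => //; rewrite gt_eqF].
  move: c => /cvgrPdist_le/(_ _ e20); apply: filterS => s.
  by rewrite ler_norml => /andP[h _]; lra.
have [d /= d0 Hd] := (nbhs_ballP _ _).1 (filterI N1 N2).
pose s := T - Num.min (d / 2) (T / 2).
have m_gt : 0 < Num.min (d / 2) (T / 2) by rewrite lt_min !divr_gt0.
have md : Num.min (d / 2) (T / 2) <= d / 2 by rewrite ge_min lexx.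
have mT : Num.min (d / 2) (T / 2) <= T / 2 by rewrite ge_min lexx orbT.
have s0 : 0 < s by rewrite /s; lra.
have sT : s < T by rewrite /s; lra.
have [|h1 h2] := Hd s.
  by rewrite -ball_normE /= /s opprB addrC subrK gtr0_norm//; lra.
have si : 0 < s < T by rewrite s0.
have h3 := harnack_interior si; rewrite -/k mulrDr in h3.
have sT' : s \in `[0, T] by rewrite in_itv /= !ltW.
rewrite mulrDr; move: (h1 sT') h2 h3.
by move: (k * E0) (k * s^-1) (k * T^-1) (F p T) (F p s) => x1 x2 x3 x4 x5; lra.
Qed.

End Estimate.

(** * The supremum of -v and the choice of the comparison radius *)

Lemma sup_negP (R : realType) (M : Type) (B : set M) (T : R) (v : M -> R -> R) (x : M) (s vm : R) :
  sup_neg B T v = vm%:E -> B x -> s \in `[0, T] -> - v x s <= vm.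
Proof.
move=> E Bx sT; rewrite -lee_fin -E; apply: ereal_sup_ubound.
by exists x, s.
Qed.

Lemma sup_neg_ninfty (R : realType) (M : Type) (B : set M) (T : R) (v : M -> R -> R) (x : M) (s : R) :
  B x -> s \in `[0, T] -> sup_neg B T v <> -oo%E.
Proof.
move=> Bx sT E; have : ((- v x s)%:E <= sup_neg B T v)%E.
  by apply: ereal_sup_ubound; exists x, s.
by rewrite E leeNy_eq.
Qed.

Lemma fde_dimension (R : realType) (n : nat) (m : R) : (0 < n)%N -> 1 - 2 / n%:R < m ->
  0 < n%:R * (m - 1) + 2.
Proof.
move=> n0 h; have nn : 0 < n%:R :> R by rewrite ltr0n.
have : n%:R * (1 - 2 / n%:R) < n%:R * m by rewrite ltr_pM2l.
have -> : n%:R * (1 - 2 / n%:R) = n%:R - 2 :> R by field; rewrite gt_eqF.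
lra.
Qed.

Lemma flat_radius (R : realType) (nn r : R) : 0 < r ->
  exists rr, [/\ 0 < rr, rr <= r & nn + r * (nn / rr + 0 * rr) <= 2 * nn].
Proof.
move=> r0; exists r; split=> //.
by rewrite mul0r addr0 mulrCA divff ?gt_eqF// mulr1; lra.
Qed.

(* The point q from which the variations start is put at distance r / (1 + K r) of x0. *)
Lemma curved_radius (R : realType) (n : nat) (K r rho : R) : (0 < n)%N -> 0 <= K -> 0 < r -> r < rho ->
  exists rr, [/\ 0 < rr, rr <= r &
    n%:R + r * (n%:R / rr + (n%:R - 1) * K ^+ 2 * rr) <= 2 * n%:R + 3 * ((n%:R - 1) * (K * rho))].
Proof.
(* In dimension 1 the curvature term vanishes and [flat_radius] applies; the final estimate uses n
   <= 2 (n - 1), which needs n >= 2. *)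
move=> n0 K0 r0 rrho; have [n1|n1] := leqP n 1.
  have -> : n = 1%N by apply/eqP; rewrite eqn_leq n1.
  rewrite subrr !mul0r !mulr0 addr0; exact: flat_radius.
have n2 : 2 <= n%:R :> R by rewrite ler_nat.
have q0 : 0 < 1 + K * r by rewrite ltr_pwDl// mulr_ge0// ltW.
exists (r / (1 + K * r)); split; first exact: divr_gt0.
  by rewrite ler_pdivrMr// ler_peMr ?(ltW r0)// lerDl mulr_ge0// ltW.
have -> : r * (n%:R / (r / (1 + K * r)) + (n%:R - 1) * K ^+ 2 * (r / (1 + K * r))) =
    n%:R + n%:R * (K * r) + (n%:R - 1) * (K * r * (K * r / (1 + K * r))).
  by field; rewrite !gt_eqF.
have k0 : 0 <= K * r by rewrite mulr_ge0// ltW.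
have k1 : K * r <= K * rho by rewrite ler_wpM2l// ltW.
have k2 : K * r / (1 + K * r) <= 1 by rewrite ler_pdivrMr// mul1r lerDr.
move: (K * r) (K * rho) (n%:R : R) n2 k0 k1 k2 => x y N N2 x0 xy x1.
have y1 : x * (x / (1 + x)) <= x by rewrite ler_piMr.
have y2 : (N - 1) * (x * (x / (1 + x))) <= (N - 1) * x by rewrite ler_wpM2l//; lra.
have y3 : (N - 1) * x <= (N - 1) * y by rewrite ler_wpM2l//; lra.
have y4 : N * x <= 2 * ((N - 1) * x) by nra.
lra.
Qed.

(** The difference of the two sides is a perfect square; the coefficient [C4] is the one for which
    this happens. *)
Lemma young_curved (R : realType) (A b e2 m nn K V Y : R) : 0 < b -> 0 < e2 ->
  2 * (A * ((1 - m) * ((nn - 1) * K ^+ 2) * (V * Y))) <=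
  b ^+ 2 * e2 ^+ 2 * Y ^+ 2 + (A * ((nn - 1) * (1 - m) / (b * e2) * K ^+ 2) * V) ^+ 2.
Proof.
move=> b0 e0; rewrite -subr_ge0.
have -> : b ^+ 2 * e2 ^+ 2 * Y ^+ 2 + (A * ((nn - 1) * (1 - m) / (b * e2) * K ^+ 2) * V) ^+ 2
    - 2 * (A * ((1 - m) * ((nn - 1) * K ^+ 2) * (V * Y))) =
  (b * e2 * Y - A * ((nn - 1) * (1 - m) / (b * e2) * K ^+ 2) * V) ^+ 2.
  by field; rewrite !gt_eqF.
exact: sqr_ge0.
Qed.

Theorem theorem4p1 (R : realType) (n : nat) (M : topologicalType)
  (g : riemannian R n M) (o : M) (rad T m : R) (u : M -> R -> R)
  (hn : (0 < n)%N) (hg : complete_riemannian g)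
  (hrad : 0 < rad) (hT : 0 < T)
  (hm0 : 0 < m) (hm1 : m < 1) (hmc : 1 - 2 / n%:R < m)
  (hu : fde_solution g (geoball g o rad) T m u) :
  let a := a_const n m in
  let v := pressure m u in
  let vmax := sup_neg (geoball g o rad) T v in
  (ricci_ge g (geoball g o rad) 0 ->
   forall alpha eps1 : R, 0 < alpha -> alpha < 1 -> 0 < eps1 ->
   0 < C1 a alpha eps1 ->
   forall (x : M) (t : R), geoball g o (rad / 2) x -> 0 < t -> t <= T ->
   (- (((- a) * alpha ^+ 2 / C1 a alpha eps1)%:E *
       ((t^-1)%:E + vmax * (rad ^- 2)%:E * (C2 m a alpha eps1 + C3 n m)%:E))
    <= (harnack g T alpha v x t)%:E)%E)
  /\
  (forall K : R, 0 <= K ->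
   ricci_ge g (geoball g o rad) (- ((n%:R - 1) * K ^+ 2)) ->
   forall alpha eps1 eps2 : R,
   0 < alpha -> alpha < 1 -> 0 < eps1 -> 0 < eps2 ->
   0 < (1 - alpha) - a - (1 - alpha) * eps2 ^+ 2 ->
   0 < C1' a alpha eps1 eps2 ->
   forall (x : M) (t : R), geoball g o (rad / 2) x -> 0 < t -> t <= T ->
   (- (((- a) * alpha ^+ 2 / C1' a alpha eps1 eps2)%:E *
       ((t^-1)%:E +
        (C4 n m alpha eps2 * Num.sqrt (C1' a alpha eps1 eps2) * K ^+ 2)%:E
          * vmax))
    - ((- a) * alpha ^+ 2 / C1' a alpha eps1 eps2)%:E *
      (vmax * (rad ^- 2)%:E * (C2 m a alpha eps1 + C5 n m (K * rad))%:E)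
    <= (harnack g T alpha v x t)%:E)%E).
Proof.
move=> a v vmax; have nm := fde_dimension hn hmc.
have n1 : 1 <= n%:R :> R by rewrite ler1n.
have A0 : 0 < - a := a_lt0 hn hm1 nm.
have half x : geoball g o (rad / 2) x -> geoball g o rad x.
  move=> /geoballE[l l1 l2]; apply/geoballE; exists l => //.
  by apply: lt_le_trans l1 _; rewrite ler_pdivrMr// ler_peMr ?ler1n// ltW.
have r20 : 0 < rad ^- 2 by rewrite invr_gt0 exprn_gt0.
split.
- move=> hRic al e1 al0 al1 e10 hC x t xB t0 tT.
  have k0 : 0 < - a * al ^+ 2 / C1 a al e1 by rewrite divr_gt0// mulr_gt0// exprn_gt0.
  have S0 : 0 < C2 m a al e1 + C3 n m.
    rewrite ltr_wpDl ?C2_ge0// /C3 mulr_gt0 ?ltr_wpDl// mulr_gt0// subr_gt0//.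
  (* An infinite supremum makes the left-hand side -oo, and the value -oo is excluded since the ball
     contains [x]. *)
  case Ev : vmax => [vm| |]; last first.
  - by have := sup_neg_ninfty (v := v) (half x xB) (_ : 0 \in `[0, T]); rewrite -/vmax Ev
      in_itv /= lexx ltW// => /(_ isT).
  - by rewrite !gt0_mulye ?lte_fin// addey// gt0_muley ?lte_fin// leNye.
  change ((- (- a * al ^+ 2 / C1 a al e1 * (t^-1 + vm * rad ^- 2 * (C2 m a al e1 + C3 n m))))%:E <=
    (harnack g T al v x t)%:E)%E; rewrite lee_fin lerNl.
  (* The flat case is the general estimate with [kp], [dl] and [c4] equal to 0, Bc = 2 n and CC = 40
     (n + 2). *)
  have D0 : 0 < 1 - al - a - (1 - al) * 0 by rewrite mulr0 subr0 addr_gt0// subr_gt0.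
  have E : C1 a al e1 = 1 + - a * (1 - al) - (1 - al) * ((1 - a + e1) ^+ 2 / (1 - al - a - (1 - al) * 0)).
    by rewrite /C1 mulr0 subr0.
  have hR : ricci_ge g (geoball g o rad) (- 0) by rewrite oppr0.
  have nB : n%:R <= 2 * n%:R :> R by lra.
  have BC : 16 * (2 * n%:R) <= 40 * (n%:R + 2) :> R by lra.
  have CC : 96 <= 40 * (n%:R + 2) :> R by lra.
  have HB r : 0 < r -> r < rad / 2 ->
      exists rr, [/\ 0 < rr, rr <= r & n%:R + r * (n%:R / rr + 0 * rr) <= 2 * n%:R].
    by move=> r0 _; exact: flat_radius.
  have yg (V Y : R) : 0 <= V -> 0 <= Y -> 2 * (- a * al ^+ 2 * ((1 - m) * 0 * (V * Y))) <=
      (1 - al) ^+ 2 * 0 * Y ^+ 2 + (- a * al ^+ 2 * 0 * V) ^+ 2.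
    by move=> _ _; rewrite !(mulr0, mul0r) expr0n addr0.
  have vP y s : geoball g o rad y -> s \in `[0, T] -> - pressure m u y s <= vm.
    by move=> By sT; exact: sup_negP Ev By sT.
  rewrite E in hC.
  apply: le_trans (harnack_bound hn hg hrad hT hm0 hm1 nm hu xB al0 al1 (lexx 0) e10 (lexx 0)
    hR nB BC CC HB D0 hC yg vP t0 tT) _.
  rewrite -/a -E mulr0 mul0r add0r; apply: eq_le_R; congr (_ * (_ + _ * (_ + _))).
  by rewrite /C3; ring.
move=> K K0 hRic al e1 e2 al0 al1 e10 e20 D0 hC x t xB t0 tT.
have b0 : 0 < 1 - al by rewrite subr_gt0.
have k0 : 0 < - a * al ^+ 2 / C1' a al e1 e2 by rewrite divr_gt0// mulr_gt0// exprn_gt0.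
have KR : 0 <= K * rad by rewrite mulr_ge0// ltW.
have nKR : 0 <= (n%:R - 1) * (K * rad) by rewrite mulr_ge0// subr_ge0.
have S0 : 0 < C2 m a al e1 + C5 n m (K * rad).
  rewrite ltr_wpDl ?C2_ge0// /C5 mulr_gt0//; first by rewrite mulr_gt0// subr_gt0.
  by rewrite mulrDr mulr1; lra.
case Ev : vmax => [vm| |]; last first.
- by have := sup_neg_ninfty (v := v) (half x xB) (_ : 0 \in `[0, T]); rewrite -/vmax Ev
    in_itv /= lexx ltW// => /(_ isT).
- by rewrite !gt0_mulye ?lte_fin// [X in (_ - X)%E]gt0_muley ?lte_fin// addeNy leNye.
(* The curved case has kp = (n - 1) K^2 and dl = e2^2; [c4] is [C4] times K^2. *)
pose c4 := (n%:R - 1) * (1 - m) / ((1 - al) * e2) * K ^+ 2.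
change ((- (- a * al ^+ 2 / C1' a al e1 e2 * (t^-1 + C4 n m al e2 * Num.sqrt (C1' a al e1 e2) * K ^+ 2 * vm))
  - - a * al ^+ 2 / C1' a al e1 e2 * (vm * rad ^- 2 * (C2 m a al e1 + C5 n m (K * rad))))%:E <=
  (harnack g T al v x t)%:E)%E; rewrite lee_fin -opprD lerNl.
(* The bound of [curved_radius] at the radius rad / 2 of the localizing ball. *)
pose Bc : R := 2 * n%:R + 3 * ((n%:R - 1) * (K * (rad / 2))).
pose CC : R := 40 * (3 + (n%:R - 1) * (1 + K * rad)).
have BcE : Bc = 2 * n%:R + 3 / 2 * ((n%:R - 1) * (K * rad)) by rewrite /Bc; field.
have CCE : CC = 40 * (n%:R + 2) + 40 * ((n%:R - 1) * (K * rad)) by rewrite /CC; ring.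
have nB : n%:R <= Bc by rewrite BcE; lra.
have BC : 16 * Bc <= CC by rewrite BcE CCE; lra.
have C96 : 96 <= CC by rewrite CCE; lra.
have HB r : 0 < r -> r < rad / 2 ->
    exists rr, [/\ 0 < rr, rr <= r & n%:R + r * (n%:R / rr + (n%:R - 1) * K ^+ 2 * rr) <= Bc].
  exact: curved_radius.
have kp0 : 0 <= (n%:R - 1) * K ^+ 2 by rewrite mulr_ge0 ?sqr_ge0// subr_ge0.
have c40 : 0 <= c4.
  rewrite mulr_ge0 ?sqr_ge0// divr_ge0//; last by rewrite mulr_ge0// ltW.
  by rewrite mulr_ge0 ?subr_ge0// ltW.
have yg (V Y : R) : 0 <= V -> 0 <= Y -> 2 * (- a * al ^+ 2 * ((1 - m) * ((n%:R - 1) * K ^+ 2) * (V * Y))) <=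
    (1 - al) ^+ 2 * e2 ^+ 2 * Y ^+ 2 + (- a * al ^+ 2 * c4 * V) ^+ 2.
  by move=> _ _; exact: young_curved.
have vP y s : geoball g o rad y -> s \in `[0, T] -> - pressure m u y s <= vm.
  by move=> By sT; exact: sup_negP Ev By sT.
apply: le_trans (harnack_bound hn hg hrad hT hm0 hm1 nm hu xB al0 al1 kp0 e10 c40
  hRic nB BC C96 HB D0 hC yg vP t0 tT) _.
rewrite -/a -/(C1' a al e1 e2); apply: eq_le_R.
have C5E : (1 - m) * CC = C5 n m (K * rad) by rewrite /CC /C5; ring.
have C4E : c4 = C4 n m al e2 * K ^+ 2 by [].
rewrite C5E C4E; move: (Num.sqrt _) (C4 n m al e2) (_ / C1' a al e1 e2) (C2 m a al e1 + _) (rad ^- 2) => s1 s2 s3 s4 s5.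
by ring.
Qed.
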